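(* For each $u\in C(M,\mathbb{R})$, the functions $U^u_n$ on $M\times[0,1]$ converge uniformly as $n\to+\infty$; the uniform limit $\bar u=\lim_{n\to+\infty}U^u_n$ satisfies \[ \bar{u}(x,\tau)=\inf_{y\in M}\big(u(y)+h_{0,\tau}(y,x)\big) \] for all $(x,\tau)\in M\times\mathbb{S}^1$. Furthermore, $\bar u$ is a backward weak KAM solution of the Hamilton-Jacobi equation $u_\tau+H(x,u_x,\tau)=0$.
   Context: Setting. $M$ is a compact connected smooth manifold with a fixed $C^\infty$ Riemannian metric. $L:TM\times\mathbb{R}\to\mathbb{R}$, $(x,v,t)\mapsto L(x,v,t)$, is $C^\infty$ and satisfies: (i) periodicity: $L(x,v,t)=L(x,v,t+1)$; (ii) positive definiteness: for each $x\in M$, $t\in\mathbb{R}$, the Hessian of $v\mapsto L(x,v,t)$ on $T_xM$ is everywhere positive definite; (iii) superlinear growth: $L(x,v,t)/\|v\|_x\to+\infty$ as $\|v\|_x\to+\infty$, uniformly in $x\in M$, $t\in\mathbb{R}$; (iv) completeness: the maximal solutions of the Euler-Lagrange equation $\frac{d}{dt}\frac{\partial L}{\partial v}(x,\dot x,t)=\frac{\partial L}{\partial x}(x,\dot x,t)$ are defined on all of $\mathbb{R}$. The Hamiltonian is $H(x,p,t)=\sup_{v\in T_xM}\{\langle p,v\rangle_x-L(x,v,t)\}$. It is assumed that the Mañé critical value vanishes, $c(L)=0$, where $c(L)=\alpha(0)=-\min_\mu\int L\,d\mu$, the minimum being over Borel probability measures on $TM\times\mathbb{S}^1$ invariant under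 the Euler-Lagrange flow. Conventions. $\mathbb{N}=\{0,1,2,\dots\}$. $\mathbb{S}^1=\mathbb{R}/\mathbb{Z}$ is viewed as $[0,1]$ with endpoints identified; $[t]=t \bmod 1$. ''Paths'' are continuous and piecewise $C^1$. The functions $U^u_n$. For $u\in C(M,\mathbb{R})$, $n\in\mathbb{N}$, $\tau\in[0,1]$, $x\in M$, \[ U^u_n(x,\tau)=\tilde T^\tau_n u(x)=\inf_{k\in\mathbb{N},\, n\le k\le 2n}\ \inf_\gamma\Big\{u(\gamma(0))+\int_0^{\tau+k}L(\gamma(s),\dot\gamma(s),s)\,ds\Big\}, \] the second infimum over paths $\gamma:[0,\tau+k]\to M$ with $\gamma(\tau+k)=x$. Action potential and extended Peierls barrier. For $t'\ge t$ and $x,y\in M$, $F_{t,t'}(x,y)=\inf_\gamma\int_t^{t'}L(\gamma(s),\dot\gamma(s),s)\,ds$ over paths $\gamma:[t,t']\to M$ with $\gamma(t)=x$, $\gamma(t')=y$. For $\tau,\tau'\in\mathbb{S}^1$ and $x,x'\in M$, $\Phi_{\tau,\tau'}(x,x')=\inf F_{t,t'}(x,x')$ over $(t,t')\in\mathbb{R}^2$ with $[t]=\tau$, $[t']=\tau'$, $t'\ge t+1$; and $h_{\tau,\tau'}(x,x')=\liminf_{t'-t\to+\infty}F_{t,t'}(x,x')$, the liminf restricted to $(t,t')\in\mathbb{R}^2$ with $[t]=\tau$, $[t']=\tau'$. Backward weak KAM solution of $u_\tau+H(x,u_x,\tau)=0$: a function $u:M\times\mathbb{S}^1\to\mathbb{R}$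 such that (1) $u(x,\tau)-u(y,s)\le\Phi_{s,\tau}(y,x)$ for all $(x,\tau),(y,s)\in M\times\mathbb{S}^1$; (2) for every $(x,\tau)\in M\times\mathbb{S}^1$ there is a curve $\gamma:(-\infty,\tilde\tau]\to M$ with $\gamma(\tilde\tau)=x$, $[\tilde\tau]=\tau$ and $u(x,\tau)-u(\gamma(t),[t])=\int_t^{\tilde\tau}L(\gamma(s),\dot\gamma(s),s)\,ds$ for all $t\in(-\infty,\tilde\tau]$. *)

(* Defs.v *)
From HB Require Import structures.
From mathcomp Require Import all_boot all_order all_algebra.
From mathcomp Require Import all_classical all_reals all_analysis.

Set Implicit Arguments.
Unset Strict Implicit.
Unset Printing Implicit Defensive.

Import Order.TTheory GRing.Theory Num.Theory.
Import numFieldNormedType.Exports.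

Local Open Scope classical_set_scope.
Local Open Scope ring_scope.
Local Open Scope quotient_scope.

Section Circle.
Variable R : realType.

Definition eq_mod1 (s t : R) : bool := s - t \is a Num.int.

Lemma eq_mod1_refl : reflexive eq_mod1.
Proof. by move=> s; rewrite /eq_mod1 subrr rpred0. Qed.

Lemma eq_mod1_sym : symmetric eq_mod1.
Proof. by move=> s t; rewrite /eq_mod1 -opprB rpredN. Qed.

Lemma eq_mod1_trans : transitive eq_mod1.
Proof.
by move=> t s r st tr; rewrite /eq_mod1 -(subrKA t) rpredD.
Qed.

Canonical eq_mod1_equiv := EquivRel eq_mod1 eq_mod1_refl eq_mod1_sym eq_mod1_trans.

Definition circle : Type := {eq_quot eq_mod1_equiv}.

HB.instance Definition _ := Choice.on circle.

Definition circle_of (t : R) : circle := \pi_({eq_quot eq_mod1_equiv}) t.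

Definition circle_repr (tau : circle) : R := repr (tau : {eq_quot eq_mod1_equiv}).

HB.instance Definition _ := isPointed.Build circle (circle_of 0).

End Circle.

Section Smooth.
Variables (R : realType) (V W : normedModType R).

(* C^k on the open set U; in finite dimension, C^(k+1) means differentiable
   with all the directional derivatives in constant directions of class C^k. *)
Fixpoint Ck_on (k : nat) (U : set V) (f : V -> W) : Prop :=
  if k is k'.+1 then
    (forall x, U x -> differentiable f x) /\
    (forall v, Ck_on k' U (fun x => 'D_v f x))
  else forall x, U x -> {for x, continuous f}.

Definition smooth_on (U : set V) (f : V -> W) : Prop := forall k, Ck_on k U f.

End Smooth.

(* A chart is a homeomorphism [cmap] from the open set [cdom] of M onto an open
   subset of R^n; [cinv] is its inverse, with junk values outside the image. *)
Record chart (R : realType) (M : topologicalType) (n : nat) := Chart {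
  cdom : set M;
  cmap : M -> 'rV[R]_n;
  cinv : 'rV[R]_n -> M;
  cdom_open : open cdom;
  cimg_open : open (cmap @` cdom);
  cmap_continuous : {within cdom, continuous cmap};
  cinv_continuous : {within cmap @` cdom, continuous cinv};
  cmapK : forall x, cdom x -> cinv (cmap x) = x }.

Definition cimg (R : realType) (M : topologicalType) (n : nat)
  (c : chart R M n) : set 'rV[R]_n := cmap c @` cdom c.

(* The preferred chart [chart_at x] around each point x is an arbitrary choice
   which only serves to represent tangent vectors. *)
Record smooth_structure (R : realType) (M : topologicalType) (n : nat) :=
  SmoothStructure {
  atlas : set (chart R M n);
  chart_at : M -> chart R M n;
  chart_at_atlas : forall x, atlas (chart_at x);
  chart_at_mem : forall x, cdom (chart_at x) x;
  atlas_compat : forall c d, atlas c -> atlas d ->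
    smooth_on (cmap c @` (cdom c `&` cdom d)) (cmap d \o cinv c) }.

Section Manifold.
Context {R : realType} {M : ptopologicalType} {n : nat}.
Variable SM : smooth_structure R M n.

(* A vector of T_xM is represented by its coordinates v : 'rV_n in the chart
   [chart_at S x], which is a linear identification of T_xM with R^n.  Hence
   the set underlying TM is M * 'rV_n, but its topology and smooth structure
   are NOT the product ones: they are given by the maps [tangent_of c]. *)

(* coordinates in [chart_at SM (cinv c q)] of the vector based at [cinv c q]
   whose coordinates in the chart c are w *)
Definition tangent_coord (c : chart R M n) (q w : 'rV[R]_n) : 'rV[R]_n :=
  'd (cmap (chart_at SM (cinv c q)) \o cinv c) q w.

Definition tangent_of (c : chart R M n) (q w : 'rV[R]_n) : M * 'rV[R]_n :=
  (cinv c q, tangent_coord c q w).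

Definition velocity (gamma : R -> M) (t : R) : 'rV[R]_n :=
  derive1 (cmap (chart_at SM (gamma t)) \o gamma) t.

Definition curve_Ck_on (k : nat) (J : set R) (gamma : R -> M) : Prop :=
  (forall t, J t -> {for t, continuous gamma}) /\
  (forall c, atlas SM c ->
     Ck_on k (J `&` gamma @^-1` cdom c) (cmap c \o gamma)).

(* C^1 on the compact interval [a, b], derivatives at the end points being
   one-sided, i.e. extendable to a C^1 curve on an open neighbourhood *)
Definition C1_segment (a b : R) (gamma : R -> M) : Prop :=
  exists (J : set R) (eta : R -> M),
    [/\ open J, `[a, b] `<=` J, curve_Ck_on 1 J eta &
        {in `[a, b], eta =1 gamma}].

(* Continuous and piecewise C^1 on [a, b]; the values of gamma outside [a, b]
   are irrelevant. *)
Definition is_path (a b : R) (gamma : R -> M) : Prop :=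
  {within `[a, b], continuous gamma} /\
  exists2 s : seq R, itv_partition a b s &
    forall i, (i < size s)%N ->
      C1_segment (nth b (a :: s) i) (nth b s i) gamma.

Definition is_riemannian_metric
    (g : M -> 'rV[R]_n -> 'rV[R]_n -> R) : Prop :=
  [/\ forall x k u v w, g x (k *: u + v) w = k * g x u w + g x v w,
      forall x v w, g x v w = g x w v,
      forall x v, v != 0 -> 0 < g x v v &
      forall c, atlas SM c -> forall a b,
        smooth_on (cimg c)
          (fun q => g (cinv c q) (tangent_coord c q a) (tangent_coord c q b))].

Section Lagrangian.
Variables (g : M -> 'rV[R]_n -> 'rV[R]_n -> R).
Variable L : M -> 'rV[R]_n -> R -> R.

Definition local_lagrangian (c : chart R M n) (q w : 'rV[R]_n) (t : R) : R :=
  L (cinv c q) (tangent_coord c q w) t.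

Definition lagrangian_smooth : Prop :=
  forall c, atlas SM c ->
    smooth_on [set z : 'rV[R]_n * 'rV[R]_n * R | cimg c z.1.1]
              (fun z => local_lagrangian c z.1.1 z.1.2 z.2).

Definition lagrangian_periodic : Prop := forall x v t, L x v (t + 1) = L x v t.

Definition lagrangian_posdef : Prop :=
  forall x t v a, a != 0 -> 0 < 'D_a (fun w => 'D_a (fun w' => L x w' t) w) v.

Definition tangent_norm (x : M) (v : 'rV[R]_n) : R := Num.sqrt (g x v v).

Definition lagrangian_superlinear : Prop :=
  forall K : R, exists C : R, forall x v t,
    C < tangent_norm x v -> K < L x v t / tangent_norm x v.

(* d/dt (dL/dv) = dL/dx on the open set J, in every chart of the atlas and
   tested against every constant direction a *)
Definition EL_solution (J : set R) (gamma : R -> M) : Prop :=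
  curve_Ck_on 2 J gamma /\
  forall c t, atlas SM c -> J t -> cdom c (gamma t) ->
    let q := cmap c \o gamma in
    forall a : 'rV[R]_n,
      is_derive t (1 : R)
        (fun s => 'D_a (fun w => local_lagrangian c (q s) w s) (derive1 q s))
        ('D_a (fun y => local_lagrangian c y (derive1 q t) t) (q t)).

Definition open_interval (J : set R) : Prop :=
  [/\ open J, is_interval J & J !=set0].

Definition EL_maximal (J : set R) (gamma : R -> M) : Prop :=
  [/\ open_interval J, EL_solution J gamma &
      forall J' eta, open_interval J' -> J `<=` J' -> EL_solution J' eta ->
        {in J, eta =1 gamma} -> J' = J].

Definition EL_complete : Prop :=
  forall J gamma, EL_maximal J gamma -> J = setT.

(* The open sets of TM x S^1: those whose preimages under all the maps
   (q, w, t) |-> (tangent_of c q w, [t]) are open. *)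
Definition phase_open : set (set (M * 'rV[R]_n * circle R)) :=
  [set O | forall c, atlas SM c ->
     open [set z : 'rV[R]_n * 'rV[R]_n * R |
       cimg c z.1.1 /\ O (tangent_of c z.1.1 z.1.2, circle_of z.2)]].

(* TM x S^1 with its Borel sigma-algebra *)
Local Notation phase := (g_sigma_algebraType phase_open).

Definition tangent_lift (gamma : R -> M) (t : R) : phase :=
  (gamma t, velocity gamma t, circle_of t).

(* For a complete Tonelli Lagrangian the set below is a singleton. *)
Definition EL_flow (s : R) (z : phase) : phase :=
  xget z [set z' | exists gamma t,
    [/\ EL_solution setT gamma, tangent_lift gamma t = z &
        tangent_lift gamma (t + s) = z']].

Definition EL_invariant (mu : probability phase R) : Prop :=
  forall (s : R) (A : set phase), measurable A -> mu (EL_flow s @^-1` A) = mu A.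

(* By periodicity of L, the choice of the representative is irrelevant. *)
Definition mean_action (mu : probability phase R) : \bar R :=
  (\int[mu]_z (L z.1.1 z.1.2 (circle_repr z.2))%:E)%E.

(* c = - min { \int L dmu }, mu ranging over the invariant probabilities *)
Definition is_critical_value (c : R) : Prop :=
  (exists2 mu : probability phase R, EL_invariant mu &
     mean_action mu = (- c)%:E) /\
  (forall mu : probability phase R, EL_invariant mu ->
     ((- c)%:E <= mean_action mu)%E).

(* [velocity] is junk at the finitely many break points of a path, which form
   a null set. *)
Definition lag_action (a b : R) (gamma : R -> M) : R :=
  \int[lebesgue_measure]_(s in `[a, b]) L (gamma s) (velocity gamma s) s.

Definition min_action (t t' : R) (x y : M) : \bar R :=
  ereal_inf [set (lag_action t t' gamma)%:E | gamma in
    [set gamma | [/\ is_path t t' gamma, gamma t = x & gamma t' = y]]].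

Definition action_potential (tau tau' : circle R) (x x' : M) : \bar R :=
  ereal_inf [set min_action p.1 p.2 x x' | p in
    [set p : R * R | [/\ circle_of p.1 = tau, circle_of p.2 = tau' &
                         p.1 + 1 <= p.2]]].

Definition peierls_barrier (tau tau' : circle R) (x x' : M) : \bar R :=
  limf_einf (fun p : R * R => min_action p.1 p.2 x x')
    (filter_from [set: R] (fun T => [set p : R * R |
       [/\ circle_of p.1 = tau, circle_of p.2 = tau' & T <= p.2 - p.1]])).

Definition U_seq (u : M -> R) (n : nat) (x : M) (tau : R) : \bar R :=
  ereal_inf [set
    ereal_inf [set (u (gamma 0) + lag_action 0 (tau + k%:R) gamma)%:E | gamma in
      [set gamma | is_path 0 (tau + k%:R) gamma /\ gamma (tau + k%:R) = x]]
    | k in [set k : nat | (n <= k <= n.*2)%N]].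

Definition backward_weak_KAM (w : M -> circle R -> R) : Prop :=
  (forall x tau y s, ((w x tau - w y s)%:E <= action_potential s tau y x)%E) /\
  (forall x tau, exists (b : R) (gamma : R -> M),
     [/\ circle_of b = tau, gamma b = x &
         forall t, t <= b -> is_path t b gamma /\
           w x tau - w (gamma t) (circle_of t) = lag_action t b gamma]).

End Lagrangian.

End Manifold.

(* Main.v *)
(** Write [F s t x y] for the minimal action between [(x, s)] and [(y, t)].

    Short extremals are strict minimizers: they are calibrated by a quadratic
    subsolution of the Hamilton-Jacobi equation.  An ultrafilter limit of a
    minimizing sequence has an instant near which the sequence is slow; there it
    is an extremal, and completeness of the Euler-Lagrange flow continues it.
    Hence minimizers exist, are orbits of the flow and have bounded speed, so
    that [F] is continuous.

    The hypothesis [c(L) = 0] bounds [F 0 n] uniformly in [n].  From below: a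
    loop of length [n] of least action among all loops is a periodic orbit, as
    a corner could be shortened; its occupation measure is invariant, so its
    action is nonnegative.  From above: if for some [n] all orbits had action at
    least [1] over all intervals of length [n], then by Fatou's lemma applied to
    Riemann sums a minimizing measure would have positive mean action.

    Given these bounds, only the first and the last unit of time of a long curve
    depend on its end points and on its final time.  By compactness, the liminf
    [h] is a lower bound up to [e] for all durations beyond some [T], and is
    attained up to [e] at some duration at most [T], uniformly in the end points.
    Cutting a nearly minimal long curve at time [n >= T], and closing it by a
    nearly minimal one of duration at most [T], gives a nearly minimal curve of
    duration between [n] and [2n]: this is why the window [n <= k <= 2n] suffices.
    Calibrated curves are concatenations of unit minimizers for
    [ubar(x, t) = min_y (ubar(y, t - 1) + F (t - 1) t y x)]. *)
Require Import Defs.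
From HB Require Import structures.
From mathcomp Require Import all_boot all_order all_algebra.
From mathcomp Require Import all_classical all_reals all_analysis.
From mathcomp Require Import measurable_realfun.
From mathcomp Require Import ring lra.
Set Implicit Arguments.
Unset Strict Implicit.
Unset Printing Implicit Defensive.
Import Order.TTheory GRing.Theory Num.Theory.
Import numFieldNormedType.Exports.
Local Open Scope classical_set_scope.
Local Open Scope ring_scope.

(** * Real analysis and the Picard theorem *)

(** Piecewise C^1 paths form a class without compactness. The limit of a minimizing sequence is
    therefore a bare function, taken pointwise along an ultrafilter, and its regularity comes from
    squeezing the sequence against short extremals, whose strict minimality carries a gain quadratic
    in the distance. The squeeze works on any short interval over which the chord of the limit has
    bounded slope. A first such interval exists because the action is additive, so that it cannot
    exceed its mean on all intervals. The following ones overlap the part already identified with an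
    orbit, where the slope is controlled; completeness has made this orbit global beforehand, so the
    continuation follows a curve that is already defined.

    The same squeeze compares charts: a solution in one chart solves the equation in another one
    because short solutions minimize in both, and the transformation law of second derivatives is
    bypassed.

    On the phase space, orbits are compared through their jets, with Lipschitz estimates over short
    times chained into continuity of the flow; averages over an invariant measure are those of
    finite Riemann sums, computed term by term. *)

Lemma fun_choice (T U : Type) (P : T -> U -> Prop) :
  (forall x, exists y, P x y) -> exists f, forall x, P x (f x).
Proof. by move=> H; exists (fun x => projT1 (cid (H x))) => x; case: cid. Qed.

Section RV.
Variables (R : realType) (m : nat).
Implicit Types (v w : 'rV[R]_m) (q : R -> 'rV[R]_m).

Lemma coord_le_norm v i : `|v 0 i| <= `|v|.
Proof.
rewrite [leRHS]/Num.Def.normr /= mx_normrE.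
exact: (le_bigmax_cond _ (fun ij : 'I_1 * 'I_m => `|v ij.1 ij.2|) (j := (0, i))).
Qed.

Lemma rV_norm_le v c : 0 <= c -> (forall i, `|v 0 i| <= c) -> `|v| <= c.
Proof.
move=> c0 vc; rewrite [leLHS]/Num.Def.normr /= mx_normrE.
by apply/bigmax_leP; split => // -[i j] _ /=; rewrite ord1.
Qed.

Lemma is_derive_rV q (t : R) w :
  is_derive t (1 : R) q w <-> forall i, is_derive t (1 : R) (fun s => q s 0 i) (w 0 i).
Proof.
split => [[qt <-] i|qi].
- split; first by move/derivable_mxP: qt; exact.
  by rewrite (derive_mx qt) mxE.
- have qt : derivable q t 1.
    by apply/derivable_mxP => i j; rewrite ord1; have [] := qi j.
  split => //; rewrite (derive_mx qt); apply/rowP => i; rewrite mxE.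
  by have [] := qi i.
Qed.

(** The norm of row vectors is the sup norm, which is not differentiable. This Euclidean product
    supplies the smooth quadratic form of the calibration argument; [dot_le] and [dot_ge] compare it
    with the norm. *)
Definition dot v w : R := \sum_i v 0 i * w 0 i.

Lemma dotC v w : dot v w = dot w v.
Proof. by apply: eq_bigr => i _; rewrite mulrC. Qed.
Lemma dotZl (k : R) u v : dot (k *: u) v = k * dot u v.
Proof. by rewrite /dot mulr_sumr; apply: eq_bigr => i _; rewrite mxE mulrA. Qed.
Lemma dot0l v : dot 0 v = 0.
Proof. by rewrite -(scale0r 0) dotZl mul0r. Qed.
Lemma dot0r v : dot v 0 = 0.
Proof. by rewrite dotC dot0l. Qed.

Lemma dot_le u v : `|dot u v| <= m%:R * `|u| * `|v|.
Proof.
apply: le_trans (ler_norm_sum _ _ _) _.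
rewrite -mulrA mulr_natl -[X in _ *+ X]card_ord -sumr_const.
by apply: ler_sum => i _; rewrite normrM ler_pM // coord_le_norm.
Qed.

Lemma dot_ge u : `|u| ^+ 2 <= dot u u.
Proof.
have d0 : 0 <= dot u u by apply: sumr_ge0 => i _; exact: sqr_ge0.
rewrite -[leRHS]sqr_sqrtr // ler_pXn2r ?nnegrE ?sqrtr_ge0 //.
apply: rV_norm_le => [|i]; first exact: sqrtr_ge0.
rewrite -sqrtr_sqr ler_wsqrtr // /dot (bigD1 i) //= expr2 lerDl.
by apply: sumr_ge0 => j _; exact: sqr_ge0.
Qed.

Lemma is_derive_dot p q (t : R) (p' q' : 'rV[R]_m) :
  is_derive t (1 : R) p p' -> is_derive t (1 : R) q q' ->
  is_derive t (1 : R) (fun s => dot (p s) (q s)) (dot p' (q t) + dot (p t) q').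
Proof.
move=> /is_derive_rV Hp /is_derive_rV Hq.
have -> : (fun s => dot (p s) (q s)) = \sum_(i < m) ((fun s => p s 0 i) * (fun s => q s 0 i)).
  by apply/funext => s; rewrite fct_sumE.
apply: is_derive_eq.
rewrite /dot -big_split; apply: eq_bigr => i _ /=.
by rewrite addrC; congr (_ + _); rewrite -[LHS]/(_ * _) mulrC.
Qed.

End RV.

Section RealLine.
Variable R : realType.
Implicit Types (a b t s : R) (P Q : R -> R).

Lemma is_derive_continuous (V : normedModType R) (q : R -> V) t w :
  is_derive t (1 : R) q w -> {for t, continuous q}.
Proof. by move=> [qt _]; apply/differentiable_continuous/derivable1_diffP. Qed.

Lemma is_derive_near (V : normedModType R) (f g : R -> V) t w :
  (\forall s \near t, f s = g s) -> is_derive t (1 : R) f w -> is_derive t (1 : R) g w.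
Proof.
move=> fg fw.
have fg' : {near t, f =1 g} by [].
have v0 : (1 : R) != 0 by exact: oner_neq0.
split; first by apply: (near_eq_derivable fg'); case: fw.
by rewrite -(near_eq_derive (1 : R) fg); have [] := fw.
Qed.

Lemma within_sub (T : topologicalType) (f : R -> T) a b a' b' :
  {within `[a, b], continuous f} -> a <= a' -> b' <= b ->
  {within `[a', b'], continuous f}.
Proof.
move=> cf aa' bb'; apply: continuous_subspaceW cf => s /=.
by rewrite !in_itv /= => /andP[? ?]; rewrite (le_trans aa') //= (le_trans _ bb').
Qed.

(** [s] lists the instants at which nothing is known of the derivative, in practice the break points
    of a path. The interval is cut at each of them and the mean value theorem is used on the
    pieces. *)
Lemma ge0_derive_le (s : seq R) P a b : a <= b ->
  {within `[a, b], continuous P} ->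
  (forall t, a < t < b -> t \notin s -> exists2 D, 0 <= D & is_derive t (1 : R) P D) ->
  P a <= P b.
Proof.
elim: s a b => [|c s IH] a b ab cP dP.
- move: ab; rewrite le_eqVlt => /predU1P[->//|ab].
  have dP' t : t \in `]a, b[ -> is_derive t (1 : R) P ('D_1 P t).
    by rewrite in_itv /= => /dP -/(_ isT) [D _ dPt]; apply: derivableP; case: dPt.
  have [c] := MVT ab dP' cP.
  rewrite in_itv /= => /dP -/(_ isT) [D D0 [_ ->]] E.
  by rewrite -subr_ge0 E mulr_ge0 // subr_ge0 ltW.
- have [/andP[ac cb]|ncab] := boolP (a < c < b).
    apply: (@le_trans _ _ (P c)).
    + apply: IH (ltW ac) _ _; first exact: within_sub cP _ (ltW cb).
      move=> t /andP[at_ tc] ts; apply: dP; first by rewrite at_ (lt_trans tc).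
      by rewrite inE negb_or ts (lt_eqF tc).
    + apply: IH (ltW cb) _ _; first exact: within_sub cP (ltW ac) _.
      move=> t /andP[ct tb] ts; apply: dP; first by rewrite tb (lt_trans ac).
      by rewrite inE negb_or ts (gt_eqF ct).
  apply: IH ab cP _ => t tab ts; apply: dP => //.
  by rewrite inE negb_or ts andbT; apply: contraNneq ncab => <-.
Qed.

Lemma le_derive_le (s : seq R) P Q a b : a <= b ->
  {within `[a, b], continuous P} -> {within `[a, b], continuous Q} ->
  (forall t, a < t < b -> t \notin s -> exists D E,
    [/\ is_derive t (1 : R) P D, is_derive t (1 : R) Q E & D <= E]) ->
  P b - P a <= Q b - Q a.
Proof.
move=> ab cP cQ dPQ; rewrite -subr_ge0.
suff : (Q - P) a <= (Q - P) b by rewrite -subr_ge0 /=; congr (_ <= _); rewrite !fctE; ring.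
apply: (@ge0_derive_le s) => //.
  by move=> t; exact: (continuousB (cQ t) (cP t)).
move=> t tab ts; have [D [E [dP dQ DE]]] := dPQ t tab ts.
by exists (E - D); [rewrite subr_ge0|exact: is_deriveB].
Qed.

(** For the sup norm each coordinate can be treated separately, by comparison with lines of slope
    [C] and [- C]. *)
Lemma mean_value_le m (q w : R -> 'rV[R]_m) a b C : a <= b -> 0 <= C ->
  (forall t, a <= t <= b -> is_derive t (1 : R) q (w t)) ->
  (forall t, a <= t <= b -> `|w t| <= C) -> `|q b - q a| <= C * (b - a).
Proof.
move=> ab C0 dq wC; apply: rV_norm_le => [|i]; first by rewrite mulr_ge0 ?subr_ge0.
have dqi t : a <= t <= b -> is_derive t (1 : R) (fun s => q s 0 i) (w t 0 i).
  by move=> tab; have /is_derive_rV := dq t tab; exact.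
have cq : {within `[a, b], continuous (fun s => q s 0 i)}.
  apply: continuous_in_subspaceT => t; rewrite inE /= in_itv /= => tab.
  exact: (@is_derive_continuous _ _ _ (w t 0 i)) (dqi _ _).
have cC (k : R) : {within `[a, b], continuous (fun s => k * s)}.
  apply: continuous_subspaceT => t; exact: mulrl_continuous.
have dC (k t : R) : is_derive t (1 : R) (fun s => k * s) k.
  by apply: is_derive_eq (is_deriveM (is_derive_cst k _ _) (is_derive_id _ _)) _;
     rewrite /GRing.scale /= mulr1 mulr0 addr0.
have wCi t : a <= t <= b -> - C <= w t 0 i <= C.
  by move=> tab; rewrite -ler_norml (le_trans (coord_le_norm _ _)) ?wC.
rewrite !mxE ler_norml; apply/andP; split.
- have := @le_derive_le [::] _ _ a b ab (cC (- C)) cq.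
  rewrite -mulrBr mulNr; apply => t /andP[at_ tb] _; exists (- C), (w t 0 i); split; first exact: dC.
    by apply: dqi; rewrite !ltW.
  by have /andP[] : - C <= w t 0 i <= C by apply: wCi; rewrite !ltW.
- have := @le_derive_le [::] _ _ a b ab cq (cC C).
  rewrite -mulrBr; apply => t /andP[at_ tb] _; exists (w t 0 i), C; split; last 1 first.
    by have /andP[] : - C <= w t 0 i <= C by apply: wCi; rewrite !ltW.
  by apply: dqi; rewrite !ltW.
  exact: dC.
Qed.

End RealLine.

(** * Continuation and covering arguments on an interval *)

Section Intervals.
Variable R : realType.
Implicit Types (a b t s : R).

Lemma within_nearP (T : topologicalType) (f : R -> T) a b :
  {within `[a, b], continuous f} <->
  forall s, a <= s <= b -> forall U, nbhs (f s) U ->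
    exists2 e : R, 0 < e & forall r, a <= r <= b -> `|r - s| < e -> U (f r).
Proof.
split.
- move=> /subspace_continuousP cf s sab U fU.
  have : `[a, b]%classic s by rewrite /= in_itv.
  move=> /cf /(_ _ fU); rewrite /nbhs /= /within /= => /nbhs_ballP[e /= e0 He].
  exists e => // r rab rs; apply: He; last by rewrite in_itv.
  by rewrite /ball /= distrC.
- move=> H; apply/subspace_continuousP => s /=; rewrite in_itv /= => sab U /= fU.
  have [e e0 He] := H s sab U fU.
  rewrite /nbhs /= /within /=; apply/nbhs_ballP; exists e => //= r.
  by rewrite /ball /= distrC => rs; rewrite in_itv /= => rab; exact: He.
Qed.

(** Connectedness of a segment in epsilon form. It propagates a property, such as the coincidence of
    two curves, from one instant to a whole interval. *)
Lemma interval_clopen (G : R -> Prop) a b :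
  (exists2 s, a <= s <= b & G s) ->
  (forall s, a <= s <= b -> G s ->
    exists2 e : R, 0 < e & forall r, a <= r <= b -> `|r - s| < e -> G r) ->
  (forall s, a <= s <= b ->
    (forall e, 0 < e -> exists r, [/\ a <= r <= b, `|r - s| < e & G r]) -> G s) ->
  forall s, a <= s <= b -> G s.
Proof.
move=> [s0 s0ab G0] Gopen Gclosed.
pose B := [set s | a <= s <= b /\ G s].
suff BE : B = `[a, b]%classic.
  by move=> s sab; have : `[a, b]%classic s by []; rewrite -BE => -[].
apply: segment_connected.
- by exists s0.
- exists [set r | exists s e, [/\ a <= s <= b, 0 < e, `|r - s| < e &
      forall r, a <= r <= b -> `|r - s| < e -> G r]].
    rewrite openE => r [s [e [sab e0 rs H]]].
    apply/nbhs_ballP; exists (e - `|r - s|); rewrite /= ?subr_gt0 // => r'.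
    rewrite /ball /= => rr'; exists s, e; split => //.
    have -> : r' - s = (r - s) - (r - r') by ring.
    by apply: le_lt_trans (ler_normB _ _) _; lra.
  apply/seteqP; split => [s [sab Gs]|s [/= + [s' [e [s'ab e0 ss' H]]]]].
    split; first by rewrite /= in_itv.
    have [e e0 H] := Gopen s sab Gs; exists s, e; split => //.
    by rewrite subrr normr0.
  by rewrite in_itv /= => sab; split => //; exact: H.
- exists (closure B); first exact: closed_closure.
  apply/seteqP; split => [s Bs|s [/= + Cs]].
    by split; [case: Bs => /=; rewrite in_itv|exact: subset_closure].
  rewrite in_itv /= => sab; split => //; apply: Gclosed => // e e0.
  have [r [[rab Gr] rs]] := Cs _ (nbhsx_ballx s e e0).
  by exists r; split => //; rewrite distrC.
Qed.

(** The supremum [s] of the ends reachable from [a] is bridged by the local hypothesis at [s], from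
    a reachable point just before it to a point just after it. This globalizes properties that are
    additive over intervals, such as estimates of actions. *)
Lemma interval_cousin (P : R -> R -> Prop) a b : a <= b ->
  (forall r s t, a <= r -> r <= s -> s <= t -> t <= b -> P r s -> P s t -> P r t) ->
  (forall s, a <= s <= b -> exists2 e : R, 0 < e & forall r t, a <= r -> r <= s -> s <= t -> t <= b ->
     s - e < r -> t < s + e -> P r t) -> P a b.
Proof.
move=> ab Padd Ploc.
pose S := [set s | a <= s <= b /\ P a s].
have Sa : S a.
  split; first by rewrite lexx.
  have [|e e0] := Ploc a; first by rewrite lexx.
  by apply => //; lra.
have supS : has_sup S by split; [exists a|exists b => r [/andP[]]].
set s := sup S.
have as_ : a <= s by apply: sup_upper_bound.
have sb : s <= b by apply: ge_sup => [|r [/andP[]]//]; exists a.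
have [|e e0 He] := Ploc s; first by rewrite as_.
have [r [/andP[ar rb] Pr] rs] := sup_adherent e0 supS.
have rs' : r <= s by apply: sup_upper_bound => //; split => //; rewrite ar.
have Pt t : s <= t -> t <= b -> t < s + e -> P a t.
  by move=> st tb te; apply: (Padd _ r) => //; [exact: le_trans st|exact: He].
have [bs|sb'] := leP b (s + e / 2); first by apply: Pt => //; lra.
have : s + e / 2 <= s.
  apply: sup_upper_bound => //; split; last by apply: Pt; lra.
  by rewrite (ltW sb') (le_trans as_) // lerDl divr_ge0 // ltW.
by lra.
Qed.

End Intervals.

(** * Local existence for ordinary differential equations *)

Section Picard.
Variables (R : realType) (m : nat).
Notation E := 'rV[R]_m.

Lemma primitive_real (f : R -> R) (a : R) : continuous f ->
  exists P : R -> R, forall t, a < t -> is_derive t (1 : R) P (f t).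
Proof.
move=> cf; exists (fun t => \int[lebesgue_measure]_(s in `[a, t]) f s) => t at_.
have int_f : lebesgue_measure.-integrable `[a, t + 1] (EFin \o f).
  apply: continuous_compact_integrable; first exact: segment_compact.
  exact: continuous_subspaceT.
have [|d1 d2] := continuous_FTC1_closed _ int_f at_ (cf t); first by rewrite ltrDl.
split; [exact: d1|rewrite -derive1E; exact: d2].
Qed.

Lemma primitive_rV (f : R -> E) (a : R) : continuous f ->
  exists P : R -> E, forall t, a < t -> is_derive t (1 : R) P (f t).
Proof.
move=> cf.
have cfi i : continuous (fun s => f s 0 i).
  by move=> s; apply: (@continuous_comp _ _ _ f (fun v : E => v 0 i)); [exact: cf|exact: coord_continuous].
have [P HP] : exists P : 'I_m -> R -> R, forall i t, a < t -> is_derive t (1 : R) (P i) (f t 0 i).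
  apply: (@fun_choice _ _ (fun i P => forall t, a < t -> is_derive t (1 : R) P (f t 0 i))) => i.
  exact: primitive_real.
exists (fun t => \row_i P i t) => t at_; apply/is_derive_rV => i.
have -> : (fun s => (\row_i0 P i0 s : E) 0 i) = P i by apply/funext => s; rewrite mxE.
exact: HP.
Qed.

Definition clamp (a b t : R) : R := Num.min (Num.max t a) b.

Lemma clamp_in a b t : a <= b -> a <= clamp a b t <= b.
Proof. by move=> ab; rewrite /clamp le_min ge_min lexx !orbT andbT /= le_max lexx orbT ab. Qed.

Lemma clamp_id a b t : a <= t <= b -> clamp a b t = t.
Proof. by move=> /andP[at_ tb]; rewrite /clamp; rewrite (max_l at_) min_l. Qed.

Lemma clamp_lip a b s t : `|clamp a b s - clamp a b t| <= `|s - t|.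
Proof.
wlog st : s t / s <= t.
  move=> H; have [st|/ltW ts] := leP s t; first exact: H.
  by rewrite distrC [leRHS]distrC; exact: H.
rewrite (ler0_norm (_ : s - t <= 0)) ?subr_le0 // opprB distrC.
rewrite /clamp; case: (leP s a) => h1; case: (leP t a) => h2; case: (leP a b) => h3;
  case: (leP s b) => h4; case: (leP t b) => h5; rewrite ler_norml; lra.
Qed.

Lemma lip_continuous (V W : normedModType R) (f : V -> W) (k : R) :
  (forall x y, `|f x - f y| <= k * `|x - y|) -> continuous f.
Proof.
move=> H x; apply/cvgrPdist_lt => e e0.
have k1 : 0 < `|k| + 1 by rewrite ltr_pwDr.
near=> y.
apply: le_lt_trans (H _ _) _.
apply: (@le_lt_trans _ _ ((`|k| + 1) * `|x - y|)).
  by rewrite ler_wpM2r // (le_trans (ler_norm _)) // lerDl.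
rewrite mulrC -ltr_pdivlMr //.
near: y; apply: cvgr_dist_lt; last by rewrite divr_gt0.
exact: cvg_id.
Unshelve. all: by end_near. Qed.

Lemma clamp_continuous a b : continuous (clamp a b).
Proof. by apply: (@lip_continuous R R _ 1) => x y; rewrite mul1r; exact: clamp_lip. Qed.

(** Time is clamped to [[t1 - h, t1 + h]], so that [I f] is continuous on the whole line while it is
    a primitive of [f] only near [t1]. The fixed-point iteration then runs among globally continuous
    functions, with estimates uniform in time. *)
Lemma integration_operator (t1 h : R) : 0 < h -> exists I : (R -> E) -> R -> E,
  [/\ forall f, continuous f -> continuous (I f),
      forall f, I f t1 = 0,
      forall f t, continuous f -> `|t - t1| < h -> is_derive t (1 : R) (I f) (f t),
      forall f g C, continuous f -> continuous g -> 0 <= C ->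
        (forall s, `|s - t1| <= h -> `|f s - g s| <= C) ->
        forall t, `|I f t - I g t| <= C * h &
      forall f C, continuous f -> 0 <= C -> (forall s, `|s - t1| <= h -> `|f s| <= C) ->
        forall t, `|I f t| <= C * h].
Proof.
move=> h0.
have [P HP] : exists P : (R -> E) -> R -> E, forall f, continuous f ->
    forall t, t1 - h - 1 < t -> is_derive t (1 : R) (P f) (f t).
  apply: (@fun_choice _ _ (fun f P => continuous f -> forall t, t1 - h - 1 < t -> is_derive t (1 : R) P (f t))) => f.
  have [cf|ncf] := pselect (continuous f); last by exists (cst 0).
  by have [P HP] := primitive_rV (t1 - h - 1) cf; exists P.
pose cl := clamp (t1 - h) (t1 + h).
have clin t : t1 - h <= cl t <= t1 + h by apply: clamp_in; lra.
have cl1 : cl t1 = t1 by apply: clamp_id; lra.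
have dP f t : continuous f -> t1 - h <= t <= t1 + h -> is_derive t (1 : R) (P f) (f t).
  by move=> cf tin; apply: HP => //; lra.
have bound (Q q : R -> E) C t : 0 <= C ->
    (forall s, t1 - h <= s <= t1 + h -> is_derive s (1 : R) Q (q s)) ->
    (forall s, `|s - t1| <= h -> `|q s| <= C) -> `|Q (cl t) - Q t1| <= C * h.
  move=> C0 dQ qC.
  have bq s : t1 - h <= s <= t1 + h -> `|q s| <= C.
    by move=> sin; apply: qC; rewrite ler_norml; lra.
  have /andP[c1 c2] := clin t.
  have [t1c|ct1] := leP t1 (cl t).
    apply: (@le_trans _ _ (C * (cl t - t1))); last by rewrite ler_wpM2l //; lra.
    apply: (@mean_value_le _ _ Q q) => // s sin.
      by apply: dQ; lra.
    by apply: bq; lra.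
  rewrite distrC; apply: (@le_trans _ _ (C * (t1 - cl t))); last by rewrite ler_wpM2l //; lra.
  apply: (@mean_value_le _ _ Q q) => //; first exact: ltW.
    by move=> s sin; apply: dQ; lra.
  by move=> s sin; apply: bq; lra.
exists (fun f t => P f (cl t) - P f t1); split.
- move=> f cf t; apply: cvgB; last exact: cvg_cst.
  apply: continuous_comp; first exact: clamp_continuous.
  exact: is_derive_continuous (dP _ _ cf (clin t)).
- by move=> f; rewrite cl1 subrr.
- move=> f t cf tt; move: (tt); rewrite ltr_norml => tt'.
  apply: (@is_derive_near _ _ (fun s => P f s - P f t1)).
    near=> s; rewrite /cl clamp_id //.
    have : `|t - s| < h - `|t - t1|.
      by near: s; apply: cvgr_dist_lt; [exact: cvg_id|rewrite subr_gt0].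
    move=> H; suff : `|s - t1| <= h by rewrite ler_norml; lra.
    have -> : s - t1 = (t - t1) - (t - s) by ring.
    by apply: le_trans (ler_normB _ _) _; lra.
  rewrite -[X in is_derive _ _ _ X]subr0; apply: is_deriveB.
  by apply: dP => //; lra.
- move=> f g C cf cg C0 fgC t.
  have -> : P f (cl t) - P f t1 - (P g (cl t) - P g t1) = (P f - P g) (cl t) - (P f - P g) t1.
     by rewrite !fctE !opprB addrACA [RHS]addrACA; congr (_ + _); rewrite addrC.
  apply: (bound _ (f - g)) => // s sin.
  by apply: is_deriveB; exact: dP.
- move=> f C cf C0 fC t; apply: (bound _ f) => // s sin; exact: dP.
Unshelve. all: by end_near. Qed.

Lemma geometric_small (C e : R) : 0 < e -> exists k, 2 * C * 2^-1 ^+ k < e.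
Proof.
move=> e0; have : 2 * C * 2^-1 ^+ k @[k --> \oo] --> (2 * C * 0 : R).
  apply: cvgM; first exact: cvg_cst.
  by apply: cvg_expr; rewrite ger0_norm ?invr_ge0 // invf_lt1 // ltr1n.
rewrite mulr0 => /cvgrPdist_lt /(_ e e0) [k _ Hk].
exists k; have := Hk k (leqnn k); rewrite /= sub0r normrN; apply: le_lt_trans.
exact: ler_norm.
Qed.

Lemma geometric_cvg (u : nat -> E) (C : R) : 0 <= C ->
  (forall k, `|u k.+1 - u k| <= C * 2^-1 ^+ k) ->
  exists l, forall k, `|u k - l| <= 2 * C * 2^-1 ^+ k.
Proof.
move=> C0 uC.
have p0 k : 0 < 2^-1 ^+ k :> R by rewrite exprn_gt0 ?invr_gt0.
have tel k j : `|u (j + k)%N - u k| <= 2 * C * 2^-1 ^+ k - 2 * C * 2^-1 ^+ (j + k)%N.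
  elim: j => [|j IH]; first by rewrite add0n !subrr normr0.
  have -> : u (j.+1 + k)%N - u k = (u (j + k).+1 - u (j + k)%N) + (u (j + k)%N - u k).
    by rewrite addrA subrK.
  apply: le_trans (ler_normD _ _) _.
  have := uC (j + k)%N; rewrite addSn exprS; lra.
have tel' k n : (k <= n)%N -> `|u n - u k| <= 2 * C * 2^-1 ^+ k.
  move=> kn; rewrite -(subnK kn); apply: le_trans (tel _ _) _.
  by rewrite lerBlDr lerDl !mulr_ge0 // ltW.
have small e : 0 < e -> exists k, 2 * C * 2^-1 ^+ k < e by exact: geometric_small.
have : cvg (u n @[n --> \oo]).
  apply/cauchy_cvgP/cauchy_exP => e e0.
  have [k Hk] := small e e0; exists (u k).
  exists k => // n /= kn; rewrite -ball_normE /= distrC.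
  exact: le_lt_trans (tel' _ _ kn) Hk.
move=> cu; exists (lim (u n @[n --> \oo])) => k.
rewrite distrC; apply/ler_addgt0Pl => e e0.
have /cvgrPdist_lt /(_ e e0) [N _ HN] := cu.
have := HN (maxn N k) (leq_maxl _ _); set n := maxn N k => Hn.
have -> : lim (u n @[n --> \oo]) - u k = (lim (u n @[n --> \oo]) - u n) + (u n - u k).
  by rewrite addrA subrK.
apply: le_trans (ler_normD _ _) _; apply: lerD; first exact: ltW.
by apply: tel'; exact: leq_maxr.
Qed.

(** Since [K * h <= 2^-1], the integral operator halves distances and the iterates converge
    geometrically, uniformly in time. Bounds are asked on the whole space because the field is
    clamped before this is applied. *)
Theorem picard (F : R -> E -> E) (t1 h K B : R) (y0 : E) : 0 < h -> 0 <= K -> 0 <= B -> K * h <= 2^-1 ->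
  (forall y, continuous y -> continuous (fun s => F s (y s))) ->
  (forall s y z, `|F s y - F s z| <= K * `|y - z|) ->
  (forall s y, `|F s y| <= B) ->
  exists y : R -> E, [/\ y t1 = y0, continuous y &
    forall t, `|t - t1| < h -> is_derive t (1 : R) y (F t (y t))].
Proof.
move=> h0 K0 B0 Kh Fc Flip FB.
have [I [Ic I1 Id Ilip Ib]] := integration_operator t1 h0.
pose T (y : R -> E) := fun t => y0 + I (fun s => F s (y s)) t.
have Tc y : continuous y -> continuous (T y).
  by move=> cy t; apply: cvgD; [exact: cvg_cst|apply: Ic; exact: Fc].
have Tlip y z C : continuous y -> continuous z -> 0 <= C ->
    (forall s, `|y s - z s| <= C) -> forall t, `|T y t - T z t| <= C * 2^-1.
  move=> cy cz C0 yz t; rewrite /T opprD addrACA subrr add0r.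
  apply: le_trans (Ilip _ _ (K * C) (Fc _ cy) (Fc _ cz) _ _ t) _.
  - by rewrite mulr_ge0.
  - by move=> s _; apply: le_trans (Flip _ _ _) _; rewrite ler_wpM2l.
  - by rewrite mulrAC mulrC ler_wpM2l.
pose u k := iter k T (cst y0).
have uc k : continuous (u k).
  by elim: k => [|k IH] /=; [move=> t; exact: cvg_cst|exact: Tc].
have C0 : 0 <= 2 * B * h by rewrite !mulr_ge0 // ltW.
have ustep k t : `|u k.+1 t - u k t| <= (2 * B * h) * 2^-1 ^+ k.
  elim: k t => [|k IH] t.
    rewrite /= /T /= expr0 mulr1 /cst.
    have -> : y0 + I (fun s => F s y0) t - y0 = I (fun s => F s y0) t by rewrite addrAC subrr add0r.
    have cF : continuous (fun s => F s y0) by apply: (Fc (cst y0)) => ?; exact: cvg_cst.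
    apply: (@le_trans _ _ (B * h)); first by apply: Ib.
    by rewrite -mulrA ler_peMl ?mulr_ge0 ?ler1n // ltW.
  rewrite exprSr mulrA; apply: (Tlip (u k.+1) (u k)) => //.
  by rewrite mulr_ge0 // exprn_ge0 // invr_ge0.
have [y Hy] : exists y : R -> E, forall t k, `|u k t - y t| <= 2 * (2 * B * h) * 2^-1 ^+ k.
  apply: (@fun_choice _ _ (fun t l => forall k, `|u k t - l| <= 2 * (2 * B * h) * 2^-1 ^+ k)) => t.
  exact: geometric_cvg.
have small e : 0 < e -> exists k, 2 * (2 * B * h) * 2^-1 ^+ k < e by exact: geometric_small.
have yc : continuous y.
  move=> t; apply/cvgrPdist_lt => e e0.
  have [k Hk] := small (e / 3) (ltac:(by rewrite divr_gt0)).
  near=> s.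
  have -> : y t - y s = - (u k t - y t) + (u k t - u k s) + (u k s - y s).
    by apply/rowP => i; rewrite !mxE; ring.
  apply: le_lt_trans (ler_normD _ _) _.
  have := le_lt_trans (Hy s k) Hk.
  suff : `|- (u k t - y t) + (u k t - u k s)| < e / 3 + e / 3 by lra.
  apply: le_lt_trans (ler_normD _ _) _; rewrite normrN.
  have := le_lt_trans (Hy t k) Hk.
  suff : `|u k t - u k s| < e / 3 by lra.
  by near: s; apply: cvgr_dist_lt; [exact: uc|rewrite divr_gt0].
have yE : y = T y.
  apply/funext => t; apply/eqP; rewrite -subr_eq0 -normr_eq0 eq_le normr_ge0 andbT.
  apply/ler_addgt0Pl => e e0; rewrite addr0.
  have [k Hk] := small (e / 2) (ltac:(by rewrite divr_gt0)).
  have -> : y t - T y t = (u k.+1 t - T y t) - (u k.+1 t - y t).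
    by apply/rowP => i; rewrite !mxE; ring.
  apply: le_trans (ler_normB _ _) _.
  have p0 j : 0 <= 2 * (2 * B * h) * 2^-1 ^+ j by rewrite !mulr_ge0 // ?exprn_ge0 ?invr_ge0 // ltW.
  have h1 := Hy t k.+1.
  have h2 : `|u k.+1 t - T y t| <= 2 * (2 * B * h) * 2^-1 ^+ k * 2^-1.
    by apply: Tlip => // s; exact: Hy.
  move: h1; rewrite exprSr mulrA; have := p0 k; lra.
exists y; split => //; first by rewrite yE /T I1 addr0.
move=> t tt; rewrite yE.
rewrite -[X in is_derive _ _ _ X]add0r; apply: is_deriveD.
by rewrite -yE; apply: Id => //; exact: Fc.
Unshelve. all: by end_near. Qed.

End Picard.

Lemma bounded_on_compact (R : realType) (T : topologicalType) (A : set T) (g : T -> R) : compact A ->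
  (forall x, A x -> {for x, continuous g}) -> exists2 C, 0 <= C & forall x, A x -> `|g x| <= C.
Proof.
move=> /compact_near_coveringP cA cg.
have H := cA R (pinfty_nbhs R) (fun C x => `|g x| <= C) _.
have : \forall C \near +oo, A `<=` [set x | `|g x| <= C].
  apply: H => x Ax; near=> y C; rewrite /=.
  apply: (@le_trans _ _ (`|g x| + 1)); last by near: C; exact: nbhs_pinfty_ge.
  rewrite -lerBlDl; apply: le_trans (ler_norm _) _.
  apply: le_trans (ler_dist_dist _ _) _; rewrite distrC; apply: ltW.
  by near: y; apply: cvgr_dist_lt; [exact: cg|exact: ltr01].
move=> HC; near (pinfty_nbhs R) => C; exists C; last by near: C.
by near: C; exact: nbhs_pinfty_ge.
Unshelve. all: by end_near. Qed.

(** * Smooth Lagrangians on an open set *)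

Section SmoothOn.
Variables (R : realType) (V W : normedModType R) (U : set V).
Implicit Types (f g : V -> W).

Lemma smooth_derive f v : smooth_on U f -> smooth_on U (fun x => 'D_v f x).
Proof. by move=> fs k; have [_] := fs k.+1; exact. Qed.

Lemma smooth_diff f x : smooth_on U f -> U x -> differentiable f x.
Proof. by move=> fs; have [H _] := fs 1%N; exact: H. Qed.

Lemma smooth_cont f x : smooth_on U f -> U x -> {for x, continuous f}.
Proof. by move=> fs; have H := fs 0%N; exact: H. Qed.

Lemma derive_period f e v x : (forall y, f (y + e) = f y) ->
  'D_v f (x + e) = 'D_v f x.
Proof.
move=> fe; rewrite /derive.
suff -> : (fun h : R => h^-1 *: ((f \o shift (x + e)) (h *: v) - f (x + e))) =
  (fun h : R => h^-1 *: ((f \o shift x) (h *: v) - f x)) by [].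
by apply/funext => h /=; rewrite addrA !fe.
Qed.

End SmoothOn.

Section Coordinates.
Variables (R : realType) (d : nat).
Notation V := 'rV[R]_d.
Notation W := (V * V * R)%type.

Definition pt (q w : V) (t : R) : W := (q, w, t).
Definition dq (a : V) : W := (a, 0, 0).
Definition dw (a : V) : W := (0, a, 0).
Definition unit_rV (i : 'I_d) : V := delta_mx 0 i.
Definition cball (p : V) (r : R) : set V := [set q | `|q - p| <= r].

Lemma cball_compact p r : compact (cball p r).
Proof.
apply: bounded_closed_compact.
  exists (r + `|p|); split; first exact: num_real.
  move=> M rM q /= qp; apply: le_trans (ltW rM).
  by rewrite -(subrK p q); apply: le_trans (ler_normD _ _) _; rewrite lerD2r.
have -> : cball p r = (fun q => `|q - p|) @^-1` [set x | x <= r] by [].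
apply: preimage_closed; last exact: closed_le.
move=> q _; apply: (@continuous_comp _ _ _ (fun q : V => q - p) (fun q : V => `|q|)); last exact: norm_continuous.
apply: (@lip_continuous R V V _ 1) => x y.
have -> : x - p - (y - p) = x - y by apply/rowP => i; rewrite !mxE; ring.
by rewrite mul1r.
Qed.

Lemma row_unit (a : V) : a = \sum_i a 0 i *: unit_rV i.
Proof. exact: row_sum_delta. Qed.

Lemma dq_sum a : dq a = \sum_i a 0 i *: dq (unit_rV i).
Proof.
have lin : linear dq.
  by move=> k u v; apply: injective_projections; [apply: injective_projections|] => /=; rewrite ?scaler0 ?addr0.
pose dql := GRing.isLinear.Build _ _ _ _ dq lin.
pose dqL : {linear V -> W} := HB.pack dq dql.
by rewrite [in LHS](row_unit a) -[dq]/(dqL : V -> W) linear_sum; apply: eq_bigr => i _; rewrite linearZ.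
Qed.

Lemma dw_sum a : dw a = \sum_i a 0 i *: dw (unit_rV i).
Proof.
have lin : linear dw.
  by move=> k u v; apply: injective_projections; [apply: injective_projections|] => /=; rewrite ?scaler0 ?addr0.
pose dwl := GRing.isLinear.Build _ _ _ _ dw lin.
pose dwL : {linear V -> W} := HB.pack dw dwl.
by rewrite [in LHS](row_unit a) -[dw]/(dwL : V -> W) linear_sum; apply: eq_bigr => i _; rewrite linearZ.
Qed.

Lemma derive_sum_dir (I : finType) (g : W -> R) z (c : I -> R) (e : I -> W) : differentiable g z ->
  'D_(\sum_i c i *: e i) g z = \sum_i c i * 'D_(e i) g z.
Proof.
move=> dg; rewrite deriveE // linear_sum; apply: eq_bigr => i _.
by rewrite linearZ /= deriveE.
Qed.

Lemma derive_dq (g : W -> R) z a : differentiable g z ->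
  'D_(dq a) g z = \sum_i a 0 i * 'D_(dq (unit_rV i)) g z.
Proof. by move=> dg; rewrite dq_sum derive_sum_dir. Qed.

Lemma derive_dw (g : W -> R) z a : differentiable g z ->
  'D_(dw a) g z = \sum_i a 0 i * 'D_(dw (unit_rV i)) g z.
Proof. by move=> dg; rewrite dw_sum derive_sum_dir. Qed.

Lemma chain_rule (U : normedModType R) (g : W -> U) (q w : R -> V) t q' w' :
  differentiable g (pt (q t) (w t) t) ->
  is_derive t (1 : R) q q' -> is_derive t (1 : R) w w' ->
  is_derive t (1 : R) (fun s => g (pt (q s) (w s) s)) ('D_(q', w', 1 : R) g (pt (q t) (w t) t)).
Proof.
move=> dg [dq0 dq'] [dw0 dw'].
have hq : differentiable q t := (derivable1_diffP _ _).1 dq0.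
have hw : differentiable w t := (derivable1_diffP _ _).1 dw0.
have hi : differentiable (fun s : R => s) t by exact: (derivable1_diffP _ _).1 (@derivable_id R R t 1).
have hz1 : differentiable (fun s : R => (q s, w s)) t := differentiable_pair hq hw.
have hz : differentiable (fun s : R => pt (q s) (w s) s) t := differentiable_pair hz1 hi.
have hg : differentiable (fun s => g (pt (q s) (w s) s)) t := differentiable_comp hz dg.
split; first exact: (derivable1_diffP _ _).2 hg.
rewrite (deriveE _ hg) (diff_comp hz dg) /= (deriveE _ dg).
congr ('d g _ _).
rewrite /pt (diff_pair hz1 hi) /= (diff_pair hq hw) /=.
have e1 : 'd q t 1 = q' by rewrite -dq' (deriveE _ hq).
have e2 : 'd w t 1 = w' by rewrite -dw' (deriveE _ hw).
have e3 : 'd (fun s : R => s) t 1 = 1 by rewrite -(deriveE _ hi) derive_id.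
congr (_, _, _); [exact: e1|exact: e2|exact: e3].
Qed.

Lemma line_derive (U : normedModType R) (g : W -> U) z v (s : R) :
  differentiable g (z + s *: v) ->
  is_derive s (1 : R) (fun s => g (z + s *: v)) ('D_v g (z + s *: v)).
Proof.
move=> dg.
have hl : is_diff s (fun s : R => z + s *: v) (fun s => s *: v).
  have h1 : is_diff s ( *:%R ^~ v) ( *:%R ^~ v) := is_diff_scalel s v.
  apply: is_diff_eq (is_diffD (is_diff_cst z s) h1) _.
  by apply/funext => x /=; rewrite fctE add0r.
have hd : differentiable (fun s : R => z + s *: v) s by case: hl.
have hg : differentiable (fun s : R => g (z + s *: v)) s := differentiable_comp hd dg.
split; first exact: (derivable1_diffP _ _).2 hg.
rewrite (deriveE _ hg) (diff_comp hd dg) /= (deriveE _ dg).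
by case: hl => _ ->; rewrite scale1r.
Qed.

Lemma pt_line (z : W) (s : R) (a b : V) :
  z + s *: (dq a + dw b) = pt (z.1.1 + s *: a) (z.1.2 + s *: b) z.2.
Proof.
case: z => [[x y] t] /=.
by apply: injective_projections; [apply: injective_projections|] => /=;
   rewrite ?addr0 ?add0r ?scaler0 ?addr0.
Qed.

End Coordinates.

Lemma is_derive_mull (R : realType) (k s : R) : is_derive s (1 : R) (fun s => k * s) k.
Proof.
by apply: is_derive_eq (is_deriveM (is_derive_cst k _ _) (is_derive_id _ _)) _;
   rewrite /GRing.scale /= mulr1 mulr0 addr0.
Qed.

Lemma second_order_le (R : realType) (P P1 P2 : R -> R) (m : R) :
  (forall s : R, 0 <= s <= 1 -> is_derive s (1 : R) P (P1 s)) ->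
  (forall s : R, 0 <= s <= 1 -> is_derive s (1 : R) P1 (P2 s)) ->
  (forall s : R, 0 <= s <= 1 -> m <= P2 s) ->
  m / 2 <= P 1 - P 0 - P1 0.
Proof.
move=> dP dP1 mP2.
have cwithin (Q Q1 : R -> R) : (forall s : R, 0 <= s <= 1 -> is_derive s (1 : R) Q (Q1 s)) ->
    forall b, b <= 1 -> {within `[0, b], continuous Q}.
  move=> dQ b b1; apply: continuous_in_subspaceT => s; rewrite inE /= in_itv /= => /andP[s0 sb].
  by apply: is_derive_continuous (dQ s _); rewrite s0 (le_trans sb).
have dlin := @is_derive_mull R.
have H1 s : 0 <= s <= 1 -> m * s <= P1 s - P1 0.
  move=> /andP[s0 s1].
  have := @le_derive_le _ [::] (fun s => m * s) P1 0 s s0.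
  rewrite mulr0 subr0; apply.
  - by apply: continuous_subspaceT => x; exact: is_derive_continuous (dlin m x).
  - exact: cwithin dP1 _ _.
  - move=> t /andP[t0 ts] _; exists m, (P2 t); split; [exact: dlin| |].
      by apply: dP1; rewrite ltW //= (le_trans (ltW ts)).
    by apply: mP2; rewrite ltW //= (le_trans (ltW ts)).
have dquad (s : R) : is_derive s (1 : R) (fun s => m / 2 * s ^+ 2 + P1 0 * s) (m * s + P1 0).
  have h1 : is_derive s (1 : R) (fun s => m / 2 * s ^+ 2) (m * s).
    have h2 : is_derive s (1 : R) (fun s : R => s ^+ 2) (2 * s).
      have -> : (fun s : R => s ^+ 2) = (fun s : R => s) * (fun s : R => s) by apply/funext.
      apply: is_derive_eq (is_deriveM (is_derive_id s 1) (is_derive_id s 1)) _.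
      by rewrite /GRing.scale /=; ring.
    apply: is_derive_eq (is_deriveM (is_derive_cst (m / 2) s 1) h2) _.
    by rewrite /GRing.scale /= mulr0 addr0; lra.
  exact: (@is_deriveD R R R _ _ s 1 _ _ h1 (dlin _ _)).
have : m / 2 * 1 ^+ 2 + P1 0 * 1 - (m / 2 * 0 ^+ 2 + P1 0 * 0) <= P 1 - P 0.
  apply: (@le_derive_le _ [::] (fun s => m / 2 * s ^+ 2 + P1 0 * s) P 0 1 ler01).
  - by apply: continuous_subspaceT => x; exact: is_derive_continuous (dquad x).
  - exact: cwithin dP _ _.
  - move=> t /andP[t0 t1] _; exists (m * t + P1 0), (P1 t); split; [exact: dquad| |].
      by apply: dP; rewrite !ltW.
    have h : m * t <= P1 t - P1 0 by apply: H1; rewrite ltW //= ltW.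
    by lra.
by rewrite expr1n expr0n /= !mulr0 !mulr1; lra.
Qed.

Lemma dist_half_le (R : realType) (a b : R) : `|a - b| < a / 2 -> a / 2 <= b.
Proof. by rewrite ltr_norml => /andP[_]; lra. Qed.

Lemma continuous_sum (R : realType) (T : topologicalType) (I : finType) (F : I -> T -> R) x :
  (forall i, {for x, continuous (F i)}) -> {for x, continuous (fun y => \sum_i F i y)}.
Proof.
move=> cF; elim: (index_enum I) => [|i s IH].
  have -> : (fun y => \sum_(j <- [::]) F j y) = cst 0 by apply/funext => y; rewrite big_nil.
  exact: cvg_cst.
have -> : (fun y => \sum_(j <- i :: s) F j y) = (fun y => F i y + \sum_(j <- s) F j y).
  by apply/funext => y; rewrite big_cons.
by apply: cvgD; [exact: cF|exact: IH].
Qed.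

Definition time_periodic (R : realType) (d : nat) (g : 'rV[R]_d * 'rV[R]_d * R -> R) :=
  forall z, g (z + (0, 0, 1)) = g z.

(** * Uniform bounds for a time-periodic Lagrangian *)

Section FieldBounds.
#[local] Opaque derive.
Variables (R : realType) (d : nat).
Notation V := 'rV[R]_d.
Notation W := (V * V * R)%type.
Variables (f : W -> R) (Omega : set V).
Hypothesis oOmega : open Omega.
Let U : set W := [set z | Omega z.1.1].
Hypothesis fs : smooth_on U f.
Hypothesis fper : time_periodic f.

Lemma U_open : open U.
Proof.
have -> : U = (fun z : W => z.1.1) @^-1` Omega by [].
apply: open_comp => // z _; apply: continuous_comp; exact: cvg_fst.
Qed.

Lemma periodic_derive (g : W -> R) v : time_periodic g -> time_periodic (fun z => 'D_v g z).
Proof. by move=> pg z; exact: derive_period. Qed.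

Lemma periodic_frac (g : W -> R) q w t : time_periodic g -> g (pt q w t) = g (pt q w (t - (Num.floor t)%:~R)).
Proof.
move=> pg.
have pn (n : nat) s : g (pt q w (s + n%:R)) = g (pt q w s).
  elim: n => [|n IH]; first by rewrite addr0.
  rewrite -IH -[in RHS]pg; congr g.
  by apply: injective_projections; [apply: injective_projections|] => /=; rewrite ?addr0 // -addrA natr1.
case: (Num.floor t) => n.
  by rewrite -[in LHS](subrK n%:~R t) pn.
by rewrite NegzE mulrNz opprK pn.
Qed.

Lemma frac_in (t : R) : 0 <= t - (Num.floor t)%:~R <= 1.
Proof.
have := floor_itv t; rewrite intrD => /andP[h1 h2]; lra.
Qed.

Section Constants.
Variables (p : V) (r K : R).
Hypothesis ballO : cball p r `<=` Omega.

(** Time is left free, so a zone is not compact; periodicity brings every bound back to times in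
    [[0, 1]]. *)
Definition zone (z : W) := `|z.1.1 - p| <= r /\ `|z.1.2| <= K.

Lemma zone_U z : zone z -> U z.
Proof. by move=> [h _]; exact: ballO. Qed.

Lemma zone_bound (g : W -> R) : time_periodic g -> (forall z, U z -> {for z, continuous g}) ->
  exists2 C, 0 <= C & forall z, zone z -> `|g z| <= C.
Proof.
move=> pg cg.
have cA : compact (cball p r `*` cball 0 K `*` `[0, 1] : set W).
  by apply: compact_setX; [apply: compact_setX; exact: cball_compact|exact: segment_compact].
have [C C0 HC] := bounded_on_compact cA (fun z Az => cg z (ballO (proj1 (proj1 Az)))).
exists C => // -[[q w] t] [zq zw]; rewrite (_ : (q, w, t) = pt q w t) // periodic_frac //.
apply: HC; split; first by split => //; rewrite /cball /= subr0.
by rewrite /= in_itv /=; exact: frac_in.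
Qed.

Lemma grad_bound (g : W -> R) : time_periodic g -> smooth_on U g ->
  exists2 C, 0 <= C & forall z, zone z -> forall a,
    `|'D_(dq a) g z| <= C * `|a| /\ `|'D_(dw a) g z| <= C * `|a|.
Proof.
move=> pg sg.
have H (e : V -> W) : (forall z a, differentiable g z -> 'D_(e a) g z = \sum_i a 0 i * 'D_(e (unit_rV R i)) g z) ->
   exists2 C, 0 <= C & forall z, zone z -> forall a, `|'D_(e a) g z| <= C * `|a|.
  move=> He.
  have [C HC] : exists C : 'I_d -> R, forall i, 0 <= C i /\ forall z, zone z -> `|'D_(e (unit_rV R i)) g z| <= C i.
    apply: (@fun_choice _ _ (fun i C => 0 <= C /\ forall z, zone z -> `|'D_(e (unit_rV R i)) g z| <= C)) => i.
    have [C C0 HC] := @zone_bound (fun z => 'D_(e (unit_rV R i)) g z) (periodic_derive _ pg)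
      (fun z Uz => smooth_cont (smooth_derive _ sg) Uz).
    by exists C.
  exists (\sum_i C i); first by apply: sumr_ge0 => i _; case: (HC i).
  move=> z zz a; rewrite He; last exact: smooth_diff sg (zone_U zz).
  apply: le_trans (ler_norm_sum _ _ _) _.
  rewrite mulr_suml; apply: ler_sum => i _; rewrite normrM mulrC.
  by apply: ler_pM => //; [case: (HC i) => _; apply|exact: coord_le_norm].
have [C1 C10 H1] := H (@dq R d) (@derive_dq R d g).
have [C2 C20 H2] := H (@dw R d) (@derive_dw R d g).
exists (C1 + C2); first exact: addr_ge0.
move=> z zz a; split.
  by apply: le_trans (H1 z zz a) _; rewrite ler_wpM2r // lerDl.
by apply: le_trans (H2 z zz a) _; rewrite ler_wpM2r // lerDr.
Qed.

Lemma zone_convex (q w q' w' : V) t t' (s : R) : zone (pt q w t) -> zone (pt q' w' t) -> 0 <= s <= 1 ->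
  zone (pt (q + s *: (q' - q)) (w + s *: (w' - w)) t').
Proof.
have H (x y c : V) k : `|x - c| <= k -> `|y - c| <= k -> 0 <= s <= 1 -> `|x + s *: (y - x) - c| <= k.
  move=> xk yk /andP[s0 s1].
  have -> : x + s *: (y - x) - c = (1 - s) *: (x - c) + s *: (y - c).
    by apply/rowP => i; rewrite !mxE; ring.
  apply: le_trans (ler_normD _ _) _; rewrite !normrZ (ger0_norm s0) ger0_norm ?subr_ge0 //.
  have -> : k = (1 - s) * k + s * k by ring.
  by apply: lerD; rewrite ler_wpM2l // subr_ge0.
move=> [/= z1 z2] [/= z3 z4] s01; split => /=; first exact: H.
by rewrite -[X in `|X|]subr0; apply: H => //; rewrite subr0.
Qed.

Lemma zone_lip (g : W -> R) : time_periodic g -> smooth_on U g ->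
  exists2 C, 0 <= C & forall q w q' w' t, zone (pt q w t) -> zone (pt q' w' t) ->
    `|g (pt q' w' t) - g (pt q w t)| <= C * (`|q' - q| + `|w' - w|).
Proof.
move=> pg sg; have [C C0 HC] := grad_bound pg sg; exists C => // q w q' w' t z1 z2.
pose v : W := dq (q' - q) + dw (w' - w).
have zs (s : R) : 0 <= s <= 1 -> zone (pt q w t + s *: v).
  by move=> s01; rewrite pt_line; exact: (zone_convex _ z1 z2 s01).
have dg (s : R) : 0 <= s <= 1 -> differentiable g (pt q w t + s *: v).
  by move=> s01; exact: smooth_diff sg (zone_U (zs _ s01)).
have dgs (s : R) : 0 <= s <= 1 -> is_derive s (1 : R) (fun s : R => g (pt q w t + s *: v)) ('D_v g (pt q w t + s *: v)).
  by move=> s01; apply: line_derive; exact: dg.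
have [] := @MVT_segment R (fun s : R => g (pt q w t + s *: v)) (fun s => 'D_v g (pt q w t + s *: v)) 0 1 ler01.
- by move=> s; rewrite in_itv /= => /andP[s0 s1]; apply: dgs; rewrite !ltW.
- apply: continuous_in_subspaceT => s; rewrite inE /= in_itv /= => s01.
  exact: is_derive_continuous (dgs s s01).
- move=> s; rewrite in_itv /= => s01.
  have -> : pt q w t + (1 : R) *: v = pt q' w' t.
    by rewrite pt_line /= !scale1r ![_ + (_ - _)]addrC !subrK.
  have -> : pt q w t + (0 : R) *: v = pt q w t by rewrite scale0r addr0.
  rewrite subr0 mulr1 => ->.
  have zz := zs s s01; have dd := dg s s01.
  rewrite (deriveE _ dd) linearD -!(deriveE _ dd) mulrDr.
  apply: le_trans (ler_normD _ _) _.
  have [h1 _] := HC _ zz (q' - q); have [_ h2] := HC _ zz (w' - w); exact: lerD h1 h2.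
Qed.

Notation ev i := (@unit_rV R d i).
Definition D2 (u v : W) z := 'D_u (fun z => 'D_v f z) z.

Lemma D2_sumr (e : V -> W) (u : W) z a :
  (forall z a, differentiable f z -> 'D_(e a) f z = \sum_i a 0 i * 'D_(e (ev i)) f z) ->
  U z -> D2 u (e a) z = \sum_i a 0 i * D2 u (e (ev i)) z.
Proof.
move=> He Uz; rewrite /D2.
have -> : 'D_u (fun z => 'D_(e a) f z) z = 'D_u (\sum_i (a 0 i \*: (fun z => 'D_(e (ev i)) f z))) z.
  apply: near_eq_derive; near=> y.
  rewrite He; last by apply: smooth_diff fs _; near: y; exact: open_nbhs_nbhs (conj U_open Uz).
  by rewrite fct_sumE; apply: eq_bigr => i _.
have dd i : derivable (a 0 i \*: (fun z => 'D_(e (ev i)) f z)) z u.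
  by apply: derivableZ; apply: diff_derivable; exact: smooth_diff (smooth_derive _ fs) Uz.
rewrite derive_sum //; apply: eq_bigr => i _; rewrite deriveZ //.
by apply: diff_derivable; exact: smooth_diff (smooth_derive _ fs) Uz.
Unshelve. all: by end_near. Qed.

Lemma hess_bound : exists2 C, 0 <= C & forall z, zone z -> forall a b,
  [/\ `|D2 (dq a) (dq b) z| <= C * `|a| * `|b|,
      `|D2 (dq a) (dw b) z| <= C * `|a| * `|b| &
      `|D2 (dw a) (dw b) z| <= C * `|a| * `|b|].
Proof.
have H (e : V -> W) : (forall z a, differentiable f z -> 'D_(e a) f z = \sum_i a 0 i * 'D_(e (ev i)) f z) ->
   exists2 C, 0 <= C & forall z, zone z -> forall a b,
     `|D2 (dq a) (e b) z| <= C * `|a| * `|b| /\ `|D2 (dw a) (e b) z| <= C * `|a| * `|b|.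
  move=> He.
  have [C HC] : exists C : 'I_d -> R, forall i, 0 <= C i /\ forall z, zone z -> forall a,
      `|D2 (dq a) (e (ev i)) z| <= C i * `|a| /\ `|D2 (dw a) (e (ev i)) z| <= C i * `|a|.
    apply: (@fun_choice _ _ (fun i C => 0 <= C /\ forall z, zone z -> forall a,
      `|D2 (dq a) (e (ev i)) z| <= C * `|a| /\ `|D2 (dw a) (e (ev i)) z| <= C * `|a|)) => i.
    have [C C0 HC] := grad_bound (periodic_derive (e (ev i)) fper) (smooth_derive (e (ev i)) fs).
    by exists C.
  exists (\sum_i C i); first by apply: sumr_ge0 => i _; case: (HC i).
  move=> z zz a b; have Uz := zone_U zz.
  split; rewrite (D2_sumr _ _ He Uz); apply: le_trans (ler_norm_sum _ _ _) _;
    rewrite !mulr_suml; apply: ler_sum => i _; rewrite normrM mulrC;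
    have [_ /(_ z zz a) [h1 h2]] := HC i.
    exact: ler_pM (normr_ge0 _) (normr_ge0 _) h1 (coord_le_norm _ _).
  exact: ler_pM (normr_ge0 _) (normr_ge0 _) h2 (coord_le_norm _ _).
have [C1 C10 H1] := H (@dq R d) (@derive_dq R d f).
have [C2 C20 H2] := H (@dw R d) (@derive_dw R d f).
exists (C1 + C2); first exact: addr_ge0.
move=> z zz a b.
have [h1 _] := H1 z zz a b; have [h2 h3] := H2 z zz a b.
have p0 : 0 <= `|a| * `|b| by exact: mulr_ge0.
split.
- by apply: le_trans h1 _; rewrite -!mulrA ler_wpM2r // lerDl.
- by apply: le_trans h2 _; rewrite -!mulrA ler_wpM2r // lerDr.
- by apply: le_trans h3 _; rewrite -!mulrA ler_wpM2r // lerDr.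
Qed.

Hypothesis fpd : forall z a, U z -> a != 0 -> 0 < D2 (dw a) (dw a) z.

Lemma D2_cont u v z : U z -> {for z, continuous (D2 u v)}.
Proof. by move=> Uz; exact: smooth_cont (smooth_derive u (smooth_derive v fs)) Uz. Qed.

Lemma D2_dw_quad z a : U z -> D2 (dw a) (dw a) z = \sum_i \sum_j a 0 i * a 0 j * D2 (dw (ev i)) (dw (ev j)) z.
Proof.
move=> Uz; rewrite D2_sumr //; last exact: derive_dw.
rewrite exchange_big /=; apply: eq_bigr => j _.
rewrite /D2 derive_dw; last exact: smooth_diff (smooth_derive _ fs) Uz.
by rewrite mulr_sumr; apply: eq_bigr => i _; rewrite mulrCA mulrA.
Qed.

Lemma D2_dwZ z k a : U z -> D2 (dw (k *: a)) (dw (k *: a)) z = k ^+ 2 * D2 (dw a) (dw a) z.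
Proof.
move=> Uz; rewrite !D2_dw_quad // mulr_sumr; apply: eq_bigr => i _.
rewrite mulr_sumr; apply: eq_bigr => j _; rewrite !mxE; ring.
Qed.

Lemma D2_dw0 z : U z -> D2 (dw 0) (dw 0) z = 0.
Proof. by move=> Uz; have := D2_dwZ 0 0 Uz; rewrite scale0r expr0n mul0r. Qed.

(** Positivity becomes uniform by compactness of one period of the zone times the unit sphere.
    Homogeneity of degree 2 then covers all directions, and periodicity all times. *)
Lemma hess_pos : exists2 c, 0 < c & forall z, zone z -> forall a, c * `|a| ^+ 2 <= D2 (dw a) (dw a) z.
Proof.
pose S : set V := [set a | `|a| = 1].
have cS : compact S.
  apply: bounded_closed_compact.
    exists 1; split; first exact: num_real.
    by move=> M M1 a /= ->; exact: ltW.
  have -> : S = (fun a => `|a|) @^-1` [set 1] by [].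
  apply: preimage_closed; last exact: closed_eq.
  by move=> a _; exact: norm_continuous.
have cA : compact (cball p r `*` cball 0 K `*` `[0, 1] `*` S : set (W * V)%type).
  apply: compact_setX => //.
  by apply: compact_setX; [apply: compact_setX; exact: cball_compact|exact: segment_compact].
(* Written as a quadratic polynomial in the coordinates of the direction, the Hessian is visibly
   continuous in the point and the direction jointly. *)
pose G (y : W * V) := \sum_i \sum_j y.2 0 i * y.2 0 j * D2 (dw (ev i)) (dw (ev j)) y.1.
have GU y : U y.1 -> {for y, continuous G}.
  move=> Uy.
  have coord i : {for y, continuous (fun y : W * V => y.2 0 i)}.
    apply: (@continuous_comp _ _ _ (fun y : W * V => y.2) (fun v : V => v 0 i)).
      exact: cvg_snd.
    exact: coord_continuous.
  apply: continuous_sum => i; apply: continuous_sum => j.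
  apply: cvgM; first by apply: cvgM; exact: coord.
  by apply: (@continuous_comp _ _ _ (fun y : W * V => y.1) (D2 (dw (ev i)) (dw (ev j)))); [exact: cvg_fst|exact: D2_cont].
have /compact_near_coveringP cov := cA.
have H := cov R 0^'+ (fun c y => c <= G y) _.
have : \forall c \near 0^'+, cball p r `*` cball 0 K `*` `[0, 1] `*` S `<=` [set y | c <= G y].
  apply: H => -[z a] [[[zq zw] zt] Sa] /=.
  have Uz : U z by exact: ballO.
  have G0 : 0 < G (z, a).
    rewrite /G /= -D2_dw_quad //; apply: fpd => //.
    by rewrite -normr_gt0 (Sa : `|a| = 1) ltr01.
  near=> y c; rewrite /=.
  apply: (@le_trans _ _ (G (z, a) / 2)); first by near: c; apply: nbhs_right_le; rewrite divr_gt0.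
  apply: dist_half_le; near: y; apply: cvgr_dist_lt; [exact: GU|by rewrite divr_gt0].
move=> Hc; near (0 : R)^'+ => c.
have c0 : 0 < c by [].
exists c => // z zz a; have Uz := zone_U zz.
have [->|a0] := eqVneq a 0.
  by rewrite normr0 expr0n mulr0 D2_dw0.
have na : `|a| != 0 by rewrite normr_eq0.
have -> : a = `|a| *: (`|a|^-1 *: a) by rewrite scalerA divff // scale1r.
set b := _ *: a.
have nb : `|b| = 1 by rewrite /b normrZ normfV normr_id mulVf.
rewrite D2_dwZ // normrZ nb mulr1 normr_id mulrC ler_wpM2l ?sqr_ge0 //.
case: z zz Uz => [[q w] t] zz Uz.
pose t' := t - (Num.floor t)%:~R.
have -> : D2 (dw b) (dw b) (q, w, t) = D2 (dw b) (dw b) (pt q w t').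
  exact: (@periodic_frac (D2 (dw b) (dw b)) q w t (periodic_derive (dw b) (periodic_derive (dw b) fper))).
rewrite D2_dw_quad; last by case: zz => h _; exact: ballO.
have Hc' : cball p r `*` cball 0 K `*` `[0, 1] `*` S `<=` [set y | c <= G y] by near: c.
apply: (Hc' (pt q w t', b)); split => //; split.
  by case: zz => h1 h2; split => //=; rewrite /cball /= subr0.
by rewrite /= in_itv /=; exact: frac_in.
Unshelve. all: by end_near. Qed.

Lemma hess_nonneg z a : U z -> 0 <= D2 (dw a) (dw a) z.
Proof.
move=> Uz; have [->|a0] := eqVneq a 0; last exact/ltW/fpd.
by rewrite D2_dw0.
Qed.

Lemma line_D2 z v (s : R) : U (z + s *: v) ->
  is_derive s (1 : R) (fun s : R => 'D_v f (z + s *: v)) (D2 v v (z + s *: v)).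
Proof.
by move=> Uz; apply: line_derive; exact: smooth_diff (smooth_derive v fs) Uz.
Qed.

Lemma line_D1 z v (s : R) : U (z + s *: v) ->
  is_derive s (1 : R) (fun s : R => f (z + s *: v)) ('D_v f (z + s *: v)).
Proof. by move=> Uz; apply: line_derive; exact: smooth_diff fs Uz. Qed.

End Constants.

(** This is the Weierstrass excess. The increment [w'] is arbitrary while the Hessian is bounded
    below only for bounded velocities, whence a bound that is quadratic for small [w'] and merely
    linear for large [w']. *)
Lemma convex_excess (p : V) (r K : R) : cball p r `<=` Omega ->
  (forall z a, U z -> a != 0 -> 0 < D2 (dw a) (dw a) z) ->
  exists2 c, 0 < c & forall q w w' t, `|q - p| <= r -> `|w| <= K ->
    c * `|w'| * Num.min 1 `|w'| <= f (pt q (w + w') t) - f (pt q w t) - 'D_(dw w') f (pt q w t).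
Proof.
move=> bO fpd; have [c c0 Hc] := @hess_pos p r (K + 1) bO fpd.
exists (c / 2); first by rewrite divr_gt0.
move=> q w w' t qp wK.
have Uq x s : U (pt q x s) by exact: bO.
have dlin := @is_derive_mull R.
set v := dw w'.
have line (s : R) : pt q w t + s *: v = pt q (w + s *: w') t.
  have -> : v = dq 0 + dw w'.
    by rewrite /v /dq /dw; apply: injective_projections; [apply: injective_projections|] => /=; rewrite ?addr0 ?add0r.
  by rewrite pt_line /= scaler0 addr0.
pose P (s : R) := f (pt q w t + s *: v).
pose P1 (s : R) := 'D_v f (pt q w t + s *: v).
pose P2 (s : R) := D2 v v (pt q w t + s *: v).
have dP s : is_derive s (1 : R) P (P1 s) by apply: line_D1; rewrite line.
have dP1 s : is_derive s (1 : R) P1 (P2 s) by apply: line_D2; rewrite line.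
have P2_ge0 s : 0 <= P2 s by rewrite /P2 line; apply: hess_nonneg.
have P10 : P1 0 = 'D_v f (pt q w t) by rewrite /P1 scale0r addr0.
have P0 : P 0 = f (pt q w t) by rewrite /P scale0r addr0.
have P1E : P 1 = f (pt q (w + w') t) by rewrite /P line scale1r.
rewrite -P1E -P0 -P10.
have [w'0|w'0] := eqVneq w' 0.
  rewrite w'0 normr0 mulr0 mul0r.
  by have := @second_order_le R P P1 P2 0 (fun s _ => dP s) (fun s _ => dP1 s) (fun s _ => P2_ge0 s); rewrite mul0r.
have nw : 0 < `|w'| by rewrite normr_gt0.
pose s0 := Num.min 1 (`|w'|^-1).
have s00 : 0 < s0 by rewrite lt_min ltr01 invr_gt0.
have s01 : s0 <= 1 by rewrite ge_min lexx.
have s0w : s0 * `|w'| = Num.min 1 `|w'|.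
  by rewrite /s0 minr_pMl ?ltW // mul1r mulVf ?gt_eqF // minC.
have P2c s : 0 <= s <= s0 -> c * `|w'| ^+ 2 <= P2 s.
  move=> /andP[h0 hs]; rewrite /P2 line; apply: Hc; split => //=.
  apply: le_trans (ler_normD _ _) _; apply: lerD => //.
  rewrite normrZ ger0_norm //; apply: le_trans (_ : s0 * `|w'| <= 1).
    by rewrite ler_wpM2r.
  by rewrite s0w ge_min lexx.
have cP s : {for s, continuous P} by exact: is_derive_continuous (dP s).
have cP1 s : {for s, continuous P1} by exact: is_derive_continuous (dP1 s).
(* The lower bound c on the Hessian is only available for s |w'| <= 1, that is up to s0; beyond s0 convexity suffices. *)
have A1 : c * `|w'| ^+ 2 * s0 ^+ 2 / 2 <= P s0 - P 0 - s0 * P1 0.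
  pose Q (s : R) := P (s0 * s).
  have dl := @is_derive_mull R s0.
  have := @second_order_le R (fun s => P (s0 * s)) (fun s => s0 * P1 (s0 * s)) (fun s => s0 * (s0 * P2 (s0 * s))) (c * `|w'| ^+ 2 * s0 ^+ 2).
  rewrite !mulr1 !mulr0; apply.
  - by move=> s _; rewrite mulrC; apply: is_derive1_comp.
  - move=> s _; have h1 : is_derive s (1 : R) (fun s => P1 (s0 * s)) (P2 (s0 * s) * s0).
      exact: (@is_derive1_comp R P1 ( *%R s0)).
    apply: is_derive_eq (is_deriveM (is_derive_cst s0 s 1) h1) _.
    by rewrite /GRing.scale /= mulr0 addr0 [P2 _ * _]mulrC.
  - move=> s /andP[h0 h1]; rewrite mulrC expr2 -mulrA ler_pM2l // ler_pM2l //.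
    by apply: P2c; apply/andP; split; [exact: mulr_ge0 (ltW s00) h0|rewrite ler_piMr // ltW].
have mono s : 0 <= s -> P1 0 <= P1 s.
  move=> h0; apply: (@ge0_derive_le _ [::] P1 0 s h0).
    by apply: continuous_subspaceT => x; exact: cP1.
  by move=> x _ _; exists (P2 x).
have mono1 s : s0 <= s -> P1 0 + c * `|w'| ^+ 2 * s0 <= P1 s.
  move=> hs.
  have h1 : P1 s0 <= P1 s.
    apply: (@ge0_derive_le _ [::] P1 s0 s hs).
      by apply: continuous_subspaceT => x; exact: cP1.
    by move=> x _ _; exists (P2 x).
  have := @le_derive_le _ [::] (fun s => c * `|w'| ^+ 2 * s) P1 0 s0 (ltW s00).
  rewrite mulr0 subr0 => H; have := H _ _ _; move=> {}H.
  suff : c * `|w'| ^+ 2 * s0 <= P1 s0 - P1 0 by lra.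
  apply: H.
  - by apply: continuous_subspaceT => x; exact: is_derive_continuous (dlin _ x).
  - by apply: continuous_subspaceT => x; exact: cP1.
  - move=> x /andP[x0 xs] _; exists (c * `|w'| ^+ 2), (P2 x); split; [exact: dlin|exact: dP1|].
    by apply: P2c; rewrite !ltW.
have A2 : (P1 0 + c * `|w'| ^+ 2 * s0) * (1 - s0) <= P 1 - P s0.
  rewrite mulrBr.
  apply: (@le_derive_le _ [::] (fun s => (P1 0 + c * `|w'| ^+ 2 * s0) * s) P s0 1 s01).
  - by apply: continuous_subspaceT => x; exact: is_derive_continuous (dlin _ x).
  - by apply: continuous_subspaceT => x; exact: cP.
  - move=> x /andP[x0 xs] _; exists (P1 0 + c * `|w'| ^+ 2 * s0), (P1 x); split; [exact: dlin|exact: dP|].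
    by apply: mono1; rewrite ltW.
have -> : c / 2 * `|w'| * Num.min 1 `|w'| = c * `|w'| ^+ 2 * s0 / 2 by rewrite -s0w; field.
set X := c * `|w'| ^+ 2 in A1 A2 *.
have X0 : 0 <= X by rewrite mulr_ge0 ?sqr_ge0 // ltW.
have X1 : 0 <= X * s0 * (1 - s0) by rewrite !mulr_ge0 ?subr_ge0 // ltW.
rewrite expr2 in A1; lra.
Qed.

End FieldBounds.

(** * The Euler-Lagrange vector field *)

Section LagrangianField.
#[local] Opaque derive.
Variables (R : realType) (d : nat).
Notation V := 'rV[R]_d.
Notation W := (V * V * R)%type.
Notation ev i := (@unit_rV R d i).
Variables (f : W -> R) (Omega : set V).
Hypothesis oOmega : open Omega.
Let U : set W := [set z | Omega z.1.1].
Hypothesis fs : smooth_on U f.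
Hypothesis fper : time_periodic f.
Hypothesis fpd : forall z a, U z -> a != 0 -> 0 < D2 f (dw a) (dw a) z.

(** The increment is cut at [(q', w)]. The step in velocity is the excess at [q'], the step in
    position is a Taylor expansion with bounded Hessian, and moving the velocity derivative from
    [q'] back to [q] produces the mixed term. *)
Lemma taylor_lower (p : V) (r K : R) : cball p r `<=` Omega ->
  exists c C, [/\ 0 < c, 0 <= C & forall q q' w w' t, `|q - p| <= r -> `|q' - p| <= r -> `|w| <= K ->
    c * `|w'| * Num.min 1 `|w'| - C * `|q' - q| * `|w'| - C * `|q' - q| ^+ 2 <=
    f (pt q' (w + w') t) - f (pt q w t) - 'D_(dq (q' - q)) f (pt q w t) - 'D_(dw w') f (pt q w t)].
Proof.
move=> bO.
have [c c0 Hc] := convex_excess oOmega fs fper K bO fpd.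
have [C C0 HC] := hess_bound oOmega fs fper K bO.
exists c, C; split => // q q' w w' t qp q'p wK.
set eta := q' - q.
have zs (s : R) : 0 <= s <= 1 -> zone p r K (pt q w t + s *: dq eta).
  move=> s01; have -> : pt q w t + s *: dq eta = pt (q + s *: (q' - q)) (w + s *: (w - w)) t.
    rewrite subrr scaler0 addr0.
    by apply: injective_projections; [apply: injective_projections|] => /=; rewrite ?scaler0 ?addr0.
  have z1 : zone p r K (pt q w t) by [].
  have z2 : zone p r K (pt q' w t) by [].
  exact: zone_convex z1 z2 s01.
have Us (s : R) : 0 <= s <= 1 -> U (pt q w t + s *: dq eta).
  by move=> s01; apply: bO; have [] := zs s s01.
have E1 : pt q w t + (1 : R) *: dq eta = pt q' w t.
  by rewrite scale1r; apply: injective_projections; [apply: injective_projections|] => /=;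
     rewrite ?addr0 // /eta addrC subrK.
have E0 : pt q w t + (0 : R) *: dq eta = pt q w t by rewrite scale0r addr0.
have A1 := Hc q' w w' t q'p wK.
have A2 : `|'D_(dw w') f (pt q' w t) - 'D_(dw w') f (pt q w t)| <= C * `|eta| * `|w'|.
  have dgs (s : R) : 0 <= s <= 1 -> is_derive s (1 : R) (fun s : R => 'D_(dw w') f (pt q w t + s *: dq eta))
      (D2 f (dq eta) (dw w') (pt q w t + s *: dq eta)).
    move=> s01; apply: line_derive; apply: smooth_diff (smooth_derive (dw w') fs) _; exact: Us.
  have [] := @MVT_segment R (fun s : R => 'D_(dw w') f (pt q w t + s *: dq eta))
    (fun s => D2 f (dq eta) (dw w') (pt q w t + s *: dq eta)) 0 1 ler01.
  - by move=> s; rewrite in_itv /= => /andP[s0 s1]; apply: dgs; rewrite !ltW.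
  - apply: continuous_in_subspaceT => s; rewrite inE /= in_itv /= => s01.
    exact: is_derive_continuous (dgs s s01).
  - move=> s; rewrite in_itv /= => s01; rewrite E1 E0 subr0 mulr1 => ->.
    by have [_ h _] := HC _ (zs s s01) eta w'; exact: h.
have A3 : (- (C * `|eta| * `|eta|)) / 2 <= f (pt q' w t) - f (pt q w t) - 'D_(dq eta) f (pt q w t).
  have := @second_order_le R (fun s => f (pt q w t + s *: dq eta)) (fun s => 'D_(dq eta) f (pt q w t + s *: dq eta))
    (fun s => D2 f (dq eta) (dq eta) (pt q w t + s *: dq eta)) (- (C * `|eta| * `|eta|)).
  rewrite E1 E0; apply.
  - by move=> s s01; apply: line_derive; apply: smooth_diff fs _; exact: Us.
  - by move=> s s01; apply: line_derive; apply: smooth_diff (smooth_derive _ fs) _; exact: Us.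
  - move=> s s01; have [h _ _] := HC _ (zs s s01) eta eta.
    by move: h; rewrite ler_norml => /andP[].
have A2' : - (C * `|eta| * `|w'|) <= 'D_(dw w') f (pt q' w t) - 'D_(dw w') f (pt q w t).
  by move: A2; rewrite ler_norml => /andP[].
have A4 : 0 <= C * `|eta| * `|eta| by rewrite !mulr_ge0.
rewrite expr2 mulrA.
move: A1 A2' A3 A4; clear; move: (f (pt q' (w + w') t)) (f (pt q w t)) (f (pt q' w t)) ('D_(dw w') f (pt q' w t))
  ('D_(dw w') f (pt q w t)) ('D_(dq eta) f (pt q w t)) (C * `|eta| * `|w'|) (C * `|eta| * `|eta|)
  (c * `|w'| * Num.min 1 `|w'|) => *; lra.
Qed.

Definition hess (z : W) : 'M[R]_d := \matrix_(i, j) D2 f (dw (ev i)) (dw (ev j)) z.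
Definition e3 : W := (0, 0, 1).
Definition rhs (z : W) : V := \row_j ('D_(dq (ev j)) f z
  - \sum_i z.1.2 0 i * D2 f (dq (ev i)) (dw (ev j)) z - D2 f e3 (dw (ev j)) z).
(** The acceleration [a] solved from the Euler-Lagrange equation [f_ww a + f_qw w + f_tw = f_q].
    Vectors are rows, so the inverse Hessian acts on the right. *)
Definition field (z : W) : V := rhs z *m invmx (hess z).

Lemma hess_quad z a : U z -> dot (a *m hess z) a = D2 f (dw a) (dw a) z.
Proof.
move=> Uz; rewrite (D2_dw_quad oOmega fs _ Uz) exchange_big /=; apply: eq_bigr => j _.
rewrite mxE mulr_suml; apply: eq_bigr => i _; rewrite mxE; ring.
Qed.

Lemma hess_unit z : U z -> hess z \in unitmx.
Proof.
move=> Uz; rewrite -row_free_unit; apply: inj_row_free => a aH.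
apply/eqP; apply/negPn/negP => a0.
by have := fpd Uz a0; rewrite -hess_quad // aH dot0l ltxx.
Qed.

Lemma field_hess z : U z -> field z *m hess z = rhs z.
Proof. by move=> Uz; rewrite /field mulmxKV // hess_unit. Qed.

Lemma derive_along z a j : U z ->
  'D_(z.1.2, a, 1 : R) (fun z => 'D_(dw (ev j)) f z) z =
  (a *m hess z) 0 j + \sum_i z.1.2 0 i * D2 f (dq (ev i)) (dw (ev j)) z + D2 f e3 (dw (ev j)) z.
Proof.
move=> Uz; have dg := smooth_diff (smooth_derive (dw (ev j)) fs) Uz.
have -> : (z.1.2, a, 1 : R) = (dw a + dq z.1.2 + e3 : W).
  by apply: injective_projections; [apply: injective_projections|] => /=; rewrite ?addr0 ?add0r.
rewrite (deriveE _ dg) !linearD -!(deriveE _ dg); congr (_ + _ + _).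
  by rewrite (derive_dw _ dg) mxE; apply: eq_bigr => i _; rewrite mxE.
by rewrite (derive_dq _ dg).
Qed.

Lemma field_eq z j : U z ->
  'D_(z.1.2, field z, 1 : R) (fun z => 'D_(dw (ev j)) f z) z = 'D_(dq (ev j)) f z.
Proof.
by move=> Uz; rewrite derive_along // field_hess // mxE; ring.
Qed.

Lemma field_unique z a : U z ->
  (forall j, 'D_(z.1.2, a, 1 : R) (fun z => 'D_(dw (ev j)) f z) z = 'D_(dq (ev j)) f z) -> a = field z.
Proof.
move=> Uz H; rewrite /field; suff <- : a *m hess z = rhs z by rewrite mulmxK // hess_unit.
by apply/rowP => j; have := H j; rewrite derive_along // => E; rewrite [RHS]mxE -E; ring.
Qed.

Section Zone.
Variables (p : V) (r K : R).
Hypothesis ballO : cball p r `<=` Omega.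
Notation zone := (zone p r K).

(** What is needed of the entries of [hess] and [rhs], in a form stable under sums and products. The
    inverse Hessian is not expanded: [field_dist] handles it by coercivity. *)
Definition regular (g : W -> R) :=
  [/\ forall z, U z -> {for z, continuous g},
      exists2 C, 0 <= C & forall z, zone z -> `|g z| <= C &
      exists2 C, 0 <= C & forall q w q' w' t, zone (pt q w t) -> zone (pt q' w' t) ->
        `|g (pt q' w' t) - g (pt q w t)| <= C * (`|q' - q| + `|w' - w|)].

Lemma regular_smooth g : time_periodic g -> smooth_on U g -> regular g.
Proof.
move=> pg sg; split; first by move=> z Uz; exact: smooth_cont sg Uz.
  by apply: (zone_bound K ballO pg) => z Uz; exact: smooth_cont sg Uz.
exact: (zone_lip K ballO pg sg).
Qed.

Lemma regular_coord i : regular (fun z => z.1.2 0 i).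
Proof.
split.
- move=> z _; apply: (@continuous_comp _ _ _ (fun z : W => z.1.2) (fun v : V => v 0 i)); last exact: coord_continuous.
  apply: (@continuous_comp _ _ _ (fun z : W => z.1) (fun v : V * V => v.2)); [exact: cvg_fst|exact: cvg_snd].
- exists `|K| => // z [_ h]; apply: le_trans (coord_le_norm _ _) _.
  by apply: le_trans h (ler_norm _).
- exists 1 => // q w q' w' t _ _; rewrite mul1r /=.
  have -> : w' 0 i - w 0 i = (w' - w) 0 i by rewrite !mxE.
  by apply: le_trans (coord_le_norm _ _) _; rewrite lerDr.
Qed.

Lemma regularD g h : regular g -> regular h -> regular (fun z => g z + h z).
Proof.
move=> [gc [C1 C10 H1] [L1 L10 G1]] [hc [C2 C20 H2] [L2 L20 G2]]; split.
- by move=> z Uz; apply: cvgD; [exact: gc|exact: hc].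
- exists (C1 + C2); first exact: addr_ge0.
  by move=> z zz; apply: le_trans (ler_normD _ _) _; apply: lerD; [exact: H1|exact: H2].
- exists (L1 + L2); first exact: addr_ge0.
  move=> q w q' w' t z1 z2; rewrite mulrDl opprD addrACA.
  by apply: le_trans (ler_normD _ _) _; apply: lerD; [exact: G1|exact: G2].
Qed.

Lemma regularN g : regular g -> regular (fun z => - g z).
Proof.
move=> [gc [C1 C10 H1] [L1 L10 G1]]; split.
- by move=> z Uz; apply: cvgN; exact: gc.
- by exists C1 => // z zz; rewrite normrN; exact: H1.
- by exists L1 => // q w q' w' t z1 z2; rewrite -opprD normrN; exact: G1.
Qed.

Lemma regularM g h : regular g -> regular h -> regular (fun z => g z * h z).
Proof.
move=> [gc [C1 C10 H1] [L1 L10 G1]] [hc [C2 C20 H2] [L2 L20 G2]]; split.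
- by move=> z Uz; apply: cvgM; [exact: gc|exact: hc].
- exists (C1 * C2); first exact: mulr_ge0.
  by move=> z zz; rewrite normrM; apply: ler_pM => //; [exact: H1|exact: H2].
- exists (C1 * L2 + L1 * C2); first by rewrite addr_ge0 // mulr_ge0.
  move=> q w q' w' t z1 z2.
  have -> : g (pt q' w' t) * h (pt q' w' t) - g (pt q w t) * h (pt q w t) =
    g (pt q' w' t) * (h (pt q' w' t) - h (pt q w t)) + (g (pt q' w' t) - g (pt q w t)) * h (pt q w t) by ring.
  rewrite [leRHS]mulrDl; apply: le_trans (ler_normD _ _) _; rewrite !normrM -mulrA [X in _ <= _ + X]mulrAC.
  by apply: lerD; apply: ler_pM => //; [exact: H1|exact: G2|exact: G1|exact: H2].
Qed.

Lemma regular_sum (I : finType) (g : I -> W -> R) : (forall i, regular (g i)) ->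
  regular (fun z => \sum_i g i z).
Proof.
move=> gr; elim: (index_enum I) => [|i s IH].
  have -> : (fun y => \sum_(j <- [::]) g j y) = cst 0 by apply/funext => y; rewrite big_nil.
  split; first by move=> z _; exact: cvg_cst.
    by exists 0 => // z _; rewrite normr0.
  by exists 0 => // *; rewrite subrr normr0 mul0r.
have -> : (fun y => \sum_(j <- i :: s) g j y) = (fun y => g i y + \sum_(j <- s) g j y).
  by apply/funext => y; rewrite big_cons.
exact: regularD.
Qed.

Lemma regular_D1 u : regular (fun z => 'D_u f z).
Proof. by apply: regular_smooth; [exact: periodic_derive|exact: smooth_derive]. Qed.

Lemma regular_D2 u v : regular (D2 f u v).
Proof.
apply: regular_smooth; first by apply: periodic_derive; exact: periodic_derive.
by apply: smooth_derive; exact: smooth_derive.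
Qed.

Lemma regular_rhs j : regular (fun z => rhs z 0 j).
Proof.
have -> : (fun z => rhs z 0 j) = (fun z => 'D_(dq (ev j)) f z +
   - (\sum_i z.1.2 0 i * D2 f (dq (ev i)) (dw (ev j)) z) + - D2 f e3 (dw (ev j)) z).
  by apply/funext => z; rewrite mxE.
apply: regularD; last by apply: regularN; exact: regular_D2.
apply: regularD; first exact: regular_D1.
apply: regularN; apply: regular_sum => i; apply: regularM; [exact: regular_coord|exact: regular_D2].
Qed.

Lemma regular_hess i j : regular (fun z => hess z i j).
Proof.
have -> : (fun z => hess z i j) = D2 f (dw (ev i)) (dw (ev j)) by apply/funext => z; rewrite mxE.
exact: regular_D2.
Qed.

Lemma hess_coercive : exists2 c, 0 < c & forall z, zone z -> forall a : V, c * `|a| <= \sum_j `|(a *m hess z) 0 j|.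
Proof.
have [c c0 Hc] := hess_pos oOmega fs fper K ballO fpd.
exists c => // z zz a; have Uz : U z by apply: ballO; case: zz.
have [->|a0] := eqVneq a 0; first by rewrite normr0 mulr0 sumr_ge0.
have na : 0 < `|a| by rewrite normr_gt0.
rewrite -(ler_pM2r na) -mulrA -expr2; apply: le_trans (Hc z zz a) _.
rewrite -hess_quad // mulr_suml; apply: ler_sum => j _.
by apply: le_trans (ler_norm _) _; rewrite normrM ler_wpM2l // coord_le_norm.
Qed.

Lemma field_bound : exists2 F, 0 <= F & forall z, zone z -> `|field z| <= F.
Proof.
have [c c0 Hc] := hess_coercive.
have [C HC] : exists C : 'I_d -> R, forall j, 0 <= C j /\ forall z, zone z -> `|rhs z 0 j| <= C j.
  apply: (@fun_choice _ _ (fun j C => 0 <= C /\ forall z, zone z -> `|rhs z 0 j| <= C)) => j.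
  by have [_ [C C0 H] _] := regular_rhs j; exists C.
exists ((\sum_j C j) / c).
  by rewrite divr_ge0 ?(ltW c0) // sumr_ge0 // => j _; case: (HC j).
move=> z zz; have Uz : U z by apply: ballO; case: zz.
rewrite ler_pdivlMr // mulrC; apply: le_trans (Hc z zz _) _; rewrite field_hess //.
by apply: ler_sum => j _; case: (HC j) => _; exact.
Qed.

(** From [X H = b] and [X' H' = b'] one gets [(X' - X) H = b' - b - X' (H' - H)]. Coercivity of [H]
    and the bound on [X'] conclude. *)
Lemma field_dist : exists c F, [/\ 0 < c, 0 <= F & forall z z', zone z -> zone z' ->
  c * `|field z' - field z| <= \sum_j (`|rhs z' 0 j - rhs z 0 j| + \sum_i F * `|hess z' i j - hess z i j|)].
Proof.
have [c c0 Hc] := hess_coercive; have [F F0 HF] := field_bound.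
exists c, F; split => // z z' zz zz'.
have Uz : U z by apply: ballO; case: zz.
have Uz' : U z' by apply: ballO; case: zz'.
apply: le_trans (Hc z zz _) _; apply: ler_sum => j _.
have -> : (field z' - field z) *m hess z = rhs z' - rhs z - field z' *m (hess z' - hess z).
  move: (field_hess Uz) (field_hess Uz').
  move: (field z) (field z') (rhs z) (rhs z') (hess z) (hess z') => X X' b b' H H' e e'.
  rewrite mulmxBl mulmxBr e e'; move: (X' *m H) => y.
  by apply/rowP => i; rewrite !mxE; ring.
have -> : (rhs z' - rhs z - field z' *m (hess z' - hess z)) 0 j =
   rhs z' 0 j - rhs z 0 j - \sum_i field z' 0 i * (hess z' i j - hess z i j).
  move: (field z') (rhs z) (rhs z') (hess z) (hess z'); clear => X b b' H H'.
  by rewrite !mxE; congr (_ - _); apply: eq_bigr => i _; rewrite !mxE.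
apply: le_trans (ler_normB _ _) _; rewrite lerD2l.
apply: le_trans (ler_norm_sum _ _ _) _; apply: ler_sum => i _; rewrite normrM ler_wpM2r //.
by apply: le_trans (coord_le_norm _ _) _; exact: HF.
Qed.

Lemma field_lip : exists2 C, 0 <= C & forall q w q' w' t, zone (pt q w t) -> zone (pt q' w' t) ->
  `|field (pt q' w' t) - field (pt q w t)| <= C * (`|q' - q| + `|w' - w|).
Proof.
have [c [F [c0 F0 H]]] := field_dist.
have [C HC] : exists C : 'I_d -> R, forall j, 0 <= C j /\ forall q w q' w' t, zone (pt q w t) -> zone (pt q' w' t) ->
        `|rhs (pt q' w' t) 0 j - rhs (pt q w t) 0 j| <= C j * (`|q' - q| + `|w' - w|).
  apply: (@fun_choice _ _ (fun j C => 0 <= C /\ forall q w q' w' t, zone (pt q w t) -> zone (pt q' w' t) ->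
        `|rhs (pt q' w' t) 0 j - rhs (pt q w t) 0 j| <= C * (`|q' - q| + `|w' - w|))) => j.
  by have [_ _ [C C0 HC]] := regular_rhs j; exists C.
have [D HD] : exists D : 'I_d * 'I_d -> R, forall j, 0 <= D j /\ forall q w q' w' t, zone (pt q w t) -> zone (pt q' w' t) ->
        `|hess (pt q' w' t) j.1 j.2 - hess (pt q w t) j.1 j.2| <= D j * (`|q' - q| + `|w' - w|).
  apply: (@fun_choice _ _ (fun j D => 0 <= D /\ forall q w q' w' t, zone (pt q w t) -> zone (pt q' w' t) ->
        `|hess (pt q' w' t) j.1 j.2 - hess (pt q w t) j.1 j.2| <= D * (`|q' - q| + `|w' - w|))) => j.
  by have [_ _ [D D0 HD]] := regular_hess j.1 j.2; exists D.
exists ((\sum_j (C j + \sum_i F * D (i, j))) / c).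
  rewrite divr_ge0 ?(ltW c0) // sumr_ge0 // => j _; rewrite addr_ge0 //; first by case: (HC j).
  by apply: sumr_ge0 => i _; rewrite mulr_ge0 //; case: (HD (i, j)).
move=> q w q' w' t z1 z2; rewrite mulrAC ler_pdivlMr // mulrC.
apply: le_trans (H _ _ z1 z2) _; rewrite mulr_suml; apply: ler_sum => j _.
rewrite mulrDl; apply: lerD; first by case: (HC j) => _; exact.
rewrite mulr_suml; apply: ler_sum => i _; rewrite -mulrA ler_wpM2l //.
by case: (HD (i, j)) => _; exact.
Qed.

Lemma zone_field_cont z : `|z.1.1 - p| < r -> `|z.1.2| < K -> {for z, continuous field}.
Proof.
move=> z1 z2; have [c [F [c0 F0 H]]] := field_dist.
have zz : zone z by split; exact: ltW.
have Uz : U z by apply: ballO; case: zz.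
pose G z' := \sum_j (`|rhs z' 0 j - rhs z 0 j| + \sum_i F * `|hess z' i j - hess z i j|).
have cG : {for z, continuous G}.
  apply: continuous_sum => j; apply: cvgD.
    apply: cvg_norm; apply: cvgB; last exact: cvg_cst.
    by have [h _ _] := regular_rhs j; exact: h.
  apply: continuous_sum => i; apply: cvgM; first exact: cvg_cst.
  apply: cvg_norm; apply: cvgB; last exact: cvg_cst.
  by have [h _ _] := regular_hess i j; exact: h.
have G0 : G z = 0.
  by apply: big1 => j _; rewrite subrr normr0 add0r big1 // => i _; rewrite subrr normr0 mulr0.
apply/cvgrPdist_lt => e e0; near=> z'.
rewrite -(ltr_pM2l c0).
apply: (@le_lt_trans _ _ (G z')).
  rewrite distrC; apply: H => //; split; apply: ltW.
  - near: z'; have : {for z, continuous (fun z : W => `|z.1.1 - p|)}.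
      apply: cvg_norm; apply: cvgB; last exact: cvg_cst.
      apply: (@continuous_comp _ _ _ (fun z : W => z.1) (fun v : V * V => v.1)); exact: cvg_fst.
    by move/cvgr_lt; exact.
  - near: z'; have : {for z, continuous (fun z : W => `|z.1.2|)}.
      apply: cvg_norm.
      apply: (@continuous_comp _ _ _ (fun z : W => z.1) (fun v : V * V => v.2)); [exact: cvg_fst|exact: cvg_snd].
    by move/cvgr_lt; exact.
near: z'; have h : G z < c * e by rewrite G0 mulr_gt0.
by move/cvgr_lt : cG; exact.
Unshelve. all: by end_near. Qed.

End Zone.

Lemma field_cont z : U z -> {for z, continuous field}.
Proof.
move=> Uz; have [e /= e0 He] := (nbhs_ballP _ _).1 (oOmega Uz).
apply: (@zone_field_cont z.1.1 (e / 2) (`|z.1.2| + 1)).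
- move=> q /= qz; apply: He; rewrite -ball_normE /= distrC; apply: le_lt_trans qz _.
  by rewrite ltr_pdivrMr // ltr_pMr // ltr1n.
- by rewrite subrr normr0 divr_gt0.
- by rewrite ltrDl.
Qed.

End LagrangianField.

Lemma mean_value_abs (R : realType) m (q w : R -> 'rV[R]_m) (a b C s t : R) : 0 <= C ->
  (forall t : R, a <= t <= b -> is_derive t (1 : R) q (w t)) ->
  (forall t : R, a <= t <= b -> `|w t| <= C) -> a <= s <= b -> a <= t <= b ->
  `|q t - q s| <= C * `|t - s|.
Proof.
move=> C0 dq wC; wlog st : s t / s <= t.
  move=> H sab tab; have [st|/ltW ts] := leP s t; first exact: H.
  by rewrite distrC [X in _ * X]distrC; exact: H.
move=> /andP[as_ sb] /andP[at_ tb]; rewrite (ger0_norm (_ : 0 <= t - s)) ?subr_ge0 //.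
apply: (@mean_value_le _ _ q w) => // r /andP[sr rt].
  by apply: dq; rewrite (le_trans as_) //= (le_trans rt).
by apply: wC; rewrite (le_trans as_) //= (le_trans rt).
Qed.

Lemma contraction_fixpoint (R : realType) m (T : 'rV[R]_m -> 'rV[R]_m) (r : R) : 0 <= r ->
  (forall v, `|v| <= r -> `|T v| <= r) ->
  (forall v v', `|v| <= r -> `|v'| <= r -> `|T v - T v'| <= 2^-1 * `|v - v'|) ->
  exists2 v, `|v| <= r & T v = v.
Proof.
move=> r0 Tr Tl; pose u k := iter k T 0.
have ur k : `|u k| <= r by elim: k => [|k IH] /=; [rewrite normr0|exact: Tr].
have us k : `|u k.+1 - u k| <= (2 * r) * 2^-1 ^+ k.
  elim: k => [|k IH].
    by rewrite expr0 mulr1; apply: le_trans (ler_normB _ _) _; have := ur 0%N; have := ur 1%N; lra.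
  apply: le_trans (Tl (u k.+1) (u k) (ur _) (ur _)) _; rewrite exprS mulrCA ler_wpM2l ?invr_ge0 //.
have [l Hl] := geometric_cvg (ltac:(by rewrite mulr_ge0) : 0 <= 2 * r) us.
have small e : 0 < e -> exists k, `|u k - l| < e.
  move=> e0; have [k Hk] := geometric_small (2 * r) e0.
  by exists k; exact: le_lt_trans (Hl k) Hk.
have lr : `|l| <= r.
  apply/ler_addgt0Pl => e e0; have [k Hk] := small e e0.
  have -> : l = u k - (u k - l) by apply/rowP => i; rewrite !mxE; ring.
  apply: le_trans (ler_normB _ _) _; have := ur k; lra.
exists l => //; apply/eqP; rewrite -subr_eq0 -normr_eq0 eq_le normr_ge0 andbT.
apply/ler_addgt0Pl => e e0; rewrite addr0.
have [k Hk] := geometric_small (2 * r) (ltac:(by rewrite divr_gt0) : 0 < e / 2).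
have -> : T l - l = (u k.+1 - l) - (T (u k) - T l) by apply/rowP => i; rewrite !mxE; ring.
apply: le_trans (ler_normB _ _) _.
have h1 := Tl (u k) l (ur k) lr; have h2 := Hl k; have h3 := Hl k.+1.
have h4 : 2 * (2 * r) * 2^-1 ^+ k.+1 = 2^-1 * (2 * (2 * r) * 2^-1 ^+ k) by rewrite exprS; ring.
rewrite h4 in h3; lra.
Qed.

Lemma pt_cont (R : realType) d (T : topologicalType) (q w : T -> 'rV[R]_d) (t : T -> R) x :
  {for x, continuous q} -> {for x, continuous w} -> {for x, continuous t} ->
  {for x, continuous (fun s => pt (q s) (w s) (t s))}.
Proof. by move=> cq cw ct; exact: (cvg_pair (cvg_pair cq cw) ct). Qed.

Section ClampVector.
Variables (R : realType) (m : nat).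
Implicit Types (v c : 'rV[R]_m).

Definition clampv c r v : 'rV[R]_m := \row_i clamp (c 0 i - r) (c 0 i + r) (v 0 i).

Lemma clampv_in c r v : 0 <= r -> `|clampv c r v - c| <= r.
Proof.
move=> r0; apply: rV_norm_le => // i; rewrite !mxE ler_norml.
have /andP[] := clamp_in (v 0 i) (ltac:(lra) : c 0 i - r <= c 0 i + r); lra.
Qed.

Lemma clampv_id c r v : `|v - c| <= r -> clampv c r v = v.
Proof.
move=> vc; apply/rowP => i; rewrite !mxE clamp_id //.
have := le_trans (coord_le_norm (v - c) i) vc; rewrite !mxE ler_norml; lra.
Qed.

Lemma clampv_lip c r v v' : `|clampv c r v - clampv c r v'| <= `|v - v'|.
Proof.
apply: rV_norm_le => // i; rewrite !mxE; apply: le_trans (clamp_lip _ _ _ _) _.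
by have := coord_le_norm (v - v') i; rewrite !mxE.
Qed.

End ClampVector.

(** * Initial value problem and dependence on initial data *)

Section Solutions.
#[local] Opaque derive.
Variables (R : realType) (d : nat).
Notation V := 'rV[R]_d.
Notation W := (V * V * R)%type.
Variables (f : W -> R) (Omega : set V).
Hypothesis oOmega : open Omega.
Let U : set W := [set z | Omega z.1.1].
Hypothesis fs : smooth_on U f.
Hypothesis fper : time_periodic f.
Hypothesis fpd : forall z a, U z -> a != 0 -> 0 < D2 f (dw a) (dw a) z.

Definition solves_at (q w : R -> V) (t : R) :=
  [/\ Omega (q t), is_derive t (1 : R) q (w t) & is_derive t (1 : R) w (field f (pt (q t) (w t) t))].

Section Zone.
Variables (p : V) (r K : R).
Hypothesis ballO : cball p r `<=` Omega.
Notation zone := (zone p r K).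

(** At the maximum [N s] of [N], the mean value inequality bounds [N s] by [N t1] plus the constant
    times [N s * |s - t1|], and the shortness of the interval absorbs half of [N s]. The second
    estimate makes the difference of velocities nearly constant, which brings the shooting map close
    to a linear one. *)
Lemma stability : exists2 C, 1 <= C & forall a b (q w q' w' : R -> V) t1, C * (b - a) <= 2^-1 ->
  (forall t, a <= t <= b -> solves_at q w t /\ zone (pt (q t) (w t) t)) ->
  (forall t, a <= t <= b -> solves_at q' w' t /\ zone (pt (q' t) (w' t) t)) ->
  a <= t1 <= b -> let N t := `|q' t - q t| + `|w' t - w t| in
  forall t, a <= t <= b -> N t <= 2 * N t1 /\ `|(w' t - w t) - (w' t1 - w t1)| <= 2 * C * N t1 * `|t - t1|.
Proof.
have [C C0 HC] := field_lip oOmega fs fper fpd K ballO.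
exists (C + 1); first by lra.
move=> a b q w q' w' t1 Cab Hq Hq' t1ab N.
have ab : a <= b by move: t1ab => /andP[]; exact: le_trans.
have cN : {within `[a, b], continuous N}.
  apply: continuous_in_subspaceT => t; rewrite inE /= in_itv /= => tab.
  have [[_ d1 d2] _] := Hq t tab; have [[_ d1' d2'] _] := Hq' t tab.
  apply: cvgD; apply: cvg_norm; apply: cvgB.
  - exact: is_derive_continuous d1'.
  - exact: is_derive_continuous d1.
  - exact: is_derive_continuous d2'.
  - exact: is_derive_continuous d2.
have [s sab Hs] := EVT_max ab cN.
have {}Hs t : a <= t <= b -> N t <= N s by move=> tab; apply: Hs; rewrite in_itv.
rewrite in_itv /= in sab.
have S0 : 0 <= N s by rewrite addr_ge0.
have dwb t : a <= t <= b -> `|(w' t - w t) - (w' t1 - w t1)| <= C * N s * `|t - t1|.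
  move=> tab; apply: (@mean_value_abs _ _ (w' - w) (fun t => field f (pt (q' t) (w' t) t) - field f (pt (q t) (w t) t)) a b) => //.
  - exact: mulr_ge0.
  - move=> x xab; have [[_ d1 d2] _] := Hq x xab; have [[_ d1' d2'] _] := Hq' x xab.
    exact: is_deriveB.
  - move=> x xab; have [_ z1] := Hq x xab; have [_ z2] := Hq' x xab.
    apply: le_trans (HC _ _ _ _ _ z1 z2) _; rewrite ler_wpM2l //; exact: Hs.
have dqb t : a <= t <= b -> `|(q' t - q t) - (q' t1 - q t1)| <= N s * `|t - t1|.
  move=> tab; apply: (@mean_value_abs _ _ (q' - q) (w' - w) a b) => //.
  - move=> x xab; have [[_ d1 d2] _] := Hq x xab; have [[_ d1' d2'] _] := Hq' x xab.
    exact: is_deriveB.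
  - move=> x xab; apply: le_trans (Hs x xab); rewrite /N.
    by rewrite -[X in X <= _]add0r lerD2r.
have NS : N s <= 2 * N t1.
  have st : `|s - t1| <= b - a by rewrite ler_norml; lra.
  have h1 := dqb s sab; have h2 := dwb s sab.
  have h3 : N s <= N t1 + (C + 1) * N s * `|s - t1|.
    rewrite {1}/N.
    have e1 : `|q' s - q s| <= `|q' t1 - q t1| + `|(q' s - q s) - (q' t1 - q t1)|.
      by rewrite -lerBlDl; apply: lerB_dist.
    have e2 : `|w' s - w s| <= `|w' t1 - w t1| + `|(w' s - w s) - (w' t1 - w t1)|.
      by rewrite -lerBlDl; apply: lerB_dist.
    rewrite /N in h1 h2 *; lra.
  have h4 : (C + 1) * N s * `|s - t1| <= N s / 2.
    rewrite mulrAC mulrC; apply: ler_wpM2l => //.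
    by apply: le_trans Cab; rewrite ler_wpM2l //; lra.
  lra.
move=> t tab; split; first by apply: le_trans (Hs t tab) NS.
apply: le_trans (dwb t tab) _; rewrite ler_wpM2r // mulrAC.
have N1 : 0 <= N t1 by rewrite addr_ge0.
rewrite mulrC; nra.
Qed.

Hypothesis r0 : 0 < r.

Lemma ivp : 1 <= K -> exists2 h, 0 < h & exists2 F, 0 <= F & forall t1 q1 w1,
  `|q1 - p| <= r / 2 -> `|w1| <= K - 1 ->
  exists q w : R -> V, [/\ q t1 = q1, w t1 = w1 &
    forall t, `|t - t1| < h -> [/\ solves_at q w t, zone (pt (q t) (w t) t) &
      `|w t - w1| <= F * `|t - t1|]].
Proof.
move=> K1.
have [C C0 HC] := field_lip oOmega fs fper fpd K ballO.
have [F F0 HF] := field_bound oOmega fs fper fpd K ballO.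
(* Clamping positions and velocities makes the field globally bounded and Lipschitz. For
   [|t - t1| < h] the solution stays where the clamps are the identity, hence it solves the original
   system. *)
pose cq := clampv p r; pose cw := clampv (0 : V) K.
have K0 : 0 <= K by lra.
have zc q w t : zone (pt (cq q) (cw w) t).
  split => /=; first exact: clampv_in (ltW r0).
  by have := clampv_in 0 w K0; rewrite subr0.
pose G s (y : 'rV[R]_(d + d)) : 'rV[R]_(d + d) :=
  row_mx (cw (rsubmx y)) (field f (pt (cq (lsubmx y)) (cw (rsubmx y)) s)).
have nrow (x y : V) c : 0 <= c -> `|x| <= c -> `|y| <= c -> `|row_mx x y| <= c.
  move=> c0 xc yc; apply: rV_norm_le => // i; rewrite mxE; case: splitP => j _.
    exact: le_trans (coord_le_norm _ _) xc.
  exact: le_trans (coord_le_norm _ _) yc.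
have nl (y : 'rV[R]_(d + d)) : `|lsubmx y| <= `|y|.
  by apply: rV_norm_le => // i; rewrite mxE; exact: coord_le_norm.
have nr (y : 'rV[R]_(d + d)) : `|rsubmx y| <= `|y|.
  by apply: rV_norm_le => // i; rewrite mxE; exact: coord_le_norm.
pose Lp := 2 * C + 1; pose B := K + F.
have Lp0 : 0 < Lp by rewrite /Lp; lra.
have B0 : 0 < B + 1 by rewrite /B; lra.
(* The three bounds ensure, in turn, a contraction, a displacement at most [r / 2] and a change of
   velocity at most 1. *)
pose h := Num.min (Num.min (2^-1 / Lp) (r / 2 / (B + 1))) (1 / (B + 1)).
have h0 : 0 < h by rewrite !lt_min !divr_gt0 ?invr_gt0.
have h1 : Lp * h <= 2^-1.
  by rewrite mulrC -ler_pdivlMr // /h !ge_min lexx.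
have h2 : (B + 1) * h <= r / 2.
  by rewrite mulrC -ler_pdivlMr // /h !ge_min lexx orbT.
have h3 : (B + 1) * h <= 1.
  by rewrite mulrC -ler_pdivlMr // /h !ge_min lexx !orbT.
exists h => //; exists F => // t1 q1 w1 q1p w1K.
have Gl s y z : `|G s y - G s z| <= Lp * `|y - z|.
  have yz0 : 0 <= Lp * `|y - z| by rewrite mulr_ge0 // ltW.
  rewrite /G opp_row_mx add_row_mx; apply: nrow => //.
    apply: le_trans (clampv_lip _ _ _ _) _; rewrite -raddfB.
    apply: le_trans (nr _) _; rewrite ler_peMl // /Lp; lra.
  apply: le_trans (HC _ _ _ _ _ (zc _ _ _) (zc _ _ _)) _.
  have a1 : `|cq (lsubmx y) - cq (lsubmx z)| <= `|y - z|.
    by apply: le_trans (clampv_lip _ _ _ _) _; rewrite -raddfB; exact: nl.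
  have a2 : `|cw (rsubmx y) - cw (rsubmx z)| <= `|y - z|.
    by apply: le_trans (clampv_lip _ _ _ _) _; rewrite -raddfB; exact: nr.
  have yz : 0 <= `|y - z| by [].
  rewrite /Lp mulrDl mul1r; nra.
have GB s y : `|G s y| <= B.
  rewrite /G /B; apply: nrow; first lra.
    have := clampv_in 0 (rsubmx y) K0; rewrite subr0 -/cw; lra.
  have := HF _ (zc (lsubmx y) (rsubmx y) s); lra.
have clc c k : continuous (@clampv R d c k).
  by apply: (@lip_continuous _ _ _ _ 1) => x y; rewrite mul1r; exact: clampv_lip.
have Gc y : continuous y -> continuous (fun s => G s (y s)).
  move=> cy s.
  have cl : {for s, continuous (fun s => cq (lsubmx (y s)))}.
    apply: (@continuous_comp _ _ _ (fun s => lsubmx (y s)) cq); last exact: clc.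
    apply: (@continuous_comp _ _ _ y (@lsubmx R 1 d d)); [exact: cy|exact: continuous_lsubmx].
  have cr : {for s, continuous (fun s => cw (rsubmx (y s)))}.
    apply: (@continuous_comp _ _ _ (fun s => rsubmx (y s)) cw); last exact: clc.
    apply: (@continuous_comp _ _ _ y (@rsubmx R 1 d d)); [exact: cy|exact: continuous_rsubmx].
  have cf : {for s, continuous (fun s => field f (pt (cq (lsubmx (y s))) (cw (rsubmx (y s))) s))}.
    apply: (@continuous_comp _ _ _ (fun s => pt (cq (lsubmx (y s))) (cw (rsubmx (y s))) s) (field f)).
      exact: (pt_cont cl cr (@cvg_id _ _)).
    apply: (field_cont oOmega fs fper fpd); apply: ballO; exact: clampv_in (ltW r0).
  apply/cvgrPdist_le => e e0.
  near=> x; rewrite /G opp_row_mx add_row_mx; apply: nrow; first exact: ltW.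
    by near: x; move/cvgrPdist_le : cr; apply.
  by near: x; move/cvgrPdist_le : cf; apply.
have [y [y1 yc yd]] := picard t1 (row_mx q1 w1) h0 (ltW Lp0) (ltac:(rewrite /B; lra) : 0 <= B) h1 Gc Gl GB.
pose q s := lsubmx (y s); pose w s := rsubmx (y s).
have dq t : `|t - t1| < h -> is_derive t (1 : R) q (cw (w t)).
  move=> /yd; rewrite !is_derive_rV => H i; have := H (lshift d i).
  rewrite /G row_mxEl; have -> : (fun s => y s 0 (lshift d i)) = (fun s => q s 0 i) by apply/funext => s; rewrite mxE.
  by [].
have dw t : `|t - t1| < h -> is_derive t (1 : R) w (field f (pt (cq (q t)) (cw (w t)) t)).
  move=> /yd; rewrite !is_derive_rV => H i; have := H (rshift d i).
  rewrite /G row_mxEr; have -> : (fun s => y s 0 (rshift d i)) = (fun s => w s 0 i) by apply/funext => s; rewrite mxE.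
  by [].
have q1E : q t1 = q1 by rewrite /q y1 row_mxKl.
have w1E : w t1 = w1 by rewrite /w y1 row_mxKr.
have bq t : `|t - t1| < h -> `|q t - q1| <= K * `|t - t1|.
  move=> th; rewrite -q1E.
  have tb : t1 - `|t - t1| <= t1 <= t1 + `|t - t1| by have := normr_ge0 (t - t1); lra.
  have tb' : t1 - `|t - t1| <= t <= t1 + `|t - t1|.
    by have := ler_norm (t - t1); have := ler_norm (t1 - t); rewrite (distrC t1 t); lra.
  apply: (@mean_value_abs _ _ q (fun s => cw (w s)) (t1 - `|t - t1|) (t1 + `|t - t1|)) => //.
    by move=> s sb; apply: dq; apply: le_lt_trans th; rewrite ler_norml; lra.
  by move=> s _; have := clampv_in 0 (w s) K0; rewrite subr0.
have bw t : `|t - t1| < h -> `|w t - w1| <= F * `|t - t1|.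
  move=> th; rewrite -w1E.
  have tb : t1 - `|t - t1| <= t1 <= t1 + `|t - t1| by have := normr_ge0 (t - t1); lra.
  have tb' : t1 - `|t - t1| <= t <= t1 + `|t - t1|.
    by have := ler_norm (t - t1); have := ler_norm (t1 - t); rewrite (distrC t1 t); lra.
  apply: (@mean_value_abs _ _ w (fun s => field f (pt (cq (q s)) (cw (w s)) s)) (t1 - `|t - t1|) (t1 + `|t - t1|)) => //.
    by move=> s sb; apply: dw; apply: le_lt_trans th; rewrite ler_norml; lra.
  by move=> s _; apply: HF; exact: zc.
exists q, w; split => // t th.
have zt : zone (pt (q t) (w t) t).
  have th' : `|t - t1| <= h by exact: ltW.
  have t0 : 0 <= `|t - t1| by [].
  split => /=.
    have -> : q t - p = (q t - q1) + (q1 - p) by apply/rowP => i; rewrite !mxE; ring.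
    apply: le_trans (ler_normD _ _) _; have := bq t th.
    have : K * `|t - t1| <= (B + 1) * h by apply: ler_pM => //; rewrite /B; lra.
    lra.
  have -> : w t = (w t - w1) + w1 by apply/rowP => i; rewrite !mxE; ring.
  apply: le_trans (ler_normD _ _) _; have := bw t th.
  have : F * `|t - t1| <= (B + 1) * h by apply: ler_pM => //; rewrite /B; lra.
  lra.
have [z1 z2] := zt.
split => //; last exact: bw.
have cwE : cw (w t) = w t by apply: clampv_id; rewrite subr0.
have cqE : cq (q t) = q t by apply: clampv_id.
split; first exact: ballO.
  by have := dq t th; rewrite cwE.
by have := dw t th; rewrite cwE cqE.
Unshelve. all: by end_near. Qed.

End Zone.
End Solutions.

Lemma is_derive_scalel (R : realType) m (v : 'rV[R]_m) (t : R) : is_derive t (1 : R) (fun s => s *: v) v.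
Proof.
apply/is_derive_rV => i.
have -> : (fun s => (s *: v) 0 i) = (fun s => v 0 i * s) by apply/funext => s; rewrite mxE mulrC.
exact: is_derive_mull.
Qed.

(** * Short extremals and their strict minimality *)

Section BoundaryValue.
#[local] Opaque derive.
Variables (R : realType) (d : nat).
Notation V := 'rV[R]_d.
Notation W := (V * V * R)%type.
Notation ev i := (@unit_rV R d i).
Variables (f : W -> R) (Omega : set V).
Hypothesis oOmega : open Omega.
Let U : set W := [set z | Omega z.1.1].
Hypothesis fs : smooth_on U f.
Hypothesis fper : time_periodic f.
Hypothesis fpd : forall z a, U z -> a != 0 -> 0 < D2 f (dw a) (dw a) z.
Variables (p : V) (r : R).
Hypothesis ballO : cball p r `<=` Omega.
Hypothesis r0 : 0 < r.
Notation solves_at := (solves_at f Omega).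

(* Shooting: the endpoint map v |-> q_v(b) is close to v |-> x + (b - a) v. *)
Lemma bvp k : 1 <= k -> exists2 h, 0 < h & forall a b x y, a < b -> b - a <= h ->
  `|x - p| <= r / 2 -> `|y - x| <= k * (b - a) ->
  exists q w : R -> V, [/\ q a = x, q b = y &
    forall t, a - h < t < b + h -> solves_at q w t /\ zone p r (2 * k + 2) (pt (q t) (w t) t)].
Proof.
move=> k1; pose K := 2 * k + 2.
have K1 : 1 <= K by rewrite /K; lra.
have [h0 h00 [F F0 Hivp]] := ivp oOmega fs fper fpd ballO r0 K1.
have [C C1 Hst] := stability oOmega fs fper fpd K ballO.
pose h := Num.min (h0 / 2) (Num.min (4^-1 / C) (k / (F + 1))).
have C0 : 0 < C by lra.
have hpos : 0 < h by rewrite !lt_min !divr_gt0 ?invr_gt0 //; lra.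
have hh0 : h <= h0 / 2 by rewrite ge_min lexx.
have hC : C * h <= 4^-1 by rewrite mulrC -ler_pdivlMr // /h !ge_min lexx !orbT.
have hF : (F + 1) * h <= k.
  by rewrite mulrC -ler_pdivlMr ?/h ?ge_min ?lexx ?orbT //; lra.
exists h => // a b x y ab bah xp yx.
have ba : 0 < b - a by rewrite subr_gt0.
have [Q HQ] : exists Q : V -> (R -> V) * (R -> V), forall v, `|v| <= 2 * k ->
  [/\ (Q v).1 a = x, (Q v).2 a = v &
    forall t, `|t - a| < h0 -> [/\ solves_at (Q v).1 (Q v).2 t, zone p r K (pt ((Q v).1 t) ((Q v).2 t) t) &
      `|(Q v).2 t - v| <= F * `|t - a|]].
  apply: (@fun_choice _ _ (fun v Q => `|v| <= 2 * k ->
  [/\ Q.1 a = x, Q.2 a = v &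
    forall t, `|t - a| < h0 -> [/\ solves_at Q.1 Q.2 t, zone p r K (pt (Q.1 t) (Q.2 t) t) &
      `|Q.2 t - v| <= F * `|t - a|]])) => v.
  have [vk|vk] := leP `|v| (2 * k); last by exists (cst 0, cst 0).
  have [|q [w Hqw]] := Hivp a x v xp _; first by rewrite /K; lra.
  by exists (q, w).
pose q v := (Q v).1; pose w v := (Q v).2.
have inh0 t : a <= t <= b -> `|t - a| < h0.
  move=> tab; have : `|t - a| <= b - a by rewrite ler_norml; lra.
  by lra.
(* Newton's iteration for [q v b = y], the derivative of the endpoint map being replaced by [b - a].
   The chord has slope at most [k], and the ball of radius [2 * k] leaves room for an error of size
   [k]. *)
pose T v := v - (b - a)^-1 *: (q v b - y).
have aab : a <= a <= b by lra.
have bab : a <= b <= b by lra.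
have qb v : `|v| <= 2 * k -> `|q v b - x - (b - a) *: v| <= F * (b - a) * (b - a).
  move=> vk; have [qa wa H] := HQ v vk.
  have -> : q v b - x - (b - a) *: v = (q v b - b *: v) - (q v a - a *: v).
    by rewrite /q qa; apply/rowP => i; rewrite !mxE; ring.
  have ->: F * (b - a) * (b - a) = F * (b - a) * `|b - a| by rewrite (gtr0_norm ba).
  apply: (@mean_value_abs _ _ (fun t => q v t - t *: v) (fun t => w v t - v) a b) => //.
  - by rewrite mulr_ge0 // ltW.
  - move=> t tab; have [[_ h1 _] _ _] := H t (inh0 t tab).
    by apply: is_deriveB; exact: is_derive_scalel.
  - move=> t tab; have [_ _ h1] := H t (inh0 t tab); apply: le_trans h1 _.
    by rewrite ler_wpM2l // ler_norml; lra.
have nba : `|(b - a)^-1| = (b - a)^-1 by rewrite gtr0_norm // invr_gt0.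
have Tb v : `|v| <= 2 * k -> `|T v| <= 2 * k.
  move=> vk.
  have -> : T v = (b - a)^-1 *: ((y - x) - (q v b - x - (b - a) *: v)).
    rewrite /T; apply/rowP => i; rewrite !mxE; field; lra.
  rewrite normrZ nba mulrC ler_pdivrMr //.
  apply: le_trans (ler_normB _ _) _; have := qb v vk.
  have : F * (b - a) <= (F + 1) * h by apply: ler_pM; lra.
  nra.
have Tl v v' : `|v| <= 2 * k -> `|v'| <= 2 * k -> `|T v - T v'| <= 2^-1 * `|v - v'|.
  move=> vk v'k; have [qa wa H] := HQ v vk; have [qa' wa' H'] := HQ v' v'k.
  have -> : T v - T v' = - ((b - a)^-1 *: ((q v b - q v' b - b *: (v - v')) - (q v a - q v' a - a *: (v - v')))).
    rewrite /T /q qa qa'; apply/rowP => i; rewrite !mxE; field; lra.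
  rewrite normrN normrZ nba mulrC ler_pdivrMr //.
  have Cba : C * (b - a) <= 4^-1.
    by apply: le_trans hC; rewrite ler_wpM2l // ltW.
  have S := Hst a b (q v') (w v') (q v) (w v) a (ltac:(lra)) (fun t tab => let: And3 h1 h2 _ := H' t (inh0 t tab) in conj h1 h2)
     (fun t tab => let: And3 h1 h2 _ := H t (inh0 t tab) in conj h1 h2) aab.
  have M : `|(q v b - q v' b - b *: (v - v')) - (q v a - q v' a - a *: (v - v'))| <= 2 * C * `|v - v'| * (b - a) * `|b - a|.
    apply: (@mean_value_abs _ _ (fun t => q v t - q v' t - t *: (v - v')) (fun t => w v t - w v' t - (v - v')) a b) => //.
    - by rewrite !mulr_ge0 // ltW.
    - move=> t tab; have [[_ h1 _] _ _] := H t (inh0 t tab); have [[_ h1' _] _ _] := H' t (inh0 t tab).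
      exact: is_deriveB (is_deriveB h1 h1') (is_derive_scalel _ _).
    - move=> t tab; have [_] := S t tab.
      rewrite /q /w qa qa' wa wa' subrr normr0 add0r => h2; apply: le_trans h2 _.
      by rewrite ler_wpM2l ?mulr_ge0 // ?(ltW C0) // ler_norml; lra.
  apply: le_trans M _; rewrite (gtr0_norm ba).
  have : 0 <= (4^-1 - C * (b - a)) * (`|v - v'| * (b - a)).
    by rewrite !mulr_ge0 ?subr_ge0 // ltW.
  lra.
have [v vk Tv] := contraction_fixpoint (ltac:(lra) : 0 <= 2 * k) Tb Tl.
have [qa wa H] := HQ v vk.
exists (q v), (w v); split => //.
  have : (b - a) *: (v - T v) = 0 by rewrite Tv subrr scaler0.
  have -> : v - T v = (b - a)^-1 *: (q v b - y) by rewrite /T; apply/rowP => i; rewrite !mxE; ring.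
  rewrite scalerA divff ?gt_eqF // scale1r => /eqP.
  by rewrite subr_eq0 => /eqP.
move=> t tab; have [|h1 h2 _] := H t; first by rewrite ltr_norml; lra.
by split.
Qed.

(** The excess must absorb mixed terms of size [D * |eta| * |om|], where the summand [d] of [D]
    comes from bounding [dot] by sup norms. For [|om| < 1] this is completion of the square, which
    creates [D ^+ 2 / (4 * c)]; for [|om| >= 1] the excess is only linear and the smallness of [eta]
    is used, which dictates [eps]. *)
Lemma calibration_ineq K : exists eps Lam, [/\ 0 < eps, 0 < Lam &
  forall q w eta om t mu, `|q - p| <= r -> `|w| <= K -> `|q + eta - p| <= r ->
    `|eta| <= eps -> `|mu| <= 1 ->
    'D_(dq eta) f (pt q w t) + 'D_(dw om) f (pt q w t) - Lam / 2 * dot eta eta - mu * dot eta om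
      <= f (pt (q + eta) (w + om) t) - f (pt q w t)].
Proof.
have [c [C [c0 C0 H]]] := taylor_lower oOmega fs fper fpd K ballO.
pose D := C + d%:R.
have D0 : 0 <= D by rewrite addr_ge0.
exists (c / (D + 1)), (2 * (C + D ^+ 2 / (4 * c) + 1)).
have E0 : 0 <= D ^+ 2 / (4 * c) by rewrite divr_ge0 ?sqr_ge0 //; lra.
split; [rewrite divr_gt0 //; lra|lra|].
move=> q w eta om t mu qp wK q'p etae mu1.
have := H q (q + eta) w om t qp q'p wK.
have -> : q + eta - q = eta by rewrite addrC addKr.
have h1 : `|eta| ^+ 2 <= dot eta eta := dot_ge eta.
have h2 : `|mu * dot eta om| <= d%:R * `|eta| * `|om|.
  rewrite normrM; apply: le_trans (dot_le eta om); rewrite -[leRHS]mul1r ler_wpM2r //.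
have h3 : - (d%:R * `|eta| * `|om|) <= mu * dot eta om by move: h2; rewrite ler_norml => /andP[].
rewrite ler_pdivlMr in etae; last lra.
move: etae h1 h3 (normr_ge0 eta) (normr_ge0 om).
move: ('D_(dq eta) f (pt q w t)) ('D_(dw om) f (pt q w t)) (f (pt (q + eta) (w + om) t)) (f (pt q w t)).
move: (dot eta eta) (mu * dot eta om) `|eta| `|om| => ee eo n o A B F1 F0 etae h1 h3 n0 o0 H1.
pose X := D ^+ 2 / (4 * c).
have XE : X * (4 * c) = D ^+ 2 by rewrite /X; field; lra.
have key : 0 <= c * o * Num.min 1 o - D * n * o + X * n ^+ 2.
  have [ho|ho] := leP 1 o.
    have : 0 <= X * n ^+ 2 by rewrite mulr_ge0 ?sqr_ge0.
    have : 0 <= o * (c - n * (D + 1)) by rewrite mulr_ge0 // subr_ge0.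
    have : 0 <= n * o by rewrite mulr_ge0.
    lra.
  have : 0 <= (2 * c * o - D * n) ^+ 2 by exact: sqr_ge0.
  have e : (2 * c * o - D * n) ^+ 2 = 4 * c * (c * o * o - D * n * o + X * n ^+ 2).
    rewrite -[LHS]/((2 * c * o - D * n) * (2 * c * o - D * n)).
    transitivity (4 * c * (c * o * o - D * n * o) + (X * (4 * c)) * n ^+ 2); last by ring.
    by rewrite XE; ring.
  by rewrite e pmulr_rge0 //; lra.
have h4 : (C + X + 1) * n ^+ 2 <= (C + X + 1) * ee by rewrite ler_wpM2l //; rewrite /X; lra.
have h5 : 0 <= n ^+ 2 by exact: sqr_ge0.
rewrite -/X; rewrite /D in key; nra.
Qed.

Definition coord_path (a b : R) (s : seq R) (q : R -> V) (P : R -> R) :=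
  [/\ {within `[a, b], continuous q}, {within `[a, b], continuous P} &
    forall t, a < t < b -> t \notin s -> exists2 w, is_derive t (1 : R) q w &
      is_derive t (1 : R) P (f (pt (q t) w t))].

Lemma coord_pathW a b s q P a' b' : coord_path a b s q P -> a <= a' -> b' <= b ->
  coord_path a' b' s q P.
Proof.
move=> [cq cP H] aa' bb'; split; [exact: within_sub cq _ _|exact: within_sub cP _ _|].
by move=> t /andP[h1 h2] ts; apply: H => //; rewrite (le_lt_trans aa') // (lt_le_trans h2).
Qed.

Definition momentum (q w : R -> V) (t : R) : V := \row_j 'D_(dw (ev j)) f (pt (q t) (w t) t).
Definition force (q w : R -> V) (t : R) : V := \row_j 'D_(dq (ev j)) f (pt (q t) (w t) t).

Lemma momentum_derive q w t : solves_at q w t -> is_derive t (1 : R) (momentum q w) (force q w t).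
Proof.
move=> [Uq dq0 dw0]; apply/is_derive_rV => j.
have -> : (fun s => momentum q w s 0 j) = (fun s => 'D_(dw (ev j)) f (pt (q s) (w s) s)).
  by apply/funext => s; rewrite mxE.
have Uz : U (pt (q t) (w t) t) by [].
have dg := smooth_diff (smooth_derive (dw (ev j)) fs) Uz.
apply: is_derive_eq (chain_rule dg dq0 dw0) _.
rewrite mxE; exact: (field_eq oOmega fs fpd j Uz).
Qed.

Lemma momentum_dot q w t om : U (pt (q t) (w t) t) -> dot (momentum q w t) om = 'D_(dw om) f (pt (q t) (w t) t).
Proof.
move=> Uz; rewrite (derive_dw _ (smooth_diff fs Uz)); apply: eq_bigr => j _.
by rewrite mxE mulrC.
Qed.

Lemma force_dot q w t eta : U (pt (q t) (w t) t) -> dot (force q w t) eta = 'D_(dq eta) f (pt (q t) (w t) t).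
Proof.
move=> Uz; rewrite (derive_dq _ (smooth_diff fs Uz)); apply: eq_bigr => j _.
by rewrite mxE mulrC.
Qed.

(* The quadratic function S(x, t) = PE(t) + p(t).(x - E(t)) - mu(t)/2 |x - E(t)|^2
   is a strict subsolution of the Hamilton-Jacobi equation near E; its variation
   along a path bounds the action of the path from below. *)
Lemma calibration K eps Lam :
  (forall q w eta om t mu, `|q - p| <= r -> `|w| <= K -> `|q + eta - p| <= r ->
    `|eta| <= eps -> `|mu| <= 1 ->
    'D_(dq eta) f (pt q w t) + 'D_(dw om) f (pt q w t) - Lam / 2 * dot eta eta - mu * dot eta om
      <= f (pt (q + eta) (w + om) t) - f (pt q w t)) ->
  forall a b E w PE s q P m0 m1, a <= b ->
    (forall t, a <= t <= b -> solves_at E w t /\ zone p r K (pt (E t) (w t) t)) ->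
    {within `[a, b], continuous PE} ->
    (forall t, a < t < b -> is_derive t (1 : R) PE (f (pt (E t) (w t) t))) ->
    coord_path a b s q P ->
    (forall t, a <= t <= b -> `|q t - p| <= r /\ `|q t - E t| <= eps) ->
    (forall t, a <= t <= b -> `|m0 + Lam * (t - m1)| <= 1) ->
    let G t := dot (momentum E w t) (q t - E t) - (m0 + Lam * (t - m1)) / 2 * dot (q t - E t) (q t - E t) in
    is_true ((PE b - PE a) + (G b - G a) <= P b - P a).
Proof.
move=> H a b E w PE s q P m0 m1 ab HE cPE dPE [cq cP dP] tube mb G.
have cE : {within `[a, b], continuous E}.
  apply: continuous_in_subspaceT => t; rewrite inE /= in_itv /= => tab.
  by have [[_ d1 _] _] := HE t tab; exact: is_derive_continuous d1.
have cM : {within `[a, b], continuous (momentum E w)}.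
  apply: continuous_in_subspaceT => t; rewrite inE /= in_itv /= => tab.
  by have [d1 _] := HE t tab; exact: is_derive_continuous (momentum_derive d1).
have cdot (u v : R -> V) : {within `[a, b], continuous u} -> {within `[a, b], continuous v} ->
    {within `[a, b], continuous (fun t => dot (u t) (v t))}.
  move=> cu cv t; rewrite /dot; apply: continuous_sum => i; apply: cvgM.
    by apply: (@continuous_comp (subspace `[a, b]) _ _ u (fun v : V => v 0 i)); [exact: cu|exact: coord_continuous].
  by apply: (@continuous_comp (subspace `[a, b]) _ _ v (fun v : V => v 0 i)); [exact: cv|exact: coord_continuous].
have ceta : {within `[a, b], continuous (fun t => q t - E t)}.
  by move=> t; apply: cvgB; [exact: cq|exact: cE].
have dm (t : R) : is_derive t (1 : R) (fun t => (m0 + Lam * (t - m1)) / 2) (Lam / 2).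
  have -> : (fun t => (m0 + Lam * (t - m1)) / 2) = cst ((m0 - Lam * m1) / 2) + (fun t => Lam / 2 * t).
    by apply/funext => x; rewrite fctE /=; field.
  by apply: is_derive_eq (is_deriveD (is_derive_cst _ t 1) (is_derive_mull (Lam / 2) t)) _; rewrite add0r.
have cG : {within `[a, b], continuous G}.
  move=> t; apply: cvgB; first by apply: (cdot _ _ cM ceta).
  apply: cvgM; last by apply: (cdot _ _ ceta ceta).
  have cm : {within `[a, b], continuous (fun t => (m0 + Lam * (t - m1)) / 2)}.
    by apply: continuous_subspaceT => x; exact: is_derive_continuous (dm x).
  exact: cm.
have -> : (PE b - PE a) + (G b - G a) = (PE + G) b - (PE + G) a by rewrite !fctE; ring.
apply: (@le_derive_le _ s) => //.
  by move=> t; apply: cvgD; [exact: cPE|exact: cG].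
move=> t tab ts; have [w' dq' dP'] := dP t tab ts.
have tab' : a <= t <= b by lra.
have [sol [z1 z2]] := HE t tab'; have [Uz dE dw'] := sol.
have [q1 q2] := tube t tab'.
set eta := q t - E t; set om := w' - w t; set mu := m0 + Lam * (t - m1).
have deta : is_derive t (1 : R) (fun t => q t - E t) om by exact: is_deriveB.
exists (f (pt (E t) (w t) t) + (dot (force E w t) eta + dot (momentum E w t) om
   - (mu / 2 * (dot om eta + dot eta om) + dot eta eta * (Lam / 2)))), (f (pt (q t) w' t)); split => //.
- apply: is_deriveD; first exact: dPE.
  apply: is_deriveB.
    exact: (is_derive_dot (momentum_derive sol) deta).
  by apply: is_derive_eq (is_deriveM (dm t) (is_derive_dot deta deta)) _.
- have ar (A B F1 F2 X Y Z l : R) : A + B - l / 2 * X - Z * Y <= F1 - F2 ->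
      F2 + (A + B - (Z / 2 * (Y + Y) + X * (l / 2))) <= F1 by lra.
  have e1 := @force_dot E w t eta Uz; have e2 := @momentum_dot E w t om Uz.
  have := H (E t) (w t) eta om t mu z1 z2.
  have -> : E t + eta = q t by rewrite addrC subrK.
  have -> : w t + om = w' by rewrite addrC subrK.
  move=> /(_ q1 q2 (mb t tab')); rewrite -e1 -e2 (dotC om eta).
  exact: ar.
Qed.

(** The calibration is applied on [[a, t]] and on [[t, b]] with different functions [mu]. The jump
    of [mu] from 0 to 1/2 at [t] turns into the gain [|q t - E t| ^+ 2 / 4]; the boundary terms are
    linear in the gaps at [a] and [b], because momenta and [eps] are bounded. *)
Lemma strict_minimality K : exists eps h C, [/\ 0 < eps, 0 < h, 0 <= C &
  forall a b E w PE s q P, a <= b -> b - a <= h ->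
    (forall t, a <= t <= b -> solves_at E w t /\ zone p r K (pt (E t) (w t) t)) ->
    {within `[a, b], continuous PE} ->
    (forall t, a < t < b -> is_derive t (1 : R) PE (f (pt (E t) (w t) t))) ->
    coord_path a b s q P ->
    (forall t, a <= t <= b -> `|q t - p| <= r /\ `|q t - E t| <= eps) ->
    forall t, a <= t <= b ->
    (PE b - PE a) + (`|q t - E t| ^+ 2 / 4 - C * (`|q a - E a| + `|q b - E b|)) <= P b - P a].
Proof.
have [eps [Lam [eps0 Lam0 H]]] := calibration_ineq K.
have [C HC] : exists C : 'I_d -> R, forall j, 0 <= C j /\ forall z, zone p r K z -> `|'D_(dw (ev j)) f z| <= C j.
  apply: (@fun_choice _ _ (fun j C => 0 <= C /\ forall z, zone p r K z -> `|'D_(dw (ev j)) f z| <= C)) => j.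
  have [C C0 HC] := @zone_bound _ _ _ p r K ballO (fun z => 'D_(dw (ev j)) f z) (periodic_derive _ fper)
      (fun z Uz => smooth_cont (smooth_derive _ fs) Uz).
  by exists C.
pose D := \sum_j C j.
have D0 : 0 <= D by apply: sumr_ge0 => j _; case: (HC j).
have d0 : 0 <= d%:R :> R by [].
exists eps, (1 / (2 * Lam)), (d%:R * D + d%:R * eps / 2); split => //.
- by rewrite divr_gt0 // mulr_gt0.
- by rewrite addr_ge0 ?mulr_ge0 // ltW.
move=> a b E w PE s q P ab bah HE cPE dPE cqP tube t tab.
have Lba : Lam * (b - a) <= 2^-1.
  move: bah; rewrite ler_pdivlMr ?mulr_gt0 //; lra.
have at_ : a <= t by case/andP: tab.
have tb : t <= b by case/andP: tab.
have sub1 : forall x, a <= x <= t -> a <= x <= b by move=> x; lra.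
have sub2 : forall x, t <= x <= b -> a <= x <= b by move=> x; lra.
(* [mu] grows at the rate [Lam] that the calibration requires: from at least -1/2 up to 0 on the
   left, from 1/2 up to at most 1 on the right. This is why [Lam * (b - a)] must not exceed 1/2. *)
have I1 := @calibration K eps Lam H a t E w PE s q P 0 t at_ (fun x xi => HE x (sub1 x xi)) (within_sub cPE (lexx _) tb)
  (fun x (xi : a < x < t) => dPE x (ltac:(lra))) (coord_pathW cqP (lexx _) tb) (fun x xi => tube x (sub1 x xi)).
have I2 := @calibration K eps Lam H t b E w PE s q P 2^-1 t tb (fun x xi => HE x (sub2 x xi)) (within_sub cPE at_ (lexx _))
  (fun x (xi : t < x < b) => dPE x (ltac:(lra))) (coord_pathW cqP at_ (lexx _)) (fun x xi => tube x (sub2 x xi)).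
have mb1 x : a <= x <= t -> `|0 + Lam * (x - t)| <= 1 by move=> xi; rewrite ler_norml; nra.
have mb2 x : t <= x <= b -> `|2^-1 + Lam * (x - t)| <= 1 by move=> xi; rewrite ler_norml; nra.
have e0 : Lam * (t - t) = 0 by rewrite subrr mulr0.
move: (I1 mb1) (I2 mb2) => /=; rewrite !e0 !addr0.
have mdot x : a <= x <= b -> `|dot (momentum E w x) (q x - E x)| <= d%:R * D * `|q x - E x|.
  move=> xi; apply: le_trans (dot_le _ _) _; rewrite -!mulrA ler_wpM2l // ler_wpM2r //.
  apply: rV_norm_le => // j; rewrite mxE.
  have [_ zz] := HE x xi; have [_ /(_ _ zz) h] := HC j.
  apply: le_trans h _; rewrite /D (bigD1 j) //= lerDl.
  by apply: sumr_ge0 => i _; case: (HC i).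
have edot x : a <= x <= b -> 0 <= dot (q x - E x) (q x - E x) <= d%:R * eps * `|q x - E x|.
  move=> xi; have [_ te] := tube x xi; apply/andP; split.
    by apply: le_trans (dot_ge _); exact: sqr_ge0.
  apply: le_trans (ler_norm _) _; apply: le_trans (dot_le _ _) _.
  by rewrite ler_wpM2r // ler_wpM2l.
have aab : a <= a <= b by lra.
have bab : a <= b <= b by lra.
have := mdot a aab; have := mdot b bab; have := edot a aab; have := edot b bab.
have := dot_ge (q t - E t).
rewrite !ler_norml.
have La : - 2^-1 <= Lam * (a - t) <= 0 by apply/andP; split; nra.
have Lb : 0 <= Lam * (b - t) <= 2^-1 by apply/andP; split; nra.
move: La Lb; rewrite !add0r.
move: (dot (q t - E t) (q t - E t)) (dot (q a - E a) (q a - E a)) (dot (q b - E b) (q b - E b)) => et ea eb.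
move: (dot (momentum E w t) (q t - E t)) (dot (momentum E w a) (q a - E a)) (dot (momentum E w b) (q b - E b)) => pt pa pb.
move: (Lam * (a - t)) (Lam * (b - t)) `|q a - E a| `|q b - E b| => la lb na nb.
move: (`|q t - E t| ^+ 2) (d%:R * D) (d%:R * eps) (PE b) (PE a) (PE t) (P b) (P a) (P t) => nt X Y PEb PEa PEt Pb Pa Pt.
clear => La Lb h1 hb ha hpb hpa I1 I2.
have : 0 <= (1 + la) * ea by rewrite mulr_ge0 //; lra.
have : 0 <= (2^-1 - lb) * eb by rewrite mulr_ge0 //; lra.
nra.
Qed.

(** Each coordinate, taken with either sign, moves at a rate at most [|w|], and the largest of these
    displacements is the sup norm. *)
Lemma displacement_bound a b s q P kap C : a <= b -> coord_path a b s q P -> 0 <= kap ->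
  (forall t, a <= t <= b -> `|q t - p| <= r) ->
  (forall x w t, `|x - p| <= r -> kap * `|w| - C <= f (pt x w t)) ->
  kap * `|q b - q a| - C * (b - a) <= P b - P a.
Proof.
move=> ab [cq cP dP] kap0 qr Hf.
have H i (sg : R) : `|sg| = 1 -> kap * (sg * (q b 0 i - q a 0 i)) - C * (b - a) <= P b - P a.
  move=> sg1.
  have := @le_derive_le _ s (fun t => kap * (sg * q t 0 i) - C * t) P a b ab.
  rewrite (_ : _ - _ = kap * (sg * (q b 0 i - q a 0 i)) - C * (b - a)); last by ring.
  apply => //.
    move=> t; apply: cvgB; last by apply: continuous_subspaceT => x; exact: mulrl_continuous.
    apply: cvgM; first exact: cvg_cst.
    apply: cvgM; first exact: cvg_cst.
    by apply: (@continuous_comp (subspace `[a, b]) _ _ q (fun v : V => v 0 i)); [exact: cq|exact: coord_continuous].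
  move=> t tab ts; have [w dq' dP'] := dP t tab ts.
  exists (kap * (sg * w 0 i) - C), (f (pt (q t) w t)); split => //.
    apply: is_deriveB; last exact: is_derive_mull.
    have /is_derive_rV/(_ i) dqi := dq'.
    have h1 : is_derive t (1 : R) (fun t => sg * q t 0 i) (sg * w 0 i).
      by apply: is_derive_eq (is_deriveM (is_derive_cst sg t 1) dqi) _; rewrite /GRing.scale /= mulr0 addr0.
    by apply: is_derive_eq (is_deriveM (is_derive_cst kap t 1) h1) _; rewrite /GRing.scale /= mulr0 addr0.
  apply: le_trans (Hf (q t) w t (qr t (ltac:(lra)))).
  rewrite lerD2r ler_wpM2l //; apply: le_trans (ler_norm _) _.
  by rewrite normrM sg1 mul1r; exact: coord_le_norm.
have PC : 0 <= P b - P a + C * (b - a).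
  have := @le_derive_le _ s (fun t => - C * t) P a b ab.
  rewrite -mulrBr mulNr => h; suff : - (C * (b - a)) <= P b - P a by lra.
  apply: h => //.
    by apply: continuous_subspaceT => x; exact: mulrl_continuous.
  move=> t tab ts; have [w dq' dP'] := dP t tab ts.
  exists (- C), (f (pt (q t) w t)); split => //; first exact: is_derive_mull.
  have := Hf (q t) w t (qr t (ltac:(lra))); have : 0 <= kap * `|w| by exact: mulr_ge0.
  lra.
move: kap0; rewrite le_eqVlt => /predU1P[<-|k1]; first by rewrite mul0r; lra.
rewrite lerBlDr mulrC -ler_pdivlMr //; apply: rV_norm_le => [|i]; first by rewrite divr_ge0 // ltW.
rewrite ler_pdivlMr // mulrC !mxE.
have h1 := H i 1 (normr1 _); have h2 := H i (-1) (normrN1 _).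
have [hh|hh] := ler0P (q b 0 i - q a 0 i); lra.
Qed.

End BoundaryValue.

Lemma derive_comp (R : realType) (U V W : normedModType R) (f : U -> V) (g : V -> W) q a :
  differentiable f q -> differentiable g (f q) ->
  'D_a (g \o f) q = 'D_('D_a f q) g (f q).
Proof.
move=> df dg; rewrite (deriveE a (differentiable_comp df dg)) (diff_comp df dg) /=.
by rewrite (deriveE a df) (deriveE _ dg).
Qed.

(** * Charts *)

Section Partial.
Context {R : realType} {d : nat}.
Notation V := 'rV[R]_d.

Lemma derive_linear (g : V -> R) (T : {linear V -> V}) a v :
  'D_a (g \o T) v = 'D_(T a) g (T v).
Proof.
rewrite /derive; suff -> : (fun h : R => h^-1 *: ((g \o T \o shift v) (h *: a) - (g \o T) v)) =
  (fun h : R => h^-1 *: ((g \o shift (T v)) (h *: T a) - g (T v))) by [].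
by apply/funext => h; rewrite /= (linearD T) (linearZ_LR T).
Qed.

Lemma partial_dw (g : V * V * R -> R) (q w : V) (t : R) a :
  'D_a (fun w => g (pt q w t)) w = 'D_(dw a) g (pt q w t).
Proof.
rewrite /derive; suff -> : (fun h : R => h^-1 *: (((fun w => g (pt q w t)) \o shift w) (h *: a) - g (pt q w t))) =
  (fun h : R => h^-1 *: ((g \o shift (pt q w t)) (h *: dw a) - g (pt q w t))) by [].
apply/funext => h /=; congr (_ *: (g _ - _)).
by apply: injective_projections; [apply: injective_projections|] => /=; rewrite ?scaler0 ?add0r.
Qed.

Lemma partial_dq (g : V * V * R -> R) (q w : V) (t : R) a :
  'D_a (fun q => g (pt q w t)) q = 'D_(dq a) g (pt q w t).
Proof.
rewrite /derive; suff -> : (fun h : R => h^-1 *: (((fun q => g (pt q w t)) \o shift q) (h *: a) - g (pt q w t))) =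
  (fun h : R => h^-1 *: ((g \o shift (pt q w t)) (h *: dq a) - g (pt q w t))) by [].
apply/funext => h /=; congr (_ *: (g _ - _)).
by apply: injective_projections; [apply: injective_projections|] => /=; rewrite ?scaler0 ?add0r.
Qed.

End Partial.

Section Charts.
#[local] Opaque derive.
Context {R : realType} {M : ptopologicalType} {d : nat}.
Variable SM : smooth_structure R M d.
Notation V := 'rV[R]_d.
Notation chart := (chart R M d).
Notation atlas := (atlas SM).
Implicit Types (c : chart) (x : M) (q w : V).

Lemma cimgP c q : cimg c q -> cdom c (cinv c q) /\ cmap c (cinv c q) = q.
Proof. by move=> [x cx <-]; rewrite cmapK. Qed.

Lemma cimg_cmap c x : cdom c x -> cimg c (cmap c x).
Proof. by move=> cx; exists x. Qed.

Lemma cmap_cont c x : cdom c x -> {for x, continuous (cmap c)}.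
Proof.
have := @cmap_continuous R M d c; rewrite continuous_open_subspace; last exact: cdom_open.
by move=> H cx; apply: H; rewrite inE.
Qed.

Lemma cinv_cont c q : cimg c q -> {for q, continuous (cinv c)}.
Proof.
have := @cinv_continuous R M d c; rewrite continuous_open_subspace; last exact: (@cimg_open R M d c).
by move=> H cq; apply: H; rewrite inE.
Qed.

Lemma near_cimg c q : cimg c q -> \forall q' \near q, cimg c q'.
Proof.
by move=> cq; have oc : open (cimg c) := @cimg_open R M d c; exact: (@open_nbhs_nbhs _ q (cimg c) (conj oc cq)).
Qed.

Definition overlap c c' : set V := [set q | cimg c q /\ cdom c' (cinv c q)].

Lemma overlapE c c' : cmap c @` (cdom c `&` cdom c') = overlap c c'.
Proof.
apply/seteqP; split => q.
  by move=> [x [cx c'x] <-]; split; [exact: cimg_cmap|rewrite cmapK].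
by move=> [/cimgP[cx xq] c'x]; exists (cinv c q).
Qed.

Lemma overlap_open c c' : open (overlap c c').
Proof.
rewrite openE => q [cq c'q].
have h1 : \forall q' \near q, cimg c q' by exact: near_cimg.
have h2 : \forall q' \near q, cdom c' (cinv c q').
  by apply: (cinv_cont cq); exact: open_nbhs_nbhs (conj (cdom_open c') c'q).
by apply: filterS2 h1 h2 => q' ? ?; split.
Qed.

Lemma near_overlap c c' q : overlap c c' q -> \forall q' \near q, overlap c c' q'.
Proof. by move=> oq; apply: open_nbhs_nbhs; split => //; exact: overlap_open. Qed.

Definition trans c c' : V -> V := cmap c' \o cinv c.

Lemma trans_smooth c c' : atlas c -> atlas c' -> smooth_on (overlap c c') (trans c c').
Proof. by move=> ac ac'; rewrite -overlapE; exact: (@atlas_compat _ _ _ SM). Qed.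

Lemma trans_diff c c' q : atlas c -> atlas c' -> overlap c c' q -> differentiable (trans c c') q.
Proof. by move=> ac ac' oq; exact: smooth_diff (trans_smooth ac ac') oq. Qed.

Lemma overlap_cmap c c' x : cdom c x -> cdom c' x -> overlap c c' (cmap c x).
Proof. by move=> cx c'x; split; [exact: cimg_cmap|rewrite cmapK]. Qed.

Lemma trans_cmap c c' x : cdom c x -> trans c c' (cmap c x) = cmap c' x.
Proof. by move=> cx; rewrite /trans /= cmapK. Qed.

Lemma trans_cocycle c c' c'' q a : atlas c -> atlas c' -> atlas c'' -> overlap c c' q -> overlap c c'' q ->
  'd (trans c c'') q a = 'd (trans c' c'') (trans c c' q) ('d (trans c c') q a).
Proof.
move=> ac ac' ac'' o1 o2.
have [cq xq] := cimgP o1.1.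
have o3 : overlap c' c'' (trans c c' q).
  by rewrite /trans /=; apply: overlap_cmap; [case: o1|case: o2].
have d1 := trans_diff ac ac' o1; have d3 := trans_diff ac' ac'' o3.
have e0 := deriveE a (trans_diff ac ac'' o2); have e1 := deriveE a d1.
have e3 := deriveE ('D_a (trans c c') q) d3; have e4 := derive_comp a d1 d3.
suff key : 'D_a (trans c c'') q = 'D_a (trans c' c'' \o trans c c') q.
  exact: (etrans (esym e0) (etrans key (etrans e4 (etrans e3 (congr1 _ e1))))).
apply: near_eq_derive; near=> q'.
have oq' : overlap c c' q' by near: q'; exact: near_overlap.
by rewrite /trans /= cmapK //; case: oq'.
Unshelve. all: by end_near. Qed.

Lemma trans_id c q a : atlas c -> cimg c q -> 'd (trans c c) q a = a.
Proof.
move=> ac cq; have [cx xq] := cimgP cq.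
have oq : overlap c c q by split.
rewrite -deriveE; last exact: trans_diff.
rewrite -[RHS](derive_id q a); apply: near_eq_derive; near=> q'.
have : cimg c q' by near: q'; exact: near_cimg.
by move=> /cimgP[_].
Unshelve. all: by end_near. Qed.

Lemma overlap_sym c c' q : overlap c c' q -> overlap c' c (trans c c' q) /\ trans c' c (trans c c' q) = q.
Proof.
move=> [cq c'q]; have [cx xq] := cimgP cq; split.
  exact: overlap_cmap.
by rewrite /trans /= cmapK.
Qed.

Lemma trans_inv c c' q a : atlas c -> atlas c' -> overlap c c' q ->
  'd (trans c' c) (trans c c' q) ('d (trans c c') q a) = a.
Proof.
move=> ac ac' oq; have oqq : overlap c c q by split; case: oq => // /cimgP[].
rewrite -(trans_cocycle _ ac ac' ac oq oqq); apply: (trans_id _ ac); exact: oq.1.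
Qed.

Lemma trans_derive_cont c c' q : atlas c -> atlas c' -> overlap c c' q ->
  forall w, {for (q, w), continuous (fun z : V * V => 'd (trans c c') (z.1 : V) (z.2 : V))}.
Proof.
move=> ac ac' oq w.
pose G (z : V * V) := \sum_i z.2 0 i *: 'D_(unit_rV R i) (trans c c') z.1.
have cG : {for (q, w), continuous G}.
  rewrite /G; elim: (index_enum _) => [|i s IH].
    have -> : (fun z : V * V => \sum_(j <- [::]) z.2 0 j *: 'D_(unit_rV R j) (trans c c') z.1) = cst 0.
      by apply/funext => z; rewrite big_nil.
    exact: cvg_cst.
  have -> : (fun z : V * V => \sum_(j <- i :: s) z.2 0 j *: 'D_(unit_rV R j) (trans c c') z.1) =
    (fun z : V * V => z.2 0 i *: 'D_(unit_rV R i) (trans c c') z.1 +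
        \sum_(j <- s) z.2 0 j *: 'D_(unit_rV R j) (trans c c') z.1).
    by apply/funext => z; rewrite big_cons.
  apply: cvgD; last exact: IH.
  apply: cvgZ.
    apply: (@continuous_comp _ _ _ (fun z : V * V => z.2) (fun v : V => v 0 i)); last exact: coord_continuous.
    exact: cvg_snd.
  apply: (@continuous_comp _ _ _ (fun z : V * V => z.1) (fun q => 'D_(unit_rV R i) (trans c c') q)); first exact: cvg_fst.
  exact: smooth_cont (smooth_derive _ (trans_smooth ac ac')) oq.
have GE z : overlap c c' z.1 -> G z = 'd (trans c c') (z.1 : V) (z.2 : V).
  move=> oz; have dz := trans_diff ac ac' oz.
  rewrite [in RHS](row_unit z.2) linear_sum; apply: eq_bigr => i _.
  by rewrite linearZ /= deriveE.
have gq : G (q, w) = 'd (trans c c') q w := GE (q, w) oq.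
have nq := near_overlap oq.
have nz : \forall z \near (q, w), overlap c c' z.1.
  by exists (overlap c c', setT); [split => //; exact: filterT|move=> z []].
have : G z @[z --> (q, w)] --> 'd (trans c c') q w by rewrite -gq; exact: cG.
apply: cvg_trans; apply: near_eq_cvg; near=> z; rewrite GE //.
by near: z.
Unshelve. all: by end_near. Qed.

Lemma tangent_coordE c q w : tangent_coord SM c q w = 'd (trans c (chart_at SM (cinv c q))) q w.
Proof. by []. Qed.

Lemma overlap_chart_at c q : cimg c q -> overlap c (chart_at SM (cinv c q)) q.
Proof. by move=> cq; split => //; exact: chart_at_mem. Qed.

Lemma tangent_coord_inj c q w : atlas c -> cimg c q -> tangent_coord SM c q w = 0 -> w = 0.
Proof.
move=> ac cq E; have oq := overlap_chart_at cq.
have := trans_inv w ac (chart_at_atlas SM (cinv c q)) oq.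
by rewrite -[X in 'd _ _ X]/(tangent_coord SM c q w) E linear0.
Qed.

Lemma near_cdom c (gamma : R -> M) (t : R) : {for t, continuous gamma} -> cdom c (gamma t) ->
  \forall s \near t, cdom c (gamma s).
Proof. by move=> cg ct; apply: cg; exact: open_nbhs_nbhs (conj (cdom_open c) ct). Qed.

Lemma chart_change c c' (gamma : R -> M) (t : R) w : atlas c -> atlas c' -> {for t, continuous gamma} ->
  cdom c (gamma t) -> cdom c' (gamma t) -> is_derive t (1 : R) (cmap c \o gamma) w ->
  is_derive t (1 : R) (cmap c' \o gamma) ('d (trans c c') (cmap c (gamma t)) w).
Proof.
move=> ac ac' cg ct c't [dq dw'].
have oq := overlap_cmap ct c't.
have hq : differentiable (cmap c \o gamma) t := (derivable1_diffP _ _).1 dq.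
have hT := trans_diff ac ac' oq.
have hd : differentiable (trans c c' \o (cmap c \o gamma)) t := differentiable_comp hq hT.
apply: (@is_derive_near _ _ (trans c c' \o (cmap c \o gamma))).
  near=> s; rewrite /trans /= cmapK //; near: s; exact: near_cdom.
split; first exact: (derivable1_diffP _ _).2 hd.
rewrite (deriveE _ hd) (diff_comp hq hT) /=; congr ('d _ _ _).
by rewrite -(deriveE _ hq).
Unshelve. all: by end_near. Qed.

Lemma velocity_coord c (gamma : R -> M) (t : R) w : atlas c -> {for t, continuous gamma} ->
  cdom c (gamma t) -> is_derive t (1 : R) (cmap c \o gamma) w ->
  velocity SM gamma t = tangent_coord SM c (cmap c (gamma t)) w.
Proof.
move=> ac cg ct dw'; have := chart_change ac (chart_at_atlas SM (gamma t)) cg ct (chart_at_mem SM _) dw'.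
move=> [_ E]; rewrite /velocity derive1E E tangent_coordE.
by rewrite (cmapK ct).
Qed.

Section Lagrangian.
Variable L : M -> V -> R -> R.
Hypothesis L_smooth : lagrangian_smooth SM L.
Hypothesis L_periodic : lagrangian_periodic L.
Hypothesis L_posdef : lagrangian_posdef L.

Definition lag c (z : V * V * R) := local_lagrangian SM L c z.1.1 z.1.2 z.2.

Lemma lag_smooth c : atlas c -> smooth_on [set z : V * V * R | cimg c z.1.1] (lag c).
Proof. exact: L_smooth. Qed.

Lemma lag_periodic c : time_periodic (lag c).
Proof. by move=> [[q w] t]; rewrite /lag /local_lagrangian /= !addr0 L_periodic. Qed.

(** At a fixed base point, chart velocities and tangent vectors differ by the injective linear map
    [T], under which a positive definite Hessian stays positive definite. *)
Lemma lag_posdef c z a : atlas c -> cimg c z.1.1 -> a != 0 -> 0 < D2 (lag c) (dw a) (dw a) z.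
Proof.
case: z => [[q w] t] ac /= cq a0.
rewrite /D2 -[(q, w, t)]/(pt q w t) -(partial_dw (fun z => 'D_(dw a) (lag c) z)).
set T := ('d (trans c (chart_at SM (cinv c q))) q : {linear V -> V}).
have -> : (fun w => 'D_(dw a) (lag c) (pt q w t)) = (fun w => 'D_(T a) (fun v => L (cinv c q) v t) w) \o T.
  apply/funext => v /=; rewrite -partial_dw.
  by rewrite -[RHS](derive_linear (fun v => L (cinv c q) v t) T a v).
rewrite derive_linear; apply: L_posdef.
by apply: contraNneq a0 => Ta; apply/eqP; exact: (tangent_coord_inj ac cq Ta).
Qed.

Lemma lag_velocity c (gamma : R -> M) (t : R) w : atlas c -> {for t, continuous gamma} ->
  cdom c (gamma t) -> is_derive t (1 : R) (cmap c \o gamma) w ->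
  L (gamma t) (velocity SM gamma t) t = lag c (pt (cmap c (gamma t)) w t).
Proof.
by move=> ac cg ct dw'; rewrite (velocity_coord ac cg ct dw') /lag /local_lagrangian /= cmapK.
Qed.

End Lagrangian.
End Charts.

(** * Paths and actions *)

Section Lines.
Variable R : realType.

Lemma Ck1P (V : normedModType R) (J : set R) (f : R -> V) : open J ->
  Ck_on 1 J f <-> exists w : R -> V, forall t, J t -> is_derive t (1 : R) f (w t) /\ {for t, continuous w}.
Proof.
move=> oJ; split.
  move=> [df cf]; exists (fun t => 'D_1 f t) => t Jt; split; last exact: cf.
  by split => //; apply: (derivable1_diffP _ _).2; exact: df.
move=> [w H]; split => [x Jx|v x Jx /=].
  by apply: (derivable1_diffP _ _).1; have [[]] := H x Jx.
have E y : J y -> 'D_v f y = v *: w y.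
  move=> Jy; have [[dy ey] _] := H y Jy.
  have hy : differentiable f y := (derivable1_diffP _ _).1 dy.
  rewrite (deriveE _ hy) -[v in LHS]mulr1 (linearZ_LR ('d f y : {linear R -> V})) /=; congr (_ *: _).
  by rewrite -(deriveE _ hy).
have [_ cx] := H x Jx; have nJ : nbhs x J by exact: open_nbhs_nbhs.
rewrite /prop_for /continuous_at (E x Jx).
have : v *: w y @[y --> x] --> v *: w x by apply: cvgZ; [exact: cvg_cst|exact: cx].
apply: cvg_trans; apply: near_eq_cvg; near=> y; rewrite E //; near: y; exact: nJ.
Unshelve. all: by end_near. Qed.

Notation mu := (@lebesgue_measure R).

Lemma integrable_itv_oo_cc (f : R -> R) a b : mu.-integrable `]a, b[ (EFin \o f) ->
  mu.-integrable `[a, b] (EFin \o f).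
Proof.
move=> /integrableP[mf fi]; apply/integrableP; split; first by apply/measurable_EFinP; apply: measurable_fun_itv_cc; apply/measurable_EFinP; exact: mf.
rewrite integral_itv_bndoo //; exact: measurableT_comp mf.
Qed.

Lemma integrable_cat (f : R -> R) a b c : a <= b -> b <= c -> mu.-integrable `[a, b] (EFin \o f) ->
  mu.-integrable `[b, c] (EFin \o f) -> mu.-integrable `[a, c] (EFin \o f).
Proof.
move=> ab bc i1 i2.
have i3 : mu.-integrable `]b, c] (EFin \o f).
  exact: (@integrableS _ _ _ mu `[b, c] `]b, c] _ (measurable_itv _) (measurable_itv _) (@subset_itv_oc_cc _ _ b c) i2).
have E : `[a, c]%classic = `[a, b] `|` `]b, c].
  by apply: itv_bndbnd_setU; rewrite bnd_simp.
move: i1 i3 => /integrableP[m1 f1] /integrableP[m3 f3].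
have m : measurable_fun (`[a, b] `|` `]b, c]) (EFin \o f) by apply/measurable_funU.
apply/integrableP; rewrite E; split => //.
rewrite ge0_integral_setU //; first by apply: lte_add_pinfty.
  exact: measurableT_comp.
apply/disj_setPS => y [] /=; rewrite !in_itv /= => /andP[_ h1] /andP[h2 _].
by move: (le_lt_trans h1 h2); rewrite ltxx.
Qed.

Lemma Rintegral_eq_oo (f g : R -> R) a b : mu.-integrable `[a, b] (EFin \o f) ->
  mu.-integrable `[a, b] (EFin \o g) -> (forall t, a < t < b -> f t = g t) ->
  \int[mu]_(s in `[a, b]) f s = \int[mu]_(s in `[a, b]) g s.
Proof.
move=> intf intg E; rewrite /Rintegral; congr fine.
have oc (h : R -> R) : mu.-integrable `[a, b] (EFin \o h) ->
    (\int[mu]_(x in `[a, b]) (h x)%:E = \int[mu]_(x in `]a, b[) (h x)%:E)%E.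
  move=> ih; apply: integral_itv_bndoo.
  by have /measurable_int := @integrableS _ _ _ mu `[a, b] `]a, b[ _ (measurable_itv _) (measurable_itv _) (@subset_itv_oo_cc _ _ a b) ih.
rewrite (oc _ intf) (oc _ intg).
by apply: eq_integral => t; rewrite inE /= in_itv /= => /E ->.
Qed.

Lemma is_derive_comp_shift (V : normedModType R) (f : R -> V) k t w :
  is_derive (t + k) (1 : R) f w -> is_derive t (1 : R) (fun s => f (s + k)) w.
Proof.
move=> [df dE]; have E : (fun h : R => h^-1 *: (((fun s => f (s + k)) \o shift t) (h *: 1) - f (t + k))) =
  (fun h : R => h^-1 *: ((f \o shift (t + k)) (h *: 1) - f (t + k))).
  by apply/funext => h /=; rewrite addrA.
by split; rewrite /derivable /derive E; [exact: df|exact: dE].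
Qed.

Lemma shift_cont (T : topologicalType) (f : R -> T) k t : {for t + k, continuous f} ->
  {for t, continuous (fun s => f (s + k))}.
Proof.
move=> cf; apply: (@continuous_comp _ _ _ (fun s : R => s + k) f) => //.
by apply: cvgD; [exact: cvg_id|exact: cvg_cst].
Qed.

End Lines.

Section Paths.
Context {R : realType} {M : ptopologicalType} {d : nat}.
Variable SM : smooth_structure R M d.
Notation V := 'rV[R]_d.
Notation atlas := (atlas SM).
Notation is_path := (is_path SM).
Notation C1_segment := (C1_segment SM).
Notation mu := (@lebesgue_measure R).
Implicit Types (gamma eta : R -> M) (J : set R).

Lemma open_preim J gamma (A : set M) : open J -> open A -> (forall t, J t -> {for t, continuous gamma}) ->
  open (J `&` gamma @^-1` A).
Proof.
move=> oJ oA cg; rewrite openE => t [Jt At].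
have h1 : \forall s \near t, J s by exact: open_nbhs_nbhs.
have h2 : \forall s \near t, A (gamma s) by apply: (cg t Jt); exact: open_nbhs_nbhs.
by apply: filterS2 h1 h2 => s ? ?; split.
Qed.

Lemma curve_C1P J gamma : open J -> curve_Ck_on SM 1 J gamma <->
  (forall t, J t -> {for t, continuous gamma}) /\
  forall c, atlas c -> exists w : R -> V, forall t, J t -> cdom c (gamma t) ->
    is_derive t (1 : R) (cmap c \o gamma) (w t) /\ {for t, continuous w}.
Proof.
move=> oJ; split => -[cg H]; split => // c ac.
  have [w Hw] := (Ck1P _ (open_preim oJ (cdom_open c) cg)).1 (H c ac).
  by exists w => t Jt ct; apply: Hw; split.
have [w Hw] := H c ac; apply: (Ck1P _ (open_preim oJ (cdom_open c) cg)).2.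
by exists w => t [Jt ct]; exact: Hw.
Qed.

Lemma curve_C1_chart J c (q w : R -> V) : open J -> atlas c ->
  (forall t, J t -> [/\ cimg c (q t), is_derive t (1 : R) q (w t) & {for t, continuous w}]) ->
  curve_Ck_on SM 1 J (cinv c \o q).
Proof.
move=> oJ ac H; apply/(curve_C1P _ oJ).
have cq t : J t -> {for t, continuous (cinv c \o q)}.
  move=> Jt; have [iq dq' _] := H t Jt.
  apply: (@continuous_comp _ _ _ q (cinv c)); [exact: is_derive_continuous dq'|exact: cinv_cont].
split => // c' ac'; exists (fun t => 'd (trans c c') (q t) (w t)) => t Jt ct.
have [iq dq' cw] := H t Jt.
have [cx xq] := cimgP iq.
split; last first.
  have oq : overlap c c' (q t) by split.
  apply: (@continuous_comp _ _ _ (fun t => (q t, w t)) (fun z : V * V => 'd (trans c c') (z.1 : V) (z.2 : V))).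
    have cq' : q s @[s --> t] --> q t := is_derive_continuous dq'.
    exact: cvg_pair cq' cw.
  have H2 := @trans_derive_cont R M d SM c c' (q t) ac ac' oq (w t); exact: H2.
have dq2 : is_derive t (1 : R) (cmap c \o (cinv c \o q)) (w t).
  apply: is_derive_near dq'; near=> s; have : J s by near: s; exact: open_nbhs_nbhs.
  by move=> /H[/cimgP[_ e] _ _]; rewrite /= e.
by have := chart_change ac ac' (cq t Jt) cx ct dq2; rewrite /= xq.
Unshelve. all: by end_near. Qed.

Lemma C1_segment_eq a b gamma eta : {in `[a, b], gamma =1 eta} -> C1_segment a b gamma -> C1_segment a b eta.
Proof.
move=> E [J [z [oJ sJ cz zE]]]; exists J, z; split => // t tab.
by rewrite zE // E.
Qed.

Lemma C1_segmentW a b a' b' gamma : C1_segment a b gamma -> a <= a' -> b' <= b -> C1_segment a' b' gamma.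
Proof.
move=> [J [z [oJ sJ cz zE]]] aa bb; exists J, z.
have S t : t \in `[a', b'] -> t \in `[a, b].
  by rewrite !in_itv /= => /andP[h1 h2]; rewrite (le_trans aa h1) (le_trans h2 bb).
by split => // t ht; [apply: sJ; exact: S|apply: zE; exact: S].
Qed.

Lemma C1_segment_cont a b gamma : C1_segment a b gamma -> {within `[a, b], continuous gamma}.
Proof.
move=> [J [z [oJ sJ [cz _] zE]]]; apply/within_nearP => s sab U Us.
have sI r : a <= r <= b -> r \in `[a, b] by rewrite in_itv.
have : \forall r \near s, U (z r) by apply: cz; [exact/sJ/sI|rewrite zE ?sI].
move=> /nbhs_ballP[e e0 H]; exists e => // r rab rs; rewrite -zE ?sI //.
by apply: H; rewrite /ball /= distrC.
Qed.

Lemma path_le a b gamma : is_path a b gamma -> a <= b.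
Proof. by move=> [_ [s /itv_partition_le]]. Qed.

Lemma path_cont a b gamma : is_path a b gamma -> {within `[a, b], continuous gamma}.
Proof. by case. Qed.

Lemma path_C1 a b gamma : a <= b -> C1_segment a b gamma -> is_path a b gamma.
Proof.
move=> ab H; split; first exact: C1_segment_cont.
move: ab; rewrite le_eqVlt => /predU1P[<-|ab]; first by exists [::].
by exists [:: b]; [exact: itv_partition1|case].
Qed.

(** With this principle most facts on paths are proved without a look at partitions: on a degenerate
    interval, on a C^1 segment, and under concatenation. *)
Lemma path_ind (Q : R -> R -> Prop) gamma : (forall a, Q a a) ->
  (forall a b, a < b -> C1_segment a b gamma -> Q a b) ->
  (forall a b c, a < b -> b <= c -> is_path a b gamma -> is_path b c gamma -> Q a b -> Q b c -> Q a c) ->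
  forall a b, is_path a b gamma -> Q a b.
Proof.
move=> Q0 Q1 Qc a b [cg [s]]; elim: s a cg => [|x s IH] a cg itv seg.
  by rewrite (itv_partition_nil itv); exact: Q0.
have ax : a < x by case: itv => /= /andP[].
have itv' := itv_partition_cons itv; have xb := itv_partition_le itv'.
have seg0 : C1_segment a x gamma := seg 0%N isT.
have cxb := within_sub cg (ltW ax) (lexx b).
have seg' i : (i < size s)%N -> C1_segment (nth b (x :: s) i) (nth b s i) gamma := fun h => seg i.+1 h.
apply: (Qc a x b) => //.
- exact: path_C1 (ltW ax) seg0.
- by split => //; exists s.
- exact: Q1.
- exact: IH.
Qed.

Lemma within_cat (T : topologicalType) (gamma : R -> T) a b c : a <= b -> b <= c -> {within `[a, b], continuous gamma} ->
  {within `[b, c], continuous gamma} -> {within `[a, c], continuous gamma}.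
Proof.
move=> ab bc /within_nearP c1 /within_nearP c2; apply/within_nearP => s /andP[as_ sc] U Us.
have [sb|bs|sb] := ltgtP s b.
- have [|e e0 H] := c1 s _ U Us; first by rewrite as_ ltW.
  exists (Num.min e (b - s)); first by rewrite lt_min e0 subr_gt0.
  move=> r /andP[ar rc]; rewrite lt_min => /andP[h1 h2]; apply: H => //; rewrite ar /=.
  by move: h2; rewrite ltr_norml => /andP[_]; rewrite ltrD2r => /ltW.
- have [|e e0 H] := c2 s _ U Us; first by rewrite sc ltW.
  exists (Num.min e (s - b)); first by rewrite lt_min e0 subr_gt0.
  move=> r /andP[ar rc]; rewrite lt_min => /andP[h1 h2]; apply: H => //; rewrite rc andbT.
  by move: h2; rewrite ltr_norml => /andP[h _]; move: h; rewrite opprB; lra.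
- subst s.
  have [|e e0 H] := c1 b _ U Us; first by rewrite ab lexx.
  have [|e' e0' H'] := c2 b _ U Us; first by rewrite bc lexx.
  exists (Num.min e e'); first by rewrite lt_min e0.
  move=> r /andP[ar rc]; rewrite lt_min => /andP[h1 h2].
  by have [rb|/ltW br] := leP r b; [apply: H; rewrite ?ar ?rb|apply: H'; rewrite ?br ?rc].
Qed.

Lemma path_cons a b c gamma : a < b -> C1_segment a b gamma -> is_path b c gamma -> is_path a c gamma.
Proof.
move=> ab seg p; have bc := path_le p; move: p => [cg [s itv H]].
split; first exact: within_cat (ltW ab) bc (C1_segment_cont seg) cg.
exists (b :: s); last by case.
by case: itv => h1 h2; split => //=; rewrite ab.
Qed.

Lemma path_refl a gamma : is_path a a gamma.
Proof.
split; last by exists [::].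
apply/within_nearP => s sa U Us; exists 1 => // r ra _.
have -> : r = s by move: sa ra => /andP[? ?] /andP[? ?]; lra.
exact: nbhs_singleton Us.
Qed.

Lemma path_cat a b c gamma : is_path a b gamma -> is_path b c gamma -> is_path a c gamma.
Proof.
move=> p; move: a b p c; apply: path_ind => [a c //|a b ab seg c|a b c ab bc p1 p2 Q1 Q2 c' p3].
  exact: path_cons.
by apply: Q1; exact: Q2.
Qed.

Lemma pathW a b a' b' gamma : is_path a b gamma -> a <= a' -> a' <= b' -> b' <= b -> is_path a' b' gamma.
Proof.
move=> p; move: a b p a' b'; apply: path_ind => [a a' b' h1 h2 h3|a b ab seg a' b' h1 h2 h3|a b c ab bc p1 p2 Q1 Q2 a' b' h1 h2 h3].
- have -> : b' = a' by apply/eqP; rewrite eq_le h2 (le_trans h3 h1).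
  exact: path_refl.
- exact: path_C1 h2 (C1_segmentW seg h1 h3).
- have [b'b|/ltW bb'] := leP b' b; first exact: Q1.
  have [ba'|/ltW a'b] := leP b a'; first exact: Q2.
  by apply: (@path_cat a' b b'); [apply: Q1|apply: Q2].
Qed.

Lemma path_eq a b gamma eta : {in `[a, b], gamma =1 eta} -> is_path a b gamma -> is_path a b eta.
Proof.
move=> E p; move: a b p E; apply: path_ind => [a _|a b ab seg E|a b c ab bc p1 p2 Q1 Q2 E].
- exact: path_refl.
- exact: path_C1 (ltW ab) (C1_segment_eq E seg).
- apply: (@path_cat a b c); [apply: Q1|apply: Q2] => t; rewrite in_itv /= => /andP[h1 h2]; apply: E;
    rewrite in_itv /=; apply/andP; split; lra.
Qed.

Definition splice (b : R) gamma eta : R -> M := fun t => if t <= b then gamma t else eta t.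

Lemma glue_l a b gamma eta : {in `[a, b], splice b gamma eta =1 gamma}.
Proof. by move=> t; rewrite in_itv /splice /= => /andP[_ ->]. Qed.

Lemma glue_r b c gamma eta : gamma b = eta b -> {in `[b, c], splice b gamma eta =1 eta}.
Proof.
move=> E t; rewrite in_itv /splice /= => /andP[bt _]; case: leP => // tb.
by have -> : t = b by apply/eqP; rewrite eq_le tb.
Qed.

Lemma path_glue a b c gamma eta : is_path a b gamma -> is_path b c eta -> gamma b = eta b ->
  is_path a c (splice b gamma eta).
Proof.
move=> p1 p2 E; apply: (@path_cat a b c).
  by apply: path_eq p1 => t ht; rewrite (glue_l _ _ ht).
by apply: path_eq p2 => t ht; rewrite (glue_r E ht).
Qed.

Lemma C1_segment_shift k a b gamma : C1_segment (a + k) (b + k) gamma ->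
  C1_segment a b (fun t => gamma (t + k)).
Proof.
move=> [J [z [oJ sJ cz zE]]].
have oJ' : open [set t | J (t + k)].
rewrite -[X in open X]/((fun t => t + k) @^-1` J).
  apply: open_comp => // t _; apply: cvgD; [exact: cvg_id|exact: cvg_cst].
have [ct Hc] := (curve_C1P _ oJ).1 cz.
exists [set t | J (t + k)], (fun t => z (t + k)); split => //.
- move=> t /=; rewrite in_itv /= => tab; apply: sJ; rewrite /= in_itv /=.
  by rewrite !lerD2r.
- apply/(curve_C1P _ oJ'); split => [t Jt|c ac]; first exact: shift_cont (ct _ Jt).
  have [w Hw] := Hc c ac; exists (fun t => w (t + k)) => t Jt cdt; have [h1 h2] := Hw _ Jt cdt.
  by split; [exact: (is_derive_comp_shift h1)|exact: shift_cont].
- by move=> t; rewrite in_itv /= => tab; apply: zE; rewrite in_itv /= !lerD2r.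
Qed.

Lemma path_shift k a b gamma : is_path (a + k) (b + k) gamma -> is_path a b (fun t => gamma (t + k)).
Proof.
move=> p; rewrite -[a](addrK k) -[b](addrK k); move: (a + k) (b + k) p.
apply: path_ind => [a'|a' b' ab seg|a' b' c' ab bc p1 p2 Q1 Q2].
- exact: path_refl.
- by apply: path_C1; [rewrite lerD2r ltW|apply: C1_segment_shift; rewrite !subrK].
- exact: path_cat Q1 Q2.
Qed.

Section Action.
Variable L : M -> V -> R -> R.
Hypothesis L_smooth : lagrangian_smooth SM L.
Notation lag := (lag SM L).
Notation lag_action := (lag_action SM L).

Definition speed gamma (t : R) := L (gamma t) (velocity SM gamma t) t.

Lemma speed_cont J gamma : open J -> curve_Ck_on SM 1 J gamma -> forall t, J t -> {for t, continuous (speed gamma)}.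
Proof.
move=> oJ cz t Jt; have [ct Hc] := (curve_C1P _ oJ).1 cz.
pose c := chart_at SM (gamma t); have ac : atlas c := chart_at_atlas SM _.
have [w Hw] := Hc c ac.
have cdt : cdom c (gamma t) := chart_at_mem SM _.
have [dt cw] := Hw t Jt cdt; have nJ : nbhs t J by exact: open_nbhs_nbhs.
have E s : J s -> cdom c (gamma s) -> speed gamma s = lag c (pt (cmap c (gamma s)) (w s) s).
  by move=> Js cs; have [ds _] := Hw s Js cs; exact: lag_velocity (ct s Js) cs ds.
rewrite /prop_for /continuous_at (E t Jt cdt).
have : lag c (pt (cmap c (gamma s)) (w s) s) @[s --> t] --> lag c (pt (cmap c (gamma t)) (w t) t).
  apply: (@continuous_comp _ _ _ (fun s => pt (cmap c (gamma s)) (w s) s) (lag c)).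
    apply: (@pt_cont _ _ _ (cmap c \o gamma) w (fun s : R => s) t) => //.
    apply: (@continuous_comp _ _ _ gamma (cmap c)); [exact: ct|exact: cmap_cont].
  have cU : [set z : V * V * R | cimg c z.1.1] (pt (cmap c (gamma t)) (w t) t) := cimg_cmap cdt.
  have H2 := smooth_cont (lag_smooth L_smooth ac) cU; exact: H2.
apply: cvg_trans; apply: near_eq_cvg; near=> s; rewrite E //.
  by near: s; exact: nJ.
by near: s; exact: near_cdom (ct t Jt) cdt.
Unshelve. all: by end_near. Qed.

(** [P] is a primitive of the Lagrangian along the path, differentiable off the break points [s],
    with the derivative read in any chart. Estimates of actions thus become comparisons of
    derivatives. *)
Definition action_rep a b gamma (s : seq R) (P : R -> R) :=
  [/\ mu.-integrable `[a, b] (EFin \o speed gamma), {within `[a, b], continuous P},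
      forall t t', a <= t -> t <= t' -> t' <= b -> lag_action t t' gamma = P t' - P t &
      forall t, a < t < b -> t \notin s -> {for t, continuous gamma} /\
        forall c, atlas c -> cdom c (gamma t) -> exists2 w, is_derive t (1 : R) (cmap c \o gamma) w &
          is_derive t (1 : R) P (lag c (pt (cmap c (gamma t)) w t))].

Lemma velocity_near gamma eta t : (\forall s \near t, gamma s = eta s) -> velocity SM gamma t = velocity SM eta t.
Proof.
move=> H; rewrite /velocity (nbhs_singleton H) !derive1E; apply: near_eq_derive.
by apply: filterS H => s /= ->.
Qed.

Lemma near_itv (a b t : R) : a < t < b -> \forall s \near t, s \in `[a, b].
Proof.
move=> /andP[at_ tb]; near=> s; rewrite in_itv /=; apply/andP; split; apply: ltW; near: s.
  exact: lt_nbhsr.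
exact: lt_nbhsl.
Unshelve. all: by end_near. Qed.

Lemma C1_segment_action a b gamma : a < b -> C1_segment a b gamma -> exists P, action_rep a b gamma [::] P.
Proof.
move=> ab [J [z [oJ sJ cz zE]]].
have ab' := ltW ab.
(* Clamping time extends the integrand of the C^1 extension [z] continuously to the line. On
   [[a, b]] it can differ from the integrand of [gamma] only at the two end points, where [velocity]
   may be junk. *)
pose f t := speed z (clamp a b t).
have cf : continuous f.
  move=> t; apply: (@continuous_comp _ _ _ (clamp a b) (speed z)); first exact: clamp_continuous.
  by apply: (speed_cont oJ cz); apply: sJ; rewrite /= in_itv /=; exact: clamp_in.
have [P dP] := primitive_real (a - 1) cf.
have cP : {within `[a, b], continuous P}.
  apply: continuous_in_subspaceT => t; rewrite inE /= in_itv /= => /andP[at_ _].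
  by apply: is_derive_continuous (dP t _); lra.
have nE t : a < t < b -> \forall s \near t, z s = gamma s.
  by move=> tab; apply: filterS (near_itv tab) => s; exact: zE.
have sE t : a < t < b -> speed gamma t = f t.
  move=> tab; have E := nE t tab.
  rewrite /f clamp_id; last by case/andP: tab => ? ?; rewrite !ltW.
  by rewrite /speed -(velocity_near E) -(nbhs_singleton E).
have intf t t' : mu.-integrable `[t, t'] (EFin \o f).
  apply: continuous_compact_integrable; first exact: segment_compact.
  exact: continuous_subspaceT.
have intg : mu.-integrable `[a, b] (EFin \o speed gamma).
  apply: integrable_itv_oo_cc; apply: (@eq_integrable _ _ _ mu `]a, b[ (measurable_itv _) (EFin \o f)).
    by move=> t; rewrite inE /= in_itv /= => /sE ->.
  exact: (@integrableS _ _ _ mu `[a, b] `]a, b[ _ (measurable_itv _) (measurable_itv _) (@subset_itv_oo_cc _ _ a b) (intf a b)).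
have [ct Hc] := (curve_C1P _ oJ).1 cz.
exists P; split => //.
- move=> t t' at_ tt t'b; rewrite /lag_action.
  rewrite (@Rintegral_eq_oo _ _ f); last 3 first.
  + apply: integrableS intg => //; apply: subset_itvScc; rewrite bnd_simp //.
  + exact: intf.
  + by move=> s /andP[h1 h2]; apply: sE; rewrite (le_lt_trans at_ h1) (lt_le_trans h2 t'b).
  move: tt; rewrite le_eqVlt => /predU1P[<-|tt]; first by rewrite set_itv1 Rintegral_set1 subrr.
  rewrite /Rintegral (@continuous_FTC2 _ f P) //.
  + exact: continuous_subspaceT.
  + split.
    * move=> s; rewrite in_itv /= => /andP[h1 _]; have [] := dP s; first lra.
      by [].
    * apply: cvg_at_right_filter; apply: is_derive_continuous (dP t _); lra.
    * apply: cvg_at_left_filter; apply: is_derive_continuous (dP t' _); lra.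
  + move=> s; rewrite in_itv /= => /andP[h1 _]; have [_ e] := dP s ltac:(lra).
    by rewrite derive1E.
- move=> t tab _.
  have Jt : J t by apply: sJ; rewrite /= in_itv /=; case/andP: tab => ? ?; rewrite !ltW.
  have E := nE t tab; have Et := nbhs_singleton E.
  have cg : {for t, continuous gamma}.
    rewrite /prop_for /continuous_at -Et; apply: cvg_trans (ct t Jt).
    by apply: near_eq_cvg; apply: filterS E => s ->.
  split => // c ac cdt; have [w Hw] := Hc c ac.
  have [|dw' _] := Hw t Jt; first by rewrite Et.
  have dg : is_derive t (1 : R) (cmap c \o gamma) (w t).
    by apply: is_derive_near dw'; apply: filterS E => s /= ->.
  exists (w t) => //; rewrite -(lag_velocity L ac cg cdt dg) -/(speed gamma t) sE //.
  by apply: dP; lra.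
Qed.

Lemma path_action a b gamma : is_path a b gamma -> exists s P, action_rep a b gamma s P.
Proof.
move=> p; move: a b p; apply: path_ind => [a|a b ab seg|a b c ab bc p1 p2 [s1 [P1 [i1 c1 e1 d1]]] [s2 [P2 [i2 c2 e2 d2]]]].
- exists [::], (fun=> 0); split.
  + by apply: integrable_itv_oo_cc; rewrite set_itvoo0; exact: integrable_set0.
  + exact: continuous_subspaceT (@cst_continuous _ _ _).
  + move=> t t' h1 h2 h3; have -> : t' = t by lra.
    by rewrite /lag_action set_itv1 Rintegral_set1 subrr.
  + by move=> t ht; exfalso; lra.
- by have [P HP] := C1_segment_action ab seg; exists [::], P.
pose P t := if t <= b then P1 t - P1 b else P2 t - P2 b.
have PE1 t : t <= b -> P t = P1 t - P1 b by rewrite /P => ->.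
have PE2 t : b <= t -> P t = P2 t - P2 b.
  move=> bt; rewrite /P; have [tb|//] := leP t b; have -> : t = b by apply/eqP; rewrite eq_le tb.
  by rewrite !subrr.
exists (b :: s1 ++ s2), P.
have int : mu.-integrable `[a, c] (EFin \o speed gamma) := integrable_cat (ltW ab) bc i1 i2.
split => //.
- apply: (within_cat (ltW ab) bc).
  + apply/within_nearP => s sab U; rewrite PE1; last by case/andP: sab.
    move=> Us; have cc : {within `[a, b], continuous (fun t => P1 t - P1 b)}.
      by move=> t; apply: cvgB; [exact: c1|exact: cvg_cst].
    have [e e0 H] := (within_nearP _ _ _).1 cc s sab U Us.
    by exists e => // r rab rs; rewrite PE1; [exact: H|case/andP: rab].
  + apply/within_nearP => s sab U; rewrite PE2; last by case/andP: sab.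
    move=> Us; have cc : {within `[b, c], continuous (fun t => P2 t - P2 b)}.
      by move=> t; apply: cvgB; [exact: c2|exact: cvg_cst].
    have [e e0 H] := (within_nearP _ _ _).1 cc s sab U Us.
    by exists e => // r rab rs; rewrite PE2; [exact: H|case/andP: rab].
- move=> t t' h1 h2 h3; have [tb|/ltW bt] := leP t' b.
    by rewrite !PE1 ?(le_trans h2 tb) // e1 //; ring.
  have [bt'|/ltW tb] := leP b t.
    by rewrite !PE2 // e2 //; ring.
  rewrite (PE1 t) // (PE2 t') //.
  suff -> : lag_action t t' gamma = lag_action t b gamma + lag_action b t' gamma by rewrite e1 // e2 //; ring.
  have it : mu.-integrable `[t, t'] (EFin \o speed gamma).
    apply: (@integrableS _ _ _ mu `[a, c] `[t, t'] _ (measurable_itv _) (measurable_itv _) _ int).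
    by apply: subset_itvScc; rewrite bnd_simp.
  have := @Rintegral_itvB _ (speed gamma) (BLeft t) (BRight t') b it.
  rewrite !bnd_simp => /(_ tb bt) E.
  have E2 : \int[mu]_(x in `]b, t']) speed gamma x = lag_action b t' gamma.
    rewrite -[RHS]/(\int[mu]_(x in `[b, t']) speed gamma x) -Rintegral_itv_obnd_cbnd //.
    apply: (@integrableS _ _ _ mu `[t, t'] `]b, t'] _ (measurable_itv _) (measurable_itv _) _ it).
    by apply: subset_itvr; rewrite bnd_simp.
  by rewrite -E2 -E /lag_action -/(speed gamma); ring.
- move=> t tac; rewrite inE mem_cat !negb_or => /and3P[tb ts1 ts2].
  have [tlt|tgt|te] := ltgtP t b; last by rewrite te eqxx in tb.
  + have [|cg H] := d1 t _ ts1; first by lra.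
    split => // c' ac' cdt; have [w h1 h2] := H c' ac' cdt; exists w => //.
    apply: (@is_derive_near _ _ (fun t => P1 t - P1 b)).
      by apply: filterS (lt_nbhsl tlt) => r /ltW /PE1.
    by have := is_deriveB h2 (is_derive_cst (P1 b) t 1); rewrite subr0.
  + have [|cg H] := d2 t _ ts2; first by lra.
    split => // c' ac' cdt; have [w h1 h2] := H c' ac' cdt; exists w => //.
    apply: (@is_derive_near _ _ (fun t => P2 t - P2 b)).
      by apply: filterS (lt_nbhsr tgt) => r /ltW /PE2.
    by have := is_deriveB h2 (is_derive_cst (P2 b) t 1); rewrite subr0.
Qed.

(** Two continuous functions with the same derivative off finitely many points have the same
    variation. Changes of representative and translations of time are therefore carried out on
    primitives rather than on integrals. *)
Lemma action_eq a b gamma (s : seq R) (Q : R -> R) : is_path a b gamma -> {within `[a, b], continuous Q} ->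
  (forall t, a < t < b -> t \notin s -> exists c, [/\ atlas c, cdom c (gamma t) &
     exists2 w, is_derive t (1 : R) (cmap c \o gamma) w & is_derive t (1 : R) Q (lag c (pt (cmap c (gamma t)) w t))]) ->
  lag_action a b gamma = Q b - Q a.
Proof.
move=> p cQ H; have ab := path_le p; have [s' [P [_ cP e dP]]] := path_action p.
rewrite e //; apply/eqP; rewrite eq_le.
have K t : a < t < b -> t \notin s ++ s' -> exists D, is_derive t (1 : R) P D /\ is_derive t (1 : R) Q D.
  move=> tab; rewrite mem_cat negb_or => /andP[ts ts'].
  have [c [ac cdt [w dw1 dw2]]] := H t tab ts; have [_ dP'] := dP t tab ts'.
  have [w' dw1' dw2'] := dP' c ac cdt.
  have E : w' = w by case: dw1 => _ <-; case: dw1' => _ <-.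
  by exists (lag c (pt (cmap c (gamma t)) w t)); rewrite {1}E in dw2'.
apply/andP; split; apply: (@le_derive_le _ (s ++ s')) => // t tab ts; have [D [d1 d2]] := K t tab ts; by exists D, D.
Qed.

Lemma lag_action_cat a b c gamma : is_path a c gamma -> a <= b -> b <= c ->
  lag_action a c gamma = lag_action a b gamma + lag_action b c gamma.
Proof.
move=> p ab bc; have [s' [P [_ cP e dP]]] := path_action p.
by rewrite !e //; [ring|exact: le_trans ab bc].
Qed.

Lemma lag_actionxx a gamma : lag_action a a gamma = 0.
Proof. by rewrite /lag_action set_itv1 Rintegral_set1. Qed.

Lemma lag_action_congr a b gamma eta : {in `[a, b], gamma =1 eta} -> is_path a b gamma ->
  lag_action a b gamma = lag_action a b eta.
Proof.
move=> E p; have ab := path_le p; have p' := path_eq E p; have [s' [P [_ cP e dP]]] := path_action p'.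
rewrite (e a b) //; apply: (@action_eq a b gamma s') => // t tab ts; have [ct H] := dP t tab ts.
have nE : \forall r \near t, gamma r = eta r by apply: filterS (near_itv tab) => r; exact: E.
have Et := nbhs_singleton nE.
exists (chart_at SM (eta t)); rewrite Et; split; [exact: chart_at_atlas|exact: chart_at_mem|].
have [w h1 h2] := H _ (chart_at_atlas SM (eta t)) (chart_at_mem SM (eta t)); exists w => //.
by apply: is_derive_near h1; apply: filterS nE => r /= ->.
Qed.

Lemma lag_action_glue a b c gamma eta : is_path a b gamma -> is_path b c eta -> gamma b = eta b ->
  lag_action a c (splice b gamma eta) = lag_action a b gamma + lag_action b c eta.
Proof.
move=> p1 p2 E; have p := path_glue p1 p2 E; have ab := path_le p1; have bc := path_le p2.
have -> : lag_action a b gamma = lag_action a b (splice b gamma eta).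
  by apply: lag_action_congr p1 => t ht; rewrite (glue_l _ _ ht).
have -> : lag_action b c eta = lag_action b c (splice b gamma eta).
  by apply: lag_action_congr p2 => t ht; rewrite (glue_r E ht).
exact: lag_action_cat.
Qed.

Lemma action_ge (C0 : R) a b gamma : (forall x v t, - C0 <= L x v t) -> is_path a b gamma ->
  - (C0 * (b - a)) <= lag_action a b gamma.
Proof.
move=> HL p; have ab := path_le p; have [s' [P [_ cP e dP]]] := path_action p.
rewrite e //; have -> : - (C0 * (b - a)) = - C0 * b - (- C0 * a) by ring.
apply: (@le_derive_le _ s') => //.
  by apply: continuous_subspaceT => t; apply: cvgM; [exact: cvg_cst|exact: cvg_id].
move=> t tab ts; have [ct H] := dP t tab ts.
have [w h1 h2] := H _ (chart_at_atlas SM (gamma t)) (chart_at_mem SM (gamma t)).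
exists (- C0), (lag (chart_at SM (gamma t)) (pt (cmap (chart_at SM (gamma t)) (gamma t)) w t)); split => //; first exact: is_derive_mull.
exact: HL.
Qed.

Lemma path_coord c a b gamma : atlas c -> is_path a b gamma -> (forall t, a <= t <= b -> cdom c (gamma t)) ->
  exists s P, coord_path (lag c) a b s (cmap c \o gamma) P /\
    forall t t', a <= t -> t <= t' -> t' <= b -> lag_action t t' gamma = P t' - P t.
Proof.
move=> ac p cd; have [s [P [_ cP e dP]]] := path_action p; exists s, P; split => //.
split => //.
  apply/within_nearP => t tab U Us.
  have /(within_nearP _ _ _).1 K := path_cont p.
  by have [e' e0 H] := K t tab (cmap c @^-1` U) (cmap_cont (cd t tab) Us); exists e'.
move=> t tab ts; have [ct H] := dP t tab ts; apply: H => //; apply: cd.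
by case/andP: tab => ? ?; rewrite !ltW.
Qed.

Lemma chart_path c J (q w : R -> V) a b : open J -> atlas c -> a <= b -> `[a, b] `<=` J ->
  (forall t, J t -> [/\ cimg c (q t), is_derive t (1 : R) q (w t) & {for t, continuous w}]) ->
  is_path a b (cinv c \o q) /\ exists P, [/\ {within `[a, b], continuous P},
    forall t, a < t < b -> is_derive t (1 : R) P (lag c (pt (q t) (w t) t)) &
    forall t t', a <= t -> t <= t' -> t' <= b -> lag_action t t' (cinv c \o q) = P t' - P t].
Proof.
move=> oJ ac ab sJ H.
have seg : C1_segment a b (cinv c \o q) by exists J, (cinv c \o q); split => //; exact: curve_C1_chart H.
split; first exact: path_C1.
move: ab; rewrite le_eqVlt => /predU1P[eab|ab].
  exists (fun=> 0); split; first exact: continuous_subspaceT (@cst_continuous _ _ _).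
    by move=> t; rewrite eab => /andP[h1 h2]; move: (lt_trans h1 h2); rewrite ltxx.
  move=> t t' h1 h2 h3; have -> : t' = t.
    by apply/eqP; rewrite eq_le h2 andbT (le_trans h3) // -eab.
  by rewrite lag_actionxx subrr.
have [P [_ cP e dP]] := C1_segment_action ab seg; exists P; split => // t tab.
have [ct Hc] := dP t tab isT.
have Jt : J t by apply: sJ; rewrite /= in_itv /=; case/andP: tab => ? ?; rewrite !ltW.
have [/cimgP[cx xq] dq' _] := H t Jt.
have [w' h1 h2] := Hc c ac cx.
have h3 : is_derive t (1 : R) q w'.
  have nJ : nbhs t J by exact: open_nbhs_nbhs.
  apply: is_derive_near h1; apply: filterS nJ => r Jr /=.
  by have [/cimgP[_ ->] _ _] := H r Jr.
have E : w' = w t by case: h3 => _ <-; case: dq' => _ <-.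
by rewrite /= xq E in h2.
Qed.

Hypothesis L_periodic : lagrangian_periodic L.

Lemma lag_int c q w t (k : int) : lag c (pt q w (t + k%:~R)) = lag c (pt q w t).
Proof.
have E s (n : nat) : lag c (pt q w (s + n%:R)) = lag c (pt q w s).
  elim: n => [|n IH]; first by rewrite addr0.
  by rewrite -natr1 addrA /lag /local_lagrangian /= L_periodic; exact: IH.
case: k => n; first exact: E.
rewrite -(E _ n.+1) NegzE mulrNz -pmulrn; congr (lag c (pt q w _)); ring.
Qed.

Lemma lag_action_shift (k : int) a b gamma : is_path (a + k%:~R) (b + k%:~R) gamma ->
  lag_action a b (fun t => gamma (t + k%:~R)) = lag_action (a + k%:~R) (b + k%:~R) gamma.
Proof.
move=> p; have p' := path_shift p; have ab := path_le p'.
have [s [P [_ cP e dP]]] := path_action p; rewrite (e (a + k%:~R)) //; last by rewrite lerD2r.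
apply: (@action_eq a b _ [seq t - k%:~R | t <- s] (fun t => P (t + k%:~R))) => //.
  apply/within_nearP => t tab U Us; have tab' : a + k%:~R <= t + k%:~R <= b + k%:~R by rewrite !lerD2r.
  have [e' e0 H] := (within_nearP _ _ _).1 cP _ tab' U Us; exists e' => // r rab rt.
  by apply: H; [rewrite !lerD2r|rewrite opprD addrACA subrr addr0].
move=> t tab ts; have ts' : t + k%:~R \notin s.
  apply: contraNN ts => h; apply/mapP; exists (t + k%:~R) => //; by rewrite addrK.
have tab' : a + k%:~R < t + k%:~R < b + k%:~R by rewrite !ltrD2r.
have [ct H] := dP _ tab' ts'; pose c := chart_at SM (gamma (t + k%:~R)).
exists c; split; [exact: chart_at_atlas|exact: chart_at_mem|].
have [w h1 h2] := H _ (chart_at_atlas SM _) (chart_at_mem SM (gamma (t + k%:~R))); exists w.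
  exact: (@is_derive_comp_shift _ _ (cmap c \o gamma) k%:~R t w h1).
by rewrite -(lag_int _ _ _ _ k); exact: is_derive_comp_shift h2.
Qed.

End Action.
End Paths.

(** * Uniform bounds on a compact manifold *)

Lemma compact_mono {R : realType} {T : topologicalType} (A : set T) (Q : R -> T -> Prop) : compact A ->
  (forall C C' y, C <= C' -> Q C y -> Q C' y) ->
  (forall x, A x -> exists C, \forall y \near x, Q C y) -> exists C, forall y, A y -> Q C y.
Proof.
move=> /compact_near_coveringP cA mono H.
have := cA _ (pinfty_nbhs R) (fun C y => Q C y) _ _.
case=> [x Ax|C [Cr HC]].
  have [C HC] := H x Ax.
  exists ([set y | Q C y], [set D | C <= D]) => /=; last by move=> [y D] /= [h1 h2]; exact: mono h2 h1.
  by split => //=; exists C; split; [rewrite num_real|move=> D /ltW].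
by exists (C + 1) => y Ay; apply: HC => //; rewrite ltrDl.
Qed.

Section Global.
Context {R : realType} {M : ptopologicalType} {d : nat}.
Variable SM : smooth_structure R M d.
Hypothesis M_compact : compact [set: M].
Notation V := 'rV[R]_d.
Notation chart := (chart R M d).
Notation atlas := (atlas SM).
Notation is_path := (is_path SM).

Lemma chart_ball (c : chart) q : cimg c q -> exists2 r : R, 0 < r & cball q r `<=` cimg c.
Proof.
move=> cq; have /nbhs_ballP[r r0 H] := near_cimg cq; exists (r / 2); first exact: divr_gt0.
move=> q' h; apply: H; rewrite -ball_normE /= distrC; apply: le_lt_trans h _.
by rewrite ltr_pdivrMr // mulr2n mulrDr mulr1 ltrDl.
Qed.

Lemma near_chart_ball (c : chart) x (e : R) : cdom c x -> 0 < e ->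
  \forall y \near x, cdom c y /\ `|cmap c y - cmap c x| < e.
Proof.
move=> cx e0; have n1 : \forall y \near x, cdom c y by apply: open_nbhs_nbhs; split => //; exact: cdom_open.
have n2 : \forall y \near x, `|cmap c x - cmap c y| < e by apply: cvgr_dist_lt => //; exact: cmap_cont.
apply: filterS2 n1 n2 => y cy h; split => //; by rewrite distrC.
Qed.

Lemma tangent_coord_surj (c : chart) y v : atlas c -> cdom c y -> exists w, v = tangent_coord SM c (cmap c y) w.
Proof.
move=> ac cy; pose c' := chart_at SM y.
have ac' : atlas c' := chart_at_atlas SM y.
have o' : overlap c' c (cmap c' y) by apply: overlap_cmap => //; exact: chart_at_mem.
have E := trans_inv v ac' ac o'.
exists ('d (trans c' c) (cmap c' y) v).
rewrite tangent_coordE (cmapK cy) -/c'.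
by rewrite (trans_cmap c (chart_at_mem SM y)) in E; rewrite E.
Qed.

(** * Growth of the Lagrangian and paths of bounded action *)

Section Metric.
Variable g : M -> V -> V -> R.
Hypothesis g_metric : is_riemannian_metric SM g.
Variable L : M -> V -> R -> R.
Hypothesis L_smooth : lagrangian_smooth SM L.
Hypothesis L_periodic : lagrangian_periodic L.
Hypothesis L_superlinear : lagrangian_superlinear g L.
Notation lag := (lag SM L).
Notation lag_action := (lag_action SM L).

Definition gram (c : chart) (q a b : V) := g (cinv c q) (tangent_coord SM c q a) (tangent_coord SM c q b).

Lemma gram_linl c q k u v w : gram c q (k *: u + v) w = k * gram c q u w + gram c q v w.
Proof.
have [h _ _ _] := g_metric; rewrite /gram -h; congr (g _ _ _).
by rewrite /tangent_coord linearP.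
Qed.

Lemma gramC c q v w : gram c q v w = gram c q w v.
Proof. by have [_ h _ _] := g_metric; rewrite /gram h. Qed.

Lemma gramZ c q k w : gram c q (k *: w) (k *: w) = k ^+ 2 * gram c q w w.
Proof.
have gram0 u : gram c q 0 u = 0.
  by have := gram_linl c q 1 0 0 u; rewrite scaler0 addr0 mul1r => h; lra.
have E u : gram c q (k *: w) u = k * gram c q w u.
  by have := gram_linl c q k w 0 u; rewrite addr0 gram0 addr0.
by rewrite E gramC E; ring.
Qed.

Lemma gram_sum c q (v : V) w : gram c q v w = \sum_i v 0 i * gram c q (unit_rV R i) w.
Proof.
have gram0 u : gram c q 0 u = 0.
  by have := gram_linl c q 1 0 0 u; rewrite scaler0 addr0 mul1r => h; lra.
rewrite {1}(row_unit v); elim: (index_enum _) => [|i s IH]; first by rewrite !big_nil.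
by rewrite !big_cons gram_linl IH.
Qed.

Lemma gram_cont c q w : atlas c -> cimg c q -> {for (q, w), continuous (fun z : V * V => gram c z.1 z.2 z.2)}.
Proof.
move=> ac cq.
have -> : (fun z : V * V => gram c z.1 z.2 z.2) =
  (fun z : V * V => \sum_i (z.2 0 i * \sum_j z.2 0 j * gram c z.1 (unit_rV R j) (unit_rV R i))).
  apply/funext => z; rewrite gram_sum; apply: eq_bigr => i _; congr (_ * _).
  by rewrite gramC gram_sum.
have cc i : {for (q, w), continuous (fun z : V * V => z.2 0 i)}.
  apply: (@continuous_comp _ _ _ (fun z : V * V => z.2) (fun v : V => v 0 i)); last exact: coord_continuous.
  exact: cvg_snd.
apply: continuous_sum => i; apply: cvgM; first exact: cc.
apply: continuous_sum => j; apply: cvgM; first exact: cc.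
apply: (@continuous_comp _ _ _ (fun z : V * V => z.1) (fun q => gram c q (unit_rV R j) (unit_rV R i))); first exact: cvg_fst.
have [_ _ _ h] := g_metric; exact: smooth_cont (h c ac _ _) cq.
Qed.

(** The metric is compared with the coordinate norm on unit vectors over a compact ball, through the
    boundedness of the inverse of [gram]; homogeneity does the rest. *)
Lemma gram_coercive c p r : atlas c -> cball p r `<=` cimg c ->
  exists2 k, 0 < k & forall q w, `|q - p| <= r -> k * `|w| <= tangent_norm g (cinv c q) (tangent_coord SM c q w).
Proof.
move=> ac bO.
pose S : set (V * V) := [set z | cball p r z.1 /\ (cball 0 1 z.2 /\ `|z.2| = 1)].
have cS : compact S.
  have -> : S = (cball p r `*` (cball 0 1 `&` [set w | `|w| = 1])) by apply/seteqP; split => z.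
  apply: compact_setX; first exact: cball_compact.
  apply: compact_closedI; first exact: cball_compact.
  have -> : [set w : V | `|w| = 1] = (fun w : V => `|w|) @^-1` [set 1] by [].
  by apply: closed_comp => [w _|]; [exact: norm_continuous|exact: closed_eq].
have pos z : S z -> 0 < gram c z.1 z.2 z.2.
  move=> [bz [_ nz]]; have [_ _ gp _] := g_metric; apply: gp.
  apply: contra_eq_neq nz => /(tangent_coord_inj ac (bO _ bz)) ->.
  by rewrite normr0 eq_sym oner_eq0.
have [C C0 HC] : exists2 C, 0 <= C & forall z, S z -> `|(gram c z.1 z.2 z.2)^-1| <= C.
  apply: bounded_on_compact => // -[q w] Sz; apply: cvgV; first by rewrite gt_eqF // pos.
  by apply: gram_cont => //; apply: bO; case: Sz.
pose k := Num.sqrt (C + 1)^-1.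
have k0 : 0 < k by rewrite sqrtr_gt0 invr_gt0; lra.
exists k => // q w hq; have [->|w0] := eqVneq w 0.
  by rewrite normr0 mulr0 /tangent_norm sqrtr_ge0.
have nw : 0 < `|w| by rewrite normr_gt0.
pose v := `|w|^-1 *: w.
have Sv : S (q, v).
  have nv : `|v| = 1 by rewrite normrZ normfV normr_id mulVf // gt_eqF.
  by split => //; split => //; rewrite /cball /= subr0 nv.
have E : gram c q w w = `|w| ^+ 2 * gram c q v v.
  by rewrite -gramZ /v scalerA mulfV ?scale1r // gt_eqF.
have h1 : (C + 1)^-1 <= gram c q v v.
  have := HC _ Sv; have := pos _ Sv; rewrite /= => h0 h.
  rewrite -[leRHS]invrK lef_pV2 ?posrE ?invr_gt0 //; last lra.
  by apply: le_trans (ler_norm _) _; lra.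
rewrite /tangent_norm -[g _ _ _]/(gram c q w w) E -[X in _ * X](ger0_norm (normr_ge0 w)) -sqrtr_sqr mulrC -sqrtrM ?sqr_ge0 //.
by apply: ler_wsqrtr; apply: ler_wpM2l => //; exact: sqr_ge0.
Qed.

Lemma superlinear_box c p r K : atlas c -> cball p r `<=` cimg c -> 0 <= K ->
  exists2 C, 0 <= C & forall q w t, `|q - p| <= r -> K * `|w| - C <= lag c (pt q w t).
Proof.
move=> ac bO K0; have [k k0 Hk] := gram_coercive ac bO.
(* A slope [K / k] with respect to the Riemannian norm is a slope [K] with respect to the coordinate
   norm. Vectors of norm at most [C2] are covered by compactness. *)
have [C1 HC1] := L_superlinear (K / k).
pose C2 := Num.max C1 0.
have [B B0 HB] := zone_bound (C2 / k) bO (lag_periodic SM L_periodic c)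
  (fun z Uz => smooth_cont (lag_smooth L_smooth ac) Uz).
have C20 : 0 <= C2 by rewrite le_max lexx orbT.
exists (K * (C2 / k) + B); first by rewrite addr_ge0 // mulr_ge0 // divr_ge0 // ltW.
move=> q w t hq; have hk := Hk q w hq.
set N := tangent_norm _ _ _ in hk.
have [NC|CN] := leP N C2.
  have wk : `|w| <= C2 / k by rewrite ler_pdivlMr // mulrC; exact: le_trans hk NC.
  have := HB (pt q w t) (conj hq wk); rewrite ler_norml => /andP[h _].
  have : K * `|w| <= K * (C2 / k) by exact: ler_wpM2l.
  by move: h; lra.
have N0 : 0 < N := le_lt_trans C20 CN.
have := HC1 (cinv c q) (tangent_coord SM c q w) t; rewrite -/N => /(_ _).
rewrite -[L _ _ _]/(lag c (pt q w t)) ltr_pdivlMr // => h.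
have {}h : K / k * N < lag c (pt q w t) by apply: h; apply: le_lt_trans CN; rewrite le_max lexx.
have h2 : K * `|w| <= K / k * N.
  by rewrite -mulrA ler_wpM2l // ler_pdivlMl.
have : 0 <= K * (C2 / k) by rewrite mulr_ge0 // divr_ge0 // ltW.
by move: h h2; lra.
Qed.

Lemma lagrangian_lower_bound : exists2 C0, 0 <= C0 & forall x v t, - C0 <= L x v t.
Proof.
have [C HC] : exists C, forall x, [set: M] x -> forall v t, - C <= L x v t.
  apply: compact_mono => //.
    by move=> C C' y CC h v t; apply: le_trans (h v t); rewrite lerN2.
  move=> x _; pose c := chart_at SM x; have ac : atlas c := chart_at_atlas SM x.
  have cx : cdom c x := chart_at_mem SM x.
  have [r r0 bO] := chart_ball (cimg_cmap cx).
  have [C _ HC] := superlinear_box ac bO (lexx 0); exists C.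
  apply: filterS (near_chart_ball cx r0) => y [cy hy] v t.
  have [w ->] := tangent_coord_surj v ac cy.
  have := HC (cmap c y) w t (ltW hy); rewrite mul0r add0r.
  by rewrite /lag /local_lagrangian /= (cmapK cy).
exists (Num.max C 0); first by rewrite le_max lexx orbT.
by move=> x v t; apply: le_trans (HC x I v t); rewrite lerN2 le_max lexx.
Qed.

Lemma straight_path c p r k : atlas c -> cball p r `<=` cimg c -> 0 < r -> 0 <= k ->
  exists2 B, 0 <= B & forall a b x y, a < b -> `|x - p| <= r / 2 -> `|y - p| <= r / 2 -> `|y - x| <= k * (b - a) ->
  exists gamma, [/\ is_path a b gamma, gamma a = cinv c x, gamma b = cinv c y & lag_action a b gamma <= B * (b - a)].
Proof.
move=> ac bO r0 k0.
have [B B0 HB] := zone_bound k bO (lag_periodic SM L_periodic c)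
  (fun z Uz => smooth_cont (lag_smooth L_smooth ac) Uz).
exists B => // a b x y ab hx hy hxy.
have ba : 0 < b - a by rewrite subr_gt0.
pose v := (b - a)^-1 *: (y - x).
have nv : `|v| <= k by rewrite normrZ gtr0_norm ?invr_gt0 // ler_pdivrMl // mulrC.
pose q (t : R) := x + (t - a) *: v.
have dq t : is_derive t (1 : R) q v.
  have h : is_derive t (1 : R) (fun s : R => (s - a) *: v) v.
    have := @is_derive_comp_shift R _ (fun s : R => s *: v) (- a) t v (is_derive_scalel v (t - a)).
    by [].
  by have := is_deriveD (is_derive_cst x t 1) h; rewrite add0r.
have cq : continuous q by move=> t; exact: is_derive_continuous (dq t).
have qa : q a = x by rewrite /q subrr scale0r addr0.
have qb : q b = y by rewrite /q /v scalerA divff ?gt_eqF // scale1r addrC subrK.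
have qz t : a <= t <= b -> `|q t - p| <= r / 2.
  move=> /andP[h1 h2]; pose s := (t - a) / (b - a).
  have s01 : 0 <= s <= 1 by rewrite /s ler_pdivrMr // mul1r lerD2r h2 andbT divr_ge0 ?subr_ge0 // ltW.
  have -> : q t - p = (1 - s) *: (x - p) + s *: (y - p).
    rewrite /q /v scalerA -/s; move: (s) => s'; clear.
    by apply/rowP => i; rewrite !mxE; ring.
  clearbody s; move/andP: s01 => [s0 s1]; have s1' : 0 <= 1 - s by rewrite subr_ge0.
  apply: le_trans (ler_normD _ _) _; rewrite !normrZ (ger0_norm s0) (ger0_norm s1').
  have : (1 - s) * `|x - p| <= (1 - s) * (r / 2) by exact: ler_wpM2l.
  have : s * `|y - p| <= s * (r / 2) by exact: ler_wpM2l.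
  by lra.
pose J : set R := q @^-1` (cimg c).
have oJ : open J by apply: open_comp => [t _|]; [exact: cq|exact: (@cimg_open R M d c)].
have sJ : `[a, b] `<=` J.
  move=> t /=; rewrite in_itv /= => /qz h; apply: bO; apply: le_trans h _; lra.
have [t Jt|pth [P [cP dP eP]]] := @chart_path _ _ _ SM L L_smooth c J q (fun=> v) a b oJ ac (ltW ab) sJ.
  by split; [exact: Jt|exact: dq|exact: cst_continuous].
exists (cinv c \o q); split => //=; rewrite ?qa ?qb // eP ?(ltW ab) //.
have -> : B * (b - a) = B * b - B * a by ring.
apply: (@le_derive_le _ [::] P (fun t => B * t)) => //; first exact: ltW.
  by apply: continuous_subspaceT => t; apply: cvgM; [exact: cvg_cst|exact: cvg_id].
move=> t tab _; exists (lag c (pt (q t) v t)), B; split; [exact: dP|exact: is_derive_mull|].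
apply: le_trans (ler_norm _) _; apply: HB; split => //=.
by apply: le_trans (qz t _) _; [case/andP: tab => ? ?; rewrite !ltW|lra].
Qed.

(** Uniformity over neighbouring end points and over all starting times prepares the compactness
    argument of [uniform_link]. Quantifying over every duration makes the relation transitive, by
    halving the time, and so allows connectedness of [M] to be used. *)
Definition linked (x y : M) := forall l : R, 0 < l -> exists C, \forall x' \near x & y' \near y,
  forall a, exists gamma, [/\ is_path a (a + l) gamma, gamma a = x', gamma (a + l) = y' & lag_action a (a + l) gamma <= C].

Lemma linked_refl x : linked x x.
Proof.
move=> l l0; pose c := chart_at SM x; have ac : atlas c := chart_at_atlas SM x.
have cx : cdom c x := chart_at_mem SM x.
have [r r0 bO] := chart_ball (cimg_cmap cx).
have [|B B0 HB] := @straight_path c (cmap c x) r (r / l) ac bO r0; first by rewrite divr_ge0 ?ltW.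
exists (B * l); have r2 : 0 < r / 2 by exact: divr_gt0.
have N := near_chart_ball cx r2.
near=> x' y'.
have [cx' hx'] : cdom c x' /\ `|cmap c x' - cmap c x| < r / 2 by near: x'.
have [cy' hy'] : cdom c y' /\ `|cmap c y' - cmap c x| < r / 2 by near: y'.
move=> a; have [||||gamma [h1 h2 h3 h4]] := HB a (a + l) (cmap c x') (cmap c y').
- by rewrite ltrDl.
- exact: ltW.
- exact: ltW.
- rewrite addrAC subrr add0r divfK ?gt_eqF //.
  by rewrite -(subrKA (cmap c x)); apply: le_trans (ler_normD _ _) _; rewrite [X in _ + X]distrC; lra.
exists gamma; split => //; rewrite ?h2 ?h3 ?cmapK //.
by apply: le_trans h4 _; rewrite addrAC subrr add0r.
Unshelve. all: by end_near. Qed.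

Lemma linked_trans x y z : linked x y -> linked y z -> linked x z.
Proof.
move=> H1 H2 l l0; have l2 : 0 < l / 2 by exact: divr_gt0.
have hl (u : R) : [/\ u + l / 2 + l / 2 = u + l, u <= u + l / 2 & u + l / 2 < u + l] by split; lra.
have [C1 K1] := H1 _ l2; have [C2 K2] := H2 _ l2; exists (C1 + C2).
move: K1 => [[A1 A2] /= [n1 n2] K1]; move: K2 => [[A3 A4] /= [n3 n4] K2].
exists (A1, A4) => //= -[x' z'] /= [A1x A4z] a.
have [g1 [p1 a1 b1 e1]] := K1 (x', y) (conj A1x (nbhs_singleton n2)) a.
have [g2 [p2 a2 b2 e2]] := K2 (y, z') (conj (nbhs_singleton n3) A4z) (a + l / 2).
have [E al2 l2l] := hl a.
rewrite /= in a1 b1 a2 b2; rewrite E in p2 b2 e2.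
have gE : g1 (a + l / 2) = g2 (a + l / 2) by rewrite b1 a2.
exists (splice (a + l / 2) g1 g2); split.
- exact: path_glue p1 p2 gE.
- by rewrite /splice al2.
- by rewrite /splice leNgt l2l.
- by rewrite (lag_action_glue L_smooth p1 p2 gE) lerD.
Qed.

Lemma linked_near x : \forall y \near x, linked x y /\ linked y x.
Proof.
pose c := chart_at SM x; have cx : cdom c x := chart_at_mem SM x.
have ac : atlas c := chart_at_atlas SM x.
have [r r0 bO] := chart_ball (cimg_cmap cx).
have r2 : 0 < r / 2 by exact: divr_gt0.
suff G x1 y1 : cdom c x1 /\ `|cmap c x1 - cmap c x| < r / 2 -> cdom c y1 /\ `|cmap c y1 - cmap c x| < r / 2 -> linked x1 y1.
  apply: filterS (near_chart_ball cx r2) => y hy; split; apply: G => //; split => //; by rewrite subrr normr0.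
move=> [cx1 hx1] [cy1 hy1] l l0.
have [|B B0 HB] := @straight_path c (cmap c x) r (r / l) ac bO r0; first by rewrite divr_ge0 ?ltW.
exists (B * l).
have nb z : cdom c z -> `|cmap c z - cmap c x| < r / 2 -> \forall z' \near z, cdom c z' /\ `|cmap c z' - cmap c x| < r / 2.
  move=> cz hz; have e0 : 0 < r / 2 - `|cmap c z - cmap c x| by rewrite subr_gt0.
  apply: filterS (near_chart_ball cz e0) => z' [cz' hz']; split => //.
  rewrite -(subrKA (cmap c z)); apply: le_lt_trans (ler_normD _ _) _; move: hz'; lra.
have N1 := nb _ cx1 hx1; have N2 := nb _ cy1 hy1.
near=> x' y'.
have [cx' hx'] : cdom c x' /\ `|cmap c x' - cmap c x| < r / 2 by near: x'.
have [cy' hy'] : cdom c y' /\ `|cmap c y' - cmap c x| < r / 2 by near: y'.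
move=> a; have [||||gamma [h1 h2 h3 h4]] := HB a (a + l) (cmap c x') (cmap c y').
- by rewrite ltrDl.
- exact: ltW.
- exact: ltW.
- rewrite addrAC subrr add0r divfK ?gt_eqF //.
  by rewrite -(subrKA (cmap c x)); apply: le_trans (ler_normD _ _) _; rewrite [X in _ + X]distrC; lra.
exists gamma; split => //; rewrite ?h2 ?h3 ?cmapK //.
by apply: le_trans h4 _; rewrite addrAC subrr add0r.
Unshelve. all: by end_near. Qed.

Hypothesis M_connected : connected [set: M].

Lemma all_linked x y : linked x y.
Proof.
suff : [set y | linked x y] = setT by move=> E; have : setT y by []; rewrite -E.
apply: M_connected.
- by exists x; exact: linked_refl.
- exists [set y | linked x y]; last by rewrite setTI.
  rewrite openE => z xz; apply: filterS (linked_near z) => z' [h _]; exact: linked_trans xz h.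
- exists [set y | linked x y]; last by rewrite setTI.
  move=> z /(_ _ (linked_near z)) [z' [h [_ h2]]]; exact: linked_trans h h2.
Qed.

Lemma uniform_link (l : R) : 0 < l -> exists C, forall a x y, exists gamma,
  [/\ is_path a (a + l) gamma, gamma a = x, gamma (a + l) = y & lag_action a (a + l) gamma <= C].
Proof.
move=> l0; have [C HC] : exists C, forall z : M * M, [set: M * M] z -> forall a, exists gamma,
  [/\ is_path a (a + l) gamma, gamma a = z.1, gamma (a + l) = z.2 & lag_action a (a + l) gamma <= C].
  apply: compact_mono.
  - by have := compact_setX M_compact M_compact; rewrite setXTT.
  - by move=> C C' z CC H a; have [gamma [h1 h2 h3 h4]] := H a; exists gamma; split => //; exact: le_trans h4 CC.
  - by move=> [x y] _; exact: all_linked l0.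
by exists C => a x y; exact: (HC (x, y)).
Qed.

End Metric.
End Global.

Lemma half_add {R : realType} (A B m e : R) : A < m -> B < m -> m <= e / 2 -> A + B <= e.
Proof. by lra. Qed.

Lemma half_le {R : realType} (x : R) : 0 < x -> x / 2 <= x.
Proof. by lra. Qed.

Lemma half_lt {R : realType} (x y : R) : x <= y / 2 -> 0 < y -> x < y.
Proof. by lra. Qed.

Lemma dist_itv {R : realType} (t e f x : R) : t - e <= x <= t + e -> e < f -> `|x - t| < f.
Proof. by rewrite ltr_norml => /andP[? ?] ?; lra. Qed.

Lemma itv_dist {R : realType} (t e x : R) : `|x - t| < e -> t - e <= x <= t + e.
Proof. by rewrite ltr_norml => /andP[? ?]; lra. Qed.

Lemma twice_quarter {R : realType} (C e t : R) : C * e <= 4^-1 -> C * (t + e - (t - e)) <= 2^-1.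
Proof. by move=> h; rewrite (_ : C * (t + e - (t - e)) = 2 * (C * e)); [lra|ring]. Qed.

Lemma minmax_itv {R : realType} (a b x s t : R) : Num.min s t <= x <= Num.max s t -> a < s < b -> a < t < b -> a < x < b.
Proof. by move=> /andP[]; rewrite ge_min le_max => /orP h1 /orP h2 ? ?; lra. Qed.

Lemma itv_sub {R : realType} (a b c d x : R) : a <= c -> d <= b -> c < x < d -> a < x < b.
Proof. by move=> ? ? ?; lra. Qed.

Lemma between_l {R : realType} (a b e s t u : R) : (a < s) || (t - e < s) -> (s < b) || (s < t + e) ->
  ~~ (`|s - t| < e) -> ~~ (a < s < b) -> a < u < b -> t <= u -> t <= s <= u.
Proof.
rewrite ltr_norml !negb_and -!leNgt => /orP h1 /orP h2 /orP h3 /orP h4 h5 h6.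
case: h3 => h3; case: h4 => h4; case: h1 => h1; case: h2 => h2; lra.
Qed.

Lemma between_r {R : realType} (a b e s t u : R) : (a < s) || (t - e < s) -> (s < b) || (s < t + e) ->
  ~~ (`|s - t| < e) -> ~~ (a < s < b) -> a < u < b -> u < t -> u <= s <= t.
Proof.
rewrite ltr_norml !negb_and -!leNgt => /orP h1 /orP h2 /orP h3 /orP h4 h5 h6.
case: h3 => h3; case: h4 => h4; case: h1 => h1; case: h2 => h2; lra.
Qed.

(** * Extremals on the manifold *)

Section Extremals.
Context {R : realType} {M : ptopologicalType} {d : nat}.
Variable SM : smooth_structure R M d.
Notation V := 'rV[R]_d.
Notation chart := (chart R M d).
Notation atlas := (atlas SM).
Notation is_path := (is_path SM).
Variable L : M -> V -> R -> R.
Hypothesis L_smooth : lagrangian_smooth SM L.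
Hypothesis L_periodic : lagrangian_periodic L.
Hypothesis L_posdef : lagrangian_posdef L.
Notation lag := (lag SM L).
Notation lag_action := (lag_action SM L).
Notation EL_solution := (EL_solution SM L).
Notation solves c := (solves_at (lag c) (cimg c)).

Let oimg (c : chart) : open (cimg c) := @cimg_open R M d c.
Let fs c (ac : atlas c) := lag_smooth L_smooth ac.
Let fper c := lag_periodic SM L_periodic c.
Let fpd c (ac : atlas c) := fun z a => @lag_posdef R M d SM L L_posdef c z a ac.

Lemma solves_path c (q w : R -> V) a b e : atlas c -> a <= b -> 0 < e ->
  (forall t : R, a - e < t < b + e -> solves c q w t) ->
  is_path a b (cinv c \o q) /\ exists P, [/\ {within `[a, b], continuous P},
    forall t, a < t < b -> is_derive t (1 : R) P (lag c (pt (q t) (w t) t)) &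
    forall t t', a <= t -> t <= t' -> t' <= b -> lag_action t t' (cinv c \o q) = P t' - P t].
Proof.
move=> ac ab e0 H.
have sJ : `[a, b] `<=` `]a - e, b + e[.
  by apply: subset_itvSoo; rewrite bnd_simp ?ltrDl // ltrBlDr ltrDl.
apply: (@chart_path _ _ _ SM L L_smooth c `]a - e, b + e[%classic q w a b _ ac ab sJ); first exact: interval_open.
move=> t; rewrite /= in_itv /= => /H[h1 h2 h3].
by split => //; exact: is_derive_continuous h3.
Qed.

(** Competitors are paths of the manifold staying in the chart, so two solutions written in
    different charts can be compared by their actions. *)
Lemma solution_strict c p r K : atlas c -> cball p r `<=` cimg c -> exists eps h C, [/\ 0 < eps, 0 < h, 0 <= C &
  forall a b e (E w : R -> V) gamma, a <= b -> b - a <= h -> 0 < e ->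
    (forall t, a - e < t < b + e -> solves c E w t) ->
    (forall t, a <= t <= b -> zone p r K (pt (E t) (w t) t)) -> is_path a b gamma ->
    (forall t, a <= t <= b -> [/\ cdom c (gamma t), `|cmap c (gamma t) - p| <= r & `|cmap c (gamma t) - E t| <= eps]) ->
    forall t, a <= t <= b ->
      lag_action a b (cinv c \o E) + (`|cmap c (gamma t) - E t| ^+ 2 / 4
        - C * (`|cmap c (gamma a) - E a| + `|cmap c (gamma b) - E b|)) <= lag_action a b gamma].
Proof.
move=> ac bO; have [eps [h [C [e0 h0 C0 H]]]] := strict_minimality (@oimg c) (fs ac) (@fper c) (fpd ac) bO K.
exists eps, h, C; split => // a b e E w gamma ab bah e00 sE zE pg tube t tab.
have [_ [PE [cPE dPE aPE]]] := solves_path ac ab e00 sE.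
have cg s : a <= s <= b -> cdom c (gamma s) by move=> /tube[].
have [s [P [cP aP]]] := path_coord L_smooth ac pg cg.
rewrite (aPE a b) // (aP a b) //.
apply: (H a b E w PE s (cmap c \o gamma) P) => //.
  move=> s' sab; split; last exact: zE.
  by apply: sE; case/andP: sab => h1 h2; rewrite ltrBlDr (le_lt_trans h1) ?ltrDl // (le_lt_trans h2) // ltrDl.
by move=> s' /tube[_ h1 h2].
Qed.

Lemma near_interval (W : normedModType R) (t : W) (P : W -> Prop) : (\forall s \near t, P s) ->
  exists2 e : R, 0 < e & forall s, `|s - t| < e -> P s.
Proof.
move=> /nbhs_ballP[e e0 H]; exists e => // s hs; apply: H.
by rewrite -ball_normE /ball_ /= distrC.
Qed.

Lemma solves_near c (q q' w : R -> V) t : (\forall s \near t, q s = q' s) -> solves c q w t -> solves c q' w t.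
Proof.
move=> E [h1 h2 h3]; have Et := nbhs_singleton E; split; [by rewrite -Et|exact: is_derive_near h2|].
by rewrite -Et.
Qed.

Lemma is_derive_trans c c' (q : R -> V) s w : atlas c -> atlas c' -> overlap c c' (q s) ->
  is_derive s (1 : R) q w -> is_derive s (1 : R) (trans c c' \o q) ('d (trans c c') (q s) w).
Proof.
move=> ac ac' o [dq dqE].
have hq : differentiable q s := (derivable1_diffP _ _).1 dq.
have hT := trans_diff ac ac' o.
have hd : differentiable (trans c c' \o q) s := differentiable_comp hq hT.
split; first exact: (derivable1_diffP _ _).2 hd.
rewrite (deriveE _ hd) (diff_comp hq hT) /=; congr ('d _ _ _).
by rewrite -(deriveE _ hq).
Qed.

(** On a short interval around [t], let [E] be the solution in [c'] with the same end points as
    [q']. The curve of [q] minimizes when compared in [c], and [E] minimizes strictly when compared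
    in [c']. The two inequalities between the same two actions force [E = q']. *)
Lemma solves_change c c' (q w : R -> V) t : atlas c -> atlas c' -> overlap c c' (q t) ->
  (\forall s \near t, solves c q w s) -> exists w', \forall s \near t, solves c' (trans c c' \o q) w' s.
Proof.
move=> ac ac' ov ns.
pose p := q t; pose p' := trans c c' p; pose q' := trans c c' \o q.
have [ov' tp] := overlap_sym ov.
have [r r0 bO] := chart_ball ov.1; have [r' r0' bO'] := chart_ball ov'.1.
have [_ dq dw'] := nbhs_singleton ns.
have cq : {for t, continuous q} := is_derive_continuous dq.
have cw : {for t, continuous w} := is_derive_continuous dw'.
pose v s := 'd (trans c c') (q s) (w s).
pose K := `|w t| + 1; pose k := `|v t| + 1.
have k1 : 1 <= k by rewrite lerDr.
have [h1 h10 BVP] := bvp (@oimg c') (fs ac') (@fper c') (fpd ac') bO' r0' k1.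
have [eps [h2 [C [eps0 h20 C0 SM1]]]] := solution_strict K ac bO.
have [eps' [h3 [C' [eps0' h30 C0' SM2]]]] := solution_strict (2 * k + 2) ac' bO'.
have cT : {for p, continuous (trans c c')} by exact: smooth_cont (trans_smooth ac ac') ov.
have cT' : {for p', continuous (trans c' c)} by exact: smooth_cont (trans_smooth ac' ac) ov'.
have cq' : {for t, continuous q'} by exact: (@continuous_comp _ _ _ q (trans c c')).
have cv : {for t, continuous v}.
  apply: (@continuous_comp _ _ _ (fun t => (q t, w t)) (fun z : V * V => 'd (trans c c') (z.1 : V) (z.2 : V))).
    exact: cvg_pair cq cw.
  have H2 := @trans_derive_cont R M d SM c c' (q t) ac ac' ov (w t); exact: H2.
pose m := Num.min r (eps / 2).
have m0 : 0 < m by rewrite lt_min r0 divr_gt0.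
have [rho rho0 Hrho] : exists2 rho, 0 < rho & forall y, `|y - p'| < rho -> overlap c' c y /\ `|trans c' c y - p| < m.
  have n1 := near_overlap ov'.
  have n2 : \forall y \near p', `|trans c' c y - p| < m.
    have : \forall y \near p', `|trans c' c p' - trans c' c y| < m.
      by have /cvgrPdist_lt K1 : trans c' c y @[y --> p'] --> trans c' c p' := cT'; exact: K1.
    by rewrite tp; apply: filterS => y; rewrite distrC.
  by apply: near_interval; apply: filterS2 n1 n2 => y.
pose m' := Num.min (r' / 2) (Num.min rho (eps' / 2)).
have m0' : 0 < m' by rewrite !lt_min rho0 !divr_gt0.
have nall : \forall s \near t, [/\ solves c q w s, `|q s - p| < m, `|w s| < K, overlap c c' (q s) & `|v s| < k /\ `|q' s - p'| < m'].
  near=> s; split.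
  - by near: s.
  - by rewrite distrC; near: s; apply: cvgr_dist_lt; [exact: cq|].
  - have : `|w t - w s| < 1 by near: s; apply: cvgr_dist_lt; [exact: cw|].
    by rewrite /K; have := ler_normD (w s - w t) (w t); rewrite subrK distrC; move: (`|w s|) (`|w t|) (`|w t - w s|) => A B D; lra.
  - near: s; apply: cq; exact: near_overlap.
  - split.
      have : `|v t - v s| < 1 by near: s; apply: cvgr_dist_lt; [exact: cv|].
      by rewrite /k; have := ler_normD (v s - v t) (v t); rewrite subrK distrC; move: (`|v s|) (`|v t|) (`|v t - v s|) => A B D; lra.
    by rewrite distrC; near: s; apply: cvgr_dist_lt; [exact: cq'|].
have [del del0 Hd] := near_interval nall.
(* Half the length of the comparison interval: below the thresholds for shooting and for both
   minimality statements, and so short that [E] remains within [m'] of [p']. *)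
pose th := Num.min (Num.min (del / 4) (h1 / 2)) (Num.min (Num.min (h2 / 2) (h3 / 2)) (m' / 4 / (2 * k + 2))).
have k2 : 0 < 2 * k + 2 by move: k1; move: (k) => k'; lra.
have th0 : 0 < th by rewrite !lt_min !divr_gt0.
have [hd hh1 hh2 hh3 hm] : [/\ th <= del / 4, th <= h1 / 2, th <= h2 / 2, th <= h3 / 2 & th <= m' / 4 / (2 * k + 2)].
  by rewrite /th !ge_min !lexx !orbT.
have {}hm : (2 * k + 2) * th <= m' / 4 by rewrite mulrC -ler_pdivlMr.
pose a := t - th; pose b := t + th.
have ba : b - a = 2 * th by rewrite /a /b; clear; lra.
have ab : a < b by rewrite -subr_gt0 ba mulr_gt0.
have inI s : a - th < s < b + th -> `|s - t| < del.
  rewrite /a /b ltr_norml => /andP[u1 u2]; clear -u1 u2 hd del0; lra.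
have inI' s : a <= s <= b -> `|s - t| < del.
  by move=> /andP[u1 u2]; apply: inI; clear -u1 u2 th0; lra.
have sq s : a - th < s < b + th -> solves c q w s by move=> /inI/Hd[].
have dq' s : a <= s <= b -> is_derive s (1 : R) q' (v s).
  by move=> /inI'/Hd[[_ u2 _] _ _ o _]; exact: is_derive_trans u2.
have dlip : `|q' b - q' a| <= k * (b - a).
  apply: (@mean_value_le _ _ q' v) => //; [exact: ltW|lra|move=> s /inI'/Hd[_ _ _ _ [u _]]; exact: ltW].
have ain : a <= a <= b by rewrite lexx ltW.
have bin : a <= b <= b by rewrite lexx ltW.
have tin : a <= t <= b by rewrite /a /b; clear -th0; lra.
have hqa : `|q' a - p'| <= r' / 2.
  by have [_ _ _ _ [_ u]] := Hd _ (inI' _ ain); apply: ltW; apply: lt_le_trans u _; rewrite ge_min lexx.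
have bah : b - a <= h1 by rewrite ba; clear -hh1; lra.
have [E [wE [Ea Eb HE]]] := BVP a b (q' a) (q' b) ab bah hqa dlip.
have HEin s : a <= s <= b -> a - h1 < s < b + h1 by move=> /andP[u1 u2]; clear -u1 u2 h10; lra.
have Ep s : a <= s <= b -> `|E s - p'| < m'.
  move=> sab; have [u1 u2] := andP sab.
  have e1 : `|E s - E a| <= (2 * k + 2) * `|s - a|.
    apply: (@mean_value_abs _ _ E wE a b) => //; [exact: ltW| |].
      by move=> x /HEin/HE[[]].
    by move=> x /HEin/HE[_ []].
  have e2 : `|q' a - p'| <= k * th.
    have -> : p' = q' t by [].
    have -> : k * th = k * `|a - t| by rewrite /a addrAC subrr add0r normrN gtr0_norm.
    apply: (@mean_value_abs _ _ q' v a b) => //; first lra.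
    by move=> x /inI'/Hd[_ _ _ _ [u _]]; exact: ltW.
  have e3 : `|s - a| <= 2 * th by rewrite ger0_norm ?subr_ge0 // -ba lerB.
  have e4 : (2 * k + 2) * `|s - a| <= (2 * k + 2) * (2 * th) by rewrite ler_wpM2l // ltW.
  rewrite -(subrKA (E a)); apply: le_lt_trans (ler_normD _ _) _; rewrite [in X in _ + X]Ea.
  have e5 : k * th <= (2 * k + 2) * th - th by clear -k1 th0; nra.
  move: e1 e2 e4 hm; move: (`|E s - E a|) (`|q' a - p'|) ((2 * k + 2) * `|s - a|) => A B D.
  have -> : (2 * k + 2) * (2 * th) = 2 * ((2 * k + 2) * th) by ring.
  by move: ((2 * k + 2) * th) e5 => F; clear -th0 m0'; lra.
have mle : [/\ m' <= r' / 2, m' <= rho, m' <= eps' / 2, m <= r & m <= eps / 2].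
  by rewrite /m' /m !ge_min !lexx !orbT.
case: mle => ml1 ml2 ml3 ml4 ml5.
have sE s : a - h1 < s < b + h1 -> solves c' E wE s by move=> /HE[].
have [pg _] := solves_path ac (ltW ab) th0 sq.
have [pe _] := solves_path ac' (ltW ab) h10 sE.
have cg s : a <= s <= b -> cdom c' (cinv c (q s)) /\ cmap c' (cinv c (q s)) = q' s.
  by move=> /inI'/Hd[_ _ _ [_ u] _]; split.
have ce s : a <= s <= b -> cdom c (cinv c' (E s)) /\ cmap c (cinv c' (E s)) = trans c' c (E s).
  by move=> sab; have [[_ u] _] := Hrho _ (lt_le_trans (Ep s sab) ml2).
have teq s : a <= s <= b -> E s = q' s -> trans c' c (E s) = q s.
  by move=> /inI'/Hd[_ _ _ o _] ->; have [_ ->] := overlap_sym o.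
have bah2 : b - a <= h2 by rewrite ba; clear -hh2; lra.
have bah3 : b - a <= h3 by rewrite ba; clear -hh3; lra.
(* Minimality of [q] in [c], with the gain dropped. Next, [I2] is that of [E] in [c'], with the gain
   kept; together they make the gain vanish. *)
have I1 : lag_action a b (cinv c \o q) <= lag_action a b (cinv c' \o E).
  have := SM1 a b th q w (cinv c' \o E) (ltW ab) bah2 th0 sq _ pe _ t tin.
  rewrite /= (ce a ain).2 (ce b bin).2 (teq a ain Ea) (teq b bin Eb) !subrr normr0 addr0 mulr0 subr0.
  have n0 : 0 <= `|cmap c (cinv c' (E t)) - q t| ^+ 2 / 4 by rewrite divr_ge0 // sqr_ge0.
  move=> H; apply: le_trans (H _ _); first by rewrite lerDl.
    by move=> s /inI'/Hd[_ u1 u2 _ _]; split; [exact: ltW (lt_le_trans u1 ml4)|exact: ltW].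
  move=> s sab; have [ce1 ce2] := ce s sab; rewrite ce2.
  have [_ u1] := Hrho _ (lt_le_trans (Ep s sab) ml2); have [_ u2 _ _ _] := Hd _ (inI' s sab).
  split => //; first exact: ltW (lt_le_trans u1 ml4).
  rewrite -(subrKA p); apply: le_trans (ler_normD _ _) _; rewrite [X in _ + X]distrC.
  exact: half_add u1 u2 ml5.
have I2 s : a <= s <= b -> lag_action a b (cinv c' \o E) + `|q' s - E s| ^+ 2 / 4 <= lag_action a b (cinv c \o q).
  move=> sab; have := SM2 a b h1 E wE (cinv c \o q) (ltW ab) bah3 h10 sE _ pg _ s sab.
  rewrite /= (cg a ain).2 (cg b bin).2 (cg s sab).2 Ea Eb !subrr normr0 addr0 mulr0 subr0.
  apply.
    by move=> x /HEin/HE[_ u].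
  move=> x xab; have [cg1 cg2] := cg x xab; rewrite cg2.
  have [_ _ _ _ [_ u1]] := Hd _ (inI' x xab); have u2 := Ep x xab; split => //.
    exact: ltW (lt_le_trans u1 (le_trans ml1 (half_le r0'))).
  rewrite -(subrKA p'); apply: le_trans (ler_normD _ _) _; rewrite [X in _ + X]distrC.
  exact: half_add u1 u2 ml3.
have qE s : a <= s <= b -> E s = q' s.
  move=> /I2 I3; have : `|q' s - E s| ^+ 2 / 4 <= 0.
    by move: I1 I3; move: (lag_action _ _ _) (lag_action _ _ _) => A B; lra.
  rewrite ler_pdivrMr // mul0r => I4; have : `|q' s - E s| ^+ 2 == 0 by rewrite eq_le I4 sqr_ge0.
  by rewrite sqrf_eq0 normr_eq0 subr_eq0 => /eqP.
have atb : a < t < b by rewrite /a /b; clear -th0; lra.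
exists wE; have : \forall s \near t, s \in `]a, b[ by apply: near_in_itvoo; rewrite in_itv.
apply: filterS => s; rewrite in_itv /= => asb.
apply: (@solves_near c' E); first by apply: filterS (near_itv asb) => x; rewrite in_itv /= => /qE.
apply: sE; apply: HEin; case/andP: asb => u1 u2; by rewrite !ltW.
Unshelve. all: by end_near. Qed.

(** One chart suffices by [solves_change], and the condition is local and open in [t]. Gluing and
    continuation are done with it; [EL_solutionP] makes the link with [EL_solution]. *)
Definition extremal_at (gamma : R -> M) (t : R) := exists c q w, atlas c /\
  \forall s \near t, gamma s = cinv c (q s) /\ solves c q w s.

Lemma extremal_in c gamma t : extremal_at gamma t -> atlas c -> cdom c (gamma t) ->
  exists w, \forall s \near t, cdom c (gamma s) /\ solves c (cmap c \o gamma) w s.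
Proof.
move=> [c0 [q [w [ac0 H]]]] ac ct.
have [Et [iq dq _]] := nbhs_singleton H.
have ov : overlap c0 c (q t) by split => //; rewrite -Et.
have nS : \forall s \near t, solves c0 q w s by apply: filterS H => s [].
have [w' Hw'] := solves_change ac0 ac ov nS; exists w'.
have cq : {for t, continuous q} := is_derive_continuous dq.
have no : \forall s \near t, overlap c0 c (q s) by apply: cq; exact: near_overlap.
have ni := nbhs_interior H.
near=> s.
have Hs : \forall r \near s, gamma r = cinv c0 (q r) /\ solves c0 q w r by near: s; exact: ni.
have os : overlap c0 c (q s) by near: s.
split; first by rewrite (nbhs_singleton Hs).1; case: os.
apply: (@solves_near c (trans c0 c \o q)); last by near: s.
by apply: filterS Hs => r [e _]; rewrite /= e.
Unshelve. all: by end_near. Qed.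

Lemma extremal_eq gamma eta t : (\forall s \near t, gamma s = eta s) -> extremal_at gamma t -> extremal_at eta t.
Proof.
by move=> E [c [q [w [ac H]]]]; exists c, q, w; split => //; apply: filterS2 E H => s <-.
Qed.

Lemma extremal_near gamma t : extremal_at gamma t -> \forall s \near t, extremal_at gamma s.
Proof.
by move=> [c [q [w [ac H]]]]; apply: filterS (nbhs_interior H) => s Hs; exists c, q, w.
Qed.

Lemma extremal_cont gamma t : extremal_at gamma t -> {for t, continuous gamma}.
Proof.
move=> [c [q [w [ac H]]]]; have [Et [iq dq _]] := nbhs_singleton H.
have : cinv c (q s) @[s --> t] --> cinv c (q t).
  by apply: (@continuous_comp _ _ _ q (cinv c)); [exact: is_derive_continuous dq|exact: cinv_cont].
by rewrite /prop_for /continuous_at Et; apply: cvg_trans; apply: near_eq_cvg; apply: filterS H => s [->].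
Qed.

Lemma Ck2_intro (J : set R) (q : R -> V) : open J ->
  (forall t, J t -> exists w w2, (\forall s \near t, is_derive s (1 : R) q (w s) /\ is_derive s (1 : R) w (w2 s)) /\
     {for t, continuous w2}) -> Ck_on 2 J q.
Proof.
move=> oJ H; split => [t Jt|v].
  have [w [w2 [H1 _]]] := H t Jt; have [[dq _] _] := nbhs_singleton H1.
  exact: (derivable1_diffP _ _).1.
have K (t : R) w w2 : (\forall s \near t, is_derive s (1 : R) q (w s) /\ is_derive s (1 : R) w (w2 s)) ->
    \forall s \near t, is_derive s (1 : R) (fun x => 'D_v q x) (v *: w2 s).
  move=> H1; apply: filterS (nbhs_interior H1) => s Hs.
  apply: (@is_derive_near _ _ (fun r => v *: w r)).
    apply: filterS Hs => r [[dr er] _].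
    have hr : differentiable q r := (derivable1_diffP _ _).1 dr.
    rewrite (deriveE _ hr) -[v in RHS]mulr1 (linearZ_LR ('d q r : {linear R -> V})) /=; congr (_ *: _).
    by rewrite -er (deriveE _ hr).
  have [_ dw'] := nbhs_singleton Hs.
  by have := is_derive_eq (is_deriveZ v dw') (erefl _).
apply/(Ck1P _ oJ); exists (fun x => 'D_1 (fun x => 'D_v q x) x) => t Jt.
have [w [w2 [H1 c2]]] := H t Jt; have H2 := K t w w2 H1.
split; first by have [d1 _] := nbhs_singleton H2.
have : v *: w2 s @[s --> t] --> v *: w2 t by apply: cvgZ; [exact: cvg_cst|exact: c2].
have [_ <-] := nbhs_singleton H2.
by apply: cvg_trans; apply: near_eq_cvg; apply: filterS H2 => s [_ ->].
Qed.

Lemma EL_solves J gamma c : open J -> EL_solution J gamma -> atlas c ->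
  exists w, forall t, J t -> cdom c (gamma t) -> solves c (cmap c \o gamma) w t.
Proof.
move=> oJ [[cg Hc] EL] ac; pose q := cmap c \o gamma.
have oJ' := open_preim oJ (cdom_open c) cg.
have [dq1 dq2] := Hc c ac.
have [w2 Hw2] := (Ck1P _ oJ').1 (dq2 1).
exists (fun x => 'D_1 q x) => t Jt ct; pose w x := 'D_1 q x.
have Jt' : (J `&` gamma @^-1` cdom c) t by split.
have [dw' _] := Hw2 t Jt'.
have qd : is_derive t (1 : R) q (w t) by split => //; apply: (derivable1_diffP _ _).2; exact: dq1.
have cq : cimg c (q t) := cimg_cmap ct.
split => //; suff <- : w2 t = field (lag c) (pt (q t) (w t) t) by exact: dw'.
have fu := field_unique (z := pt (q t) (w t) t) (a := w2 t) (@oimg c) (fs ac) (fpd ac) cq.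
apply: fu => j.
have e1 := EL c t ac Jt ct (unit_rV R j).
have df : differentiable (fun z => 'D_(dw (unit_rV R j)) (lag c) z) (pt (q t) (w t) t).
  have cU : [set z : V * V * R | cimg c z.1.1] (pt (q t) (w t) t) := cq.
  have H2 := smooth_diff (smooth_derive (dw (unit_rV R j)) (fs ac)) cU; exact: H2.
have e2 := chain_rule df qd dw'.
have e3 : is_derive t (1 : R) (fun s => 'D_(dw (unit_rV R j)) (lag c) (pt (q s) (w s) s))
    ('D_(dq (unit_rV R j)) (lag c) (pt (q t) (w t) t)).
  have E1 : (fun s => 'D_(dw (unit_rV R j)) (lag c) (pt (q s) (w s) s)) =
      (fun s => 'D_(unit_rV R j) (fun w => local_lagrangian SM L c (q s) w s) (derive1 q s)).
    apply/funext => s; rewrite -partial_dw derive1E; reflexivity.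
  rewrite E1 -partial_dq; move: e1; rewrite !derive1E; exact.
by have [_ <-] := e2; have [_ <-] := e3.
Qed.

Lemma solves_EL c gamma w t a : atlas c -> (\forall s \near t, solves c (cmap c \o gamma) w s) ->
  let q := cmap c \o gamma in
  is_derive t (1 : R) (fun s => 'D_a (fun w => local_lagrangian SM L c (q s) w s) (derive1 q s))
    ('D_a (fun y => local_lagrangian SM L c y (derive1 q t) t) (q t)).
Proof.
move=> ac H q; have S := nbhs_singleton H.
have m := momentum_derive (@oimg c) (fs ac) (fpd ac) S.
have m2 := is_derive_dot m (is_derive_cst a t 1).
have ar (F P : V) : dot F a + dot P 0 = dot F a by rewrite dot0r addr0.
have {}m2 := is_derive_eq m2 (ar _ _).
have [iq [_ eq] _] := S.
have E0 : 'D_a (fun y => local_lagrangian SM L c y (derive1 q t) t) (q t) = 'D_(dq a) (lag c) (pt (q t) (w t) t).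
  rewrite -partial_dq derive1E eq; reflexivity.
rewrite E0 -(force_dot (w := w) (fs ac)) //; apply: is_derive_near m2.
apply: filterS H => s [is_ [_ es] _].
rewrite (momentum_dot (fs ac)) // -partial_dw derive1E es; reflexivity.
Qed.

(** A solution of the first-order system is of class C^2 because its acceleration [field] is
    continuous along it; the equation in direction [a] is the derivative of the momentum paired with
    [a]. *)
Lemma EL_solutionP J gamma : open J -> EL_solution J gamma <-> forall t, J t -> extremal_at gamma t.
Proof.
move=> oJ; split => [EL t Jt|H].
  pose c := chart_at SM (gamma t); have ac : atlas c := chart_at_atlas SM _.
  have ct : cdom c (gamma t) := chart_at_mem SM _.
  have [w Hw] := EL_solves oJ EL ac.
  have nJ : nbhs t J by exact: open_nbhs_nbhs.
  have cg := EL.1.1 t Jt.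
  exists c, (cmap c \o gamma), w; split => //; apply: filterS2 nJ (near_cdom cg ct) => s Js cs.
  by split; [rewrite /= cmapK|exact: Hw].
have cg t : J t -> {for t, continuous gamma} by move=> /H /extremal_cont.
split; last first.
  move=> c t ac Jt ct q a; have [w Hw] := extremal_in (H t Jt) ac ct.
  by apply: (solves_EL a ac (w := w)); apply: filterS Hw => s [].
split => // c ac; apply: Ck2_intro; first exact: open_preim oJ (cdom_open c) cg.
move=> t [Jt ct]; have [w Hw] := extremal_in (H t Jt) ac ct.
exists w, (fun s => field (lag c) (pt (cmap c (gamma s)) (w s) s)); split.
  by apply: filterS Hw => s [_ []].
have [_ [iq dq dw']] := nbhs_singleton Hw.
apply: (@continuous_comp _ _ _ (fun s => pt (cmap c (gamma s)) (w s) s) (field (lag c))).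
  have cid : {for t, continuous (fun s : R => s)} by exact: cvg_id.
  exact: (@pt_cont _ _ _ (cmap c \o gamma) w (fun s : R => s) t (is_derive_continuous dq) (is_derive_continuous dw') cid).
have H2 := field_cont (@oimg c) (fs ac) (@fper c) (fpd ac) (z := pt (cmap c (gamma t)) (w t) t) iq; exact: H2.
Qed.

Definition same_jet (gamma eta : R -> M) t := gamma t = eta t /\ velocity SM gamma t = velocity SM eta t.

Lemma tangent_coord_injective c q w w' : atlas c -> cimg c q ->
  tangent_coord SM c q w = tangent_coord SM c q w' -> w = w'.
Proof.
move=> ac cq E; apply/eqP; rewrite -subr_eq0; apply/eqP; apply: (tangent_coord_inj ac cq).
by rewrite /tangent_coord linearB /=; move: E; rewrite /tangent_coord => ->; rewrite subrr.
Qed.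

Lemma solves_velocity c gamma w t : atlas c -> extremal_at gamma t -> cdom c (gamma t) -> solves c (cmap c \o gamma) w t ->
  velocity SM gamma t = tangent_coord SM c (cmap c (gamma t)) (w t).
Proof. by move=> ac /extremal_cont cg ct [_ dq _]; exact: velocity_coord dq. Qed.

(** [stability] with equal data at [r] leaves no gap at [s]. In [extremal_unique], the case [r = t]
    gives openness of the coincidence set and the case [s = t] its closedness, once the values at
    [t] are known to agree. *)
Lemma jet_local gamma eta t : extremal_at gamma t -> extremal_at eta t -> gamma t = eta t ->
  exists2 e, 0 < e & forall r s, `|r - t| < e -> `|s - t| < e -> same_jet gamma eta r -> same_jet gamma eta s.
Proof.
move=> xg xe E; pose c := chart_at SM (gamma t); have ac : atlas c := chart_at_atlas SM _.
have ct : cdom c (gamma t) := chart_at_mem SM _.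
have ct' : cdom c (eta t) by rewrite -E.
have [w Hw] := extremal_in xg ac ct; have [w' Hw'] := extremal_in xe ac ct'.
have [_ [iq dq dw1]] := nbhs_singleton Hw; have [_ [iq' dq' dw2]] := nbhs_singleton Hw'.
have [r0 r00 bO] := chart_ball iq.
pose K := `|w t| + `|w' t| + 1.
have [C C1 ST] := stability (@oimg c) (fs ac) (@fper c) (fpd ac) K bO.
have nn (f : R -> V) : {for t, continuous f} -> forall e, 0 < e -> \forall s \near t, `|f s - f t| < e.
  by move=> cf e e0; near=> s; rewrite distrC; near: s; apply: cvgr_dist_lt; [exact: cf|].
have nr (A B D : R) : A < 1 -> D <= A + B -> D <= B + 1 by lra.
have nz q v : solves c q v t -> q t = cmap c (gamma t) -> (\forall s \near t, solves c q v s) -> `|v t| + 1 <= K ->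
    \forall s \near t, solves c q v s /\ zone (cmap c (gamma t)) r0 K (pt (q s) (v s) s).
  move=> [_ h1 h2] q0 hs vK; apply: filterS3 hs (nn q (is_derive_continuous h1) r0 r00) (nn v (is_derive_continuous h2) 1 ltr01) => s hs h3 h4.
  split => //; split => /=; first by rewrite -q0 ltW.
  by apply: le_trans vK; apply: (nr _ _ _ h4); rewrite -[X in `|X|](subrK (v t)) ler_normD.
have n1 : \forall s \near t, solves c (cmap c \o gamma) w s /\ zone (cmap c (gamma t)) r0 K (pt (cmap c (gamma s)) (w s) s).
  apply: (nz (cmap c \o gamma)) => //; first by apply: filterS Hw => s [].
  by rewrite /K lerD2r lerDl.
have n2 : \forall s \near t, solves c (cmap c \o eta) w' s /\ zone (cmap c (gamma t)) r0 K (pt (cmap c (eta s)) (w' s) s).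
  apply: (nz (cmap c \o eta)); [by []|by rewrite /= E|by apply: filterS Hw' => s []|].
  by rewrite /K lerD2r lerDr.
have n3 : \forall s \near t, [/\ cdom c (gamma s), cdom c (eta s), extremal_at gamma s & extremal_at eta s].
  near=> s; split; near: s; [by apply: filterS Hw => s []|by apply: filterS Hw' => s []|exact: extremal_near|exact: extremal_near].
have [e1 e10 H1] := near_interval (filterI n3 (filterI n1 n2)).
pose e := Num.min (e1 / 2) (4^-1 / C).
have C0 : 0 < C by apply: lt_le_trans C1.
have e0 : 0 < e by rewrite lt_min !divr_gt0.
have ee1 : e <= e1 / 2 by rewrite /e ge_min lexx.
have eC : C * e <= 4^-1 by rewrite mulrC -ler_pdivlMr // /e ge_min lexx orbT.
exists e => // r s hr hs [Er Ev].
have inI x : t - e <= x <= t + e -> `|x - t| < e1.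
  by move=> h; exact: dist_itv h (half_lt ee1 e10).
have inI' x : `|x - t| < e -> t - e <= x <= t + e.
  exact: itv_dist.
have [[cgr cer xgr xer] [[sr _] [sr' _]]] := H1 r (inI _ (inI' _ hr)).
have [[cgs ces xgs xes] [[ss _] [ss' _]]] := H1 s (inI _ (inI' _ hs)).
have wr : w r = w' r.
  apply: (tangent_coord_injective ac (cimg_cmap cgr)).
  by rewrite -(solves_velocity ac xgr cgr sr) Ev (solves_velocity ac xer cer sr') Er.
have [|x hx|x hx||H2 _] := ST (t - e) (t + e) (cmap c \o gamma) w (cmap c \o eta) w' r _ _ _ _ s (inI' _ hs).
- exact: twice_quarter.
- by have [_ []] := H1 x (inI x hx).
- by have [_ []] := H1 x (inI x hx).
- exact: inI'.
have {}H2 : `|cmap c (eta s) - cmap c (gamma s)| + `|w' s - w s| = 0.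
  apply/eqP; rewrite eq_le addr_ge0 // andbT; apply: le_trans H2 _.
  by rewrite /= Er wr !subrr normr0 addr0 mulr0.
have /andP[] : (`|cmap c (eta s) - cmap c (gamma s)| == 0) && (`|w' s - w s| == 0).
  by rewrite -paddr_eq0 // H2.
rewrite !normr_eq0 !subr_eq0 => /eqP qE /eqP wE.
split; first by rewrite -(cmapK cgs) -qE cmapK.
by rewrite (solves_velocity ac xgs cgs ss) (solves_velocity ac xes ces ss') qE wE.
Unshelve. all: by end_near. Qed.

Lemma jet_near (gamma eta : R -> M) t : (\forall s \near t, gamma s = eta s) -> same_jet gamma eta t.
Proof. by move=> H; split; [exact: nbhs_singleton H|exact: velocity_near]. Qed.

Hypothesis M_hausdorff : hausdorff_space M.

Lemma extremal_unique gamma eta a b : (forall t, a <= t <= b -> extremal_at gamma t /\ extremal_at eta t) ->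
  (exists2 t, a <= t <= b & same_jet gamma eta t) -> forall t, a <= t <= b -> same_jet gamma eta t.
Proof.
move=> X X0; apply: interval_clopen => // t tab.
  move=> J; have [xg xe] := X t tab; have [e e0 H] := jet_local xg xe J.1.
  exists e => // r _ rt; apply: H rt J; by rewrite subrr normr0.
move=> H; have [xg xe] := X t tab.
have E : gamma t = eta t.
  apply: M_hausdorff => A B nA nB.
  have n1 : \forall s \near t, A (gamma s) /\ B (eta s).
    near=> s; split; near: s; [exact: (extremal_cont xg)|exact: (extremal_cont xe)].
  have [e e0 He] := near_interval n1; have [r [_ rt [Er _]]] := H e e0.
  by exists (gamma r); have [h1 h2] := He r rt; split => //; rewrite Er.
have [e e0 He] := jet_local xg xe E; have [r [_ rt J]] := H e e0.
by apply: He rt _ J; rewrite subrr normr0.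
Unshelve. all: by end_near. Qed.

Hypothesis L_complete : EL_complete SM L.

Definition orbit (gamma : R -> M) := forall t, extremal_at gamma t.

Lemma orbitP gamma : EL_solution setT gamma <-> orbit gamma.
Proof.
have := EL_solutionP gamma openT; move=> [h1 h2]; split => [h t|h]; first exact: h1.
by apply: h2 => t _.
Qed.

Lemma extremal_unique2 gamma eta s t : (forall x, Num.min s t <= x <= Num.max s t -> extremal_at gamma x /\ extremal_at eta x) ->
  same_jet gamma eta t -> same_jet gamma eta s.
Proof.
move=> H J; apply: (@extremal_unique gamma eta (Num.min s t) (Num.max s t)) => //.
  by exists t => //; rewrite ge_min le_max lexx !orbT.
by rewrite ge_min le_max lexx.
Qed.

Lemma orbit_unique gamma eta t : orbit gamma -> orbit eta -> same_jet gamma eta t -> gamma = eta.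
Proof.
move=> og oe J; apply/funext => s; by have [] := @extremal_unique2 gamma eta s t (fun x _ => conj (og x) (oe x)) J.
Qed.

(** All extremals extending [gamma] agree where they overlap, by uniqueness of jets from the
    midpoint [t0]. Their union [Gam] lives on a maximal interval, which completeness makes the whole
    line. *)
Lemma orbit_extension gamma a b : a < b -> (forall t, a < t < b -> extremal_at gamma t) ->
  exists2 Gam, orbit Gam & forall t, a < t < b -> Gam t = gamma t.
Proof.
move=> ab Hg; pose t0 := (a + b) / 2.
have t0ab : a < t0 < b by rewrite /t0 !midf_lt.
pose fam (al be : R) (eta : R -> M) := [/\ al <= a, b <= be, forall t, al < t < be -> extremal_at eta t &
  forall t, a < t < b -> eta t = gamma t].
have jet0 al be eta : fam al be eta -> same_jet eta gamma t0.
  move=> [_ _ _ E]; apply: jet_near; apply: filterS (near_in_itvoo _) => [s|]; last by rewrite in_itv /=; exact: t0ab.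
  by rewrite in_itv /= => /E.
have fam0 : fam a b gamma by split.
have [Gam HG] : exists Gam : R -> M, forall t, (exists al be eta, fam al be eta /\ al < t < be) ->
    exists al be eta, [/\ fam al be eta, al < t < be & Gam t = eta t].
  apply: (@fun_choice R M (fun t x => (exists al be eta, fam al be eta /\ al < t < be) ->
    exists al be eta, [/\ fam al be eta, al < t < be & x = eta t])) => t; have [[al [be [eta [f h]]]]|n] := pselect (exists al be eta, fam al be eta /\ al < t < be).
    by exists (eta t) => _; exists al, be, eta.
  by exists (gamma t).
have GE al be eta t : fam al be eta -> al < t < be -> Gam t = eta t.
  move=> f h; have [|al' [be' [eta' [f' h' ->]]]] := HG t; first by exists al, be, eta.
  have [j1 j2] := jet0 _ _ _ f; have [j1' j2'] := jet0 _ _ _ f'.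
  have J : same_jet eta' eta t0 by split; [exact: etrans j1' (esym j1)|exact: etrans j2' (esym j2)].
  have [f1 f2 f3 _] := f; have [f1' f2' f3' _] := f'.
  suff : same_jet eta' eta t by case.
  apply: (extremal_unique2 _ J) => x hx; split; [apply: f3'|apply: f3].
    exact: minmax_itv hx h' (itv_sub f1' f2' t0ab).
  exact: minmax_itv hx h (itv_sub f1 f2 t0ab).
pose J : set R := [set t | exists al be eta, fam al be eta /\ al < t < be].
have oJ : open J.
  rewrite openE => t [al [be [eta [f h]]]].
  apply: filterS (near_in_itvoo _) => [s|]; last by rewrite in_itv /=; exact: h.
  by rewrite in_itv /= => hs; exists al, be, eta.
have Jab t : a < t < b -> J t by move=> h; exists a, b, gamma.
have xG t : J t -> extremal_at Gam t.
  move=> [al [be [eta [f h]]]]; have [_ _ f3 _] := f; apply: extremal_eq (f3 t h).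
  apply: filterS (near_in_itvoo _) => [s|]; last by rewrite in_itv /=; exact: h.
  by rewrite in_itv /= => hs; rewrite (GE _ _ _ _ f hs).
have Gg t : a < t < b -> Gam t = gamma t by move=> h; exact: GE fam0 h.
have JT : J = setT.
  apply: (L_complete (gamma := Gam)); split.
  - split => //; last by exists t0; exact: Jab.
    move=> x y [al [be [eta [f h]]]] [al' [be' [eta' [f' h']]]] z zxy.
    have [f1 f2 _ _] := f; have [f1' f2' _ _] := f'.
    have [zb|bz] := ltP z be; first by exists al, be, eta; split => //; case/andP: zxy => /(lt_le_trans _) K _; rewrite zb andbT K //; case/andP: h.
    exists al', be', eta'; split => //; case/andP: zxy => _ h1; apply/andP; split; last by apply: le_lt_trans h1 _; case/andP: h'.
    exact: le_lt_trans f1' (lt_le_trans ab (le_trans f2 bz)).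
  - exact/(EL_solutionP _ oJ).
  - move=> J' eta [oJ' iJ' _] sJ ELe E; apply/seteqP; split => // t Jt.
    have Xe := (EL_solutionP _ oJ').1 ELe.
    have nJ : nbhs t J' by exact: open_nbhs_nbhs.
    have [e e0 He] := near_interval nJ.
    have J't0 : J' t0 by apply/sJ/Jab.
    (* A solution on a larger interval provides members of the family: the hull of []a, b[] and of a
       ball around [t] lies in [J'], hence [t] already belongs to [J]. *)
    exists (Num.min a (t - e)), (Num.max b (t + e)), eta; split; last first.
      by rewrite gt_min lt_max ltrBlDr !ltrDl e0 !orbT.
    split; [by rewrite ge_min lexx|by rewrite le_max lexx| |]; last first.
      by move=> s sab; rewrite E ?inE ?Gg //; exact: Jab.
    move=> s; rewrite gt_min lt_max => /andP[s1 s2]; apply: Xe.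
    have [h|] := boolP (a < s < b); first exact/sJ/Jab.
    have [h|] := boolP (`|s - t| < e); first by move=> _; exact: He.
    move=> n2 n1.
    have [tt0|t0t] := leP t t0.
      by apply: (iJ' t t0) => //; exact: between_l s1 s2 n2 n1 t0ab tt0.
    by apply: (iJ' t0 t) => //; exact: between_r s1 s2 n2 n1 t0ab t0t.
by exists Gam => // t; apply: xG; rewrite JT.
Qed.

End Extremals.

(** * Existence and regularity of minimizers *)

Section Boxes.
Context {R : realType} {M : ptopologicalType} {d : nat}.
Variable SM : smooth_structure R M d.
Hypothesis M_hausdorff : hausdorff_space M.
Notation V := 'rV[R]_d.
Notation chart := (chart R M d).
Notation atlas := (atlas SM).
Notation is_path := (is_path SM).

Definition in_box (c : chart) (p : V) (rho : R) (x : M) := cdom c x /\ `|cmap c x - p| <= rho.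

Lemma in_box_closed c p rho : cball p rho `<=` cimg c -> closed [set x | in_box c p rho x].
Proof.
move=> bO; have -> : [set x | in_box c p rho x] = cinv c @` cball p rho.
  apply/seteqP; split => [x [cx hx]|x [q hq <-]]; first by exists (cmap c x) => //; rewrite cmapK.
  by have [h1 h2] := cimgP (bO _ hq); split; rewrite ?h2.
apply: compact_closed => //; apply: continuous_compact; last exact: cball_compact.
by apply: continuous_in_subspaceT => q; rewrite inE => /bO; exact: cinv_cont.
Qed.

(** Closedness of the box in [M], which rests on the Hausdorff property, prevents the curve from
    leaving the chart without first crossing the sphere of radius [rho]. *)
Lemma box_exit c p rho (f : R -> M) s0 s1 : cball p rho `<=` cimg c -> s0 <= s1 ->
  {within `[s0, s1], continuous f} -> cdom c (f s0) -> `|cmap c (f s0) - p| < rho ->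
  (forall s, s0 <= s <= s1 -> cdom c (f s) /\ `|cmap c (f s) - p| < rho) \/
  exists s', [/\ s0 <= s' <= s1, forall s, s0 <= s <= s' -> in_box c p rho (f s) & `|cmap c (f s') - p| = rho].
Proof.
move=> bO s01 cf c0 h0.
have [|nE] := pselect (exists s', [/\ s0 <= s' <= s1, forall s, s0 <= s <= s' -> in_box c p rho (f s) & `|cmap c (f s') - p| = rho]).
  by right.
left; pose G s := forall r, s0 <= r <= s -> cdom c (f r) /\ `|cmap c (f r) - p| < rho.
suff H : forall s, s0 <= s <= s1 -> G s by move=> s ss; apply: (H s ss s); rewrite lexx andbT; case/andP: ss.
have op s : s0 <= s <= s1 -> cdom c (f s) /\ `|cmap c (f s) - p| < rho ->
    exists2 e, 0 < e & forall r, s0 <= r <= s1 -> `|r - s| < e -> cdom c (f r) /\ `|cmap c (f r) - p| < rho.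
  move=> ss [cs hs]; apply: ((within_nearP _ _ _).1 cf s ss [set x | cdom c x /\ `|cmap c x - p| < rho]).
  have e0 : 0 < rho - `|cmap c (f s) - p| by rewrite subr_gt0.
  apply: filterS (near_chart_ball cs e0) => y [cy hy]; split => //.
  rewrite -(subrKA (cmap c (f s))); apply: le_lt_trans (ler_normD _ _) _.
  by move: hy; rewrite ltrBrDr.
apply: interval_clopen.
- exists s0; first by rewrite lexx.
  by move=> r /andP[h1 h2]; have -> : r = s0 by apply/eqP; rewrite eq_le h1 h2.
- move=> s ss Gs; have [|e e0 He] := op s ss; first by apply: Gs; rewrite lexx andbT; case/andP: ss.
  exists e => // r rr rs x /andP[x1 x2].
  have [xs|sx] := leP x s; first by apply: Gs; rewrite x1.
  apply: He; first by rewrite x1 (le_trans x2) //; case/andP: rr.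
  rewrite ger0_norm; last by rewrite subr_ge0 ltW.
  by apply: le_lt_trans rs; rewrite ger0_norm ?lerD2r // subr_ge0 (le_trans _ x2) // ltW.
- move=> s ss H.
  have below r : s0 <= r -> r < s -> cdom c (f r) /\ `|cmap c (f r) - p| < rho.
    move=> h1 h2; have [|r' [_ h3 Gr']] := H (s - r); first by rewrite subr_gt0.
    apply: Gr'; rewrite h1 /=; move: h3; rewrite ltr_norml => /andP[h3 _].
    by move: h3; rewrite opprB ltrD2r => /ltW.
  suff fs : cdom c (f s) /\ `|cmap c (f s) - p| < rho.
    move=> r /andP[h1 h2]; move: h2; rewrite le_eqVlt => /predU1P[->//|]; exact: below.
  have [s0s|] := ltP s0 s; last first.
    by move=> h; have -> : s = s0 by apply/eqP; rewrite eq_le h; case/andP: ss.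
  have fB : in_box c p rho (f s).
    apply: (in_box_closed bO) => B nB.
    have [e e0 He] := (within_nearP _ _ _).1 cf s ss B nB.
    pose r := Num.max s0 (s - e / 2).
    have rs : r < s by rewrite gt_max s0s ltrBlDr ltrDl divr_gt0.
    have s0r : s0 <= r by rewrite le_max lexx.
    exists (f r); split; first by have [h1 h2] := below r s0r rs; split => //; exact: ltW.
    apply: He; first by rewrite s0r (le_trans (ltW rs)) //; case/andP: ss.
    rewrite ltr0_norm ?subr_lt0 // opprB ltrBlDr -ltrBlDl lt_max; apply/orP; right.
    by rewrite ltrD2l ltrN2 half_lt.
  split; first by case: fB.
  rewrite lt_neqAle fB.2 andbT; apply/eqP => E; apply: nE; exists s; split => // r /andP[h1 h2].
  by move: h2; rewrite le_eqVlt => /predU1P[->//|h2]; have [h3 h4] := below r h1 h2; split => //; exact: ltW.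
Qed.

Lemma box_exit_back c p rho (f : R -> M) s0 s1 : cball p rho `<=` cimg c -> s0 <= s1 ->
  {within `[s0, s1], continuous f} -> cdom c (f s1) -> `|cmap c (f s1) - p| < rho ->
  (forall s, s0 <= s <= s1 -> cdom c (f s) /\ `|cmap c (f s) - p| < rho) \/
  exists s', [/\ s0 <= s' <= s1, forall s, s' <= s <= s1 -> in_box c p rho (f s) & `|cmap c (f s') - p| = rho].
Proof.
move=> bO s01 cf c1 h1.
have rI (r a b : R) : a <= r <= b -> (a + b) - b <= (a + b) - r <= (a + b) - a.
  by move=> /andP[? ?]; rewrite !lerD2l !lerN2; apply/andP.
have rI' r : s0 <= r <= s1 -> s0 <= s0 + s1 - r <= s1 by move/rI; rewrite addrK [s0 + s1 - s0]addrAC subrr add0r.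
pose g r := f (s0 + s1 - r).
have cg : {within `[s0, s1], continuous g}.
  apply/within_nearP => s ss U Us.
  have [e e0 He] := (within_nearP _ _ _).1 cf _ (rI' s ss) U Us; exists e => // r rr rs.
  apply: He; first exact: rI'.
  by rewrite (_ : s0 + s1 - r - (s0 + s1 - s) = s - r); [rewrite distrC|ring].
have g0 : g s0 = f s1 by rewrite /g addrAC subrr add0r.
have [||H|[s' [ss H1 H2]]] := box_exit bO s01 cg; rewrite ?g0 //.
  left => s ss; have := H _ (rI' s ss); rewrite /g opprB addrC.
  by rewrite subrK.
right; exists (s0 + s1 - s'); split => //; first exact: rI'.
have subE (x : R) : s0 + s1 - (s0 + s1 - x) = x by ring.
move=> s /andP[h2 h3]; have := H1 (s0 + s1 - s); rewrite /g subE; apply.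
by apply/andP; split; lra.
Qed.

Section Lagrangian.
Variable g : M -> V -> V -> R.
Hypothesis g_metric : is_riemannian_metric SM g.
Variable L : M -> V -> R -> R.
Hypothesis L_smooth : lagrangian_smooth SM L.
Hypothesis L_periodic : lagrangian_periodic L.
Hypothesis L_superlinear : lagrangian_superlinear g L.
Notation lag := (lag SM L).
Notation lag_action := (lag_action SM L).

Lemma box_displacement c p r K : atlas c -> cball p r `<=` cimg c -> 0 <= K ->
  exists2 C, 0 <= C & forall a b gamma, is_path a b gamma -> (forall t, a <= t <= b -> in_box c p r (gamma t)) ->
    K * `|cmap c (gamma b) - cmap c (gamma a)| - C * (b - a) <= lag_action a b gamma.
Proof.
move=> ac bO K0; have [C C0 HC] := superlinear_box g_metric L_smooth L_periodic L_superlinear ac bO K0.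
exists C => // a b gamma pg ig; have ab := path_le pg.
have cg t : a <= t <= b -> cdom c (gamma t) by move=> /ig[].
have [s [P [cP aP]]] := path_coord L_smooth ac pg cg; rewrite (aP a b) //.
have H := @displacement_bound R d (lag c) p r a b s (cmap c \o gamma) P K C; apply: H => //.
  by move=> t /ig[].
Qed.

(** Leaving the box means crossing a coordinate distance [rho / 2]. With slope [(B + 2) / (rho / 2)]
    in [box_displacement] this costs at least [B + 2 - C * del], hence at least [B + 1], against the
    bound [B] on all partial actions. *)
Lemma no_escape c p r rho B : atlas c -> cball p r `<=` cimg c -> 0 < rho -> rho <= r -> 0 <= B ->
  exists2 del, 0 < del & forall s0 s1 t gamma, is_path s0 s1 gamma -> s1 - s0 <= del ->
    (forall s s', s0 <= s -> s <= s' -> s' <= s1 -> lag_action s s' gamma <= B) ->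
    s0 <= t <= s1 -> in_box c p (rho / 2) (gamma t) ->
    forall s, s0 <= s <= s1 -> in_box c p rho (gamma s).
Proof.
move=> ac bO rho0 rhor B0.
have bO' : cball p rho `<=` cimg c by move=> q hq; apply: bO; exact: le_trans hq rhor.
have rho2 : 0 < rho / 2 by exact: divr_gt0.
have K0 : 0 <= (B + 2) / (rho / 2) by apply: divr_ge0; [exact: addr_ge0|exact: ltW].
have [C C0 HC] := box_displacement ac bO' K0.
have C10 : 0 < C + 1 by exact: ltr_wpDl.
exists (C + 1)^-1; first by rewrite invr_gt0.
move=> s0 s1 t gamma pg sd bA tin it.
have key x y : s0 <= x -> x <= y -> y <= s1 -> (forall s, x <= s <= y -> in_box c p rho (gamma s)) ->
    rho / 2 <= `|cmap c (gamma y) - cmap c (gamma x)| -> False.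
  move=> h1 h2 h3 h4 h5; have := HC x y gamma (pathW pg h1 h2 h3) h4.
  have e1 : B + 2 <= (B + 2) / (rho / 2) * `|cmap c (gamma y) - cmap c (gamma x)|.
    rewrite -[leLHS](divfK (lt0r_neq0 rho2)) ler_wpM2l // divr_ge0 ?ltW // addr_ge0 //.
  have e2 : C * (y - x) <= 1.
    have e3 : y - x <= (C + 1)^-1 by apply: le_trans sd; rewrite lerB.
    have e4 : C * (y - x) <= C * (C + 1)^-1 by rewrite ler_wpM2l.
    apply: le_trans e4 _; rewrite ler_pdivrMr // mul1r lerDl //.
  have e5 := bA x y h1 h2 h3; move: e1 e2 e5.
  move: (_ * `|_|) (C * _) (lag_action _ _ _) => X Y Z; lra.
have [t0 t1] := andP tin; have [ct ht] := it.
have ht' : `|cmap c (gamma t) - p| < rho by apply: le_lt_trans ht _; exact: half_lt.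
have dl (A' B' D : R) : A' = rho -> B' <= rho / 2 -> A' <= D + B' -> rho / 2 <= D by lra.
have fin x y : `|cmap c (gamma x) - p| = rho -> `|cmap c (gamma y) - p| <= rho / 2 -> rho / 2 <= `|cmap c (gamma x) - cmap c (gamma y)|.
  move=> e1 e2; apply: (dl _ _ _ e1 e2); rewrite -[X in `|X| <= _](subrKA (cmap c (gamma y))); exact: ler_normD.
move=> s /andP[ss0 ss1]; have [ts|/ltW st] := leP t s.
  have [H|[s' [/andP[h1 h2] H1 H2]]] := box_exit bO' t1 (within_sub (path_cont pg) t0 (lexx _)) ct ht'.
    by have [|h1 h2] := H s; [rewrite ts|split => //; exact: ltW].
  exfalso; apply: (key t s') => //; exact: fin.
have [H|[s' [/andP[h1 h2] H1 H2]]] := box_exit_back bO' t0 (within_sub (path_cont pg) (lexx _) t1) ct ht'.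
  by have [|h1 h2] := H s; [rewrite ss0|split => //; exact: ltW].
exfalso; apply: (key s' t) => //; rewrite distrC; exact: fin.
Qed.

Hypothesis L_posdef : lagrangian_posdef L.
Notation solves c := (solves_at (lag c) (cimg c)).

Lemma subpath_replace a b s t gamma eta : is_path a b gamma -> a <= s -> s <= t -> t <= b -> is_path s t eta ->
  eta s = gamma s -> eta t = gamma t -> exists zeta, [/\ is_path a b zeta, zeta a = gamma a, zeta b = gamma b &
    lag_action a b zeta = lag_action a b gamma - lag_action s t gamma + lag_action s t eta].
Proof.
move=> pg as_ st tb pe es et; have sb := le_trans st tb; have at_ := le_trans as_ st.
have p1 := pathW pg (lexx a) as_ sb; have p2 := pathW pg at_ tb (lexx b).
have p3 : is_path s b (splice t eta gamma) := path_glue pe p2 et.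
have e3 : gamma s = splice t eta gamma s by rewrite /splice st.
exists (splice s gamma (splice t eta gamma)); split.
- exact: path_glue p1 p3 e3.
- by rewrite /splice as_.
- rewrite /splice; have [bs|_] := leP b s.
    by [].
  by have [bt|//] := leP b t; have -> : b = t by apply/eqP; rewrite eq_le bt.
- rewrite (lag_action_glue L_smooth p1 p3 e3) (lag_action_glue L_smooth pe p2 et).
  rewrite (lag_action_cat L_smooth pg as_ sb) (lag_action_cat L_smooth (pathW pg as_ sb (lexx b)) st tb).
  have ar (A B C D : R) : A + (D + C) = A + (B + C) - B + D by ring.
  exact: ar.
Qed.

(** The affine interpolation of [u1] and [u2] is added to [E]. Positions and velocities change by a
    multiple of [|u1| + |u2|], and the Lagrangian is Lipschitz on a zone; [|u1| + |u2| <= t - s]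
    keeps the added velocity at most 1. *)
Lemma perturbed_path c p r K E w s t e : atlas c -> cball p r `<=` cimg c -> 0 < r -> 0 <= K -> s < t -> 0 < e ->
  (forall x, s - e < x < t + e -> solves c E w x) -> (forall x, s <= x <= t -> `|E x - p| <= r / 2 /\ `|w x| <= K) ->
  exists2 C, 0 <= C & forall u1 u2, `|u1| + `|u2| <= r / 4 -> `|u1| + `|u2| <= t - s ->
  exists eta, [/\ is_path s t eta, eta s = cinv c (E s + u1), eta t = cinv c (E t + u2) &
    lag_action s t eta <= lag_action s t (cinv c \o E) + C * (`|u1| + `|u2|)].
Proof.
move=> ac bO r0 K0 st e0 sE zE.
have ts0 : 0 < t - s by rewrite subr_gt0.
have [C C0 HC] := zone_lip (K + 1) bO (lag_periodic SM L_periodic c) (lag_smooth L_smooth ac).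
pose D := C * (1 + (t - s)^-1) * (t - s).
have D0 : 0 <= D by rewrite /D; apply: mulr_ge0; [apply: mulr_ge0 => //; apply: addr_ge0 => //; rewrite invr_ge0 ltW|exact: ltW].
exists D => // u1 u2 us1 us2; pose sg := `|u1| + `|u2|; rewrite -/sg in us1 us2 *.
have sg0 : 0 <= sg by rewrite addr_ge0.
pose v := (t - s)^-1 *: (u2 - u1); pose q x := E x + (u1 + (x - s) *: v).
have u21 : `|u2 - u1| <= sg by rewrite /sg [leRHS]addrC; exact: ler_normB.
have nv : `|v| <= (t - s)^-1 * sg by rewrite normrZ gtr0_norm ?invr_gt0 // ler_wpM2l // invr_ge0 ltW.
have nv1 : `|v| <= 1 by apply: le_trans nv _; rewrite mulrC ler_pdivrMr // mul1r.
have dl x : is_derive x (1 : R) (fun x : R => u1 + (x - s) *: v) v.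
  have h : is_derive x (1 : R) (fun s' : R => (s' - s) *: v) v.
    exact: (@is_derive_comp_shift R _ (fun s : R => s *: v) (- s) x v (is_derive_scalel v (x - s))).
  exact: is_derive_eq (is_deriveD (is_derive_cst u1 x 1) h) (add0r v).
have dq x : s - e < x < t + e -> is_derive x (1 : R) q (w x + v).
  by move=> /sE[_ h _]; exact: is_deriveD h (dl x).
have inI x : s <= x <= t -> s - e < x < t + e.
  by move=> /andP[h1 h2]; rewrite ltrBlDr (le_lt_trans h1) ?ltrDl // (le_lt_trans h2) // ltrDl.
have qE x : s <= x <= t -> `|u1 + (x - s) *: v| <= sg.
  move=> /andP[h1 h2]; pose l := (x - s) / (t - s).
  have l0 : 0 <= l by rewrite divr_ge0 ?subr_ge0 // ltW.
  have l1 : 0 <= 1 - l by rewrite subr_ge0 ler_pdivrMr // mul1r lerD2r.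
  have -> : u1 + (x - s) *: v = (1 - l) *: u1 + l *: u2.
    rewrite /v scalerA -/l; move: (l) => l'; clear.
    by apply/rowP => i; rewrite !mxE; ring.
  clearbody l; apply: le_trans (ler_normD _ _) _; rewrite !normrZ (ger0_norm l0) (ger0_norm l1).
  apply: lerD; [apply: ler_piMl => //; by rewrite lerBlDr lerDl|apply: ler_piMl => //; by rewrite -subr_ge0].
have qp x : s <= x <= t -> `|q x - p| <= r.
  move=> xst; have [h _] := zE x xst; have h2 := qE x xst.
  rewrite /q addrAC; apply: le_trans (ler_normD _ _) _.
  have ar (A B : R) : A <= r / 2 -> B <= sg -> A + B <= r.
    by move=> h3 h4; apply: le_trans (lerD h3 (le_trans h4 us1)) _; have := r0; lra.
  exact: ar.
pose J : set R := `]s - e, t + e[%classic `&` [set x | cimg c (q x)].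
have oJ : open J.
  rewrite openE => x [xI cx].
  have n1 : \forall y \near x, y \in `]s - e, t + e[ by apply: near_in_itvoo.
  have cq : {for x, continuous q} by apply: is_derive_continuous (dq x _); move: xI; rewrite /= in_itv.
  have n2 : \forall y \near x, cimg c (q y) by apply: cq; exact: near_cimg.
  by apply: filterS2 n1 n2 => y h1 h2.
have sJ : `[s, t] `<=` J.
  move=> x /=; rewrite in_itv /= => xst; split; first by rewrite /= in_itv /=; exact: inI.
  by apply: bO; exact: qp.
have [x [xI cx]|pe [P [cP dP aP]]] := @chart_path _ _ _ SM L L_smooth c J q (fun x => w x + v) s t oJ ac (ltW st) sJ.
  have {}xI : s - e < x < t + e by move: xI; rewrite /= in_itv.
  split; [exact: cx|exact: dq|].
  have [_ _ dw'] := sE x xI.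
  by apply: cvgD; [exact: is_derive_continuous dw'|exact: cvg_cst].
have [_ [PE [cPE dPE aPE]]] := solves_path L_smooth ac (ltW st) e0 sE.
exists (cinv c \o q); split => //=; [| |].
- by rewrite /q subrr scale0r addr0.
- by rewrite /q /v scalerA divff ?gt_eqF // scale1r [u1 + _]addrC subrK.
rewrite (aP s t) ?(ltW st) // (aPE s t) ?(ltW st) //.
pose B := C * (1 + (t - s)^-1) * sg.
have -> : D * sg = B * (t - s) by rewrite /D /B; ring.
have -> : PE t - PE s + B * (t - s) = (PE t + B * t) - (PE s + B * s) by ring.
apply: (@le_derive_le _ [::] P (fun x => PE x + B * x)) => //; [exact: ltW| |].
  move=> x; apply: cvgD; first exact: cPE.
  by apply: (continuous_subspaceT (f := fun x : R => B * x)) => y; apply: cvgM; [exact: cvg_cst|exact: cvg_id].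
move=> x xst _; have xst' : s <= x <= t by case/andP: xst => ? ?; rewrite !ltW.
exists (lag c (pt (q x) (w x + v) x)), (lag c (pt (E x) (w x) x) + B); split.
- exact: dP.
- exact: is_deriveD (dPE x xst) (is_derive_mull B x).
have [h1 h2] := zE x xst'.
have := HC (E x) (w x) (q x) (w x + v) x _ _.
have z1 : zone p r (K + 1) (pt (E x) (w x) x).
  by split => /=; [apply: le_trans h1 _; exact: half_le|apply: le_trans h2 _; rewrite lerDl].
have z2 : zone p r (K + 1) (pt (q x) (w x + v) x).
  by split => /=; [exact: qp|apply: le_trans (ler_normD _ _) _; exact: lerD].
move=> /(_ z1 z2) h; rewrite -lerBlDl; apply: le_trans (ler_norm _) (le_trans h _).
rewrite /B -mulrA ler_wpM2l // mulrDl mul1r.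
have -> : q x - E x = u1 + (x - s) *: v by rewrite /q addrAC subrr add0r.
have -> : w x + v - w x = v by rewrite addrAC subrr add0r.
by apply: lerD; [exact: qE|].
Qed.

(** The two sides of the squeeze, for a path whose end points are near, but not equal to, those of
    the extremal [E]. From below, its action is that of [E] plus the quadratic gain; from above,
    some competitor with the path's own end points costs hardly more than [E]. Both errors are
    linear in the mismatch [sg]. *)
Lemma window c p r k : atlas c -> cball p r `<=` cimg c -> 0 < r -> 1 <= k ->
  exists H rho, [/\ 0 < H, 0 < rho, rho <= r & forall s t x y, s < t -> t - s <= H -> `|x - p| <= rho -> `|y - p| <= rho ->
    `|y - x| <= k * (t - s) -> exists E w e C sg0, [/\ E s = x /\ E t = y, 0 < e,
      forall x, s - e < x < t + e -> solves c E w x, 0 <= C /\ 0 < sg0 &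
      forall gamma, is_path s t gamma -> (forall x, s <= x <= t -> in_box c p rho (gamma x)) ->
      let sg := `|cmap c (gamma s) - x| + `|cmap c (gamma t) - y| in
      (forall x, s <= x <= t -> lag_action s t (cinv c \o E) + (`|cmap c (gamma x) - E x| ^+ 2 / 4 - C * sg) <= lag_action s t gamma) /\
      (sg <= sg0 -> exists eta, [/\ is_path s t eta, eta s = gamma s, eta t = gamma t &
        lag_action s t eta <= lag_action s t (cinv c \o E) + C * sg])]].
Proof.
move=> ac bO r0 k1.
have oi : open (cimg c) := @cimg_open R M d c.
have fpd z a : cimg c z.1.1 -> a != 0 -> 0 < D2 (lag c) (dw a) (dw a) z by exact: (lag_posdef L_posdef ac).
have [h1 h10 BVP] := bvp oi (lag_smooth L_smooth ac) (@lag_periodic _ _ _ SM L L_periodic c) fpd bO r0 k1.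
have [eps [h2 [C [eps0 h20 C0 SMin]]]] := solution_strict L_smooth L_periodic L_posdef (2 * k + 2) ac bO.
have k2 : 0 < 2 * k + 2 by move: k1; move: (k) => k'; lra.
pose rho := Num.min (r / 4) (eps / 4).
pose H := Num.min (Num.min h1 h2) (rho / (2 * k + 2)).
have rho0 : 0 < rho by rewrite lt_min !divr_gt0.
have H0 : 0 < H by rewrite !lt_min h10 h20 divr_gt0.
have [Hh1 Hh2 Hk] : [/\ H <= h1, H <= h2 & (2 * k + 2) * H <= rho].
  split; [by rewrite /H !ge_min lexx|by rewrite /H !ge_min lexx orbT|].
  by rewrite mulrC -ler_pdivlMr // /H ge_min lexx orbT.
have [rr re] : rho <= r / 4 /\ rho <= eps / 4 by rewrite /rho !ge_min !lexx orbT.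
exists H, rho; split => //; first by move: rr; move: (rho) => a; lra.
move=> s t x y st tsH hx hy hxy.
have [||||E [w [Es Et HE]]] := BVP s t x y => //.
- exact: le_trans tsH Hh1.
- by apply: le_trans hx _; move: rr; move: (rho) => a; lra.
have inI z : s <= z <= t -> s - h1 < z < t + h1.
  by move=> /andP[u1 u2]; rewrite ltrBlDr (le_lt_trans u1) ?ltrDl // (le_lt_trans u2) // ltrDl.
have sE z : s - h1 < z < t + h1 -> solves c E w z by move=> /HE[].
have Ex z : s <= z <= t -> `|E z - x| <= rho.
  move=> zst; have [u1 u2] := andP zst.
  have sst : s <= s <= t by rewrite lexx ltW.
  have e1 : `|E z - E s| <= (2 * k + 2) * `|z - s|.
    apply: (@mean_value_abs _ _ E w s t) => //; [exact: ltW| |].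
      by move=> a /inI/HE[[]].
    by move=> a /inI/HE[_ []].
  rewrite Es in e1; apply: le_trans e1 _; apply: le_trans Hk; rewrite ler_wpM2l ?(ltW k2) //.
  rewrite ger0_norm ?subr_ge0 //; apply: le_trans tsH; by rewrite lerD2r.
have Ep z : s <= z <= t -> `|E z - p| <= r / 2 /\ `|w z| <= 2 * k + 2.
  move=> zst; split; last by have [_ []] := HE z (inI z zst).
  rewrite -(subrKA x); apply: le_trans (ler_normD _ _) _; have := Ex z zst; move: hx rr.
  by move: (`|_ - p|) (`|_ - x|) (rho) => a b a'; lra.
have [C2 C20 PP] := perturbed_path ac bO r0 (ltW k2) st h10 sE Ep.
have CC : 0 <= C + C2 by exact: addr_ge0.
exists E, w, h1, (C + C2), (Num.min (r / 4) (t - s)); split => //.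
  by split => //; rewrite lt_min divr_gt0 // subr_gt0.
move=> gamma pg ig sg.
have sg0 : 0 <= sg by rewrite addr_ge0.
have sst : s <= s <= t by rewrite lexx ltW.
have tst : s <= t <= t by rewrite lexx ltW.
have le1 (A B : R) : A + (B - (C + C2) * sg) <= A + (B - C * sg).
  by rewrite lerD2l lerD2l lerN2 ler_wpM2r // lerDl.
split.
  move=> z zst; apply: le_trans (le1 _ _) _; rewrite /sg -{1}Es -{1}Et.
  apply: (SMin s t h1 E w gamma (ltW st) (le_trans tsH Hh2) h10 sE) => //.
    by move=> a /inI/HE[].
  move=> a ast; have [u1 u2] := ig a ast; split => //.
    by apply: le_trans u2 _; move: rr; move: (rho) => b; lra.
  rewrite -(subrKA p); apply: le_trans (ler_normD _ _) _; rewrite [`|p - _|]distrC.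
  have u3 : `|E a - p| <= rho + rho.
    by rewrite -(subrKA x); apply: le_trans (ler_normD _ _) _; apply: lerD => //; exact: Ex.
  by move: u2 u3 re; move: (`|_ - p|) (`|_ - p|) (rho) => a1 a2 a3; lra.
rewrite le_min => /andP[g1 g2].
have [eta [pe e1 e2 e3]] := PP (cmap c (gamma s) - x) (cmap c (gamma t) - y) g1 g2.
exists eta; split => //.
- by rewrite e1 Es addrC subrK cmapK //; case: (ig s sst).
- by rewrite e2 Et addrC subrK cmapK //; case: (ig t tst).
by apply: le_trans e3 _; rewrite lerD2l ler_wpM2r // lerDr.
Qed.

End Lagrangian.
End Boxes.

Lemma itv_dist_le {R : realType} (t e x : R) : `|x - t| <= e -> t - e <= x <= t + e.
Proof. by rewrite ler_norml => /andP[? ?]; lra. Qed.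

Lemma dist_itv_le {R : realType} (t e x : R) : t - e <= x <= t + e -> `|x - t| <= e.
Proof. by rewrite ler_norml => /andP[? ?]; lra. Qed.

Section Tonelli.
Context {R : realType} {M : ptopologicalType} {d : nat}.
Variable SM : smooth_structure R M d.
Hypothesis M_hausdorff : hausdorff_space M.
Hypothesis M_compact : compact [set: M].
Notation V := 'rV[R]_d.
Notation chart := (chart R M d).
Notation atlas := (atlas SM).
Notation is_path := (is_path SM).
Variable g : M -> V -> V -> R.
Hypothesis g_metric : is_riemannian_metric SM g.
Variable L : M -> V -> R -> R.
Hypothesis L_smooth : lagrangian_smooth SM L.
Hypothesis L_periodic : lagrangian_periodic L.
Hypothesis L_superlinear : lagrangian_superlinear g L.
Hypothesis L_posdef : lagrangian_posdef L.
Hypothesis L_complete : EL_complete SM L.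
Notation lag := (lag SM L).
Notation lag_action := (lag_action SM L).
Notation solves c := (solves_at (lag c) (cimg c)).
Notation extremal_at := (extremal_at SM L).
Notation orbit := (orbit SM L).

Lemma hausdorff_eq (x y : M) : (forall A B, nbhs x A -> nbhs y B -> A `&` B !=set0) -> x = y.
Proof. by move=> H; apply: M_hausdorff. Qed.

Lemma orbit_path gamma s t : orbit gamma -> s <= t -> is_path s t gamma.
Proof.
move=> oG st; apply: path_C1 => //; exists setT, gamma; split => //; first exact: openT.
have [h1 h2] := ((orbitP L_smooth L_periodic L_posdef gamma).2 oG).1.
split => // c ac; have [h3 h4] := h2 c ac.
by split => // v x Hx; exact: differentiable_continuous ((h4 v).1 x Hx).
Qed.

Definition minimizes (a b : R) (gamma : R -> M) := is_path a b gamma /\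
  forall eta, is_path a b eta -> eta a = gamma a -> eta b = gamma b -> lag_action a b gamma <= lag_action a b eta.

(** * Limits of minimizing sequences *)

Section Sequence.
Variable U : set_system nat.
Hypothesis UU : UltraFilter U.
Variables (a b : R) (gam : nat -> R -> M) (A : R).
Hypothesis ab : a < b.
Hypothesis pgam : forall i, is_path a b (gam i).
Hypothesis Agam : forall i, lag_action a b (gam i) <= A.
Hypothesis minim : forall e, 0 < e -> \forall i \near U, forall eta, is_path a b eta ->
  eta a = gam i a -> eta b = gam i b -> lag_action a b (gam i) <= lag_action a b eta + e.

Let UP : ProperFilter U := ultra_proper.

(** An ultrafilter on the indices yields limits at all times at once, with no regularity in [t] so
    far. It also decides every alternative on the sequence, which [slow_window] exploits. *)
Lemma ultra_limit : exists gs : R -> M, forall t, gam i t @[i --> U] --> gs t.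
Proof.
apply: (@fun_choice R M (fun t z => gam i t @[i --> U] --> z)) => t.
have [z [_ cz]] := M_compact (fmap_proper_filter (fun i => gam i t) UP) filterT.
exists z => B nB; have [//|nU] := in_ultra_setVsetC ((fun i => gam i t) @^-1` B) UU.
have [y [h1 h2]] := cz (~` B) B nU nB; exact: (False_rect _ (h1 h2)).
Qed.

Lemma subaction_bounded : exists2 B, 0 <= B & forall i s s', a <= s -> s <= s' -> s' <= b -> lag_action s s' (gam i) <= B.
Proof.
have [C0 C00 HC0] := lagrangian_lower_bound M_compact g_metric L_smooth L_periodic L_superlinear.
exists (`|A| + C0 * (b - a)); first by rewrite addr_ge0 // mulr_ge0 // subr_ge0 ltW.
move=> i s s' h1 h2 h3.
have e1 := lag_action_cat L_smooth (pgam i) h1 (le_trans h2 h3).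
have e2 := lag_action_cat L_smooth (pathW (pgam i) h1 (le_trans h2 h3) (lexx b)) h2 h3.
have f1 := action_ge L_smooth HC0 (pathW (pgam i) (lexx a) h1 (le_trans h2 h3)).
have f2 := action_ge L_smooth HC0 (pathW (pgam i) (le_trans h1 h2) h3 (lexx b)).
have f3 := Agam i; have f4 := ler_norm A.
have f5 : C0 * (s - a) + C0 * (b - s') <= C0 * (b - a).
  by rewrite -mulrDr ler_wpM2l //; move: h2; lra.
move: e1 e2 f1 f2 f3 f4 f5; move: (lag_action _ _ _) (lag_action _ _ _) (lag_action _ _ _) (lag_action _ _ _) (lag_action _ _ _).
move: (C0 * _) (C0 * _) (C0 * _) (`|A|) => x1 x2 x3 x4 y1 y2 y3 y4 y5; lra.
Qed.

Variable gs : R -> M.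
Hypothesis gs_lim : forall t, gam i t @[i --> U] --> gs t.

(** All partial actions share a bound, so [no_escape] applies with the same [del] to all paths of
    the sequence; closedness of the box passes the conclusion to the limit. *)
Lemma equicont t0 c r rho : a <= t0 <= b -> atlas c -> cdom c (gs t0) -> cball (cmap c (gs t0)) r `<=` cimg c ->
  0 < rho -> rho <= r -> exists2 del, 0 < del &
  (\forall i \near U, forall s, a <= s <= b -> `|s - t0| <= del -> in_box c (cmap c (gs t0)) rho (gam i s)) /\
  forall s, a <= s <= b -> `|s - t0| <= del -> in_box c (cmap c (gs t0)) rho (gs s).
Proof.
move=> tab ac ct bO rho0 rhor; set p := cmap c (gs t0).
have [B B0 HB] := subaction_bounded.
have [del del0 Hd] := no_escape M_hausdorff g_metric L_smooth L_periodic L_superlinear ac bO rho0 rhor B0.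
have rho2 : 0 < rho / 2 by exact: divr_gt0.
have N1 : \forall i \near U, forall s, a <= s <= b -> `|s - t0| <= del / 2 -> in_box c p rho (gam i s).
  have n1 : \forall i \near U, cdom c (gam i t0) /\ `|cmap c (gam i t0) - p| < rho / 2.
    exact: (gs_lim (near_chart_ball ct rho2)).
  apply: filterS n1 => i [h1 h2] s sab st.
  have [t1 t2] := andP tab; have [s1 s2] := andP sab.
  pose s0 := Num.max a (t0 - del / 2); pose s' := Num.min b (t0 + del / 2).
  have st' : t0 - del / 2 <= s <= t0 + del / 2.
    exact: itv_dist_le.
  have [d1 d2] := andP st'; have del2 : 0 <= del / 2 by rewrite divr_ge0 ?ltW.
  have u1 : s0 <= t0 by rewrite ge_max t1 lerBlDr lerDl.
  have u2 : t0 <= s' by rewrite le_min t2 lerDl.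
  have u3 : a <= s0 by rewrite le_max lexx.
  have u4 : s' <= b by rewrite ge_min lexx.
  have u5 : s' - s0 <= del.
    have v1 : s' <= t0 + del / 2 by rewrite ge_min lexx orbT.
    have v2 : t0 - del / 2 <= s0 by rewrite le_max lexx orbT.
    by move: v1 v2; move: (s') (s0) => x y; lra.
  apply: (Hd s0 s' t0 (gam i)) => //.
  - exact: pathW (pgam i) u3 (le_trans u1 u2) u4.
  - move=> x x' x1 x2 x3; apply: HB => //; [exact: le_trans u3 x1|exact: le_trans x3 u4].
  - by rewrite u1 u2.
  - by split => //; exact: ltW.
  - by rewrite ge_max le_min s1 s2 d1 d2.
exists (del / 2); first exact: divr_gt0.
split => // s sab st; apply: (in_box_closed M_hausdorff) => [|O nO].
  by move=> q hq; apply: bO; exact: le_trans hq rhor.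
have [i [h1 h2]] := @filter_ex _ U _ _ (filterI N1 (gs_lim nO)).
by exists (gam i s); split => //; exact: h1.
Qed.

Lemma coord_lim (c : chart) (t : R) : cdom c (gs t) -> forall e : R, 0 < e ->
  \forall i \near U, cdom c (gam i t) /\ `|cmap c (gam i t) - cmap c (gs t)| < e.
Proof. by move=> ct e e0; exact: (gs_lim (near_chart_ball ct e0)). Qed.

(** The bounded slope provides an extremal [E] with the end points of the limit. A nearly minimizing
    [gam i] cannot cost much more than the competitor given by [window], whose cost is nearly that
    of [E]; the quadratic gain then sends [gam i] to [E]. *)
Lemma limit_window t0 c r k : a <= t0 <= b -> atlas c -> cdom c (gs t0) -> cball (cmap c (gs t0)) r `<=` cimg c -> 0 < r -> 1 <= k ->
  exists2 H, 0 < H & (forall s, a <= s <= b -> `|s - t0| <= H -> cdom c (gs s)) /\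
  forall s t, a <= s -> s < t -> t <= b -> `|s - t0| <= H -> `|t - t0| <= H ->
  `|cmap c (gs t) - cmap c (gs s)| <= k * (t - s) -> exists E w e, [/\ 0 < e, forall x, s - e < x < t + e -> solves c E w x,
    forall x, s <= x <= t -> gs x = cinv c (E x) &
    forall e, 0 < e -> \forall i \near U, lag_action s t (cinv c \o E) <= lag_action s t (gam i) + e].
Proof.
move=> tab ac ct bO r0 k1.
have [H1 [rho [H10 rho0 rhor W]]] := window L_smooth L_periodic L_posdef ac bO r0 k1.
have [del del0 [Q1 Q2]] := equicont tab ac ct bO rho0 rhor.
exists (Num.min (H1 / 2) del); first by rewrite lt_min del0 divr_gt0.
split; first by move=> s sab; rewrite le_min => /andP[_ h]; case: (Q2 s sab h).
move=> s t as_ st tb; rewrite !le_min => /andP[s1 s2] /andP[t1 t2] hk.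
have sab : a <= s <= b by rewrite as_ (le_trans (ltW st)).
have tab' : a <= t <= b by rewrite tb andbT (le_trans as_) // ltW.
have tsH : t - s <= H1.
  by move: s1 t1; rewrite !ler_norml => /andP[? ?] /andP[? ?]; lra.
have [cs hs] := Q2 s sab s2; have [ct' ht] := Q2 t tab' t2.
have [E [w [e [C [sg0 [[Es Et] e0 sE [C0 sg00] HW]]]]]] := W s t _ _ st tsH hs ht hk.
have stI x : s <= x <= t -> a <= x <= b /\ `|x - t0| <= del.
  move=> /andP[x1 x2]; split; first by rewrite (le_trans as_ x1) (le_trans x2 tb).
  move: s2 t2; rewrite !ler_norml => /andP[u1 _] /andP[_ u2].
  by rewrite (le_trans u1) ?lerD2r //= (le_trans _ u2) ?lerD2r.
pose sg i := `|cmap c (gam i s) - cmap c (gs s)| + `|cmap c (gam i t) - cmap c (gs t)|.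
have sgl e' : 0 < e' -> \forall i \near U, sg i <= e'.
  move=> e'0; have e2 : 0 < e' / 2 by exact: divr_gt0.
  apply: filterS2 (coord_lim cs e2) (coord_lim ct' e2) => i [_ h1] [_ h2].
  by rewrite (splitr e'); apply: lerD; exact: ltW.
have pst i : is_path s t (gam i) := pathW (pgam i) as_ (ltW st) tb.
have lowact e' : 0 < e' -> \forall i \near U, C * sg i <= e'.
  move=> e'0; have e2 : 0 < e' / (C + 1) by rewrite divr_gt0 // ltr_wpDl.
  apply: filterS (sgl _ e2) => i h; apply: le_trans (_ : C * (e' / (C + 1)) <= _).
    by rewrite ler_wpM2l.
  by rewrite mulrCA ler_piMr ?(ltW e'0) // ler_pdivrMr ?mul1r ?lerDl ?ltr_wpDl.
have key e' : 0 < e' -> \forall i \near U, (forall x, s <= x <= t -> `|cmap c (gam i x) - E x| ^+ 2 / 4 <= e') /\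
    lag_action s t (cinv c \o E) <= lag_action s t (gam i) + e'.
  move=> e'0; have e3 : 0 < e' / 3 by exact: divr_gt0.
  have ar1 (X Y Z T W' S : R) : X <= (X - Y + Z) + e' / 3 -> Z <= T + S -> S <= e' / 3 -> T + (W' - S) <= Y -> W' <= e'.
    by lra.
  have ar2 (Y T W' S : R) : 0 <= W' -> S <= e' / 3 -> T + (W' - S) <= Y -> T <= Y + e' by move: e'0; lra.
  near=> i.
  have q1 : C * sg i <= e' / 3 by near: i; exact: lowact.
  have q2 : sg i <= sg0 by near: i; exact: sgl.
  have q3 : forall s, a <= s <= b -> `|s - t0| <= del -> in_box c (cmap c (gs t0)) rho (gam i s) by near: i.
  have q4 : forall eta, is_path a b eta -> eta a = gam i a -> eta b = gam i b -> lag_action a b (gam i) <= lag_action a b eta + e' / 3.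
    by near: i; exact: minim.
  have ib x : s <= x <= t -> in_box c (cmap c (gs t0)) rho (gam i x) by move=> /stI[u1 u2]; exact: q3.
  have [w1 w2] := HW (gam i) (pst i) ib.
  have [eta [pe ea eb le]] := w2 q2.
  have [zeta [pz za zb lz]] := subpath_replace L_smooth (pgam i) as_ (ltW st) tb pe ea eb.
  have q5 := q4 zeta pz za zb; rewrite lz in q5.
  split; last first.
    have sst : s <= s <= t by rewrite lexx ltW.
    by apply: (ar2 _ _ _ _ _ q1 (w1 s sst)); rewrite divr_ge0 // sqr_ge0.
  by move=> x xst; exact: ar1 q5 le q1 (w1 x xst).
exists E, w, e; split => //; last first.
  by move=> e' e'0; apply: filterS (key e' e'0) => i [].
move=> x xst; have [xab xd] := stI x xst; have [cx _] := Q2 x xab xd.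
suff -> : E x = cmap c (gs x) by rewrite cmapK.
apply/eqP; rewrite eq_sym -subr_eq0 -normr_eq0; apply/negPn/negP => n0.
have n1 : 0 < `|cmap c (gs x) - E x| by rewrite lt_neqAle eq_sym n0 normr_ge0.
set D := `|_| in n1.
have D4 : 0 < D / 4 by exact: divr_gt0.
have D5 : 0 < (D / 4) ^+ 2 / 4 by rewrite divr_gt0 // exprn_gt0.
have [i [[k2 _] [_ k3]]] := @filter_ex _ U _ _ (filterI (key _ D5) (coord_lim cx D4)).
have := k2 x xst; rewrite ler_pdivrMr // divfK // ler_sqr ?nnegrE ?(ltW D4) // => k4.
have : D <= `|cmap c (gam i x) - cmap c (gs x)| + `|cmap c (gam i x) - E x|.
  by rewrite /D -[X in `|X|](subrKA (cmap c (gam i x))) [X in _ <= X + _]distrC; exact: ler_normD.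
by move: k3 k4 n1; move: (`|_|) (`|_|) (D) => X Y Z; lra.
Unshelve. all: by end_near. Qed.

(** Otherwise, near every instant, no interval eventually has action at most [A1] per unit of time,
    since that would bound the slope of the limit. This failure is additive along the ultrafilter,
    so it would hold on [[a, b]], where [A1] is the mean of the bound [A]. *)
Lemma slow_window : exists t0 c r k, [/\ a <= t0 <= b, atlas c, cdom c (gs t0) & cball (cmap c (gs t0)) r `<=` cimg c] /\
  [/\ 0 < r, 1 <= k & forall H, 0 < H -> exists s t, [/\ a <= s, s < t, t <= b, `|s - t0| <= H /\ `|t - t0| <= H &
     `|cmap c (gs t) - cmap c (gs s)| <= k * (t - s)]].
Proof.
apply: contrapT => N; pose A1 := A / (b - a).
pose P r s := r < s -> ~ \forall i \near U, lag_action r s (gam i) <= A1 * (s - r).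
suff : P a b.
  move=> /(_ ab); apply; apply: filterE => i; rewrite /A1 divfK //.
  by rewrite subr_eq0 gt_eqF.
apply: interval_cousin; first exact: ltW.
  move=> r s t ar rs st tb Prs Pst rt Xrt.
  move: rs; rewrite le_eqVlt => /predU1P[ers|rs]; first by subst s; exact: Pst rt Xrt.
  move: st; rewrite le_eqVlt => /predU1P[est|st]; first by subst t; exact: Prs rs Xrt.
  have [X|X] := in_ultra_setVsetC [set i | lag_action r s (gam i) <= A1 * (s - r)] UU; first exact: Prs rs X.
  apply: (Pst st); apply: filterS2 Xrt X => i h1 h2.
  have h3 := lag_action_cat L_smooth (pathW (pgam i) ar (ltW rt) tb) (ltW rs) (ltW st).
  have {}h2 : A1 * (s - r) < lag_action r s (gam i) by rewrite ltNge; apply/negP.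
  have ar' (X1 X2 X3 : R) : X1 = X2 + X3 -> X1 <= A1 * (t - r) -> A1 * (s - r) < X2 -> X3 <= A1 * (t - s).
    have -> : A1 * (t - r) = A1 * (s - r) + A1 * (t - s) by ring.
    by move: (A1 * (s - r)) (A1 * (t - s)) => u v; lra.
  exact: ar' h3 h1 h2.
move=> t0 tab; pose c := chart_at SM (gs t0); have ac : atlas c := chart_at_atlas SM _.
have ct : cdom c (gs t0) := chart_at_mem SM _.
have [r r0 bO] := chart_ball (cimg_cmap ct).
have [C C0 HC] := box_displacement g_metric L_smooth L_periodic L_superlinear ac bO ler01.
have [del del0 [Q1 Q2]] := equicont tab ac ct bO r0 (lexx r).
(* By [box_displacement] with slope 1, an action at most [A1 * (t - s)] moves a path by at most
   [(A1 + C) * (t - s)] in the chart. *)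
pose k := Num.max 1 (A1 + C).
have [H H0 HH] : exists2 H, 0 < H & forall s t, a <= s -> s < t -> t <= b -> `|s - t0| <= H -> `|t - t0| <= H ->
    ~ `|cmap c (gs t) - cmap c (gs s)| <= k * (t - s).
  apply: contrapT => N'; apply: N; exists t0, c, r, k; split => //; split => //; first by rewrite le_max lexx.
  move=> H H0; apply: contrapT => N2; apply: N'; exists H => // s t h1 h2 h3 h4 h5 h6; apply: N2.
  by exists s, t.
exists (Num.min H del); first by rewrite lt_min H0.
move=> s t as_ st0 t0t tb sm tm st X.
have ds : `|s - t0| <= Num.min H del.
  by apply: dist_itv_le; rewrite (ltW sm) /= (le_trans st0) // lerDl le_min !ltW.
have dt : `|t - t0| <= Num.min H del.
  by apply: dist_itv_le; rewrite (ltW tm) andbT (le_trans _ t0t) // lerBlDr lerDl le_min !ltW.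
move: ds dt; rewrite !le_min => /andP[s1 s2] /andP[t1 t2].
apply: (HH s t) => //.
have sab : a <= s <= b by rewrite as_ (le_trans (ltW st)).
have tab' : a <= t <= b by rewrite tb andbT (le_trans as_) // ltW.
have [cs _] := Q2 s sab s2; have [ct' _] := Q2 t tab' t2.
apply/ler_addgt0Pr => e e0; have e2 : 0 < e / 2 by exact: divr_gt0.
have [i [[x1 x2] [[_ x3] [_ x4]]]] := @filter_ex _ U _ _ (filterI (filterI X Q1) (filterI (coord_lim cs e2) (coord_lim ct' e2))).
have ib x : s <= x <= t -> in_box c (cmap c (gs t0)) r (gam i x).
  move=> /andP[u1 u2]; apply: x2; first by rewrite (le_trans as_ u1) (le_trans u2 tb).
  move: s2 t2; rewrite !ler_norml => /andP[v1 _] /andP[_ v2].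
  by rewrite (le_trans v1) ?lerD2r //= (le_trans _ v2) ?lerD2r.
have x5 := HC s t (gam i) (pathW (pgam i) as_ (ltW st) tb) ib; rewrite mul1r in x5.
have x6 : (A1 + C) * (t - s) <= k * (t - s).
  by rewrite ler_wpM2r ?subr_ge0 ?(ltW st) // le_max lexx orbT.
have x7 : `|cmap c (gs t) - cmap c (gs s)| <= `|cmap c (gam i t) - cmap c (gs t)| + `|cmap c (gam i t) - cmap c (gam i s)| + `|cmap c (gam i s) - cmap c (gs s)|.
  rewrite -(subrKA (cmap c (gam i s))) -(subrKA (cmap c (gam i t)) (cmap c (gs t))) [X in _ <= X + _ + _]distrC.
  by apply: le_trans (ler_normD _ _) _; rewrite lerD2r; exact: ler_normD.
have ar' (X1 X2 X3 X4 X5 Y Z W : R) : X5 <= X1 + X2 + X3 -> X1 < e / 2 -> X3 < e / 2 -> X2 - Z <= X4 -> X4 <= Y -> Y + Z <= W -> X5 <= W + e by lra.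
by apply: (ar' _ _ _ _ _ _ _ _ x7 x4 x3 x5 x1); rewrite -mulrDl.
Qed.

Lemma solves_extremal c (E w : R -> V) s t : atlas c -> (forall x, s < x < t -> solves c E w x) ->
  forall x, s < x < t -> extremal_at (cinv c \o E) x.
Proof.
move=> ac H x xst; exists c, E, w; split => //.
apply: filterS (near_in_itvoo (a := s) (b := t) _) => [y|]; last by rewrite in_itv.
by rewrite in_itv /= => /H.
Qed.

Lemma first_piece : exists Gam r s, [/\ orbit Gam, a <= r, r < s, s <= b & forall x, r <= x <= s -> gs x = Gam x].
Proof.
have [t0 [c [r [k [[tab ac ct bO] [r0 k1 SW]]]]]] := slow_window.
have [H H0 [_ W]] := limit_window tab ac ct bO r0 k1.
have [s [t [as_ st tb [s1 t1] h]]] := SW H H0.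
have [E [w [e [e0 sE gE _]]]] := W s t as_ st tb s1 t1 h.
have se : s - e < t + e by rewrite ltrBlDr (lt_trans st) // -addrA ltrDl addr_gt0.
have [Gam oG GE] := orbit_extension L_smooth L_periodic L_posdef M_hausdorff L_complete se (solves_extremal ac sE).
exists Gam, s, t; split => // x /[dup] xst /andP[x1 x2]; rewrite gE // GE //.
by rewrite ltrBlDr (le_lt_trans x1) ?ltrDl // (le_lt_trans x2) // ltrDl.
Qed.

(** The extremal of the window and the orbit [Gam] coincide on a subinterval, hence have a common
    jet there, and uniqueness identifies them on the whole window. *)
Lemma window_extends Gam t0 c r k : orbit Gam -> a <= t0 <= b -> atlas c -> cdom c (gs t0) ->
  cball (cmap c (gs t0)) r `<=` cimg c -> 0 < r -> 1 <= k -> exists2 H, 0 < H & (forall s, a <= s <= b -> `|s - t0| <= H -> cdom c (gs s)) /\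
  forall s t, a <= s -> s < t -> t <= b -> `|s - t0| <= H -> `|t - t0| <= H ->
  `|cmap c (gs t) - cmap c (gs s)| <= k * (t - s) ->
  (exists s' t', [/\ s <= s', s' < t', t' <= t & forall x, s' <= x <= t' -> gs x = Gam x]) ->
  (forall x, s <= x <= t -> gs x = Gam x) /\
  forall e, 0 < e -> \forall i \near U, lag_action s t Gam <= lag_action s t (gam i) + e.
Proof.
move=> oG tab ac ct bO r0 k1; have [H H0 [Hc W]] := limit_window tab ac ct bO r0 k1; exists H => //; split => //.
move=> s t as_ st tb s1 t1 h [s' [t' [ss' st' tt' gG]]].
have [E [w [e [e0 sE gE lE]]]] := W s t as_ st tb s1 t1 h.
have xE := solves_extremal ac sE.
have inI x : s <= x <= t -> s - e < x < t + e.
  by move=> /andP[x1 x2]; rewrite ltrBlDr (le_lt_trans x1) ?ltrDl // (le_lt_trans x2) // ltrDl.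
pose m := (s' + t') / 2.
have [m1 m2] : s' < m /\ m < t' by rewrite /m !midf_lt.
have J : same_jet SM Gam (cinv c \o E) m.
  apply: jet_near; apply: filterS (near_in_itvoo (a := s') (b := t') _) => [y|]; last by rewrite in_itv /= m1 m2.
  rewrite in_itv /= => /andP[y1 y2]; rewrite -gG ?(ltW y1) ?(ltW y2) // gE //.
  by rewrite (le_trans ss' (ltW y1)) (le_trans (ltW y2) tt').
have mst : s <= m <= t by rewrite (le_trans ss' (ltW m1)) (le_trans (ltW m2) tt').
have JJ x : s <= x <= t -> same_jet SM Gam (cinv c \o E) x.
  apply: (extremal_unique L_smooth L_periodic L_posdef M_hausdorff) => [y yst|]; last by exists m.
  by split; [exact: oG|exact: xE (inI y yst)].
have GE x : s <= x <= t -> gs x = Gam x by move=> xst; rewrite (gE x xst); have [-> _] := JJ x xst.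
have [pE _] := solves_path L_smooth ac (ltW st) e0 sE.
have LE : lag_action s t (cinv c \o E) = lag_action s t Gam.
  apply: (lag_action_congr L_smooth _ pE) => x; rewrite in_itv /= => xst.
  by have [-> _] := JJ x xst.
split; first exact: GE.
by move=> e' e'0; have := lE e' e'0; rewrite LE.
Qed.

Lemma slow_chart Gam t0 : orbit Gam -> a <= t0 <= b -> gs t0 = Gam t0 ->
  exists c r k del, [/\ atlas c, cdom c (gs t0), cball (cmap c (gs t0)) r `<=` cimg c, 0 < r & 1 <= k] /\
  [/\ 0 < del, forall x, `|x - t0| <= del -> cdom c (Gam x) &
    forall x y, `|x - t0| <= del -> `|y - t0| <= del -> `|cmap c (Gam x) - cmap c (Gam y)| <= k * `|x - y| ].
Proof.
move=> oG tab E; pose c := chart_at SM (gs t0); have ac : atlas c := chart_at_atlas SM _.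
have ct : cdom c (gs t0) := chart_at_mem SM _.
have [r r0 bO] := chart_ball (cimg_cmap ct).
have [|w Hw] := extremal_in L_smooth L_periodic L_posdef (oG t0) ac; first by rewrite -E.
have [_ [_ _ dw']] := nbhs_singleton Hw.
have cw : {for t0, continuous w} := is_derive_continuous dw'.
pose k := `|w t0| + 1; have k1 : 1 <= k by rewrite lerDr.
have nw : \forall x \near t0, `|w x| <= k.
  have : \forall x \near t0, `|w t0 - w x| < 1.
    by have /cvgrPdist_lt K1 : w x @[x --> t0] --> w t0 := cw; exact: K1 _ ltr01.
  apply: filterS => x h; rewrite -[X in `|X|](subrK (w t0)); apply: le_trans (ler_normD _ _) _.
  by rewrite /k addrC lerD2l distrC ltW.
have [e e0 He] := near_interval (filterI Hw nw).
have e2 : 0 < e / 2 by exact: divr_gt0.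
have ee (x : R) : `|x - t0| <= e / 2 -> `|x - t0| < e by move=> h; apply: le_lt_trans h _; exact: half_lt.
exists c, r, k, (e / 2); split => //; split => // [x /ee/He[[]]//|x y hx hy].
have hI z : t0 - e / 2 <= z <= t0 + e / 2 -> `|z - t0| < e by move=> /dist_itv_le/ee.
apply: (@mean_value_abs _ _ (cmap c \o Gam) w (t0 - e / 2) (t0 + e / 2)); [exact: le_trans k1|..|exact: itv_dist_le|exact: itv_dist_le].
- by move=> z /hI/He[[_ []]].
- by move=> z /hI/He[_].
Qed.

(** The set of times up to which the limit follows the orbit found in [first_piece] is shown to be
    open and closed in [[a, b]]. Openness is the delicate part, because no slope bound is known
    beyond the current time [t]. *)
Lemma limit_orbit : exists2 Gam, orbit Gam & forall t, a <= t <= b -> gs t = Gam t.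
Proof.
have [Gam [r [s [oG ar rs sb gG]]]] := first_piece; exists Gam => //.
pose m := (r + s) / 2; have [rm ms] : r < m /\ m < s by rewrite /m !midf_lt.
pose G t := forall x, Num.min m t <= x <= Num.max m t -> gs x = Gam x.
suff : forall t, a <= t <= b -> G t by move=> H t /H; apply; rewrite ge_min le_max lexx !orbT.
have GL t x : G t -> t <= x <= m -> gs x = Gam x.
  by move=> Gt /andP[h1 h2]; apply: Gt; rewrite ge_min le_max h1 h2 orbT.
have GR t x : G t -> m <= x <= t -> gs x = Gam x.
  by move=> Gt /andP[h1 h2]; apply: Gt; rewrite ge_min le_max h1 h2 orbT.
have mk t : (forall x, t <= x <= m -> gs x = Gam x) -> (forall x, m <= x <= t -> gs x = Gam x) -> G t.
  move=> h1 h2 x; rewrite ge_min le_max => /andP[/orP x1 /orP x2].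
  have [tx|xt] := leP t x; last first.
    by apply: h2; rewrite (ltW xt) andbT; case: x1 => // x1; lra.
  have [xm|mx] := leP x m; first by apply: h1; rewrite tx xm.
  by apply: h2; rewrite (ltW mx) /=; case: x2 => // x2; lra.
apply: interval_clopen.
- exists m; first by rewrite (le_trans ar (ltW rm)) (le_trans (ltW ms) sb).
  by apply: mk => x /andP[x1 x2]; apply: gG; apply/andP; split; lra.
- move=> t tab Gt.
  have Et : gs t = Gam t by apply: Gt; rewrite ge_min le_max lexx !orbT.
  have [c [q [k [del [[ac ct bO q0 k1] [del0 cG lipG]]]]]] := slow_chart oG tab Et.
  have k2 : 1 <= 2 * k by move: k1; lra.
  have k0 : 0 < k by apply: lt_le_trans k1.
  have [H H0 [Hc W]] := window_extends oG tab ac ct bO q0 k2.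
  have [ta tb] := andP tab.
  have [mt|tm|em] := ltgtP m t.
  (* The window [[t - sg, x]] straddles [t]. On its left part the limit is [Gam], of slope at most
     [k]; beyond [t], [equicont] bounds the displacement by [k * sg]. As the window is longer than
     [sg], the chord has slope at most [2 * k]. *)
  + pose sg := Num.min (t - m) (Num.min del H).
    have sg0 : 0 < sg by rewrite !lt_min subr_gt0 mt del0 H0.
    have [sg1 sg2 sg3] : [/\ sg <= t - m, sg <= del & sg <= H] by rewrite /sg !ge_min !lexx !orbT.
    clearbody sg.
    pose rho := Num.min q (k * sg).
    have rho0 : 0 < rho by rewrite lt_min q0 mulr_gt0.
    have [del' del0' [_ Q]] := equicont tab ac ct bO rho0 (ltac:(by rewrite ge_min lexx)).
    pose e := Num.min sg del'.
    have e0 : 0 < e by rewrite lt_min sg0.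
    have [e1 e2] : e <= sg /\ e <= del' by split; rewrite /e ge_min lexx ?orbT.
    clearbody e.
    exists e => // x xab; rewrite ltr_norml => /andP[x1 x2].
    have [xt|tx] := leP x t.
      apply: mk => y /andP[y1 y2]; last by apply: (GR t) => //; rewrite y1 (le_trans y2 xt).
      by exfalso; lra.
    have mts : m <= t - sg by lra.
    have tts : t - sg < t by rewrite gtrBl.
    have sst : `|t - sg - t| = sg by rewrite addrAC subrr add0r normrN gtr0_norm.
    have xt : `|x - t| = x - t by rewrite gtr0_norm // subr_gt0.
    have disp : `|cmap c (gs x) - cmap c (gs (t - sg))| <= 2 * k * (x - (t - sg)).
      have b1 : `|cmap c (gs x) - cmap c (gs t)| <= k * sg.
        have [|_ h] := Q x xab; first by rewrite xt; lra.
        by apply: le_trans h _; rewrite ge_min lexx orbT.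
      have b2 : `|cmap c (gs t) - cmap c (gs (t - sg))| <= k * sg.
        rewrite Et (GR t (t - sg)) //; last by rewrite mts ltW.
        apply: le_trans (lipG t (t - sg) _ _) _; [by rewrite subrr normr0 ltW|by rewrite sst|].
        by rewrite opprB addrCA subrr addr0 gtr0_norm.
      rewrite -(subrKA (cmap c (gs t))); apply: le_trans (ler_normD _ _) (le_trans (lerD b1 b2) _).
      have -> : k * sg + k * sg = 2 * k * sg by ring.
      by rewrite ler_wpM2l; [|lra|lra].
    have [||||||gW _] := W (t - sg) x _ _ _ _ _ disp _.
    * by lra.
    * by lra.
    * by case/andP: xab.
    * by rewrite sst.
    * by rewrite xt; lra.
    * exists (t - sg), t; split => //; first exact: ltW.
      by move=> y /andP[y1 y2]; apply: (GR t) => //; rewrite y2 andbT (le_trans mts).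
    apply: mk => y /andP[y1 y2]; first by exfalso; lra.
    have [yt|ty] := leP y t; first by apply: (GR t) => //; rewrite y1.
    by apply: gW; rewrite y2 andbT (le_trans (ltW tts) (ltW ty)).
  + pose sg := Num.min (m - t) (Num.min del H).
    have sg0 : 0 < sg by rewrite !lt_min subr_gt0 tm del0 H0.
    have [sg1 sg2 sg3] : [/\ sg <= m - t, sg <= del & sg <= H] by rewrite /sg !ge_min !lexx !orbT.
    clearbody sg.
    pose rho := Num.min q (k * sg).
    have rho0 : 0 < rho by rewrite lt_min q0 mulr_gt0.
    have [del' del0' [_ Q]] := equicont tab ac ct bO rho0 (ltac:(by rewrite ge_min lexx)).
    pose e := Num.min sg del'.
    have e0 : 0 < e by rewrite lt_min sg0.
    have [e1 e2] : e <= sg /\ e <= del' by split; rewrite /e ge_min lexx ?orbT.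
    clearbody e.
    exists e => // x xab; rewrite ltr_norml => /andP[x1 x2].
    have [tx|xt] := leP t x.
      apply: mk => y /andP[y1 y2]; first by apply: (GL t) => //; rewrite y2 (le_trans tx y1).
      by exfalso; lra.
    have mts : t + sg <= m by lra.
    have tts : t < t + sg by rewrite ltrDl.
    have sst : `|t + sg - t| = sg by rewrite addrAC subrr add0r gtr0_norm.
    have xtE : `|x - t| = t - x by rewrite ltr0_norm ?opprB // subr_lt0.
    have disp : `|cmap c (gs (t + sg)) - cmap c (gs x)| <= 2 * k * (t + sg - x).
      have b1 : `|cmap c (gs t) - cmap c (gs x)| <= k * sg.
        rewrite distrC; have [|_ h] := Q x xab; first by rewrite xtE; lra.
        by apply: le_trans h _; rewrite ge_min lexx orbT.
      have b2 : `|cmap c (gs (t + sg)) - cmap c (gs t)| <= k * sg.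
        rewrite Et (GL t (t + sg)) //; last by rewrite mts andbT ltW.
        apply: le_trans (lipG (t + sg) t _ _) _; [by rewrite sst|by rewrite subrr normr0 ltW|].
        by rewrite sst.
      rewrite -(subrKA (cmap c (gs t))); apply: le_trans (ler_normD _ _) (le_trans (lerD b2 b1) _).
      have -> : k * sg + k * sg = 2 * k * sg by ring.
      by rewrite ler_wpM2l; [|lra|lra].
    have [||||||gW _] := W x (t + sg) _ _ _ _ _ disp _.
    * by case/andP: xab.
    * by lra.
    * by lra.
    * by rewrite xtE; lra.
    * by rewrite sst.
    * exists t, (t + sg); split => //; first exact: ltW.
      by move=> y /andP[y1 y2]; apply: (GL t) => //; rewrite y1 (le_trans y2).
    apply: mk => y /andP[y1 y2]; last by exfalso; lra.
    have [ty|yt] := leP t y; first by apply: (GL t) => //; rewrite ty.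
    by apply: gW; rewrite y1 (le_trans (ltW yt) (ltW tts)).
  + exists (Num.min (m - r) (s - m)); first by rewrite lt_min !subr_gt0 rm.
    move=> x xab; rewrite -em ltr_norml lt_min => /andP[]; rewrite ltrNl lt_min => /andP[x1 _] /andP[_ x2].
    by apply: mk => y /andP[y1 y2]; apply: gG; apply/andP; split; lra.
- move=> t tab H.
  have strict x : (t < x <= m) || (m <= x < t) -> gs x = Gam x.
    move=> /orP[/andP[x1 x2]|/andP[x1 x2]].
      have [|y [_ yt Gy]] := H (x - t); first by rewrite subr_gt0.
      apply: (GL y) => //; rewrite x2 andbT; move: yt; rewrite ltr_norml => /andP[_ yt]; lra.
    have [|y [_ yt Gy]] := H (t - x); first by rewrite subr_gt0.
    apply: (GR y) => //; rewrite x1 /=; move: yt; rewrite ltr_norml => /andP[yt _]; lra.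
  have Et : gs t = Gam t.
    (* Near a limit instant there are times at which [gs] equals the continuous [Gam], while
       [equicont] keeps [gs] close to its value at [t]; Hausdorff separation identifies the two
       values. *)
    apply: hausdorff_eq => A1 B1 nA nB.
    have [c [q [k [del [ac ct bO q0]]]]] : exists c q (k : R) (del : R), [/\ atlas c, cdom c (gs t), cball (cmap c (gs t)) q `<=` cimg c & 0 < q].
      have ct := chart_at_mem SM (gs t); have [q q0 bO] := chart_ball (cimg_cmap ct).
      by exists (chart_at SM (gs t)), q, 1, 1; split => //; exact: chart_at_atlas.
    have nA' : \forall y \near cmap c (gs t), A1 (cinv c y).
      by apply: (cinv_cont (cimg_cmap ct)); rewrite cmapK.
    have [e1 e10 He1] := near_interval nA'.
    pose rho := Num.min q (e1 / 2).
    have rho0 : 0 < rho by rewrite lt_min q0 divr_gt0.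
    have [d1 d10 [_ Q]] := equicont tab ac ct bO rho0 (ltac:(by rewrite ge_min lexx)).
    have [d2 d20 Hd2] := near_interval (extremal_cont (oG t) nB).
    pose dd := Num.min d1 d2; have dd0 : 0 < dd by rewrite lt_min d10.
    have [y [yab yt Gy]] := H dd dd0.
    exists (gs y); split; last first.
      rewrite (_ : gs y = Gam y); last by apply: Gy; rewrite ge_min le_max lexx !orbT.
      by apply: Hd2; apply: lt_le_trans yt _; rewrite ge_min lexx orbT.
    have [|cy hy] := Q y yab; first by apply: ltW; apply: lt_le_trans yt _; rewrite ge_min lexx.
    rewrite -(cmapK cy); apply: He1; apply: le_lt_trans hy _; rewrite gt_min; apply/orP; right; exact: half_lt.
  apply: mk => x /andP[]; rewrite le_eqVlt.
    by move=> /predU1P[<-//|h1 h2]; apply: strict; rewrite h1 h2.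
  by rewrite -le_eqVlt => h1; rewrite le_eqVlt => /predU1P[->//|h2]; apply: strict; rewrite h1 h2 orbT.
Qed.

(** Since the limit is an orbit, every short chord has bounded slope and [window_extends] gives
    semicontinuity there. The estimates add up over adjacent intervals, each taking half of the
    error. *)
Lemma action_lsc Gam : orbit Gam -> (forall t, a <= t <= b -> gs t = Gam t) ->
  forall e, 0 < e -> \forall i \near U, lag_action a b Gam <= lag_action a b (gam i) + e.
Proof.
move=> oG gG.
have ar1 (X1 X2 Y1 Y2 e : R) : X1 <= Y1 + e / 2 -> X2 <= Y2 + e / 2 -> X1 + X2 <= Y1 + Y2 + e by lra.
have pG s t : s <= t -> is_path s t Gam by move=> st; exact: orbit_path.
pose P s t := forall e, 0 < e -> \forall i \near U, lag_action s t Gam <= lag_action s t (gam i) + e.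
suff : P a b by [].
apply: interval_cousin; first exact: ltW.
  move=> r s t ar rs st tb Prs Pst e e0; have e2 : 0 < e / 2 by exact: divr_gt0.
  apply: filterS2 (Prs _ e2) (Pst _ e2) => i h1 h2.
  rewrite (lag_action_cat L_smooth (pG r t (le_trans rs st)) rs st).
  rewrite (lag_action_cat L_smooth (pathW (pgam i) ar (le_trans rs st) tb) rs st).
  exact: ar1 h1 h2.
move=> t0 tab; have [c [r [k [del [[ac ct bO r0 k1] [del0 cG lipG]]]]]] := slow_chart oG tab (gG t0 tab).
have [H H0 [_ W]] := window_extends oG tab ac ct bO r0 k1.
exists (Num.min H del); first by rewrite lt_min H0.
move=> s t as_ st0 t0t tb sm tm e e0.
have : s <= t := le_trans st0 t0t; rewrite le_eqVlt => /predU1P[<-|st].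
  by apply: filterE => i; rewrite !(lag_actionxx SM L) add0r ltW.
have ds : `|s - t0| <= Num.min H del.
  by apply: dist_itv_le; rewrite (ltW sm) /= (le_trans st0) // lerDl le_min !ltW.
have dt : `|t - t0| <= Num.min H del.
  by apply: dist_itv_le; rewrite (ltW tm) andbT (le_trans _ t0t) // lerBlDr lerDl le_min !ltW.
move: ds dt; rewrite !le_min => /andP[s1 s2] /andP[t1 t2].
have gst x : s <= x <= t -> gs x = Gam x.
  by move=> /andP[x1 x2]; apply: gG; rewrite (le_trans as_ x1) (le_trans x2 tb).
have [||_ h] := W s t as_ st tb s1 t1; last exact: h.
  rewrite !gst ?lexx ?(ltW st) //; apply: le_trans (lipG t s t2 s2) _.
  by rewrite gtr0_norm // subr_gt0.
by exists s, t.
Qed.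

Lemma minimizing_sequence : exists Gam, [/\ orbit Gam, forall t, a <= t <= b -> gam i t @[i --> U] --> Gam t &
  forall e, 0 < e -> \forall i \near U, lag_action a b Gam <= lag_action a b (gam i) + e].
Proof.
have [Gam oG gG] := limit_orbit; exists Gam; split => //; last exact: action_lsc.
by move=> t tab; rewrite -gG.
Qed.

End Sequence.

Lemma free_ultrafilter : exists2 U : set_system nat, UltraFilter U & forall n, \forall i \near U, (n <= i)%N.
Proof.
have [U [UU sU]] := ultraFilterLemma (F := \oo) _; exists U => // n; apply: sU; exact: nbhs_infty_ge.
Qed.

(** The constant sequence is minimizing, and it is its own limit. *)
Lemma minimizer_orbit a b gamma : a < b -> minimizes a b gamma -> exists2 Gam, orbit Gam & forall t, a <= t <= b -> gamma t = Gam t.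
Proof.
move=> ab [pg mg]; have [U UU _] := free_ultrafilter.
have UP : ProperFilter U := @ultra_proper _ _ UU.
have lim (t : R) : gamma t @[i --> U] --> gamma t by exact: cvg_cst.
have [|Gam oG gG] := @limit_orbit U UU a b (fun=> gamma) (lag_action a b gamma) ab (fun=> pg) (fun=> lexx _) _ gamma lim.
  move=> e e0; apply: filterE => i eta pe ea eb; apply: le_trans (mg eta pe ea eb) _.
  by rewrite lerDl ltW.
by exists Gam.
Qed.

Hypothesis M_connected : connected [set: M].

Lemma minimizer_exists a b x y : a < b -> exists gamma, [/\ minimizes a b gamma, orbit gamma, gamma a = x & gamma b = y].
Proof.
move=> ab; have ba : 0 < b - a by rewrite subr_gt0.
have [C0 C00 HC0] := lagrangian_lower_bound M_compact g_metric L_smooth L_periodic L_superlinear.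
have [C HC] := uniform_link M_compact L_smooth L_periodic M_connected ba.
have [g0 [p0 x0 y0 a0]] := HC a x y.
have abE : a + (b - a) = b by rewrite addrC subrK.
rewrite abE in p0 y0 a0.
pose S := [set r | exists gamma, [/\ is_path a b gamma, gamma a = x, gamma b = y & lag_action a b gamma = r]].
have Sne : S !=set0 by exists (lag_action a b g0), g0.
have Slb : has_lbound S.
  by exists (- (C0 * (b - a))) => r [gamma [p _ _ <-]]; exact: (action_ge L_smooth HC0).
have Sinf : has_inf S by split.
have seq n : exists gamma, [/\ is_path a b gamma, gamma a = x, gamma b = y & lag_action a b gamma < inf S + n.+1%:R^-1].
  have n0 : 0 < n.+1%:R^-1 :> R by rewrite invr_gt0.
  have [r [gamma [p h1 h2 <-]] h3] := inf_adherent n0 Sinf.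
  by exists gamma.
have [gam Hgam] := fun_choice seq.
have [U UU tails] := free_ultrafilter.
have UP : ProperFilter U := @ultra_proper _ _ UU.
have [gs gs_lim] := ultra_limit UU gam.
have infle gamma : is_path a b gamma -> gamma a = x -> gamma b = y -> inf S <= lag_action a b gamma.
  by move=> p h1 h2; apply: ge_inf => //; exists gamma.
have small e : 0 < e -> \forall i \near U, lag_action a b (gam i) <= inf S + e.
  move=> e0; have := near_infty_natSinv_lt (PosNum e0).
  move=> [n _ Hn]; apply: filterS (tails n) => i ni; have [_ _ _ h] := Hgam i.
  by apply: le_trans (ltW h) _; rewrite lerD2l; apply: ltW; exact: Hn.
have [|||Gam [oG GL Gle]] := @minimizing_sequence U UU a b gam (inf S + 1) ab _ _ _ gs gs_lim.
- by move=> i; case: (Hgam i).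
- move=> i; have [_ _ _ h] := Hgam i; apply: le_trans (ltW h) _; rewrite lerD2l invf_le1 //.
  by rewrite ler1n.
- move=> e e0; apply: filterS (small e e0) => i h eta pe ea eb; apply: le_trans h _; rewrite lerD2r.
  by have [_ h1 h2 _] := Hgam i; apply: infle => //; rewrite ?ea ?eb.
have ends t z : (forall i, gam i t = z) -> a <= t <= b -> Gam t = z.
  move=> h tab; have := GL t tab; rewrite (_ : (fun i => gam i t) = cst z); last exact/funext.
  move=> cz; apply: hausdorff_eq => B D nB nD; exists z; split; last exact: nbhs_singleton nD.
  by have [i Hi] := @filter_ex _ U _ _ (cz _ nB).
have Ga : Gam a = x by apply: ends => [i|]; [by case: (Hgam i)|rewrite lexx ltW].
have Gb : Gam b = y by apply: ends => [i|]; [by case: (Hgam i)|rewrite lexx ltW].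
exists Gam; split; [|exact: oG|exact: Ga|exact: Gb].
split; first exact: orbit_path oG (ltW ab).
move=> eta pe ea eb; apply: le_trans (_ : inf S <= _); last by apply: infle; rewrite ?ea ?eb.
apply/ler_addgt0Pr => e e0; have e2 : 0 < e / 2 by exact: divr_gt0.
have [i [h1 h2]] := @filter_ex _ U _ _ (filterI (Gle _ e2) (small _ e2)).
apply: le_trans h1 _; rewrite [X in _ <= _ + X]splitr addrA lerD2r; exact: h2.
Qed.

End Tonelli.

(** * The action potential *)

Lemma usc_arith {R : realType} (B1 B2 C0 eta X1 X2 X3 X4 X5 X6 A1 A2 A3 A4 : R) : 0 < eta -> X1 <= X2 + X3 -> X3 <= X4 + X5 ->
  X2 <= B1 * (2 * eta) -> X5 <= B2 * (2 * eta) -> X4 <= A2 -> X6 = A1 + A4 -> A4 = A2 + A3 -> - (C0 * eta) <= A1 -> - (C0 * eta) <= A3 ->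
  X1 <= X6 + (2 * B1 + 2 * B2 + 2 * C0 + 1) * eta.
Proof.
have -> : (2 * B1 + 2 * B2 + 2 * C0 + 1) * eta = B1 * (2 * eta) + B2 * (2 * eta) + C0 * eta + C0 * eta + eta by ring.
by move: (B1 * _) (B2 * _) (C0 * eta) => u v w'; lra.
Qed.

Lemma lsc_arith {R : realType} (B1 B2 eta e X Y Z T A1 A2 : R) : 0 < eta -> (4 * B1 + 4 * B2 + 1) * eta <= e ->
  X <= Y + e / 2 -> Y <= A1 + T -> T <= Z + A2 -> A1 <= B1 * (2 * eta) -> A2 <= B2 * (2 * eta) -> X <= Z + e.
Proof.
have -> : (4 * B1 + 4 * B2 + 1) * eta = (B1 * (2 * eta) + B2 * (2 * eta)) * 2 + eta by ring.
by move: (B1 * _) (B2 * _) => u v; lra.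
Qed.

Lemma order_arith {R : realType} (s s0 t t0 eta : R) : 0 < eta -> eta <= (t0 - s0) / 4 -> - (eta / 2) < s - s0 -> s - s0 < eta / 2 ->
  - (eta / 2) < t - t0 -> t - t0 < eta / 2 -> [/\ s < s0 + eta, s0 + eta < t0 - eta, t0 - eta < t & s < t] /\
  [/\ eta / 2 <= s0 + eta - s, s0 + eta - s <= 2 * eta, eta / 2 <= t - (t0 - eta) & t - (t0 - eta) <= 2 * eta].
Proof. by move=> ? ? ? ? ? ?; split; split; lra. Qed.

Lemma order_arith2 {R : realType} (s s0 t t0 eta : R) : 0 < eta -> - (eta / 2) < s - s0 -> s - s0 < eta / 2 ->
  - (eta / 2) < t - t0 -> t - t0 < eta / 2 -> [/\ s0 - eta < s, eta / 2 <= s - (s0 - eta) & s - (s0 - eta) <= 2 * eta] /\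
  [/\ t < t0 + eta, eta / 2 <= t0 + eta - t & t0 + eta - t <= 2 * eta].
Proof. by move=> ? ? ? ? ?; split; split; lra. Qed.

Lemma cancel_arith {R : realType} (X Y Z e : R) : 0 < e -> X <= X - Y + Z -> Y <= Z + e.
Proof. by lra. Qed.

Lemma subaction_arith {R : realType} (A e X Y1 Y2 Y3 Z u v w : R) : 0 < e -> X = Y1 + Z -> Z = Y2 + Y3 -> - u <= Y1 -> - v <= Y3 ->
  u + v <= w -> X <= A - e -> Y2 <= `|A| + w.
Proof. by have := ler_norm A; lra. Qed.

Lemma stretch_arith {R : realType} (A e X Y T A1 A2 A3 w : R) : 0 < e -> A <= X -> X <= A2 + e / 4 -> Y = A1 + T -> T = A2 + A3 ->
  - w <= A1 -> - w <= A3 -> w <= e / 4 -> Y <= A - e -> False.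
Proof. by lra. Qed.

Section Potential.
Context {R : realType} {M : ptopologicalType} {d : nat}.
Variable SM : smooth_structure R M d.
Hypothesis M_hausdorff : hausdorff_space M.
Hypothesis M_compact : compact [set: M].
Hypothesis M_connected : connected [set: M].
Notation V := 'rV[R]_d.
Notation atlas := (atlas SM).
Notation is_path := (is_path SM).
Variable g : M -> V -> V -> R.
Hypothesis g_metric : is_riemannian_metric SM g.
Variable L : M -> V -> R -> R.
Hypothesis L_smooth : lagrangian_smooth SM L.
Hypothesis L_periodic : lagrangian_periodic L.
Hypothesis L_superlinear : lagrangian_superlinear g L.
Hypothesis L_posdef : lagrangian_posdef L.
Hypothesis L_complete : EL_complete SM L.
Notation lag_action := (lag_action SM L).
Notation min_action := (min_action SM L).
Notation orbit := (orbit SM L).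
Notation minimizes := (minimizes SM L).

Definition potential (a b : R) (x y : M) : R := fine (min_action a b x y).
Notation F := potential.

#[local] Opaque Defs.lag_action.

Lemma min_actionE a b gamma : minimizes a b gamma -> min_action a b (gamma a) (gamma b) = (lag_action a b gamma)%:E.
Proof.
move=> [pg mg]; apply/eqP; rewrite eq_le; apply/andP; split.
  by apply: ereal_inf_lbound; exists gamma.
by apply: le_ereal_inf_tmp => _ [eta [p1 h1 h2] <-]; rewrite lee_fin; exact: mg.
Qed.

Lemma potential_attained a b x y : a < b -> exists gamma, [/\ is_path a b gamma, orbit gamma, gamma a = x, gamma b = y & lag_action a b gamma = F a b x y].
Proof.
move=> ab; have [gamma [mg og ga gb]] := minimizer_exists M_hausdorff M_compact g_metric L_smooth L_periodic L_superlinear L_posdef L_complete M_connected x y ab.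
exists gamma; split => //; first by case: mg.
by rewrite /F -ga -gb min_actionE.
Qed.

Lemma min_action_fin a b x y : a < b -> min_action a b x y = (F a b x y)%:E.
Proof.
move=> ab; have [gamma [mg og <- <-]] := minimizer_exists M_hausdorff M_compact g_metric L_smooth L_periodic L_superlinear L_posdef L_complete M_connected x y ab.
by rewrite /F min_actionE.
Qed.

#[local] Opaque potential Defs.min_action.

Lemma potential_le a b gamma : a < b -> is_path a b gamma -> F a b (gamma a) (gamma b) <= lag_action a b gamma.
Proof.
move=> ab pg; rewrite -lee_fin -(min_action_fin _ _ ab).
by apply: ereal_inf_lbound; exists gamma.
Qed.

Lemma potential_minimizes a b gamma : a < b -> is_path a b gamma -> lag_action a b gamma <= F a b (gamma a) (gamma b) -> minimizes a b gamma.
Proof.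
move=> ab pg le; split; [exact: pg|move=> eta pe ea eb]; apply: le_trans le _; rewrite -ea -eb; exact: potential_le.
Qed.

Lemma potential_tri a b c x y z : a < b -> b < c -> F a c x z <= F a b x y + F b c y z.
Proof.
move=> ab bc; have [g1 [p1 _ a1 b1 <-]] := potential_attained x y ab.
have [g2 [p2 _ a2 b2 <-]] := potential_attained y z bc.
have E : g1 b = g2 b by rewrite b1 a2.
rewrite -(lag_action_glue L_smooth p1 p2 E) -a1 -b2.
have := potential_le (lt_trans ab bc) (path_glue p1 p2 E).
by rewrite /splice (ltW ab) [c <= b]leNgt bc.
Qed.

Lemma potential_split a b c x z : a < b -> b < c -> exists y, F a c x z = F a b x y + F b c y z.
Proof.
move=> ab bc; have [gamma [p _ h1 h2 h3]] := potential_attained x z (lt_trans ab bc).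
exists (gamma b); apply/eqP; rewrite eq_le potential_tri //= -h3 (lag_action_cat L_smooth p (ltW ab) (ltW bc)) -h1 -h2.
by apply: lerD; apply: potential_le => //; apply: pathW p _ _ _; rewrite ?lexx ?(ltW ab) ?(ltW bc).
Qed.

Lemma potential_shift_le (k : int) a b x y : a < b -> F a b x y <= F (a + k%:~R) (b + k%:~R) x y.
Proof.
move=> ab; have ab' : a + k%:~R < b + k%:~R by rewrite ltrD2r.
have [gamma [p _ h1 h2 <-]] := potential_attained x y ab'.
rewrite -(lag_action_shift L_smooth L_periodic p) -h1 -h2.
exact: (potential_le ab (path_shift p)).
Qed.

Lemma potential_shift (k : int) a b x y : a < b -> F (a + k%:~R) (b + k%:~R) x y = F a b x y.
Proof.
move=> ab; apply/eqP; rewrite eq_le (potential_shift_le _ _ _ ab) andbT.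
have ab' : a + k%:~R < b + k%:~R by rewrite ltrD2r.
by apply: le_trans (potential_shift_le (- k) x y ab') _; rewrite mulrNz !addrK.
Qed.

Lemma potential_ge : exists2 C0, 0 <= C0 & (forall x v t, - C0 <= L x v t) /\ forall a b x y, a < b -> - (C0 * (b - a)) <= F a b x y.
Proof.
have [C0 C00 HC0] := lagrangian_lower_bound M_compact g_metric L_smooth L_periodic L_superlinear.
exists C0 => //; split => // a b x y ab; have [gamma [p _ _ _ <-]] := potential_attained x y ab.
exact: action_ge.
Qed.

Lemma potential_bounded l : 0 < l -> exists C, forall a x y, F a (a + l) x y <= C.
Proof.
move=> l0; have [C HC] := uniform_link M_compact L_smooth L_periodic M_connected l0.
exists C => a x y; have [gamma [p h1 h2 h3]] := HC a x y; apply: le_trans h3.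
by rewrite -h1 -h2; apply: potential_le => //; rewrite ltrDl.
Qed.

Lemma short_connection x0 k : 0 <= k -> exists r B, [/\ 0 < r, 0 <= B & forall a b x y, a < b ->
  in_box (chart_at SM x0) (cmap (chart_at SM x0) x0) r x -> in_box (chart_at SM x0) (cmap (chart_at SM x0) x0) r y ->
  `|cmap (chart_at SM x0) y - cmap (chart_at SM x0) x| <= k * (b - a) -> F a b x y <= B * (b - a)].
Proof.
move=> k0; set c := chart_at SM x0; have ac : atlas c := chart_at_atlas SM _.
have cx : cdom c x0 := chart_at_mem SM _.
have [r r0 bO] := chart_ball (cimg_cmap cx).
have [B B0 HB] := straight_path L_smooth L_periodic ac bO r0 k0.
exists (r / 2), B; split => //; first exact: divr_gt0.
move=> a b x y ab [cx' hx] [cy' hy] hxy.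
have [gamma [p h1 h2 h3]] := HB a b _ _ ab hx hy hxy.
rewrite cmapK // in h1; rewrite cmapK // in h2.
by apply: le_trans h3; rewrite -h1 -h2; exact: potential_le.
Qed.

Lemma orbit_lipschitz gamma t0 : orbit gamma -> exists k del, [/\ 1 <= k, 0 < del &
  forall x y, `|x - t0| <= del -> `|y - t0| <= del -> [/\ cdom (chart_at SM (gamma t0)) (gamma x), cdom (chart_at SM (gamma t0)) (gamma y) &
    `|cmap (chart_at SM (gamma t0)) (gamma x) - cmap (chart_at SM (gamma t0)) (gamma y)| <= k * `|x - y| ]].
Proof.
move=> oG; set c := chart_at SM (gamma t0); have ac : atlas c := chart_at_atlas SM _.
have ct : cdom c (gamma t0) := chart_at_mem SM _.
have [w Hw] := extremal_in L_smooth L_periodic L_posdef (oG t0) ac ct.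
have [_ [_ _ dw']] := nbhs_singleton Hw.
have cw : {for t0, continuous w} := is_derive_continuous dw'.
pose k := `|w t0| + 1; have k1 : 1 <= k by rewrite lerDr.
have nw : \forall x \near t0, `|w x| <= k.
  have : \forall x \near t0, `|w t0 - w x| < 1.
    by have /cvgrPdist_lt K1 : w x @[x --> t0] --> w t0 := cw; exact: K1 _ ltr01.
  apply: filterS => x h; rewrite -[X in `|X|](subrK (w t0)); apply: le_trans (ler_normD _ _) _.
  by rewrite /k addrC lerD2l distrC ltW.
have [e e0 He] := near_interval (filterI Hw nw).
have e2 : 0 < e / 2 by exact: divr_gt0.
have ee (x : R) : `|x - t0| <= e / 2 -> `|x - t0| < e by move=> h; apply: le_lt_trans h _; exact: half_lt.
exists k, (e / 2); split => // x y hx hy.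
have [[cx _] _] := He x (ee x hx); have [[cy _] _] := He y (ee y hy).
split => //.
have hI z : t0 - e / 2 <= z <= t0 + e / 2 -> `|z - t0| < e by move=> /dist_itv_le/ee.
apply: (@mean_value_abs _ _ (cmap c \o gamma) w (t0 - e / 2) (t0 + e / 2)); [exact: le_trans k1|..|exact: itv_dist_le|exact: itv_dist_le].
- by move=> z /hI/He[[_ []]].
- by move=> z /hI/He[_].
Qed.

(** A competitor follows the minimizer between [s0 + eta] and [t0 - eta] and is linked to the new
    end points by two straight pieces, whose action is of order [eta]. The discarded ends of the
    minimizer have action at least [- (C0 * eta)] each. *)
Lemma potential_usc s0 t0 y0 x0 e : s0 < t0 -> 0 < e -> exists2 del, 0 < del & \forall y \near y0 & x \near x0,
  forall s t, `|s - s0| < del -> `|t - t0| < del -> s < t /\ F s t y x <= F s0 t0 y0 x0 + e.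
Proof.
move=> st0 e0; have [C0 C00 [HC0 _]] := potential_ge.
have [gam [pg og ga gb ag]] := potential_attained y0 x0 st0.
have [k1 [d1 [k11 d10 H1]]] := orbit_lipschitz s0 og; have [k2 [d2 [k21 d20 H2]]] := orbit_lipschitz t0 og.
rewrite ga in H1; rewrite gb in H2.
set c1 := chart_at SM y0 in H1; set c2 := chart_at SM x0 in H2.
have k10 : 0 < k1 by apply: lt_le_trans k11.
have k20 : 0 < k2 by apply: lt_le_trans k21.
(* The link has coordinate length at most [2 * k1 * eta], half for the motion of the minimizer and
   half for that of [y], and its duration is at least [eta / 2]: hence the slope [4 * k1]. *)
have [r1 [B1 [r10 B10 S1]]] := short_connection y0 (k := 4 * k1) ltac:(by rewrite mulr_ge0 // ltW).
have [r2 [B2 [r20 B20 S2]]] := short_connection x0 (k := 4 * k2) ltac:(by rewrite mulr_ge0 // ltW).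
pose D := 2 * B1 + 2 * B2 + 2 * C0 + 1.
have D0 : 0 < D by rewrite ltr_wpDl // !addr_ge0 ?mulr_ge0.
pose eta := Num.min (Num.min (Num.min d1 d2) (Num.min (r1 / k1) (r2 / k2))) (Num.min ((t0 - s0) / 4) (e / D)).
have eta0 : 0 < eta by rewrite !lt_min d10 d20 !divr_gt0 ?subr_gt0.
have [n1 n2 n3 n4] : [/\ eta <= d1, eta <= d2, eta <= r1 / k1 & eta <= r2 / k2].
  by split; rewrite /eta !ge_min lexx ?orbT.
have [n5 n6] : eta <= (t0 - s0) / 4 /\ eta <= e / D by split; rewrite /eta !ge_min lexx ?orbT.
have {}n3 : k1 * eta <= r1 by rewrite mulrC -ler_pdivlMr.
have {}n4 : k2 * eta <= r2 by rewrite mulrC -ler_pdivlMr.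
have {}n6 : D * eta <= e by rewrite mulrC -ler_pdivlMr.
exists (eta / 2); first exact: divr_gt0.
have rho1 : 0 < Num.min r1 (k1 * eta) by rewrite lt_min r10 mulr_gt0.
have rho2 : 0 < Num.min r2 (k2 * eta) by rewrite lt_min r20 mulr_gt0.
have N1 := near_chart_ball (chart_at_mem SM y0) rho1; have N2 := near_chart_ball (chart_at_mem SM x0) rho2.
near=> y x.
have [cy] : cdom c1 y /\ `|cmap c1 y - cmap c1 y0| < Num.min r1 (k1 * eta) by near: y.
rewrite lt_min => /andP[hy1 hy2].
have [cx] : cdom c2 x /\ `|cmap c2 x - cmap c2 x0| < Num.min r2 (k2 * eta) by near: x.
rewrite lt_min => /andP[hx1 hx2].
move=> s t; rewrite !ltr_norml => /andP[s1 s2] /andP[t1 t2].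
have [[ord1 ord2 ord3 ord4] [se1 se2 te1 te2]] := order_arith eta0 n5 s1 s2 t1 t2; split; [exact: ord4|rewrite /=].
have q1 : `|s0 + eta - s0| = eta by rewrite addrAC subrr add0r gtr0_norm.
have q2 : `|t0 - eta - t0| = eta by rewrite addrAC subrr add0r normrN gtr0_norm.
have z1 : `|s0 - s0| <= d1 by rewrite subrr normr0 ltW.
have z2 : `|t0 - t0| <= d2 by rewrite subrr normr0 ltW.
have [ca1 _ la1] := H1 (s0 + eta) s0 ltac:(by rewrite q1) z1.
have [ca2 _ la2] := H2 (t0 - eta) t0 ltac:(by rewrite q2) z2.
rewrite q1 ga in la1; rewrite q2 gb in la2.
have f1 : F s (s0 + eta) y (gam (s0 + eta)) <= B1 * (2 * eta).
  apply: le_trans (S1 _ _ _ _ ord1 _ _ _) _.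
  - by split => //; exact: ltW.
  - by split => //; exact: le_trans la1 n3.
  - have : `|cmap c1 (gam (s0 + eta)) - cmap c1 y| <= k1 * eta + k1 * eta.
      rewrite -(subrKA (cmap c1 y0)); apply: le_trans (ler_normD _ _) (lerD la1 _).
      by rewrite distrC ltW.
    move=> h; apply: le_trans h _; have -> : k1 * eta + k1 * eta = 4 * k1 * (eta / 2) by field.
    by rewrite ler_wpM2l ?mulr_ge0 ?(ltW k10).
  - by rewrite ler_wpM2l.
have f2 : F (t0 - eta) t (gam (t0 - eta)) x <= B2 * (2 * eta).
  apply: le_trans (S2 _ _ _ _ ord3 _ _ _) _.
  - by split => //; exact: le_trans la2 n4.
  - by split => //; exact: ltW.
  - have : `|cmap c2 x - cmap c2 (gam (t0 - eta))| <= k2 * eta + k2 * eta.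
      rewrite -(subrKA (cmap c2 x0)); apply: le_trans (ler_normD _ _) (lerD (ltW hx2) _).
      by rewrite distrC.
    move=> h; apply: le_trans h _; have -> : k2 * eta + k2 * eta = 4 * k2 * (eta / 2) by field.
    by rewrite ler_wpM2l ?mulr_ge0 ?(ltW k20).
  - by rewrite ler_wpM2l.
have i1 : s0 <= s0 + eta by rewrite lerDl ltW.
have i2 : t0 - eta <= t0 by rewrite lerBlDr lerDl ltW.
have i3 : s0 + eta <= t0 := le_trans (ltW ord2) i2.
have pm := pathW pg i1 (ltW ord2) i2.
have f3 := potential_le ord2 pm.
have f4 := action_ge L_smooth HC0 (pathW pg (lexx _) i1 i3).
have f5 := action_ge L_smooth HC0 (pathW pg (le_trans i1 (ltW ord2)) i2 (lexx _)).
have f6 := lag_action_cat L_smooth pg i1 i3.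
have f7 := lag_action_cat L_smooth (pathW pg i1 i3 (lexx _)) (ltW ord2) i2.
have f8 := potential_tri y (gam (s0 + eta)) x ord1 (lt_trans ord2 ord3).
have f9 := potential_tri (gam (s0 + eta)) (gam (t0 - eta)) x ord2 ord3.
rewrite ag in f6.
have e1 : s0 + eta - s0 = eta by ring.
have e2 : t0 - (t0 - eta) = eta by ring.
rewrite e1 in f4; rewrite e2 in f5.
apply: le_trans (usc_arith eta0 f8 f9 f1 f2 f3 f6 f7 f4 f5) _.
by rewrite lerD2l.
Unshelve. all: by end_near. Qed.

Lemma no_escape_near x0 B (O : set M) : 0 <= B -> nbhs x0 O -> exists2 del, 0 < del & forall a b t gamma, is_path a b gamma -> b - a <= del ->
  (forall s s', a <= s -> s <= s' -> s' <= b -> lag_action s s' gamma <= B) -> a <= t <= b -> gamma t = x0 ->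
  forall s, a <= s <= b -> O (gamma s).
Proof.
move=> B0 nO; pose c := chart_at SM x0; have ac : atlas c := chart_at_atlas SM _.
have cx : cdom c x0 := chart_at_mem SM _.
have [r r0 bO] := chart_ball (cimg_cmap cx).
have n1 : \forall q \near cmap c x0, O (cinv c q) by apply: (cinv_cont (cimg_cmap cx)); rewrite cmapK.
have [e e0 He] := near_interval n1.
pose rho := Num.min r (e / 2).
have rho0 : 0 < rho by rewrite lt_min r0 divr_gt0.
have rhor : rho <= r by rewrite /rho ge_min lexx.
have [del del0 Hd] := no_escape M_hausdorff g_metric L_smooth L_periodic L_superlinear ac bO rho0 rhor B0.
exists del => // a b t gamma pg ba HB tab gt s sab.
have [|cs hs] := Hd a b t gamma pg ba HB tab _ s sab.
  by rewrite gt; split => //; rewrite subrr normr0 divr_ge0 // ltW.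
rewrite -(cmapK cs); apply: He; apply: le_lt_trans hs _; rewrite gt_min; apply/orP; right; exact: half_lt.
Qed.

(** If enlarging the interval by arbitrarily small amounts lowered the potential by more than [e],
    the minimizers on the enlarged intervals, restricted to [[s0, t0]], would have as limit an orbit
    from [y0] to [x0] of action below the minimum. The two discarded ends and the semicontinuity
    cost [e / 4] each. *)
Lemma potential_stretch s0 t0 y0 x0 e : s0 < t0 -> 0 < e -> exists2 eta0, 0 < eta0 & forall eta, 0 < eta -> eta <= eta0 ->
  F s0 t0 y0 x0 <= F (s0 - eta) (t0 + eta) y0 x0 + e.
Proof.
move=> st0 e0; apply: contrapT => N; have [C0 C00 [HC0 _]] := potential_ge.
have seq n : exists eta, [/\ 0 < eta, eta <= n.+1%:R^-1 & F (s0 - eta) (t0 + eta) y0 x0 + e < F s0 t0 y0 x0].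
  apply: contrapT => N2; apply: N; exists n.+1%:R^-1; first by rewrite invr_gt0.
  by move=> eta h1 h2; rewrite leNgt; apply/negP => h3; apply: N2; exists eta.
have [eta Heta] := fun_choice seq.
have st n : [/\ s0 - eta n <= s0, t0 <= t0 + eta n, eta n <= 1 & s0 - eta n < t0 + eta n].
  have [h1 h2 _] := Heta n; have h3 : eta n <= 1 by apply: le_trans h2 _; rewrite invf_le1 // ler1n.
  have h4 : s0 - eta n <= s0 by rewrite lerBlDr lerDl ltW.
  have h5 : t0 <= t0 + eta n by rewrite lerDl ltW.
  by split => //; apply: le_lt_trans h4 (lt_le_trans st0 h5).
have [gam Hgam] := fun_choice (fun n => potential_attained y0 x0 (let: And4 _ _ _ h := st n in h)).
pose F0 := F s0 t0 y0 x0; pose B := `|F0| + C0 * (t0 - s0 + 2).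
have len0 : 0 <= t0 - s0 + 2 by rewrite addr_ge0 // subr_ge0 ltW.
have B0 : 0 <= B by rewrite addr_ge0 // mulr_ge0.
have pgam n : is_path (s0 - eta n) (t0 + eta n) (gam n) by case: (Hgam n).
have lgam n : lag_action (s0 - eta n) (t0 + eta n) (gam n) <= F0 - e.
  by have [_ _ _ _ ->] := Hgam n; have [_ _ h] := Heta n; rewrite lerBrDr ltW.
have HB n s s' : s0 - eta n <= s -> s <= s' -> s' <= t0 + eta n -> lag_action s s' (gam n) <= B.
  move=> h1 h2 h3.
  have e1 := lag_action_cat L_smooth (pgam n) h1 (le_trans h2 h3).
  have e2 := lag_action_cat L_smooth (pathW (pgam n) h1 (le_trans h2 h3) (lexx _)) h2 h3.
  have f1 := action_ge L_smooth HC0 (pathW (pgam n) (lexx _) h1 (le_trans h2 h3)).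
  have f2 := action_ge L_smooth HC0 (pathW (pgam n) (le_trans h1 h2) h3 (lexx _)).
  have [_ _ h4 _] := st n.
  have f5 : C0 * (s - (s0 - eta n)) + C0 * (t0 + eta n - s') <= C0 * (t0 - s0 + 2).
    by rewrite -mulrDr ler_wpM2l //; move: h2 h4; lra.
  exact: subaction_arith e0 e1 e2 f1 f2 f5 (lgam n).
have [U UU tails] := free_ultrafilter.
have UP : ProperFilter U := @ultra_proper _ _ UU.
have [gs gs_lim] := ultra_limit M_compact UU gam.
have pmid n : is_path s0 t0 (gam n) by have [h1 h2 _ _] := st n; exact: pathW (pgam n) h1 (ltW st0) h2.
have etasmall e' : 0 < e' -> \forall i \near U, eta i <= e'.
  move=> e'0; have [n _ Hn] := near_infty_natSinv_lt (PosNum e'0).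
  apply: filterS (tails n) => i ni; have [_ h _] := Heta i; apply: le_trans h _; exact: ltW (Hn i ni).
have minim e' : 0 < e' -> \forall i \near U, forall z, is_path s0 t0 z -> z s0 = gam i s0 -> z t0 = gam i t0 ->
    lag_action s0 t0 (gam i) <= lag_action s0 t0 z + e'.
  move=> e'0; apply: filterE => i z pz z1 z2; have [h1 h2 _ h3] := st i.
  have [ze [pze za zb lz]] := subpath_replace L_smooth (pgam i) h1 (ltW st0) h2 pz z1 z2.
  have [_ _ g1 g2 g3] := Hgam i; have := potential_le h3 pze; rewrite za zb g1 g2 -g3 lz.
  exact: cancel_arith.
have lB n : lag_action s0 t0 (gam n) <= B by have [h1 h2 _ _] := st n; apply: HB => //; exact: ltW.
have [Gam [oG GL Gle]] := minimizing_sequence M_hausdorff M_compact g_metric L_smooth L_periodic L_superlinear L_posdef L_complete UU st0 pmid lB minim gs_lim.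
(* The paths take the prescribed values at the ends of the enlarged intervals and not at [s0] and
   [t0]. Their partial actions being bounded, they cannot move far in the vanishing time between, so
   the limit has the right end points. *)
have ends t z : t = s0 \/ t = t0 -> (forall n, exists tn, [/\ `|t - tn| <= eta n, s0 - eta n <= tn <= t0 + eta n & gam n tn = z]) -> Gam t = z.
  move=> tt Hz; apply: (hausdorff_eq M_hausdorff) => O1 P1 nO nP.
  have [del del0 Hd] := no_escape_near B0 nP.
  have tst : s0 <= t <= t0 by case: tt => ->; rewrite lexx ltW.
  have nG : \forall i \near U, O1 (gam i t) := GL t tst _ nO.
  have [i [h1 h2]] := @filter_ex _ U _ _ (filterI nG (etasmall _ del0)).
  exists (gam i t); split => //; have [tn [u1 u2 u3]] := Hz i; have [v1 v2 _ _] := st i.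
  have tin : s0 - eta i <= t <= t0 + eta i by case/andP: tst => w1 w2; rewrite (le_trans v1 w1) (le_trans w2 v2).
  have [a1 a2] := andP tin; have [b1 b2] := andP u2.
  have [le|le] := leP t tn.
    apply: (Hd t tn tn (gam i)) => //; rewrite ?lexx ?le //.
    - exact: pathW (pgam i) a1 le b2.
    - by apply: le_trans h2; apply: le_trans u1; rewrite distrC ler_norm.
    - by move=> s s' q1 q2 q3; apply: HB => //; [exact: le_trans a1 q1|exact: le_trans q3 b2].
  apply: (Hd tn t tn (gam i)) => //; rewrite ?lexx ?(ltW le) //.
  - exact: pathW (pgam i) b1 (ltW le) a2.
  - by apply: le_trans h2; apply: le_trans u1; exact: ler_norm.
  - by move=> s s' q1 q2 q3; apply: HB => //; [exact: le_trans b1 q1|exact: le_trans q3 a2].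
have Ga : Gam s0 = y0.
  apply: ends => [|n]; first by left.
  have [h0 _ _] := Heta n; have [h1 h2 _ h3] := st n; have [_ _ g1 _ _] := Hgam n.
  exists (s0 - eta n); split => //; last by rewrite lexx ltW.
  by rewrite opprB addrCA subrr addr0 ger0_norm // ltW.
have Gb : Gam t0 = x0.
  apply: ends => [|n]; first by right.
  have [h0 _ _] := Heta n; have [h1 h2 _ h3] := st n; have [_ _ _ g1 _] := Hgam n.
  exists (t0 + eta n); split => //; last by rewrite lexx ltW.
  by rewrite opprD addrA subrr add0r normrN ger0_norm // ltW.
have e4 : 0 < e / 4 by exact: divr_gt0.
have e5 : 0 < e / 4 / (C0 + 1) by rewrite divr_gt0 // ltr_wpDl.
have [i [h1 h2]] := @filter_ex _ U _ _ (filterI (Gle _ e4) (etasmall _ e5)).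
have [v1 v2 _ v3] := st i.
have f0 := potential_le st0 (orbit_path L_smooth L_periodic L_posdef oG (ltW st0)).
have f1 := action_ge L_smooth HC0 (pathW (pgam i) (lexx _) v1 (le_trans (ltW st0) v2)).
have f2 := action_ge L_smooth HC0 (pathW (pgam i) (le_trans v1 (ltW st0)) v2 (lexx _)).
have f3 := lag_action_cat L_smooth (pgam i) v1 (le_trans (ltW st0) v2).
have f4 := lag_action_cat L_smooth (pathW (pgam i) v1 (le_trans (ltW st0) v2) (lexx _)) (ltW st0) v2.
have f5 := lgam i.
rewrite Ga Gb -/F0 in f0.
rewrite (_ : s0 - (s0 - eta i) = eta i) in f1; last by ring.
rewrite (_ : t0 + eta i - t0 = eta i) in f2; last by ring.
have f6 : C0 * eta i <= e / 4.
  apply: le_trans (_ : (C0 + 1) * eta i <= _); last by rewrite mulrC -ler_pdivlMr // ltr_wpDl.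
  by rewrite ler_wpM2r ?lerDl //; case: (Heta i) => h _ _; exact: ltW.
exact: stretch_arith e0 f0 h1 f3 f4 f1 f2 f6 f5.
Qed.

(** A path for the perturbed data is prolonged by straight pieces to [y0] at [s0 - eta] and to [x0]
    at [t0 + eta]; [potential_stretch] then compares the enlarged interval with the original one. *)
Lemma potential_lsc s0 t0 y0 x0 e : s0 < t0 -> 0 < e -> exists2 del, 0 < del & \forall y \near y0 & x \near x0,
  forall s t, `|s - s0| < del -> `|t - t0| < del -> s < t -> F s0 t0 y0 x0 <= F s t y x + e.
Proof.
move=> st0 e0; have e2 : 0 < e / 2 by exact: divr_gt0.
have [eta1 eta10 ST] := potential_stretch y0 x0 st0 e2.
have [r1 [B1 [r10 B10 S1]]] := short_connection y0 ler01.
have [r2 [B2 [r20 B20 S2]]] := short_connection x0 ler01.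
pose D := 4 * B1 + 4 * B2 + 1.
have D0 : 0 < D by rewrite ltr_wpDl // !addr_ge0 ?mulr_ge0.
pose eta := Num.min eta1 (e / D).
have eta0 : 0 < eta by rewrite lt_min eta10 divr_gt0.
have etaD : D * eta <= e by rewrite mulrC -ler_pdivlMr // /eta ge_min lexx orbT.
have eta2 : 0 < eta / 2 by exact: divr_gt0.
have etle : eta <= eta1 by rewrite /eta ge_min lexx.
have ST1 := ST eta eta0 etle.
exists (eta / 2) => //.
have rho1 : 0 < Num.min r1 (eta / 2) by rewrite lt_min r10.
have rho2 : 0 < Num.min r2 (eta / 2) by rewrite lt_min r20.
have N1 := near_chart_ball (chart_at_mem SM y0) rho1; have N2 := near_chart_ball (chart_at_mem SM x0) rho2.
near=> y x.
have [cy] : cdom (chart_at SM y0) y /\ `|cmap (chart_at SM y0) y - cmap (chart_at SM y0) y0| < Num.min r1 (eta / 2) by near: y.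
rewrite lt_min => /andP[hy1 hy2].
have [cx] : cdom (chart_at SM x0) x /\ `|cmap (chart_at SM x0) x - cmap (chart_at SM x0) x0| < Num.min r2 (eta / 2) by near: x.
rewrite lt_min => /andP[hx1 hx2].
move=> s t; rewrite !ltr_norml /= => /andP[s1 s2] /andP[t1 t2] lst.
have [[w1 w2 w3] [w4 w5 w6]] := order_arith2 eta0 s1 s2 t1 t2.
have f1 : F (s0 - eta) s y0 y <= B1 * (2 * eta).
  apply: le_trans (S1 _ _ _ _ w1 _ _ _) _.
  - by split; [exact: chart_at_mem|rewrite subrr normr0 ltW].
  - by split => //; exact: ltW.
  - by rewrite mul1r; apply: le_trans w2; exact: ltW.
  - by rewrite ler_wpM2l.
have f2 : F t (t0 + eta) x x0 <= B2 * (2 * eta).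
  apply: le_trans (S2 _ _ _ _ w4 _ _ _) _.
  - by split => //; exact: ltW.
  - by split; [exact: chart_at_mem|rewrite subrr normr0 ltW].
  - by rewrite mul1r distrC; apply: le_trans w5; exact: ltW.
  - by rewrite ler_wpM2l.
have f3 := potential_tri y0 y x0 w1 (lt_trans lst w4).
have f4 := potential_tri y x x0 lst w4.
exact: lsc_arith eta0 etaD ST1 f3 f4 f1 f2.
Unshelve. all: by end_near. Qed.

Lemma potential_cont s0 t0 y0 x0 e : s0 < t0 -> 0 < e -> exists2 del, 0 < del & \forall y \near y0 & x \near x0,
  forall s t, `|s - s0| < del -> `|t - t0| < del -> s < t /\ `|F s t y x - F s0 t0 y0 x0| <= e.
Proof.
move=> st0 e0; have [d1 d10 H1] := potential_usc y0 x0 st0 e0; have [d2 d20 H2] := potential_lsc y0 x0 st0 e0.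
exists (Num.min d1 d2); first by rewrite lt_min d10.
apply: filterS2 H1 H2 => -[y x] /= K1 K2 s t; rewrite !lt_min => /andP[s1 s2] /andP[t1 t2].
have [lst h1] := K1 s t s1 t1; split => //; have h2 := K2 s t s2 t2 lst.
by rewrite ler_norml lerBlDr [e + _]addrC h1 andbT lerNl opprB lerBlDl.
Qed.

End Potential.

(** * The Euler-Lagrange flow and invariant measures *)

Lemma circle_ofP {R : realType} (s t : R) : circle_of s = circle_of t <-> exists k : int, s = t + k%:~R.
Proof.
rewrite /circle_of; split.
  move/eqquotP; rewrite /= /eq_mod1 => /intrP[k E]; exists k; by rewrite -E addrC subrK.
by move=> [k E]; apply/eqquotP; rewrite /= /eq_mod1 E addrC addKr; apply/intrP; exists k.
Qed.

Lemma circle_reprE {R : realType} (t : R) : exists k : int, circle_repr (circle_of t) = t + k%:~R.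
Proof. by apply/circle_ofP; rewrite /circle_of /circle_repr reprK. Qed.

Section Translation.
Variable R : realType.
Notation mu := (@lebesgue_measure R).

Lemma measurable_shift (k : R) : measurable_fun setT (fun t : R => t + k).
Proof. by apply: measurable_funD => //; exact: measurable_cst. Qed.

Lemma lebesgue_measure_shift (k : R) (A : set R) : measurable A -> mu ((fun t => t + k) @^-1` A) = mu A.
Proof.
move=> mA; rewrite -[LHS]/(pushforward mu ((fun t => t + k) : _ -> measurableTypeR R) A).
apply/esym/lebesgue_measure_unique => //=; first exact: measurable_shift.
move=> _ X [[a b]] _ <-; rewrite /pushforward /=.
have -> : (fun t : R => t + k) @^-1` `]a, b] = `]a - k, b - k]%classic.
  by apply/seteqP; split => x /=; rewrite !in_itv /= ltrBlDr lerBrDr.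
rewrite !lebesgue_measure_itv /= !lte_fin ltrD2r; case: ifP => // _; rewrite -!EFinB; congr (_%:E); ring.
Qed.

Lemma measure_left_open (a b : R) (X : set R) : a <= b -> measurable X -> mu (`[a, b] `&` X) = mu (`]a, b] `&` X).
Proof.
move=> ab mX; have -> : `[a, b] `&` X = (`]a, b] `&` X) `|` ([set a] `&` X).
  rewrite -setIUl; congr (_ `&` _); apply/seteqP; split => x /=; rewrite !in_itv /=.
    move=> /andP[ax ->]; move: ax; rewrite le_eqVlt => /orP[/eqP ->|->]; [by right|by left].
  by case=> [/andP[/ltW -> ->] //|->]; rewrite lexx ab.
have z : mu ([set a] `&` X) = 0%E.
  apply/eqP; rewrite eq_le measure_ge0 andbT -(lebesgue_measure_set1 a).
  by apply: le_measure; rewrite ?inE; [apply: measurableI|exact: measurable_set1|move=> x []].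
rewrite measureU.
- by rewrite [X in (_ + X)%E]z adde0.
- by apply: measurableI => //; exact: measurable_itv.
- by apply: measurableI.
- by apply/seteqP; split => x //= -[[]]; rewrite in_itv /= => /andP[h _] _ [E _]; move: h; rewrite E ltxx.
Qed.

Lemma measure_itv_cat (a b c : R) (X : set R) : a <= b -> b <= c -> measurable X ->
  mu (`]a, c] `&` X) = (mu (`]a, b] `&` X) + mu (`]b, c] `&` X))%E.
Proof.
move=> ab bc mX; rewrite -measureU.
- congr (mu _); rewrite -setIUl; congr (_ `&` _); apply/seteqP; split => x /=; rewrite !in_itv /=.
    by move=> /andP[-> ->]; case: (leP x b) => h; [left|right].
  by case=> /andP[h1 h2]; apply/andP; split => //; [apply: le_trans bc|apply: le_lt_trans h1].
- by apply: measurableI => //; exact: measurable_itv.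
- by apply: measurableI => //; exact: measurable_itv.
- by apply/seteqP; split => x //= -[[]]; rewrite !in_itv /= => /andP[_ h] _ [/andP[h' _] _]; move: h'; rewrite ltNge h.
Qed.

(** The shift is reduced modulo [n] to a remainder [r]; the part of [[r, n + r]] beyond [n] is
    carried back to the beginning by periodicity. *)
Lemma periodic_window (n s : R) (B : set R) : 0 < n -> measurable B -> (forall t, B (t + n) <-> B t) ->
  mu (`[0, n] `&` (fun t => t + s) @^-1` B) = mu (`[0, n] `&` B).
Proof.
move=> n0 mB pB.
have pBn (k : nat) t : B (t + k%:R * n) <-> B t.
  elim: k => [|k IH]; first by rewrite mul0r addr0.
  by rewrite -natr1 mulrDl mul1r addrA; apply: iff_trans (pB _) IH.
have pBz (k : int) t : B (t + k%:~R * n) <-> B t.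
  case: k => k; first exact: pBn.
  by rewrite -(pBn k.+1) NegzE mulrNz -pmulrn mulNr subrK.
pose k := Num.floor (s / n); pose r := s - k%:~R * n.
have r0 : 0 <= r by rewrite /r subr_ge0 -ler_pdivlMr //; exact: floor_le.
have rn : r <= n.
  have h : s / n <= (k + 1)%:~R by apply: ltW; exact: floorD1_gt.
  by rewrite /r lerBlDr; move: h; rewrite ler_pdivrMr // intrD mulrDl mul1r addrC.
have -> : (fun t => t + s) @^-1` B = (fun t => t + r) @^-1` B.
  by apply/seteqP; split => t /=; rewrite -(pBz k (t + r)) /r addrA subrK.
have -> : `[0, n] `&` (fun t => t + r) @^-1` B = (fun t => t + r) @^-1` (`[r, n + r] `&` B).
  apply/seteqP; split => t /=; rewrite !in_itv /=.
    by move=> [/andP[t0 tn] Bt]; split => //; rewrite lerDr t0 lerD2r.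
  by rewrite lerDr lerD2r.
have mr : measurable (`[r, n + r] `&` B) by apply: measurableI => //; exact: measurable_itv.
rewrite lebesgue_measure_shift //.
rewrite !measure_left_open ?lerDr ?(ltW n0) // (measure_itv_cat (b := n)) ?lerDl //.
rewrite (@measure_itv_cat 0 r n) // addeC; congr (_ + _)%E.
have mn : measurable (`]n, n + r] `&` B) by apply: measurableI => //; exact: measurable_itv.
rewrite -(lebesgue_measure_shift n mn); congr (mu _); apply/seteqP; split => t /=; rewrite !in_itv /= pB ltrDr (addrC n) lerD2r //.
Qed.
End Translation.

Section Occupation.
Context {R : realType} {d : measure_display} {T : measurableType d}.

(** [h] is bounded below but possibly not integrable. Its negative part is at most [C], hence of
    finite integral, and can be moved to the other side of an identity between nonnegative
    integrals. *)
Lemma integral_probability_shift (P : probability T R) (h : T -> R) (C : R) : measurable_fun setT h -> 0 <= C ->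
  (forall z, - C <= h z) -> (\int[P]_z (h z + C)%:E = \int[P]_z (h z)%:E + C%:E)%E.
Proof.
move=> mh C0 hC; pose f z := (h z)%:E.
have mf : measurable_fun setT f by exact/measurable_EFinP.
have mp := measurable_funepos mf; have mn := measurable_funeneg mf.
have ic : (\int[P]_z (cst C%:E) z = C%:E)%E
  by rewrite integral_cst //; apply: etrans (mule1 _); congr (_ * _)%E; exact: probability_setT.
have fn_le z : (f^\- z <= C%:E)%E by rewrite funenegE ge_max /f -EFinN !lee_fin C0 andbT lerNl.
have in_le : (\int[P]_z f^\- z <= C%:E)%E.
  by rewrite -ic; apply: ge0_le_integral.
have in_ge : (0 <= \int[P]_z f^\- z)%E by apply: integral_ge0 => z _; exact: funeneg_ge0.
have in_fin : (\int[P]_z f^\- z)%E \is a fin_num.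
  by rewrite ge0_fin_numE // (le_lt_trans in_le) // ltry.
have E : (\int[P]_z (h z + C)%:E + \int[P]_z f^\- z = \int[P]_z f^\+ z + C%:E)%E.
  rewrite -ic -!ge0_integralD //.
  - apply: eq_integral => z _ /=.
    rewrite funenegE funeposE /f -!EFin_max -!EFinD; congr (_%:E).
    by rewrite !maxEle; case: ifP => h1; case: ifP => h2; move: h1 h2; lra.
  - by move=> z _; rewrite lee_fin; have := hC z; lra.
  - by apply/measurable_EFinP; apply: measurable_funD.
rewrite -[LHS](addeK _ in_fin) E [X in _ = (X + _)%E]integralE.
by rewrite addeAC.
Qed.

(** The uniform law on [[0, N]] pushed forward by [X]; for the lift of an orbit this is its
    occupation measure. *)
Lemma occupation (N : R) (X : R -> T) : 0 < N -> @measurable_fun _ _ (measurableTypeR R) T setT X ->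
  exists P : probability T R,
    (forall A, measurable A -> P A = (N^-1%:E * lebesgue_measure (`[0%R, N] `&` X @^-1` A))%E) /\
    (forall h : T -> R, measurable_fun setT h -> (forall z, 0 <= h z) ->
      (\int[P]_z (h z)%:E = N^-1%:E * \int[lebesgue_measure]_(t in `[0%R, N]) (h (X t))%:E)%E).
Proof.
move=> N0 mX; pose X' : {mfun measurableTypeR R >-> T} := @mfun_Sub _ _ (measurableTypeR R) T X (mem_set mX).
exists (distribution (uniform_prob N0) X'); split => [A mA|h mh h0].
  have mB : measurable (X @^-1` A) by rewrite -[Y in measurable Y]setTI; exact (mX measurableT _ mA).
  rewrite /distribution /pushforward /= /uniform_prob integral_uniform_pdf.
  rewrite (eq_integral (fun=> N^-1%:E)); last first.
    move=> t; rewrite inE /= => -[_]; rewrite in_itv /= => ht.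
    by rewrite /uniform_pdf ht subr0.
  rewrite (setIC (X @^-1` A)); apply: integral_cst; apply: measurableI; [exact: measurable_itv|exact: mB].
rewrite ge0_integral_pushforward //.
- rewrite preimage_setT integral_uniform ?subr0 //.
    by apply/measurable_EFinP; exact: (measurableT_comp mh).
  by move=> t; rewrite lee_fin.
- exact/measurable_EFinP.
- by move=> z _; rewrite lee_fin.
Qed.
End Occupation.

Section FieldPeriodic.
#[local] Opaque derive.
Variables (R : realType) (d : nat) (f : 'rV[R]_d * 'rV[R]_d * R -> R).
Hypothesis fp : time_periodic f.
Variables (k : int) (q w : 'rV[R]_d) (t : R).

Let int_per (h : 'rV[R]_d * 'rV[R]_d * R -> R) : time_periodic h -> h (pt q w (t + k%:~R)) = h (pt q w t).
Proof.
move=> ph; rewrite (periodic_frac q w t ph) (periodic_frac q w (t + k%:~R) ph); congr (h (pt q w _)).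
by rewrite floorDrz ?intr_int // intrKfloor intrD; lra.
Qed.

Let D2_per u v : D2 f u v (pt q w (t + k%:~R)) = D2 f u v (pt q w t).
Proof. by apply: int_per; apply: periodic_derive; exact: periodic_derive. Qed.

Lemma field_periodic : field f (pt q w (t + k%:~R)) = field f (pt q w t).
Proof.
rewrite /field; have -> : hess f (pt q w (t + k%:~R)) = hess f (pt q w t).
  by apply: eq_mx => i j; exact: D2_per.
have -> // : rhs f (pt q w (t + k%:~R)) = rhs f (pt q w t).
apply: eq_mx => i j; have E1 := int_per (periodic_derive (dq (@unit_rV R d j)) fp).
apply: (congr2 (fun x y => x - y) (congr2 (fun x y => x - y) E1 _) (D2_per _ _)).
apply: eq_bigr => l _; exact: (congr1 (fun x => w 0 l * x) (D2_per _ _)).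
Qed.
End FieldPeriodic.

Section Flow.
Context {R : realType} {M : ptopologicalType} {d : nat}.
Variable SM : smooth_structure R M d.
Hypothesis M_hausdorff : hausdorff_space M.
Hypothesis M_compact : compact [set: M].
Hypothesis M_connected : connected [set: M].
Notation V := 'rV[R]_d.
Notation atlas := (atlas SM).
Variable g : M -> V -> V -> R.
Hypothesis g_metric : is_riemannian_metric SM g.
Variable L : M -> V -> R -> R.
Hypothesis L_smooth : lagrangian_smooth SM L.
Hypothesis L_periodic : lagrangian_periodic L.
Hypothesis L_superlinear : lagrangian_superlinear g L.
Hypothesis L_posdef : lagrangian_posdef L.
Hypothesis L_complete : EL_complete SM L.
Notation lag := (lag SM L).
Notation orbit := (orbit SM L).
Notation solves c := (solves_at (lag c) (cimg c)).
Notation phase := (g_sigma_algebraType (phase_open SM)).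
Notation lift := (tangent_lift SM).

Lemma field_int c (k : int) q w t : field (lag c) (pt q w (t + k%:~R)) = field (lag c) (pt q w t).
Proof. by apply: field_periodic; exact: lag_periodic. Qed.

Lemma orbit_shift (k : int) gamma : orbit gamma -> orbit (fun t => gamma (t + k%:~R)).
Proof.
move=> og t; have [c [q [w [ac H]]]] := og (t + k%:~R).
exists c, (fun s => q (s + k%:~R)), (fun s => w (s + k%:~R)); split; first exact: ac.
have [e e0 He] := near_interval H.
apply: filterS (nbhsx_ballx t e e0) => s ts.
have [h1 [h2 h3 h4]] : gamma (s + k%:~R) = cinv c (q (s + k%:~R)) /\ solves c q w (s + k%:~R).
  apply: He; rewrite (_ : s + _ - _ = s - t); [by rewrite distrC|ring].
split; [exact: h1|split; [exact: h2|exact: is_derive_comp_shift h3|]].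
by rewrite -(field_int c k); exact: is_derive_comp_shift h4.
Qed.

Lemma orbit_solves gamma t c : orbit gamma -> atlas c -> cdom c (gamma t) ->
  exists w, \forall s \near t, cdom c (gamma s) /\ solves c (cmap c \o gamma) w s.
Proof. by move=> og ac ct; exact: extremal_in (og t) ac ct. Qed.

Lemma velocity_shift (k : int) gamma t : orbit gamma ->
  velocity SM (fun t => gamma (t + k%:~R)) t = velocity SM gamma (t + k%:~R).
Proof.
move=> og; pose c := chart_at SM (gamma (t + k%:~R)).
have [w H] := orbit_solves og (chart_at_atlas SM _) (chart_at_mem SM (gamma (t + k%:~R))).
have [_ [_ h2 _]] := nbhs_singleton H.
rewrite /velocity !derive1E (@derive_val _ _ _ _ _ _ _ h2).
have h3 := is_derive_comp_shift h2.
by rewrite (@derive_val _ _ _ _ _ _ _ h3).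
Qed.

(** [EL_flow] is defined by choice among orbits. Two orbits with the same lifted point at [t] and
    [t'] have [t - t'] integer; translating one of them by this integer, which periodicity of [L]
    allows, makes them equal. *)
Lemma flow_lift gamma s t : orbit gamma -> EL_flow L s (lift gamma t) = lift gamma (t + s).
Proof.
move=> og; rewrite /EL_flow; apply: xget_unique.
  by exists gamma, t; split => //; apply/(orbitP L_smooth L_periodic L_posdef).
move=> y [eta [t' [/(orbitP L_smooth L_periodic L_posdef) oe [E1 E2 /circle_ofP[k Ek]] <-]]].
have oe' := orbit_shift k oe; have -> : gamma = fun t => eta (t + k%:~R).
  apply: (orbit_unique L_smooth L_periodic L_posdef M_hausdorff og oe' (t := t)).
  have Ev := velocity_shift k t oe; rewrite -Ek E2 in Ev.
  by rewrite /same_jet -Ek E1 Ev.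
rewrite /tangent_lift (velocity_shift k (t + s) oe) Ek addrAC; congr (_, _, _); apply/circle_ofP; exact: (ex_intro _ k).
Qed.

Lemma lift_open gamma (A : set phase) : orbit gamma -> phase_open SM A -> open (lift gamma @^-1` A).
Proof.
move=> og oA; rewrite openE => t At; pose c := chart_at SM (gamma t).
have ac := chart_at_atlas SM (gamma t).
have [w H] := orbit_solves og ac (chart_at_mem SM (gamma t)).
have liftE s : cdom c (gamma s) /\ solves c (cmap c \o gamma) w s ->
  lift gamma s = (tangent_of SM c (cmap c (gamma s)) (w s), circle_of s).
  by move=> [h1 h2]; rewrite /lift (solves_velocity ac (og s) h1 h2) /tangent_of cmapK.
have Ht := nbhs_singleton H; have [ct [_ h2 h3]] := Ht.
have oS := oA c ac.
have : nbhs (pt (cmap c (gamma t)) (w t) t) [set z : V * V * R | cimg c z.1.1 /\ A (tangent_of SM c z.1.1 z.1.2, circle_of z.2)].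
  apply: open_nbhs_nbhs; split => //; split; first exact: cimg_cmap.
  by rewrite -(liftE t Ht).
have cp : {for t, continuous (fun s => pt ((cmap c \o gamma) s) (w s) s)}.
  by apply: pt_cont; [apply/differentiable_continuous/derivable1_diffP; case: h2|apply/differentiable_continuous/derivable1_diffP; case: h3|exact: cvg_id].
move=> /cp HA.
by apply: filterS2 H HA => s h [_ hA]; rewrite /= (liftE s h).
Qed.

Lemma lift_measurable gamma : orbit gamma -> @measurable_fun _ _ (measurableTypeR R) phase setT (lift gamma).
Proof.
move=> og; apply: (@measurability _ _ (measurableTypeR R) phase setT _ (phase_open SM)) => // _ [A oA <-].
by rewrite setTI; apply: open_measurable; exact: lift_open.
Qed.

Definition phase_lagrangian (z : phase) : R := L z.1.1 z.1.2 (circle_repr z.2).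

Lemma phase_lagrangian_lift gamma t : phase_lagrangian (lift gamma t) = speed SM L gamma t.
Proof.
rewrite /phase_lagrangian /=; have [k ->] := circle_reprE t.
have E x v s (j : nat) : L x v (s + j%:R) = L x v s.
  by elim: j => [|j IH]; [rewrite addr0|rewrite -natr1 addrA L_periodic].
case: k => j; first exact: E.
by rewrite -(E _ _ _ j.+1) NegzE mulrNz -pmulrn subrK.
Qed.

(** Preimages of open intervals are [phase_open]: in each chart the function is the continuous
    [lag c], periodicity removing the choice of a representative of the circle. *)
Lemma phase_lagrangian_measurable : measurable_fun setT phase_lagrangian.
Proof.
apply: (measurability _ (RGenOpens.measurableE R)) => _ [_ [a [b ->] <-]]; rewrite setTI.
apply: sub_sigma_algebra => c ac /=.
rewrite openE => -[[q w] t] /= [cq H].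
have E q' w' t' : phase_lagrangian (tangent_of SM c q' w', circle_of t') = lag c (pt q' w' t').
  rewrite /phase_lagrangian /=; have [k ->] := circle_reprE t'.
  exact: lag_int.
have cl : {for (pt q w t), continuous (lag c)}.
  have cU : [set z : V * V * R | cimg c z.1.1] (pt q w t) := cq.
  have sl := lag_smooth L_smooth ac; exact: (sl 0%N _ cU).
have nI : nbhs (lag c (pt q w t)) `]a, b[%classic.
  by apply: open_nbhs_nbhs; split; [exact: interval_open|rewrite -E].
have N1 : \forall z \near pt q w t, lag c z \in `]a, b[ := cl _ nI.
have N2 : \forall z \near pt q w t, cimg c z.1.1.
  have p1 : {for pt q w t, continuous (fun z : V * V * R => z.1.1)}.
    by apply: (continuous_comp (f := fst) (g := fst)); exact: cvg_fst.
  have nc : nbhs q [set q' | cimg c q'] := near_cimg cq.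
  exact: (p1 _ nc).
apply: filterS2 N1 N2 => -[[q' w'] t'] /= h1 h2; split; first exact: h2.
by rewrite E.
Qed.

End Flow.

Lemma near_jet_arith {R : realType} (A1 A2 B1 B2 B3 B4 eta : R) : A1 <= B1 + B2 -> A2 <= B3 + B4 ->
  B1 < eta -> B3 < eta -> B2 < eta -> B4 < eta -> A1 + A2 < 4 * eta.
Proof. lra. Qed.

Lemma near_jet_arith2 {R : realType} (A1 A2 B1 B2 B3 B4 D eta de : R) : A1 <= B1 + B2 -> A2 <= B3 + B4 ->
  B2 < eta -> B4 < eta -> B1 + B3 <= 2 * D -> D < 4 * eta -> 0 <= B1 -> 0 <= B3 -> 16 * eta <= de -> A1 < de /\ A2 < de.
Proof. by move=> *; split; lra. Qed.

(** * Continuity of the Euler-Lagrange flow *)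

Section Flow.
Context {R : realType} {M : ptopologicalType} {d : nat}.
Variable SM : smooth_structure R M d.
Hypothesis M_hausdorff : hausdorff_space M.
Hypothesis M_compact : compact [set: M].
Hypothesis M_connected : connected [set: M].
Notation V := 'rV[R]_d.
Notation chart := (chart R M d).
Notation atlas := (atlas SM).
Variable g : M -> V -> V -> R.
Hypothesis g_metric : is_riemannian_metric SM g.
Variable L : M -> V -> R -> R.
Hypothesis L_smooth : lagrangian_smooth SM L.
Hypothesis L_periodic : lagrangian_periodic L.
Hypothesis L_superlinear : lagrangian_superlinear g L.
Hypothesis L_posdef : lagrangian_posdef L.
Hypothesis L_complete : EL_complete SM L.
Notation lag := (lag SM L).
Notation orbit := (orbit SM L).
Notation solves c := (solves_at (lag c) (cimg c)).
Notation F := (potential SM L).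
Notation phase := (g_sigma_algebraType (phase_open SM)).
Notation lift := (tangent_lift SM).

Definition jet_at (c : chart) gamma (t : R) (z : V * V) :=
  [/\ cdom c (gamma t), cmap c (gamma t) = z.1 & is_derive t (1 : R) (cmap c \o gamma) z.2].

Lemma jet_lift c gamma t z : orbit gamma -> atlas c -> jet_at c gamma t z ->
  lift gamma t = (tangent_of SM c z.1 z.2, circle_of t).
Proof.
move=> og ac [h1 h2 h3].
by rewrite /tangent_lift (velocity_coord ac (extremal_cont (og t)) h1 h3) /tangent_of -h2 cmapK.
Qed.

Lemma jet_exists c gamma t : orbit gamma -> atlas c -> cdom c (gamma t) -> exists z, jet_at c gamma t z.
Proof.
move=> og ac ct; have [w H] := extremal_in L_smooth L_periodic L_posdef (og _) ac ct; have [_ [_ h _]] := nbhs_singleton H.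
by exists (cmap c (gamma t), w t); split.
Qed.

Lemma jet_unique c gamma eta t z : orbit gamma -> orbit eta -> atlas c -> jet_at c gamma t z -> jet_at c eta t z -> gamma = eta.
Proof.
move=> og oe ac j1 j2; have := jet_lift oe ac j2; rewrite -(jet_lift og ac j1) => -[E1 E2].
exact: (orbit_unique L_smooth L_periodic L_posdef M_hausdorff og oe (t := t)).
Qed.

Lemma jet_derive c gamma t z z' : jet_at c gamma t z -> jet_at c gamma t z' -> z = z'.
Proof.
move=> [_ h1 h2] [_ h1' h2']; apply: injective_projections; first by rewrite -h1 -h1'.
by rewrite -(@derive_val _ _ _ _ _ _ _ h2) -(@derive_val _ _ _ _ _ _ _ h2').
Qed.

Lemma ivp_orbit c p r K : atlas c -> cball p r `<=` cimg c -> 0 < r -> 1 <= K ->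
  exists2 h, 0 < h & forall t1 q1 w1, `|q1 - p| <= r / 2 -> `|w1| <= K - 1 ->
    exists gamma w, [/\ orbit gamma, cmap c (gamma t1) = q1, w t1 = w1 & forall t, `|t - t1| < h ->
      [/\ cdom c (gamma t), solves c (cmap c \o gamma) w t & zone p r K (pt (cmap c (gamma t)) (w t) t)]].
Proof.
move=> ac bO r0 K1; have [h h0 [F _ H]] := ivp (@cimg_open R M d c) (lag_smooth L_smooth ac) (lag_periodic SM L_periodic c)
  (fun z a => @lag_posdef R M d SM L L_posdef c z a ac) bO r0 K1.
exists h => // t1 q1 w1 hq hw; have [q [w [E1 E2 Hs]]] := H t1 q1 w1 hq hw.
have habs t : t1 - h < t < t1 + h -> `|t - t1| < h by move=> ?; rewrite ltr_distl.
have tt : t1 - h < t1 + h by lra.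
have [Gam oG EG] : exists2 Gam, orbit Gam & forall t, t1 - h < t < t1 + h -> Gam t = (cinv c \o q) t.
  apply: (orbit_extension L_smooth L_periodic L_posdef M_hausdorff L_complete tt) => t tI.
  exists c, q, w; split; first exact: ac.
  have tI' : t \in `]t1 - h, t1 + h[ by rewrite in_itv.
  apply: filterS (near_in_itvoo tI') => s; rewrite in_itv /= => sI.
  by split => //; have [] := Hs s (habs s sI).
have ball t : `|t - t1| < h -> [/\ t1 - h < t < t1 + h, cdom c (Gam t) & cmap c (Gam t) = q t].
  move=> th; have [[iq _ _] _ _] := Hs t th; have tI : t1 - h < t < t1 + h by rewrite -ltr_distl.
  by rewrite EG //=; have [c1 c2] := cimgP iq.
have t1h : `|t1 - t1| < h by rewrite subrr normr0.
exists Gam, w; split; [exact: oG| |exact: E2|].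
  by have [_ _ ->] := ball t1 t1h.
move=> t th; have [tI ct Eq] := ball t th; have [sv zn _] := Hs t th.
split; [exact: ct| |by rewrite Eq].
apply: solves_near sv.
have tI' : t \in `]t1 - h, t1 + h[ by rewrite in_itv.
apply: filterS (near_in_itvoo tI') => s; rewrite in_itv /= => sI.
by have [_ _ ->] := ball s (habs s sI).
Qed.

Lemma orbit_through c q w t : atlas c -> cimg c q -> exists2 gamma, orbit gamma & jet_at c gamma t (q, w).
Proof.
move=> ac iq; have [r r0 bO] := chart_ball iq.
have K1 : 1 <= `|w| + 1 by rewrite lerDr.
have [h h0 H] := ivp_orbit ac bO r0 K1.
have q0 : `|q - q| <= r / 2 by rewrite subrr normr0 divr_ge0 // ltW.
have w0 : `|w| <= `|w| + 1 - 1 by rewrite addrK.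
have [gam [v [og E1 E2 Hs]]] := H t q w q0 w0.
exists gam => //; have [|ct [_ h2 _] _] := Hs t; first by rewrite subrr normr0.
by split => //=; rewrite -E2.
Qed.

(** [eps] and [del] serve all orbits [eta] at once. A jet near that of [gamma] is continued inside
    the chart by [ivp_orbit], uniqueness identifies the continuation with [eta], and [stability]
    bounds the growth of the gap by a factor 2. *)
Lemma jet_stability gamma t0 c : orbit gamma -> atlas c -> cdom c (gamma t0) -> exists eps del w, [/\ 0 < eps, 0 < del,
  forall s, `|s - t0| < eps -> cdom c (gamma s) /\ solves c (cmap c \o gamma) w s &
  forall eta s s' z, orbit eta -> `|s - t0| < eps -> `|s' - t0| < eps -> jet_at c eta s z ->
    `|z.1 - cmap c (gamma s)| + `|z.2 - w s| < del -> exists z', jet_at c eta s' z' /\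
    `|z'.1 - cmap c (gamma s')| + `|z'.2 - w s'| <= 2 * (`|z.1 - cmap c (gamma s)| + `|z.2 - w s|)].
Proof.
move=> og ac ct; have [w Hw] := extremal_in L_smooth L_periodic L_posdef (og _) ac ct.
have [_ [iq dq dw']] := nbhs_singleton Hw.
have [r r0 bO] := chart_ball iq; set p := cmap c (gamma t0) in iq bO.
pose K := `|w t0| + 2; have K1 : 1 <= K by rewrite /K; have := normr_ge0 (w t0); lra.
have [h h0 IVP] := ivp_orbit ac bO r0 K1.
have [C C1 ST] := stability (@cimg_open R M d c) (lag_smooth L_smooth ac) (lag_periodic SM L_periodic c)
  (fun z a => @lag_posdef R M d SM L L_posdef c z a ac) K bO.
have nn (f : R -> V) : {for t0, continuous f} -> forall e, 0 < e -> \forall s \near t0, `|f s - f t0| < e.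
  by move=> cf e e0; near=> s; rewrite distrC; near: s; apply: cvgr_dist_lt; [exact: cf|].
have r4 : 0 < r / 4 by rewrite divr_gt0.
have h2 : 0 < (2^-1 : R) by rewrite invr_gt0.
have n3 : \forall s \near t0, (cdom c (gamma s) /\ solves c (cmap c \o gamma) w s) /\
    (`|(cmap c \o gamma) s - (cmap c \o gamma) t0| < r / 4 /\ `|w s - w t0| < 2^-1).
  by apply: filterS3 Hw (nn _ (is_derive_continuous dq) _ r4) (nn _ (is_derive_continuous dw') _ h2) => s h1 h3 h4.
have [e e0 He] := near_interval n3.
pose eps := Num.min e (Num.min (h / 2) ((4 * C)^-1)).
have C0' : 0 < C by lra.
have [ep0 [ee eh eC]] : 0 < eps /\ [/\ eps <= e, eps <= h / 2 & eps <= (4 * C)^-1].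
  split; first by rewrite /eps !lt_min e0 divr_gt0 // invr_gt0 mulr_gt0.
  by split; rewrite /eps !ge_min lexx ?orbT.
pose del := Num.min (r / 4) 2^-1.
have [de0 dr d1] : [/\ 0 < del, del <= r / 4 & del <= 2^-1].
  by split; rewrite /del ?lt_min ?r4 //= ge_min lexx ?orbT.
have aK (A B D T : R) : A <= B + D -> B < del -> D < 2^-1 + T -> T = `|w t0| -> A <= K - 1 by move: d1; rewrite /K; lra.
have ar (A B D : R) : A <= B + D -> B < del -> D < r / 4 -> A <= r / 2 by move: dr; lra.
have ab' (A B D T : R) : A <= B + D -> B < 2^-1 -> D = `|w t0| -> A <= K by rewrite /K; lra.
have aq (A : R) : A < r / 4 -> A <= r by lra.
have adist (s s' : R) : `|s - t0| < eps -> `|s' - t0| < eps -> `|s' - s| < h.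
  move=> a1 a2; have := ler_distD t0 s' s; rewrite (distrC t0) => H; apply: le_lt_trans H _; move: a1 a2 eh; lra.
have eC2 : C * (2 * eps) <= 2^-1.
  have -> : (2^-1 : R) = C * (2 * (4 * C)^-1) by rewrite invfM; field; rewrite gt_eqF.
  by rewrite ler_pM2l // ler_pM2l.
exists eps, del, w; split; [exact: ep0|exact: de0|..].
  by move=> s hs; have [] := He s (lt_le_trans hs ee).
move=> eta s s' z oe hs hs' jz hz.
have [h1 [h3 h4]] := He s (lt_le_trans hs ee).
have [x1 x2] := conj (normr_ge0 (z.1 - cmap c (gamma s))) (normr_ge0 (z.2 - w s)).
have z1 : `|z.1 - p| <= r / 2.
  apply: (ar _ `|z.1 - cmap c (gamma s)| `|cmap c (gamma s) - p|); [exact: ler_distD| |exact: h3].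
  by apply: le_lt_trans hz; rewrite lerDl.
have z2 : `|z.2| <= K - 1.
  apply: (aK _ `|z.2 - w s| `|w s| `|w t0|) => //.
  - by rewrite -[X in `|X| <= _](subrK (w s)) ler_normD.
  - by apply: le_lt_trans hz; rewrite lerDr.
  - by apply: le_lt_trans (_ : `|w s - w t0| + `|w t0| < _); [rewrite -[X in `|X| <= _](subrK (w t0)) ler_normD|rewrite ltrD2r].
have [eta' [v [oe' E1 E2 Hs]]] := IVP s z.1 z.2 z1 z2.
have s_h : `|s - s| < h by rewrite subrr normr0.
have Ee : eta' = eta.
  apply: (jet_unique oe' oe ac (t := s) (z := z)) jz.
  have [a1 [_ a2 _] _] := Hs s s_h; by split; [exact: a1|exact: E1|rewrite -E2].
subst eta'; exists (cmap c (eta s'), v s'); split.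
  by have [a1 [_ a2 _] _] := Hs s' (adist _ _ hs hs'); split.
have -> : `|z.1 - cmap c (gamma s)| + `|z.2 - w s| = `|cmap c (eta s) - cmap c (gamma s)| + `|v s - w s| by rewrite E1 E2.
pose a := Num.min s s'; pose b := Num.max s s'.
have near_ab x : a <= x <= b -> `|x - t0| < eps.
  move=> /andP[x3 x4]; rewrite ltr_distl; move: hs hs'; rewrite !ltr_distl => /andP[y1 y2] /andP[y3 y4]; apply/andP; split.
    by apply: lt_le_trans x3; rewrite /a lt_min y1 y3.
  by apply: le_lt_trans x4 _; rewrite /b gt_max y2 y4.
have sab : a <= s <= b by rewrite /a /b ge_min le_max lexx.
have s'ab : a <= s' <= b by rewrite /a /b ge_min le_max lexx !orbT.
have Cab : C * (b - a) <= 2^-1.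
  apply: le_trans eC2; rewrite ler_pM2l //.
  have aab : a <= a <= b by rewrite lexx (le_trans (proj1 (andP sab)) (proj2 (andP sab))).
  have bab : a <= b <= b by rewrite lexx andbT (le_trans (proj1 (andP sab)) (proj2 (andP sab))).
  move: (near_ab _ aab) (near_ab _ bab); rewrite !ltr_distl => /andP[y1 y2] /andP[y3 y4]; move: y1 y4; lra.
have A1 x : a <= x <= b -> solves c (cmap c \o gamma) w x /\ zone p r K (pt ((cmap c \o gamma) x) (w x) x).
  move=> xab; have [[y1 y2] [y3 y4]] := He x (lt_le_trans (near_ab x xab) ee).
  split; first exact: y2.
  split => /=; first exact: aq y3.
  apply: (ab' `|w x| `|w x - w t0| `|w t0| 0) => //; by rewrite -[X in `|X| <= _](subrK (w t0)) ler_normD.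
have A2 x : a <= x <= b -> solves c (cmap c \o eta) v x /\ zone p r K (pt ((cmap c \o eta) x) (v x) x).
  by move=> xab; have [y1 y2 y3] := Hs x (adist _ _ hs (near_ab x xab)).
by have [] := ST a b _ _ _ _ s Cab A1 A2 sab s' s'ab.
Unshelve. all: by end_near. Qed.

(** Neighbourhoods of [gamma] among orbits, seen at time [t]. The offset [r] is there because time
    is one of the coordinates of the phase space. Continuity of the flow is the fact that this
    notion does not depend on [t]. *)
Definition near_jet gamma (t : R) (S : (R -> M) -> R -> Prop) := exists c z del, [/\ atlas c, jet_at c gamma t z, 0 < del &
  forall eta r z', orbit eta -> `|r| < del -> jet_at c eta (t + r) z' -> `|z'.1 - z.1| < del -> `|z'.2 - z.2| < del -> S eta r].

Lemma jet_change c c' gamma t z : orbit gamma -> atlas c -> atlas c' -> jet_at c gamma t z -> cdom c' (gamma t) ->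
  jet_at c' gamma t (trans c c' z.1, 'd (trans c c') (z.1 : V) (z.2 : V)).
Proof.
move=> og ac ac' [h1 h2 h3] ct; split => //=; first by rewrite -h2 trans_cmap.
by rewrite -h2; exact: (chart_change ac ac' (extremal_cont (og t)) h1 ct h3).
Qed.

Lemma near_jet_chart gamma t S c z : near_jet gamma t S -> orbit gamma -> atlas c -> jet_at c gamma t z ->
  exists2 del, 0 < del &
  forall eta r z', orbit eta -> `|r| < del -> jet_at c eta (t + r) z' -> `|z'.1 - z.1| < del -> `|z'.2 - z.2| < del -> S eta r.
Proof.
move=> [c0 [z0 [del [ac0 j0 del0 H]]]] og ac jz.
have [ct Ez dz] := jz; have [ct0 _ _] := j0.
have jz0 : z0 = (trans c c0 z.1, 'd (trans c c0) (z.1 : V) (z.2 : V)) := jet_derive j0 (jet_change og ac ac0 jz ct0).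
have ov : overlap c c0 z.1 by rewrite -Ez; exact: overlap_cmap.
have c1 : {for (z.1 : V, z.2 : V), continuous (fun y : V * V => 'd (trans c c0) (y.1 : V) (y.2 : V))} := @trans_derive_cont _ _ _ _ _ _ _ ac ac0 ov z.2.
have c2 : {for z.1, continuous (trans c c0)} by exact: differentiable_continuous (trans_diff ac ac0 ov).
have n1 := near_overlap ov.
have n2 : \forall y \near z.1, `|trans c c0 z.1 - trans c c0 y| < del.
  have /cvgrPdist_lt K1 : trans c c0 x @[x --> (z.1 : V)] --> trans c c0 z.1 := c2; exact: K1 _ del0.
have n3 : \forall y \near (z.1 : V, z.2 : V), `|'d (trans c c0) (z.1 : V) (z.2 : V) - 'd (trans c c0) (y.1 : V) (y.2 : V)| < del.
  have /cvgrPdist_lt K1 := c1; exact: K1 _ del0.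
have [e1 e10 He1] := near_interval (filterI n1 n2); have [e3 e30 He3] := near_interval n3.
exists (Num.min del (Num.min e1 e3)); first by rewrite !lt_min del0 e10.
move=> eta r z'; rewrite !lt_min => oe /and3P[r1 _ _] je /and3P[_ a1 a3] /and3P[_ _ b3].
have [ov' d1] := He1 _ a1.
have d3 : `|'d (trans c c0) (z.1 : V) (z.2 : V) - 'd (trans c c0) (z'.1 : V) (z'.2 : V)| < del.
  by apply: (He3 (z'.1, z'.2)); rewrite prod_normE /= gt_max a3 b3.
have ce : cdom c0 (eta (t + r)).
  have [q1 q2 _] := je; by move: ov' => [_]; rewrite -q2 cmapK.
apply: H (jet_change oe ac ac0 je ce) _ _ => //=; by rewrite jz0 distrC.
Qed.

Lemma near_jet_local gamma t0 : orbit gamma -> exists2 eps, 0 < eps & forall s s' S,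
  `|s - t0| < eps -> `|s' - t0| < eps -> near_jet gamma s S -> near_jet gamma s' S.
Proof.
move=> og; pose c := chart_at SM (gamma t0); have ac : atlas c := chart_at_atlas SM _.
have [eps [del [w [eps0 del0 Hg Hst]]]] := jet_stability og ac (chart_at_mem SM (gamma t0)).
have jg s : `|s - t0| < eps -> jet_at c gamma s (cmap c (gamma s), w s).
  by move=> /Hg[h1 [_ h2 _]]; split.
exists eps => // s s' S hs hs' N.
have [de de0 HS] := near_jet_chart N og ac (jg s hs).
(* Gaps add up to less than [4 * eta0] at time [s' + r], are at most doubled by [jet_stability], and
   gain another [eta0] when referred to time [s]: 9 in all, below 16. *)
pose eta0 := Num.min del de / 16.
have ee0 : 0 < eta0 by rewrite divr_gt0 // lt_min del0.
have [ed ede] : 16 * eta0 <= del /\ 16 * eta0 <= de.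
  by rewrite /eta0 mulrC divfK ?pnatr_eq0 //; split; rewrite ge_min lexx ?orbT.
have nr s1 : `|s1 - t0| < eps -> exists2 e, 0 < e & forall r, `|r| < e -> [/\ `|s1 + r - t0| < eps,
    `|cmap c (gamma (s1 + r)) - cmap c (gamma s1)| < eta0 & `|w (s1 + r) - w s1| < eta0].
  move=> h1; have [_ [_ d1 d2]] := Hg _ h1.
  have n0 : \forall x \near s1, `|x - t0| < eps.
    have h2 : 0 < eps - `|s1 - t0| by rewrite subr_gt0.
    apply: filterS (nbhsx_ballx s1 _ h2) => x hx; rewrite /ball /= distrC ltrBrDr in hx.
    by apply: le_lt_trans hx; exact: ler_distD.
  have n1 : \forall x \near s1, `|(cmap c \o gamma) s1 - (cmap c \o gamma) x| < eta0.
    have /cvgrPdist_lt K1 : (cmap c \o gamma) x @[x --> s1] --> (cmap c \o gamma) s1 := is_derive_continuous d1; exact: K1 _ ee0.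
  have n2 : \forall x \near s1, `|w s1 - w x| < eta0.
    have /cvgrPdist_lt K1 : w x @[x --> s1] --> w s1 := is_derive_continuous d2; exact: K1 _ ee0.
  have n3 : \forall x \near s1, [/\ `|x - t0| < eps, `|(cmap c \o gamma) s1 - (cmap c \o gamma) x| < eta0 & `|w s1 - w x| < eta0].
    by apply: filterS3 n0 n1 n2.
  have [e e0 He] := near_interval n3; exists e => // r hr.
  by have [|x1 x2 x3] := He (s1 + r); [rewrite addrAC subrr add0r|split => //; rewrite distrC].
have [e1 e10 He1] := nr s hs; have [e2 e20 He2] := nr s' hs'.
exists c, (cmap c (gamma s'), w s'), (Num.min e1 (Num.min e2 (Num.min eta0 de))).
split; [exact: ac|exact: jg|by rewrite !lt_min e10 e20 ee0|].
move=> eta r z'; rewrite !lt_min /= => oe /and4P[r1 r2 r3 r4] jz /and4P[_ _ a1 _] /and4P[_ _ b1 _].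
have [x1 x2 x3] := He1 r r1; have [y1 y2 y3] := He2 r r2.
have T (v1 v2 v3 : V) : `|v1 - v3| <= `|v1 - v2| + `|v2 - v3| by exact: ler_distD.
have close : `|z'.1 - cmap c (gamma (s' + r))| + `|z'.2 - w (s' + r)| < 4 * eta0.
  have t1 := T z'.1 (cmap c (gamma s')) (cmap c (gamma (s' + r))); have t2 := T z'.2 (w s') (w (s' + r)).
  rewrite (distrC (cmap c (gamma s'))) in t1; rewrite (distrC (w s')) in t2.
  apply: near_jet_arith t1 t2 a1 b1 y2 y3.
have [z2 [jz2 hz2]] : exists z2, jet_at c eta (s + r) z2 /\
    `|z2.1 - cmap c (gamma (s + r))| + `|z2.2 - w (s + r)| <= 2 * (`|z'.1 - cmap c (gamma (s' + r))| + `|z'.2 - w (s' + r)|).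
  by apply: (Hst eta (s' + r) (s + r) z' oe y1 x1 jz); apply: lt_le_trans close _; apply: le_trans ed; rewrite ler_pM2r // ler_nat.
have t1 := T z2.1 (cmap c (gamma (s + r))) (cmap c (gamma s)); have t2 := T z2.2 (w (s + r)) (w s).
have [u1 u2] := near_jet_arith2 t1 t2 x2 x3 hz2 close (normr_ge0 _) (normr_ge0 _) ede.
exact: (HS eta r z2).
Qed.

(** [near_jet_local] gives an equivalence between nearby times, and equivalences chain along the
    interval. *)
Lemma near_jet_all gamma S s t : orbit gamma -> near_jet gamma s S -> near_jet gamma t S.
Proof.
move=> og.
have main a b : a <= b -> near_jet gamma a S <-> near_jet gamma b S.
  move=> ab; apply: (interval_cousin (P := fun a b => near_jet gamma a S <-> near_jet gamma b S) ab).
    by move=> x y z _ _ _ _ h1 h2; exact: iff_trans h1 h2.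
  move=> x _; have [e e0 He] := near_jet_local x og; exists e => // r y _ rx xy _ h1 h2.
  have hr : `|r - x| < e by rewrite ler0_norm ?subr_le0 // opprB; move: h1; rewrite ltrBlDr ltrBlDl addrC.
  have hy : `|y - x| < e by rewrite ger0_norm ?subr_ge0 // ltrBlDl.
  by split; apply: He.
by have [/main[h _]|/ltW/main[_ h]] := leP s t.
Qed.

(** Membership in [O] at time [t + s] is an open condition on jets there; [near_jet_all] transports
    it to time [t], where it reads as an open condition on the initial point, velocity and time. *)
Lemma flow_open s (O : set phase) : phase_open SM O -> phase_open SM (EL_flow L s @^-1` O).
Proof.
move=> oO c ac; rewrite openE => -[[q w] t] /= [iq Oz].
have [gam og jg] := orbit_through w t ac iq.
have flw eta r y : orbit eta -> jet_at c eta r y -> EL_flow L s (tangent_of SM c y.1 y.2, circle_of r) = lift eta (r + s).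
  by move=> oe jy; rewrite -(jet_lift oe ac jy); apply: flow_lift.
have := Oz; rewrite (flw _ _ _ og jg) => Og.
pose S (eta : R -> M) (r : R) := O (lift eta (t + s + r)).
have NS : near_jet gam (t + s) S.
  pose c1 := chart_at SM (gam (t + s)); have ac1 : atlas c1 := chart_at_atlas SM _.
  have [z1 jz1] := jet_exists og ac1 (chart_at_mem SM (gam (t + s))).
  have n1 : \forall z \near (z1.1, z1.2, t + s), cimg c1 z.1.1 /\ O (tangent_of SM c1 z.1.1 z.1.2, circle_of z.2).
    apply: open_nbhs_nbhs; split; first exact: (oO c1 ac1).
    rewrite /= -(jet_lift og ac1 jz1); split; last exact: Og.
    by have [h1 <- _] := jz1; exact: cimg_cmap.
  have [e e0 He] := near_interval n1.
  exists c1, z1, e; split => // eta r z' oe hr jz' a1 a2.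
  rewrite /S (jet_lift oe ac1 jz').
  have [|_] := He (z'.1, z'.2, t + s + r); last exact.
  by rewrite prod_normE /= prod_normE /= !gt_max a1 a2 addrAC subrr add0r.
have [de de0 HS] := near_jet_chart (near_jet_all t og NS) og ac jg.
have n1 := near_cimg iq; have [e e0 He] := near_interval n1.
pose del := Num.min e de; have del0 : 0 < del by rewrite lt_min e0.
have nz : \forall z \near ((q, w, t) : V * V * R), `|(q, w, t) - z| < del.
  have /cvgrPdist_lt K1 : z @[z --> ((q, w, t) : V * V * R)] --> ((q, w, t) : V * V * R) by exact: cvg_id.
  exact: K1 _ del0.
apply: filterS nz => -[[q' w'] t']; rewrite prod_normE /= prod_normE /= !gt_max => /andP[/andP[b1 b2] b3] /=.
have b1' : `|q' - q| < del by rewrite distrC.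
have b2' : `|w' - w| < del by rewrite distrC.
have b3' : `|t' - t| < del by rewrite distrC.
have iq' : cimg c q' by apply: He; apply: lt_le_trans b1' _; rewrite ge_min lexx.
have lede x : x < del -> x < de by move=> /lt_le_trans; apply; rewrite ge_min lexx orbT.
have [eta oe je] := orbit_through w' t' ac iq'.
split; first exact: iq'.
rewrite -[q']/((q', w').1) -[X in tangent_of _ _ _ X]/((q', w').2) (flw _ _ _ oe je).
have := HS eta (t' - t) (q', w') oe (lede _ b3'); rewrite /S.
rewrite (_ : t + (t' - t) = t'); last by ring.
rewrite (_ : t + s + (t' - t) = t' + s); last by ring.
by apply => //=; exact: lede.
Qed.

Lemma flow_measurable s (A : set phase) : measurable A -> measurable (EL_flow L s @^-1` A).
Proof.
have mf : @measurable_fun _ _ phase phase setT (EL_flow L s).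
  apply: (@measurability _ _ phase phase setT _ (phase_open SM)) => // _ [B oB <-].
  by rewrite setTI; apply: sub_sigma_algebra; exact: flow_open oB.
by move=> mA; rewrite -[X in measurable X]setTI; exact: mf.
Qed.

End Flow.

(** * Bounds at the critical value *)

Lemma uniformly_continuous {R : realType} (f : R -> R) a b e : continuous f -> a <= b -> 0 < e ->
  exists2 del, 0 < del & forall x y, a <= x <= b -> `|y - x| < del -> `|f y - f x| <= e.
Proof.
move=> cf ab e0; apply: (interval_cousin (P := fun a b => exists2 del, 0 < del & forall x y, a <= x <= b -> `|y - x| < del -> `|f y - f x| <= e) ab).
  move=> r s t _ rs st _ [d1 d10 H1] [d2 d20 H2]; exists (Num.min d1 d2); first by rewrite lt_min d10.
  move=> x y /andP[rx xt]; rewrite lt_min => /andP[y1 y2].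
  by have [xs|/ltW sx] := leP x s; [apply: H1; rewrite ?rx|apply: H2; rewrite ?sx].
move=> s _; have /cvgrPdist_lt K1 : f x @[x --> s] --> f s := cf s.
have e2 : 0 < e / 2 by exact: divr_gt0.
have [d d0 Hd] := near_interval (K1 _ e2).
have d2 : 0 < d / 2 by exact: divr_gt0.
exists (d / 2) => // r t _ _ _ _ h1 h2; exists (d / 2) => // x y /andP[rx xt] yx.
have xs : `|x - s| < d / 2 by rewrite ltr_distl (lt_le_trans h1 rx) (le_lt_trans xt h2).
have d2d : d / 2 < d by lra.
have x1 := Hd x (lt_trans xs d2d).
have y1 : `|y - s| < d.
  by have := ler_distD x y s; move: xs yx; lra.
have := Hd y y1; have := ler_distD (f s) (f y) (f x); rewrite (distrC (f y) (f s)); move: x1; lra.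
Qed.

(** [A] stands for the action along an orbit. Additivity and the bound by an upper bound of the
    integrand are all that enters, so the estimate is one-sided; uniform continuity of [f] gives the
    mesh. *)
Lemma riemann_sum {R : realType} (f : R -> R) (A : R -> R -> R) a T e : continuous f ->
  (forall r s t, r <= s -> s <= t -> A r t = A r s + A s t) ->
  (forall r t B, r <= t -> (forall s, r <= s <= t -> f s <= B) -> A r t <= B * (t - r)) ->
  0 < T -> 0 < e -> exists m0, forall m, (m0 <= m)%N ->
    A a (a + T) <= \sum_(j < m.+1) T / m.+1%:R * f (a + j%:R * (T / m.+1%:R)) + e.
Proof.
move=> cf addA leA T0 e0; have eT : 0 < e / T by exact: divr_gt0.
have aT : a <= a + T by rewrite lerDl ltW.
have [d d0 Hd] := uniformly_continuous cf aT eT.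
exists (Num.truncn (T / d)).+1 => m hm; pose h := T / m.+1%:R.
have h0 : 0 < h by rewrite divr_gt0.
have hd : h < d.
  rewrite /h ltr_pdivrMr // mulrC -ltr_pdivrMr //.
  apply: lt_le_trans (truncnS_gt _) _; rewrite ler_nat; exact: leq_trans hm (leqnSn _).
have hm1 : m.+1%:R * h = T by rewrite /h mulrC divfK ?pnatr_eq0.
have main (j : nat) : (j <= m.+1)%N -> A a (a + j%:R * h) <= \sum_(i < j) h * f (a + i%:R * h) + j%:R * h * (e / T).
  elim: j => [_|j IH jm].
    rewrite mul0r addr0 big_ord0 !mul0r addr0.
    have z := leA a a (f a) (lexx a); rewrite subrr mulr0 in z; apply: z => s /andP[s1 s2].
    by rewrite (le_anti (introT andP (conj s2 s1))).
  have jh : 0 <= j%:R * h by rewrite mulr_ge0 // ltW.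
  rewrite big_ord_recr /= -natr1 mulrDl mul1r addrA.
  rewrite (addA a (a + j%:R * h)) ?lerDl // ?(ltW h0) //.
  have step : A (a + j%:R * h) (a + j%:R * h + h) <= (f (a + j%:R * h) + e / T) * h.
    rewrite [X in _ <= _ * X](_ : h = a + j%:R * h + h - (a + j%:R * h)); last by ring.
    apply: leA; first by rewrite lerDl ltW.
    move=> s /andP[s1 s2].
    have jT : a <= a + j%:R * h <= a + T.
      by rewrite lerDl jh lerD2l -hm1 ler_pM2r // ler_nat ltnW.
    have sd : s - (a + j%:R * h) < d by move: s2 hd; lra.
    have sd' : `|s - (a + j%:R * h)| < d by rewrite ger0_norm ?subr_ge0.
    by have := Hd _ s jT sd'; rewrite ler_distl => /andP[].
  have := IH (ltnW jm); move: step.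
  rewrite (mulrDl _ _ (e / T)) (mulrDl (f _)) (mulrC (f _)) (mulrC (e / T) h).
  move: (A _ _) (A _ _) (\sum_(i < j) _) (h * f _) (h * (e / T)) (j%:R * h * (e / T)) => *; lra.
by have := main m.+1 (leqnn _); rewrite hm1 (mulrC T) divfK ?gt_eqF.
Qed.

Lemma upper_arith {R : realType} (A A1 A2 A3 A4 P C0 k t N : R) : A <= 1 -> A = A1 + A2 -> A2 = A3 + A4 ->
  - (C0 * (k - t)) <= A1 -> - (C0 * (t + N + 1 - (k + N))) <= A4 -> P <= A3 -> P <= 1 + C0.
Proof.
have -> : C0 * (t + N + 1 - (k + N)) = C0 - C0 * (k - t) by ring.
move: (C0 * (k - t)) => u; lra.
Qed.

Lemma lower_arith {R : realType} (X A B C : R) : 0 <= X -> X <= A + B -> B <= C -> - A <= C.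
Proof. lra. Qed.

Lemma fatou_arith {R : realType} (X Y Z : R) : 1 < X -> X <= Y + 1 / 2 -> 1 / 2 + Z <= Y + Z.
Proof. lra. Qed.

Lemma upper_arith2 {R : realType} (X1 X2 X3 X4 C1 C0 : R) : X1 <= C1 -> X2 <= X3 + X4 -> X3 <= 1 + C0 -> X4 <= C1 ->
  X1 + X2 <= 2 * C1 + 1 + C0.
Proof. lra. Qed.

Section Flow.
Context {R : realType} {M : ptopologicalType} {d : nat}.
Variable SM : smooth_structure R M d.
Hypothesis M_hausdorff : hausdorff_space M.
Hypothesis M_compact : compact [set: M].
Hypothesis M_connected : connected [set: M].
Notation V := 'rV[R]_d.
Notation atlas := (atlas SM).
Notation is_path := (is_path SM).
Variable g : M -> V -> V -> R.
Hypothesis g_metric : is_riemannian_metric SM g.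
Variable L : M -> V -> R -> R.
Hypothesis L_smooth : lagrangian_smooth SM L.
Hypothesis L_periodic : lagrangian_periodic L.
Hypothesis L_superlinear : lagrangian_superlinear g L.
Hypothesis L_posdef : lagrangian_posdef L.
Hypothesis L_complete : EL_complete SM L.
Notation lag := (lag SM L).
Notation lag_action := (lag_action SM L).
Notation orbit := (orbit SM L).
Notation F := (potential SM L).
Notation phase := (g_sigma_algebraType (phase_open SM)).
Notation lift := (tangent_lift SM).

Hypothesis L_critical : is_critical_value SM L 0.
Variable C0 : R.
Hypothesis C00 : 0 <= C0.
Hypothesis HC0 : forall x v t, - C0 <= L x v t.

Lemma mean_action_shift (mu : probability phase R) :
  (\int[mu]_z (phase_lagrangian L z + C0)%:E = mean_action L mu + C0%:E)%E.
Proof. by apply: integral_probability_shift => //; [exact: (phase_lagrangian_measurable L_smooth L_periodic)|move=> z; exact: HC0]. Qed.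

Lemma loop_minimizer (n : nat) : (0 < n)%N -> exists x0, forall x, F 0 n%:R x0 x0 <= F 0 n%:R x x.
Proof.
move=> n0; have n0R : 0 < n%:R :> R by rewrite ltr0n.
have cF : {within [set: M], continuous (fun x => F 0 n%:R x x)}.
  apply: continuous_subspaceT => x; apply/cvgrPdist_le => e e0.
  have [del del0 H] := potential_cont M_hausdorff M_compact M_connected g_metric L_smooth L_periodic L_superlinear L_posdef L_complete x x n0R e0.
  have [[A B] [nA nB] AB] := H.
  apply: filterS (filterI nA nB) => y [Ay By].
  have := AB (y, y) (conj Ay By) 0 n%:R; rewrite !subrr normr0 distrC => h.
  by have [] := h del0 del0.
have [x0 _ H] := compact_EVT_min (ex_intro _ point I) M_compact cF.
by exists x0 => x; apply: H; rewrite inE.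
Qed.

(** A minimal loop might have a corner at its base point. Cut instead at the half period [sig], it
    still minimizes between its new end points, so it is an orbit across time [N]. Hence [Gam] and
    its translate by [n] both coincide with that orbit. *)
Lemma periodic_minimizer (n : nat) x0 : (0 < n)%N -> (forall x, F 0 n%:R x0 x0 <= F 0 n%:R x x) ->
  exists gamma, [/\ orbit gamma, forall t, gamma (t + n%:R) = gamma t & lag_action 0 n%:R gamma = F 0 n%:R x0 x0].
Proof.
move=> n0 mx0; set N : R := n%:R; have N0 : 0 < N by rewrite ltr0n.
have [Gam [pG oG G0 GN AG]] := potential_attained M_hausdorff M_compact M_connected g_metric L_smooth L_periodic L_superlinear L_posdef L_complete x0 x0 N0.
pose sig := N / 2; have [s0 sN] : 0 < sig /\ sig < N by rewrite /sig; lra.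
pose Gs := fun t => Gam (t + (- n%:Z)%:~R).
have nE : (- n%:Z)%:~R = - N by rewrite mulrNz -pmulrn.
have oGs : orbit Gs := orbit_shift L_periodic _ oG.
pose eta := splice N Gam Gs.
have p1 : is_path sig N Gam by apply: pathW pG _ _ _; rewrite ?lexx // ltW.
have p2' : is_path (N + (- n%:Z)%:~R) (N + sig + (- n%:Z)%:~R) Gam.
  by rewrite nE; apply: pathW pG _ _ _; lra.
have p2 : is_path N (N + sig) Gs := path_shift p2'.
have EN : Gam N = Gs N by rewrite /Gs nE subrr G0.
have pe : is_path sig (N + sig) eta := path_glue p1 p2 EN.
have Ae : lag_action sig (N + sig) eta = F 0 N x0 x0.
  rewrite (lag_action_glue L_smooth p1 p2 EN) (lag_action_shift L_smooth L_periodic p2') nE subrr.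
  rewrite (_ : N + sig - N = sig); last by ring.
  by rewrite addrC -(lag_action_cat L_smooth pG (ltW s0) (ltW sN)).
have sNs : sig < N + sig by rewrite ltrDr.
have e1 : eta sig = Gam sig by rewrite /eta /splice (ltW sN).
have e2 : eta (N + sig) = Gam sig.
  rewrite /eta /splice leNgt ltrDl s0 /= /Gs nE; congr Gam; ring.
(* A minimizer from [sig] to [N + sig], cut at time [N] at a point [y] and rearranged, becomes a
   loop based at [y], whose action is at least that of the minimal loop. *)
have min : lag_action sig (N + sig) eta <= F sig (N + sig) (eta sig) (eta (N + sig)).
  rewrite e1 e2 Ae.
  have NNs : N < N + sig by rewrite ltrDl.
  have [y ->] := potential_split M_hausdorff M_compact M_connected g_metric L_smooth L_periodic L_superlinear L_posdef L_complete (Gam sig) (Gam sig) sN NNs.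
  apply: le_trans (mx0 y) _.
  apply: le_trans (potential_tri M_hausdorff M_compact M_connected g_metric L_smooth L_periodic L_superlinear L_posdef L_complete _ (Gam sig) _ s0 sN) _.
  rewrite addrC lerD2l.
  have := potential_shift M_hausdorff M_compact M_connected g_metric L_smooth L_periodic L_superlinear L_posdef L_complete n%:Z y (Gam sig) s0.
  by rewrite -pmulrn add0r addrC => ->.
have me := potential_minimizes M_hausdorff M_compact M_connected g_metric L_smooth L_periodic L_superlinear L_posdef L_complete sNs pe min.
have [Del oD ED] := minimizer_orbit M_hausdorff M_compact g_metric L_smooth L_periodic L_superlinear L_posdef L_complete sNs me.
have ident (ga : R -> M) (a b : R) : orbit ga -> a < b -> (forall t, a < t < b -> ga t = Del t) -> ga = Del.
  move=> oga ab E; pose t := (a + b) / 2.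
  apply: (orbit_unique L_smooth L_periodic L_posdef M_hausdorff oga oD (t := t)).
  have tI : t \in `]a, b[ by rewrite in_itv /= /t !midf_lt.
  apply: jet_near; apply: filterS (near_in_itvoo tI).
  by move=> s; rewrite in_itv /= => /E.
have G1 : Gam = Del.
  apply: (ident _ _ _ oG sN) => t /andP[t1 t2].
  rewrite -ED; last by rewrite (ltW t1) (le_trans (ltW t2)) // lerDl ltW.
  by rewrite /eta /splice (ltW t2).
have G2 : Gs = Del.
  apply: (ident _ N (N + sig) oGs); first by rewrite ltrDl.
  move=> t /andP[t1 t2]; rewrite -ED; last by rewrite (ltW t2) andbT ltW // (lt_trans sN).
  by rewrite /eta /splice leNgt t1.
exists Gam; split; [exact: oG| |exact: AG] => t; have <- : Gs (t + N) = Gam t by rewrite /Gs nE addrK.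
by rewrite G2 -G1.
Qed.

(** Flowing the orbit is a shift of time, and over a full period the measure of a set of times is
    shift invariant; hence the occupation measure is invariant and [L_critical] applies. Adding [C0]
    makes the integrand nonnegative, as the occupation formula requires; it cancels in the end. *)
Lemma periodic_orbit_action (n : nat) gamma : (0 < n)%N -> orbit gamma -> (forall t, gamma (t + n%:R) = gamma t) ->
  0 <= lag_action 0 n%:R gamma.
Proof.
move=> n0 og pg; have N0 : (0 : R) < n%:R by rewrite ltr0n.
have [mu [muE muI]] := occupation N0 (lift_measurable L_smooth L_periodic L_posdef og).
have mB (A : set phase) : measurable A -> measurable (lift gamma @^-1` A).
  by move=> mA; rewrite -[X in measurable X]setTI; exact: (lift_measurable L_smooth L_periodic L_posdef og).
have liftn t : lift gamma (t + n%:R) = lift gamma t.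
  have Ek : (n%:R : R) = n%:Z%:~R by rewrite -pmulrn.
  rewrite /tangent_lift pg; congr (_, _, _).
    have E : (fun r => gamma (r + n%:Z%:~R)) = gamma by apply/funext => r; rewrite -Ek pg.
    by have := velocity_shift L_smooth L_periodic L_posdef n t og; rewrite E -Ek => <-.
  by apply/circle_ofP; exists n.
have inv : EL_invariant L mu.
  move=> s A mA.
  have E : lift gamma @^-1` (EL_flow L s @^-1` A) = (fun t => t + s) @^-1` (lift gamma @^-1` A).
    by apply/seteqP; split => t /=; rewrite (flow_lift M_hausdorff L_smooth L_periodic L_posdef).
  have pB t : (lift gamma @^-1` A) (t + n%:R) <-> (lift gamma @^-1` A) t by rewrite /= liftn.
  rewrite (muE _ mA) (muE _ (flow_measurable M_hausdorff L_smooth L_periodic L_posdef L_complete s mA)) E; congr (_ * _)%E.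
  exact (periodic_window s N0 (mB _ mA) pB).
have /(_ mu inv) := L_critical.2; rewrite oppr0 => m0.
have := mean_action_shift mu.
have h0 (z : phase) : 0 <= phase_lagrangian L z + C0.
  by have := HC0 z.1.1 z.1.2 (circle_repr z.2); rewrite /phase_lagrangian; lra.
rewrite muI //; last by apply: measurable_funD => //; exact: (phase_lagrangian_measurable L_smooth L_periodic).
have [sq [P [iP _ _ _]]] := path_action L_smooth (orbit_path L_smooth L_periodic L_posdef og (ltW N0)).
under eq_integral => t _ do rewrite (phase_lagrangian_lift _ L_periodic) EFinD.
have icst : lebesgue_measure.-integrable `[0%R, n%:R : R] (EFin \o (cst C0)).
  by apply: continuous_compact_integrable; [exact: segment_compact|move=> ?; exact: cvg_cst].
rewrite integralD //= integral_cst //= lebesgue_measure_itv /= lte_fin N0 sube0.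
have -> : (\int[lebesgue_measure]_(t in `[0%R, n%:R]) (speed SM L gamma t)%:E = (lag_action 0 n%:R gamma)%:E)%E.
  by rewrite /lag_action /Rintegral fineK //; exact: integrable_fin_num.
case: (mean_action L mu) m0 => [m| |]; rewrite ?leeNy_eq //= lee_fin => m0.
move=> /(congr1 fine) /= E.
have h : n%:R^-1 * lag_action 0 n%:R gamma = m.
  by move: E; rewrite mulrDr (mulrC C0) mulKf ?gt_eqF // => /addIr.
by move: m0; rewrite -h pmulr_rge0 ?invr_gt0.
Qed.

Lemma loop_nonneg (n : nat) x : (0 < n)%N -> 0 <= F 0 n%:R x x.
Proof.
move=> n0; have [x0 m0] := loop_minimizer n0; apply: le_trans (m0 x).
have [gamma [og pg <-]] := periodic_minimizer n0 m0; exact: periodic_orbit_action.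
Qed.

Lemma orbit_C1 gamma : orbit gamma -> curve_Ck_on SM 1 setT gamma.
Proof.
move=> /(orbitP L_smooth L_periodic L_posdef)[[h1 h2] _]; split => // c ac; have [k1 k2] := h2 c ac.
split => // v x Jx; have [k3 _] := k2 v; exact: differentiable_continuous (k3 x Jx).
Qed.

Lemma orbit_speed gamma : orbit gamma -> continuous (speed SM L gamma).
Proof. by move=> og t; exact: (speed_cont L_smooth openT (orbit_C1 og)). Qed.

Lemma orbit_action_le gamma B r t : orbit gamma -> r <= t -> (forall s, r <= s <= t -> speed SM L gamma s <= B) ->
  lag_action r t gamma <= B * (t - r).
Proof.
move=> og rt H; have p := orbit_path L_smooth L_periodic L_posdef og rt.
have [s' [P [_ cP e dP]]] := path_action L_smooth p.
rewrite e //; have -> : B * (t - r) = B * t - B * r by ring.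
apply: (@le_derive_le _ s') => //.
  by apply: continuous_subspaceT => x; apply: cvgM; [exact: cvg_cst|exact: cvg_id].
move=> x xrt xs; have [cx K] := dP x xrt xs.
have ac := chart_at_atlas SM (gamma x); have ct := chart_at_mem SM (gamma x).
have [w h1 h2] := K _ ac ct.
exists (lag (chart_at SM (gamma x)) (pt (cmap (chart_at SM (gamma x)) (gamma x)) w x)), B; split => //; first exact: is_derive_mull.
rewrite -(lag_velocity L ac cx ct h1); apply: H; by case/andP: xrt => /ltW -> /ltW ->.
Qed.

Lemma orbit_riemann gamma a T e : orbit gamma -> 0 < T -> 0 < e -> exists m0, forall m, (m0 <= m)%N ->
  lag_action a (a + T) gamma <= \sum_(j < m.+1) T / m.+1%:R * speed SM L gamma (a + j%:R * (T / m.+1%:R)) + e.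
Proof.
move=> og T0 e0; apply: (riemann_sum (A := fun s t => lag_action s t gamma) _ (orbit_speed og)) => //.
  by move=> r s t rs st; apply: lag_action_cat => //; apply: (orbit_path L_smooth L_periodic L_posdef og); exact: le_trans st.
by move=> r t B rt H; exact: orbit_action_le.
Qed.

Lemma flow_average (mu : probability phase R) s : EL_invariant L mu ->
  (\int[mu]_z (phase_lagrangian L (EL_flow L s z) + C0)%:E = \int[mu]_z (phase_lagrangian L z + C0)%:E)%E.
Proof.
move=> inv.
have mf : @measurable_fun _ _ phase phase setT (EL_flow L s).
  by move=> _ A mA; rewrite setTI; exact: (flow_measurable M_hausdorff L_smooth L_periodic L_posdef L_complete).
have mh : measurable_fun setT (fun z : phase => (phase_lagrangian L z + C0)%:E).
  by apply/measurable_EFinP; apply: measurable_funD => //; exact: (phase_lagrangian_measurable L_smooth L_periodic).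
have := @ge0_integral_pushforward _ _ _ _ R _ mf mu setT (fun z : phase => (phase_lagrangian L z + C0)%:E) measurableT mh.
rewrite preimage_setT => <-; last by move=> z _; rewrite lee_fin; have := HC0 z.1.1 z.1.2 (circle_repr z.2); rewrite /phase_lagrangian; lra.
apply: eq_measure_integral => A mA _; exact: inv.
Qed.

Lemma low_action_orbit (n : nat) : (0 < n)%N -> exists gamma t, orbit gamma /\ lag_action t (t + n%:R) gamma <= 1.
Proof.
move=> n0; apply: contrapT => Hno; set T : R := n%:R; have T0 : 0 < T by rewrite ltr0n.
have Hact gamma t : orbit gamma -> 1 < lag_action t (t + T) gamma.
  by move=> og; rewrite ltNge; apply/negP => h; apply: Hno; exists gamma, t.
have [[mu inv mean0] _] := L_critical.
pose h (m : nat) := T / m.+1%:R.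
(* Riemann sums of [L + C0] along the orbit of [z] over a time [T]. They are nonnegative, as Fatou's
   lemma asks, and being finite sums they are integrated term by term, each term having the same
   mean by invariance. *)
pose f (m : nat) (z : phase) : \bar R := (\sum_(j < m.+1) (h m)%:E * (phase_lagrangian L (EL_flow L (j%:R * h m) z) + C0)%:E)%E.
have hge0 m : 0 <= h m by rewrite divr_ge0 // ltW.
have pl0 z : 0 <= phase_lagrangian L z + C0.
  by have := HC0 z.1.1 z.1.2 (circle_repr z.2); rewrite /phase_lagrangian; lra.
have mterm (s : R) : measurable_fun setT (fun z : phase => (phase_lagrangian L (EL_flow L s z) + C0)%:E).
  apply/measurable_EFinP; apply: measurable_funD => //.
  apply: (measurableT_comp (phase_lagrangian_measurable L_smooth L_periodic)).
  by move=> _ A mA; rewrite setTI; exact: (flow_measurable M_hausdorff L_smooth L_periodic L_posdef L_complete).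
have mf m : measurable_fun setT (f m).
  by apply: emeasurable_sum => j; apply: measurable_funeM; exact: mterm.
have f0 m z : (0 <= f m z)%E.
  by apply: sume_ge0 => j _; rewrite mule_ge0 // lee_fin.
have intf m : (\int[mu]_z f m z = (C0 * T)%:E)%E.
  rewrite ge0_integral_sum //; [|by move=> j; apply: measurable_funeM; exact: mterm|by move=> j z _; rewrite mule_ge0 // lee_fin].
  rewrite (eq_bigr (fun=> (h m * C0)%:E)) => [|j _].
    rewrite sumEFin big_const_ord iter_addr_0 -mulr_natl /h mulrA (mulrC _ (T / _)) divfK ?pnatr_eq0 //.
    by rewrite mulrC.
  rewrite ge0_integralZl //; [|by move=> z _; rewrite lee_fin|by rewrite lee_fin].
  by rewrite flow_average // mean_action_shift mean0 oppr0 add0e EFinM.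
have := fatou mu measurableT mf (fun m z _ => f0 m z).
have -> : (fun m => \int[mu]_z f m z)%E = (fun=> (C0 * T)%:E) by apply/funext => m; exact: intf.
rewrite (cvg_limn_einf_sup (cvg_cst _)).1.
(* All actions over a time [T] are supposed to exceed 1, and the Riemann sums lose at most 1/2; the
   pointwise lower limit thus exceeds the common value [C0 * T] of the integrals. *)
have low z : ((1 / 2 + C0 * T)%:E <= limn_einf (f ^~ z))%E.
  have [gam [t [og Ez]]] : exists gam t, orbit gam /\ lift gam t = z.
    case: z => [[x v] tau]; pose c := chart_at SM x; have ac : atlas c := chart_at_atlas SM x.
    have cx : cdom c x := chart_at_mem SM x.
    have [gam og jg] := orbit_through M_hausdorff L_smooth L_periodic L_posdef L_complete v (circle_repr tau) ac (cimg_cmap cx).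
    exists gam, (circle_repr tau); split => //; rewrite (jet_lift og ac jg) /tangent_of /= cmapK //.
    rewrite tangent_coordE cmapK // (trans_id (c := c) v ac (cimg_cmap cx)).
    by rewrite /circle_of /circle_repr reprK.
  have [m0 Hm0] := orbit_riemann t og T0 (divr_gt0 ltr01 (ltr0Sn R 1)).
  rewrite limn_einf_lim; apply: lime_ge; first exact: is_cvg_einfs.
  exists m0 => // m /= m0m; apply: le_ereal_inf_tmp => _ [k /= mk <-].
  have fE : f k z = (\sum_(j < k.+1) T / k.+1%:R * speed SM L gam (t + j%:R * (T / k.+1%:R)) + C0 * T)%:E.
    rewrite /f (eq_bigr (fun j : 'I_k.+1 => (h k * speed SM L gam (t + j%:R * h k) + h k * C0)%:E)) => [|j _].
      rewrite sumEFin big_split /= sumr_const card_ord -[X in _ + X]mulr_natr /h.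
      by rewrite (_ : T / _ * C0 * _ = C0 * T) // mulrAC divfK ?pnatr_eq0 // mulrC.
    rewrite -Ez (flow_lift M_hausdorff L_smooth L_periodic L_posdef (j%:R * h k) t og).
    by rewrite (phase_lagrangian_lift _ L_periodic) -mulrDr EFinM.
  rewrite fE lee_fin; exact: fatou_arith (Hact _ t og) (Hm0 k (leq_trans m0m mk)).
have ic (r : R) : (\int[mu]_z (cst r%:E) z = r%:E)%E.
  by rewrite integral_cst //; apply: etrans (mule1 _); congr (_ * _)%E; exact: probability_setT.
move=> H; have : ((1 / 2 + C0 * T)%:E <= (C0 * T)%:E)%E.
  apply: le_trans H; rewrite -[X in (X <= _)%E]ic; apply: ge0_le_integral => //.
  - by move=> z _; rewrite lee_fin; have := mulr_ge0 C00 (ltW T0); lra.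
  - rewrite /limn_einf; apply: measurableT_comp => //; apply: measurable_fun_limn_esup => m; exact: measurableT_comp.
rewrite lee_fin; lra.
Qed.

(** A link of unit duration from [x] to a low-action orbit, the orbit itself, then a link of unit
    duration to [y]. Durations 1 and 2 leave no room for the orbit and are treated apart. *)
Lemma potential_upper : exists C, forall n x y, (0 < n)%N -> F 0 n%:R x y <= C.
Proof.
have [C1 H1] := potential_bounded M_hausdorff M_compact M_connected g_metric L_smooth L_periodic L_superlinear L_posdef L_complete (ltr01 : 0 < (1 : R)).
have [C2 H2] := potential_bounded M_hausdorff M_compact M_connected g_metric L_smooth L_periodic L_superlinear L_posdef L_complete (ltr0Sn R 1).
exists (Num.max (Num.max C1 C2) (2 * C1 + 1 + C0)) => -[|[|[|n]]] // x y _; rewrite !le_max.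
- by have := H1 0 x y; rewrite add0r => ->.
- by have := H2 0 x y; rewrite add0r => ->; rewrite orbT.
have [gam [t [og hA]]] := low_action_orbit (ltn0Sn n.+1).
(* The orbit is controlled from a real time [t] on. It is restricted to [[k, k + N]], with [N] one
   less than its duration, to be translatable to [[0, N]]; the two discarded pieces have total
   length 1, whence the extra [C0]. *)
pose k := Num.ceil t; pose N : R := n.+1%:R.
have k1 : t <= k%:~R by exact: ceil_ge.
have k2 : k%:~R < t + 1 by have := ceilB1_lt t; rewrite intrD; lra.
have N0 : 0 < N by exact: ltr0Sn.
have p s s' : s <= s' -> is_path s s' gam by exact: (orbit_path L_smooth L_periodic L_posdef og).
have tN : t + n.+2%:R = t + N + 1 by rewrite -natr1 addrA.
have kN : k%:~R + N <= t + n.+2%:R by rewrite tN; move: k2; lra.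
have kkN : k%:~R < k%:~R + N by rewrite ltrDl.
have A1 := lag_action_cat L_smooth (p _ _ (le_trans k1 (le_trans (ltW kkN) kN))) k1 (le_trans (ltW kkN) kN).
have A2 := lag_action_cat L_smooth (p _ _ (le_trans (ltW kkN) kN)) (ltW kkN) kN.
have B1 := action_ge L_smooth HC0 (p _ _ k1).
have B2 := action_ge L_smooth HC0 (p _ _ kN).
have B3 := potential_le M_hausdorff M_compact M_connected g_metric L_smooth L_periodic L_superlinear L_posdef L_complete kkN (p _ _ (ltW kkN)).
have B4 : F 0 N (gam k%:~R) (gam (k%:~R + N)) <= 1 + C0.
  have E := potential_shift M_hausdorff M_compact M_connected g_metric L_smooth L_periodic L_superlinear L_posdef L_complete k (gam k%:~R) (gam (k%:~R + N)) N0.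
  rewrite add0r addrC in E; rewrite -E; rewrite tN in hA A1 A2 B2; exact: upper_arith hA A1 A2 B1 B2 B3.
have N1 : 0 < 1 + N by rewrite addr_gt0.
have a1 : 1 < 1 + N by rewrite ltrDl.
have a2 : 1 + N < 1 + N + 1 by rewrite ltrDl.
have t1 := potential_tri M_hausdorff M_compact M_connected g_metric L_smooth L_periodic L_superlinear L_posdef L_complete x (gam k%:~R) y (ltr01 : 0 < (1 : R)) (lt_trans a1 a2).
have t2 := potential_tri M_hausdorff M_compact M_connected g_metric L_smooth L_periodic L_superlinear L_posdef L_complete (gam k%:~R) (gam (k%:~R + N)) y a1 a2.
apply/orP; right.
have -> : n.+3%:R = 1 + N + 1 by rewrite -natr1 -natr1 /N (addrC 1).
apply: le_trans t1 _.
have s1 : F 1 (1 + N) (gam k%:~R) (gam (k%:~R + N)) = F 0 N (gam k%:~R) (gam (k%:~R + N)).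
  by have := potential_shift M_hausdorff M_compact M_connected g_metric L_smooth L_periodic L_superlinear L_posdef L_complete 1 (gam k%:~R) (gam (k%:~R + N)) N0; rewrite add0r (addrC N).
have h1 := H1 0 x (gam k%:~R); rewrite add0r in h1.
have h2 := H1 (1 + N) (gam (k%:~R + N)) y.
rewrite s1 in t2.
exact: upper_arith2 h1 t2 B4 h2.
Qed.

(** The lower bound closes a curve into a loop: [0 <= F 0 n.+1 x x <= F 0 n x y + F 0 1 y x], where
    the last term is bounded above. *)
Lemma potential_int_bounded : exists2 C, 0 <= C & forall n x y, (0 < n)%N -> `|F 0 n%:R x y| <= C.
Proof.
have [C HC] := potential_upper.
exists (Num.max 0 C); first by rewrite le_max lexx.
move=> n x y n0; rewrite ler_norml lerNl !le_max HC // orbT andbT; apply/orP; right.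
have N0 : (0 : R) < n%:R by rewrite ltr0n.
have N1 : (n%:R : R) < n.+1%:R by rewrite ltr_nat.
have := potential_tri M_hausdorff M_compact M_connected g_metric L_smooth L_periodic L_superlinear L_posdef L_complete x y x N0 N1.
have := loop_nonneg x (ltn0Sn n).
have E : F n%:R n.+1%:R y x = F 0 1 y x.
  by have := potential_shift M_hausdorff M_compact M_connected g_metric L_smooth L_periodic L_superlinear L_posdef L_complete n%:Z y x (ltr01 : 0 < (1 : R)); rewrite -pmulrn add0r addrC natr1.
rewrite E => h1 h2; exact: lower_arith h1 h2 (HC 1%N y x isT).
Qed.

End Flow.

(** * Weak KAM theory of an abstract action potential *)

Section LimInf.
Variable R : realType.

(** Meaningful under [ev_bounded], where the extended lower limit is finite. *)
Definition liminf (v : nat -> R) : R := fine (limn_einf (EFin \o v)).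

Definition ev_bounded (v : nat -> R) := exists C N, forall k, (N <= k)%N -> `|v k| <= C.

Lemma liminfP v : ev_bounded v ->
  (forall e, 0 < e -> exists N, forall k, (N <= k)%N -> liminf v - e <= v k) /\
  (forall e N, 0 < e -> exists2 k, (N <= k)%N & v k <= liminf v + e).
Proof.
move=> [C [N0 HC]]; set u := EFin \o v.
have E : limn_einf u = ereal_sup (range (einfs u)).
  by rewrite limn_einf_lim; apply/cvg_lim => //; exact: cvg_einfs_sup.
have low : ((- C)%:E <= einfs u N0)%E by apply: le_ereal_inf_tmp => _ [k /= Nk <-]; rewrite lee_fin; have := HC k Nk; rewrite ler_norml => /andP[].
have upp n : (einfs u n <= C%:E)%E.
  apply: (@le_trans _ _ (u (maxn n N0))); first by apply: ereal_inf_lbound; exists (maxn n N0) => //=; exact: leq_maxl.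
  by rewrite lee_fin; have := HC (maxn n N0) (leq_maxr _ _); rewrite ler_norml => /andP[].
have fl : limn_einf u \is a fin_num.
  rewrite E fin_numElt; apply/andP; split.
    by apply: lt_le_trans (ltNyr (- C)) _; apply: le_trans low _; apply: ereal_sup_ubound; exists N0.
  by apply: le_lt_trans (ltry C); apply: ge_ereal_sup => _ [n _ <-].
have lE : (liminf v)%:E = limn_einf u by rewrite /liminf fineK.
split=> [e e0|e N e0].
  have : ((liminf v - e)%:E < ereal_sup (range (einfs u)))%E by rewrite -E -lE lte_fin ltrBlDr ltrDl.
  move=> /ereal_sup_gt[_ [n _ <-]] h; exists n => k nk.
  rewrite -lee_fin; apply: le_trans (ltW h) _; apply: ereal_inf_lbound; by exists k.
have : (einfs u N < (liminf v + e)%:E)%E.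
  apply: (@le_lt_trans _ _ (liminf v)%:E); last by rewrite lte_fin ltrDl.
  by rewrite lE E; apply: ereal_sup_ubound; exists N.
move=> /ereal_inf_lt[_ [k /= Nk <-]] h; exists k => //.
by rewrite -lee_fin ltW.
Qed.

Lemma liminf_le v c : ev_bounded v -> (forall e N, 0 < e -> exists2 k, (N <= k)%N & v k <= c + e) -> liminf v <= c.
Proof.
move=> bv H; rewrite leNgt; apply/negP => h; have [h1 _] := liminfP bv.
have e0 : 0 < (liminf v - c) / 4 by rewrite divr_gt0 // subr_gt0.
have [N HN] := h1 _ e0; have [k Nk vk] := H _ N e0; have := HN k Nk; move: vk e0; lra.
Qed.

Lemma liminf_ge v c : ev_bounded v -> (forall e, 0 < e -> exists N, forall k, (N <= k)%N -> c - e <= v k) -> c <= liminf v.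
Proof.
move=> bv H; rewrite leNgt; apply/negP => h; have [_ h2] := liminfP bv.
have e0 : 0 < (c - liminf v) / 4 by rewrite divr_gt0 // subr_gt0.
have [N HN] := H _ e0; have [k Nk vk] := h2 _ N e0; have := HN k Nk; move: vk e0; lra.
Qed.

Lemma liminf_mono v w c : ev_bounded v -> ev_bounded w -> (exists N, forall k, (N <= k)%N -> v k <= w k + c) ->
  liminf v <= liminf w + c.
Proof.
move=> bv bw [N0 H]; apply: liminf_le => // e N e0.
have [_ h2] := liminfP bw; have [k Nk wk] := h2 e (maxn N N0) e0.
exists k; first by apply: leq_trans Nk; exact: leq_maxl.
have := H k (leq_trans (leq_maxr _ _) Nk); move: wk; lra.
Qed.

Lemma liminf_shift v : ev_bounded v -> liminf (fun k => v k.+1) = liminf v.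
Proof.
move=> bv; have [C [N0 HC]] := bv.
have bs : ev_bounded (fun k => v k.+1) by exists C, N0 => k Nk; apply: HC; exact: leq_trans Nk (leqnSn _).
have [h1 h2] := liminfP bv; have [g1 g2] := liminfP bs.
apply/eqP; rewrite eq_le; apply/andP; split.
  apply: liminf_le => // e N e0; have [[|k] Nk vk] := h2 e N.+1 e0; first by [].
  by exists k.
apply: liminf_le => // e N e0; have [k Nk vk] := g2 e N e0; exists k.+1 => //; exact: leq_trans Nk (leqnSn _).
Qed.
End LimInf.

Section WeakKAM.
Variables (R : realType) (M : ptopologicalType) (F : R -> R -> M -> M -> R).
Hypothesis M_compact : compact [set: M].
Hypothesis F_tri : forall a b c x y z, a < b -> b < c -> F a c x z <= F a b x y + F b c y z.
Hypothesis F_split : forall a b c x z, a < b -> b < c -> exists y, F a c x z = F a b x y + F b c y z.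
Hypothesis F_shift : forall (k : int) a b x y, a < b -> F (a + k%:~R) (b + k%:~R) x y = F a b x y.
Hypothesis F_cont : forall y x t, 0 < t -> {for (y, x, t), continuous (fun p : M * M * R => F 0 p.2 p.1.1 p.1.2)}.
Hypothesis F_bounded : exists2 C, 0 <= C & forall n x y, (0 < n)%N -> `|F 0 n%:R x y| <= C.

Lemma F_shiftn (k : nat) a b x y : a < b -> F (a + k%:R) (b + k%:R) x y = F a b x y.
Proof. exact: (F_shift k). Qed.

Lemma F_near (y0 x0 : M) (t0 e : R) : 0 < t0 -> 0 < e -> exists A B C, [/\ nbhs y0 A, nbhs x0 B, nbhs t0 C &
  forall y x t, A y -> B x -> C t -> `|F 0 t y x - F 0 t0 y0 x0| < e].
Proof.
move=> t00 e0; have /cvgrPdist_lt K1 := F_cont (y := y0) (x := x0) t00.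
have [[U C] [[[A B] [nA nB] AB] nC] H] := K1 _ e0.
exists A, B, C; split => // y x t Ay Bx Ct; rewrite distrC.
by apply: (H ((y, x), t)); split => //; apply: (AB (y, x)).
Qed.

Lemma F_right (t0 : R) (x0 : M) (e : R) : 0 < t0 -> 0 < e ->
  \forall p \near (x0, t0), forall w, `|F 0 p.2 w p.1 - F 0 t0 w x0| <= e.
Proof.
move=> t00 e0; have e2 : 0 < e / 2 by exact: divr_gt0.
have K := (compact_near_coveringP _).1 M_compact.
have H := K _ (nbhs (x0, t0)) (fun p w => `|F 0 p.2 w p.1 - F 0 t0 w x0| <= e) _.
have {}H : \forall p \near (x0, t0), [set: M] `<=` (fun w => `|F 0 p.2 w p.1 - F 0 t0 w x0| <= e).
  apply: H => w _; have [A [B [C [nA nB nC AB]]]] := F_near w x0 t00 e2.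
  exists (A, B `*` C); first by split => //=; exists (B, C).
  move=> [w' [x t]] /= [Aw [Bx Ct]].
  have h1 := AB w' x t Aw Bx Ct; have h2 := AB w' x0 t0 Aw (nbhs_singleton nB) (nbhs_singleton nC).
  have := ler_distD (F 0 t0 w x0) (F 0 t w' x) (F 0 t0 w' x0); rewrite (distrC (F 0 t0 w x0)).
  move: h1 h2; lra.
by apply: filterS H => p Hp w; exact: Hp.
Qed.

Lemma F_left t0 y0 e : 0 < t0 -> 0 < e -> \forall y \near y0, forall w, `|F 0 t0 y w - F 0 t0 y0 w| <= e.
Proof.
move=> t00 e0; have e2 : 0 < e / 2 by exact: divr_gt0.
have K := (compact_near_coveringP _).1 M_compact.
have H := K _ (nbhs y0) (fun y w => `|F 0 t0 y w - F 0 t0 y0 w| <= e) _.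
have {}H : \forall y \near y0, [set: M] `<=` (fun w => `|F 0 t0 y w - F 0 t0 y0 w| <= e).
  apply: H => w _; have [A [B [C [nA nB nC AB]]]] := F_near y0 w t00 e2.
  exists (B, A); first by split.
  move=> [w' y] /= [Bw Ay].
  have h1 := AB y w' t0 Ay Bw (nbhs_singleton nC); have h2 := AB y0 w' t0 (nbhs_singleton nA) Bw (nbhs_singleton nC).
  have := ler_distD (F 0 t0 y0 w) (F 0 t0 y w') (F 0 t0 y0 w'); rewrite (distrC (F 0 t0 y0 w)).
  move: h1 h2; lra.
by apply: filterS H => p Hp w; exact: Hp.
Qed.

Lemma F_fixed_bounded r : 0 < r -> exists C, forall y x, `|F 0 r y x| <= C.
Proof.
move=> r0; have cMM : compact [set: M * M].
  rewrite -setXTT; exact: compact_setX.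
have K := (compact_near_coveringP _).1 cMM.
have H := K _ (pinfty_nbhs R) (fun C p => `|F 0 r p.1 p.2| <= C) _.
have : \forall C \near +oo, [set: M * M] `<=` (fun p => `|F 0 r p.1 p.2| <= C).
  apply: H => -[y x] _; have [A [B [D [nA nB nD AB]]]] := F_near y x r0 ltr01.
  exists (A `*` B, [set C | `|F 0 r y x| + 1 <= C]); first split => /=.
  - by exists (A, B).
  - exists (`|F 0 r y x| + 1); split; [exact: num_real|by move=> C /ltW].
  move=> [[y' x'] C] /= [[Ay Bx] hC]; have := AB y' x' r Ay Bx (nbhs_singleton nD).
  have := ler_normD (F 0 r y' x' - F 0 r y x) (F 0 r y x); rewrite subrK; move: hC; lra.
by move=> [C [_ /(_ (C + 1))]]; rewrite ltrDl ltr01 => /(_ isT) HC; exists (C + 1) => y x; exact: (HC (y, x)).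
Qed.

(** The curve is split at an integer time: [F_bounded] controls the first piece, and the second one
    has the fixed duration [t + m], with [m] chosen to make it positive even for negative [t]. *)
Lemma action_bounded t y x : ev_bounded (fun k => F 0 (t + k%:R) y x).
Proof.
pose m := (Num.truncn `|t|).+1; have tm : `|t| < m%:R by exact: truncnS_gt.
have r0 : 0 < t + m%:R by move: tm; rewrite ltr_norml => /andP[h _]; rewrite addrC -ltrBlDl sub0r ltrNl in h *; rewrite ?opprK.
have [C HC] := F_fixed_bounded r0; have [C1 C10 HC1] := F_bounded.
exists (C1 + C), m.+1 => k mk; pose j := (k - m)%N.
have j0 : (0 < j)%N by rewrite subn_gt0.
have j0R : 0 < (j%:R : R) by rewrite ltr0n.
have jt : (j%:R : R) < t + k%:R.
  by rewrite -(subnK (ltnW mk)) natrD addrCA ltrDl.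
have [w ->] := F_split y x j0R jt.
have -> : F j%:R (t + k%:R) w x = F 0 (t + m%:R) w x.
  by rewrite -[RHS](F_shiftn j) // add0r -addrA -natrD (addnC m) subnK // ltnW.
by apply: le_trans (ler_normD _ _) _; apply: lerD; [exact: HC1|exact: HC].
Qed.

(** The Peierls barrier from time 0 to time [t] modulo 1, with integers only as free parameter;
    [peierls_barrierE] identifies it with the lower limit over all admissible pairs of times. *)
Definition barrier (t : R) (y x : M) : R := liminf (fun k => F 0 (t + k%:R) y x).

Lemma barrier_shift t y x : barrier (t + 1) y x = barrier t y x.
Proof.
rewrite /barrier -[RHS]liminf_shift; last exact: action_bounded.
by congr liminf; apply/funext => k; rewrite -addrA nat1r.
Qed.

Lemma barrier_shiftn (n : nat) t y x : barrier (t + n%:R) y x = barrier t y x.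
Proof. by elim: n => [|n IH]; rewrite ?addr0 // -natr1 addrA barrier_shift. Qed.

Lemma barrier_int (k : int) t y x : barrier (t + k%:~R) y x = barrier t y x.
Proof.
case: k => n; first exact: barrier_shiftn.
by rewrite -[LHS](barrier_shiftn n.+1) NegzE mulrNz -pmulrn subrK.
Qed.

(* Only the first and the last unit of time depend on the end points and on the final time, whence the uniformity in k. *)
Lemma action_diff t t' y y' x x' e1 e2 k : -1 < t -> -1 < t' -> (3 <= k)%N ->
  (forall w, F 0 1 y w <= F 0 1 y' w + e1) -> (forall w, F 0 (t + 1) w x <= F 0 (t' + 1) w x' + e2) ->
  F 0 (t + k%:R) y x <= F 0 (t' + k%:R) y' x' + (e1 + e2).
Proof.
move=> t1 t1' k3 H1 H2; case: k k3 => [|[|[|j]]] // _; set m : R := j.+2%:R.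
have m1 : 1 < m by rewrite /m ltr1n.
have E s : s + j.+3%:R = (s + 1) + m by rewrite -natr1 addrA addrAC.
rewrite !E; have s0 : 0 < t + 1 by rewrite -ltrBlDr sub0r.
have s0' : 0 < t' + 1 by rewrite -ltrBlDr sub0r.
have mt : m < t + 1 + m by rewrite ltrDr.
have mt' : m < t' + 1 + m by rewrite ltrDr.
have Z s w z : 0 < s -> F m (s + m) w z = F 0 s w z.
  by move=> hs; rewrite -{1}(add0r m) F_shiftn.
have [w ->] := F_split y' x' (ltr01 : 0 < (1 : R)) (lt_trans m1 mt').
have [w' ->] := F_split w x' m1 mt'.
have a1 := F_tri y w x (ltr01 : 0 < (1 : R)) (lt_trans m1 mt).
have a2 := F_tri w w' x m1 mt.
rewrite Z // in a2; rewrite Z //; have := H1 w; have := H2 w'; move: a1 a2; lra.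
Qed.

Lemma barrier_diff t t' y y' x x' e1 e2 : -1 < t -> -1 < t' ->
  (forall w, F 0 1 y w <= F 0 1 y' w + e1) -> (forall w, F 0 (t + 1) w x <= F 0 (t' + 1) w x' + e2) ->
  barrier t y x <= barrier t' y' x' + (e1 + e2).
Proof.
move=> t1 t1' H1 H2; apply: liminf_mono; [exact: action_bounded|exact: action_bounded|].
by exists 3%N => k k3; exact: action_diff.
Qed.

(** Tailored to [action_diff]: [k >= 3] leaves room for a first and a last unit of time, and
    [-1 < t'] admits slightly negative times, which are neighbours of [t = 0]. *)
Definition close (e : R) (t t' : R) (y y' x x' : M) := (-1 < t') /\
  forall k, (3 <= k)%N -> `|F 0 (t' + k%:R) y' x' - F 0 (t + k%:R) y x| <= e /\ `|barrier t' y' x' - barrier t y x| <= e.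

Lemma near_close (t : R) (y x : M) (e : R) : 0 <= t -> 0 < e -> \forall p \near (t, y, x), close e t p.1.1 y p.1.2 x p.2.
Proof.
move=> t0 e0; have e2 : 0 < e / 2 by exact: divr_gt0.
have t1 : 0 < t + 1 by rewrite ltr_wpDl.
have t2 : -1 < t by apply: lt_le_trans t0; rewrite oppr_lt0.
have [[B C] [nB nC] BC] := F_right x t1 e2; have nA := F_left y ltr01 e2.
have nC' : \forall s \near t, C (s + 1) /\ -1 < s.
  have c1 : {for t, continuous (fun s : R => s + 1)} by apply: cvgD; [exact: cvg_id|exact: cvg_cst].
  by apply: filterI; [exact: (c1 _ nC)|by apply: open_nbhs_nbhs; split; [exact: open_gt|]].
exists ([set s | C (s + 1) /\ -1 < s] `*` [set y' | forall w, `|F 0 1 y' w - F 0 1 y w| <= e / 2], B).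
  by split => //=; exists ([set s | C (s + 1) /\ -1 < s], [set y' | forall w, `|F 0 1 y' w - F 0 1 y w| <= e / 2]).
move=> [[s y'] x'] /= [[[Cs s1] Ay] Bx]; split => // k k3.
have r1 w := BC (x', s + 1) (conj Bx Cs) w.
have ee : e / 2 + e / 2 = e by rewrite -splitr.
rewrite /= in r1.
have up1 w : F 0 1 y' w <= F 0 1 y w + e / 2 by have := Ay w; rewrite ler_distl => /andP[].
have up2 w : F 0 (s + 1) w x' <= F 0 (t + 1) w x + e / 2 by have := r1 w; rewrite ler_distl => /andP[].
have lo1 w : F 0 1 y w <= F 0 1 y' w + e / 2 by have := Ay w; rewrite distrC ler_distl => /andP[].
have lo2 w : F 0 (t + 1) w x <= F 0 (s + 1) w x' + e / 2 by have := r1 w; rewrite distrC ler_distl => /andP[].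
have u1 := action_diff s1 t2 k3 up1 up2; have u2 := action_diff t2 s1 k3 lo1 lo2.
have v1 := barrier_diff s1 t2 up1 up2; have v2 := barrier_diff t2 s1 lo1 lo2.
by rewrite !ler_distl; move: u1 u2 v1 v2; rewrite ee => *; split; apply/andP; split; rewrite ?lerBlDr.
Qed.

Let box : set (R * M * M) := (`[0, 1] `*` setT) `*` setT.

Let box_compact : compact box.
Proof. by apply: compact_setX => //; apply: compact_setX => //; exact: segment_compact. Qed.

(** The threshold for given data also serves nearby data, since [near_close] controls the actions
    uniformly in [k] together with the barrier; compactness of [box] leaves a single threshold. *)
Lemma uniform_lower e : 0 < e -> exists N, forall k t y x, (N <= k)%N -> 0 <= t <= 1 ->
  barrier t y x - e <= F 0 (t + k%:R) y x.
Proof.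
move=> e0; have e3 : 0 < e / 3 by exact: divr_gt0.
have K := (compact_near_coveringP _).1 box_compact.
have H := K _ \oo (fun k p => forall j, (k <= j)%N -> barrier p.1.1 p.1.2 p.2 - e <= F 0 (p.1.1 + j%:R) p.1.2 p.2) _.
have : \forall k \near \oo, box `<=` (fun p => forall j, (k <= j)%N -> barrier p.1.1 p.1.2 p.2 - e <= F 0 (p.1.1 + j%:R) p.1.2 p.2).
  apply: H => -[[t y] x] /= [[]]; rewrite /= in_itv /= => /andP[t0 t1] _ _.
  have nc := near_close y x t0 e3.
  have [h1 _] := liminfP (action_bounded t y x); have [N HN] := h1 _ e3.
  exists ([set p | close (e / 3) t p.1.1 y p.1.2 x p.2], [set k | (maxn N 3 <= k)%N]).
    split => //=; by exists (maxn N 3).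
  move=> [p k] /= [[_ cp] Nk] j kj; have Nj := leq_trans Nk kj.
  have [c1 c2] := cp j (leq_trans (leq_maxr _ _) Nj); have := HN j (leq_trans (leq_maxl _ _) Nj).
  move: c1 c2; rewrite !ler_distl /barrier => /andP[? ?] /andP[? ?] ?; lra.
move=> [N _ HN]; exists N => k t y x Nk t01.
by have := HN N (leqnn N) (t, y, x) _ k Nk; apply; split => //; split => //=; rewrite in_itv.
Qed.

Lemma uniform_upper e : 0 < e -> exists N, forall t y x, 0 <= t <= 1 ->
  exists k, (0 < k <= N)%N /\ F 0 (t + k%:R) y x <= barrier t y x + e.
Proof.
move=> e0; have e3 : 0 < e / 3 by exact: divr_gt0.
have K := (compact_near_coveringP _).1 box_compact.
have H := K _ \oo (fun N p => exists k, (0 < k <= N)%N /\ F 0 (p.1.1 + k%:R) p.1.2 p.2 <= barrier p.1.1 p.1.2 p.2 + e) _.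
have : \forall N \near \oo, box `<=` (fun p => exists k, (0 < k <= N)%N /\ F 0 (p.1.1 + k%:R) p.1.2 p.2 <= barrier p.1.1 p.1.2 p.2 + e).
  apply: H => -[[t y] x] /= [[]]; rewrite /= in_itv /= => /andP[t0 t1] _ _.
  have nc := near_close y x t0 e3.
  have [_ h2] := liminfP (action_bounded t y x); have [k k3 Hk] := h2 _ 3%N e3.
  exists ([set p | close (e / 3) t p.1.1 y p.1.2 x p.2], [set N | (k <= N)%N]).
    split => //=; by exists k.
  move=> [p N] /= [[_ cp] Nk]; exists k; split; first by rewrite Nk (leq_trans _ k3).
  have [c1 c2] := cp k k3; move: c1 c2 Hk; rewrite !ler_distl /barrier => /andP[? ?] /andP[? ?] ?; lra.
move=> [N _ HN]; exists N => t y x t01.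
by have := HN N (leqnn N) (t, y, x); apply; split => //; split => //=; rewrite in_itv.
Qed.

(* A nearly minimal long curve is cut at time n and closed by a nearly minimal curve of bounded duration. *)
Lemma uniform_window e : 0 < e -> exists N, forall n t y x, (N <= n)%N -> 0 <= t <= 1 ->
  exists k, (n <= k <= n.*2)%N /\ F 0 (t + k%:R) y x <= barrier t y x + e.
Proof.
move=> e0; have e3 : 0 < e / 3 by exact: divr_gt0.
have [N1 H1] := uniform_lower e3; have [N2 H2] := uniform_upper e3.
exists (maxn N2 1) => n t y x Nn t01; have n0 : (0 < n)%N := leq_trans (leq_maxr _ _) Nn.
have t0 : 0 <= t by case/andP: t01.
have n0R : 0 < (n%:R : R) by rewrite ltr0n.
have [_ h2] := liminfP (action_bounded t y x); have [K hK FK] := h2 _ (n + N1).+1 e3.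
pose j := (K - n)%N; have Kn : (n <= K)%N by rewrite (leq_trans _ (ltnW hK)) // leq_addr.
have jN : (N1 <= j)%N by rewrite /j -(leq_add2r n) subnK // addnC; exact: leq_trans (leqnSn _) hK.
have j0 : (0 < j)%N by rewrite subn_gt0; apply: leq_trans hK; rewrite ltnS leq_addr.
have shiftF (i : nat) w : (0 < i)%N -> F n%:R (t + (n + i)%:R) w x = F 0 (t + i%:R) w x.
  move=> i0; rewrite -[RHS](F_shiftn n) ?ltr_wpDl ?ltr0n // add0r.
  by rewrite -addrA -natrD addnC.
have lt_n (i : nat) : (0 < i)%N -> (n%:R : R) < t + (n + i)%:R.
  by move=> i0; rewrite natrD addrCA ltrDl ltr_wpDl // ltr0n.
have [w Ew] := F_split y x n0R (lt_n j j0).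
rewrite shiftF // in Ew; rewrite /j subnKC // in Ew.
have [k [/andP[k0 kN] Fk]] := H2 t w x t01.
exists (n + k)%N; split.
  by rewrite leq_addr -addnn leq_add2l; apply: leq_trans kN (leq_trans (leq_maxl _ _) Nn).
have := F_tri y w x n0R (lt_n k k0); rewrite shiftF //.
have := H1 j t w x jN t01; move: Fk FK; rewrite Ew /j /barrier; lra.
Qed.

Variable u : M -> R.
Hypothesis u_continuous : continuous u.

Lemma continuous_bounded_below (f : M -> R) : continuous f -> exists C, forall x, C <= f x.
Proof.
move=> cf; have [x0 _ H] := compact_EVT_min (ex_intro _ point I) M_compact (continuous_subspaceT cf).
by exists (f x0) => x; apply: H; rewrite inE.
Qed.

Definition limit_solution (x : M) (t : R) : R := inf [set u y + barrier t y x | y in [set: M]].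

Lemma barrier_ge t : exists C, forall y x, C <= barrier t y x.
Proof.
pose m := (Num.truncn `|t|).+1; have tm : `|t| < m%:R by exact: truncnS_gt.
have r0 : 0 < t + m%:R by move: tm; rewrite ltr_norml => /andP[h _]; rewrite -ltrBlDr sub0r.
have [C HC] := F_fixed_bounded r0; have [C1 C10 HC1] := F_bounded.
exists (- (C1 + C)) => y x; apply: liminf_ge; first exact: action_bounded.
move=> e e0; exists m.+1 => k mk; pose j := (k - m)%N.
have j0 : (0 < j)%N by rewrite subn_gt0.
have j0R : 0 < (j%:R : R) by rewrite ltr0n.
have jt : (j%:R : R) < t + k%:R by rewrite -(subnK (ltnW mk)) natrD addrCA ltrDl.
have [w ->] := F_split y x j0R jt.
have -> : F j%:R (t + k%:R) w x = F 0 (t + m%:R) w x.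
  by rewrite -[RHS](F_shiftn j) // add0r -addrA -natrD (addnC m) subnK // ltnW.
have := HC w x; have := HC1 j y w j0; rewrite !ler_norml => /andP[? _] /andP[? _]; lra.
Qed.

Lemma limit_has_inf x t : has_inf [set u y + barrier t y x | y in [set: M]].
Proof.
have [C HC] := barrier_ge t; have [C' HC'] := continuous_bounded_below u_continuous.
split; first by exists (u point + barrier t point x); exists point.
by exists (C' + C) => _ [y _ <-]; exact: lerD.
Qed.

Lemma limit_le x t y : limit_solution x t <= u y + barrier t y x.
Proof. by apply: ge_inf; [exact: (limit_has_inf x t).2|exists y]. Qed.

Lemma limit_ge x t c : (forall y, c <= u y + barrier t y x) -> c <= limit_solution x t.
Proof. by move=> H; apply: lb_le_inf; [exact: (limit_has_inf x t).1|move=> _ [y _ <-]]. Qed.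

Lemma limit_near x t e : 0 < e -> exists y, u y + barrier t y x < limit_solution x t + e.
Proof. by move=> e0; have [_ [y _ <-] h] := inf_adherent e0 (limit_has_inf x t); exists y. Qed.

Lemma limit_int (k : int) x t : limit_solution x (t + k%:~R) = limit_solution x t.
Proof. by rewrite /limit_solution; congr inf; apply: eq_imagel => y _; rewrite barrier_int. Qed.

(** The triangle inequality at time [s + k], after translation by [k], passes to the lower limit in
    [k] and then to the infimum over [z]. *)
Lemma limit_dominated x y s t : s < t -> limit_solution x t - limit_solution y s <= F s t y x.
Proof.
move=> st; rewrite lerBlDr -lerBlDl; apply: limit_ge => z; rewrite lerBlDl.
apply: le_trans (limit_le x t z) _; rewrite addrCA lerD2l addrC.
apply: liminf_mono; [exact: action_bounded|exact: action_bounded|].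
exists (Num.truncn `|s|).+1 => k sk.
have s0 : 0 < s + k%:R.
  have : `|s| < k%:R by apply: lt_le_trans (truncnS_gt _) _; rewrite ler_nat.
  by rewrite ltr_norml => /andP[h _]; rewrite -ltrBlDr sub0r.
have stk : s + k%:R < t + k%:R by rewrite ltrD2r.
by have := F_tri z y x s0 stk; rewrite F_shiftn.
Qed.

Lemma limit_continuous t : 0 <= t -> continuous (fun z => limit_solution z t).
Proof.
move=> t0 z; apply/cvgrPdist_le => e e0.
have t1 : 0 < t + 1 by rewrite ltr_wpDl.
have t2 : -1 < t by apply: lt_le_trans t0; rewrite oppr_lt0.
have [[B C] [nB nC] BC] := F_right z t1 e0.
apply: filterS nB => z' Bz'.
have main a b : (forall w, F 0 (t + 1) w a <= F 0 (t + 1) w b + e) -> limit_solution a t <= limit_solution b t + e.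
  move=> H; rewrite -lerBlDr; apply: limit_ge => y; rewrite lerBlDr.
  apply: le_trans (limit_le a t y) _; rewrite -addrA lerD2l.
  have := @barrier_diff t t y y a b 0 e t2 t2 (fun w => _) H; rewrite add0r; apply.
  by move=> w; rewrite addr0.
have r1 w := BC (z', t + 1) (conj Bz' (nbhs_singleton nC)) w.
rewrite /= in r1; rewrite distrC ler_distl lerBlDr; apply/andP; split; apply: main => w.
  by have := r1 w; rewrite distrC ler_distl => /andP[].
by have := r1 w; rewrite ler_distl => /andP[].
Qed.

(** The minimum over [z] is attained by continuity. A long nearly minimal curve to [x] is cut at an
    integer time [k], and its beginning is compared with the barrier at time 0. *)
Lemma limit_calibrated x t : 0 < t -> exists z, limit_solution x t = limit_solution z 0 + F 0 t z x.
Proof.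
move=> t0; pose phi z := limit_solution z 0 + F 0 t z x.
have cphi : continuous phi.
  move=> z; apply: cvgD; first exact: limit_continuous.
  apply/cvgrPdist_lt => e e0; have [A [B [C [nA nB nC H]]]] := F_near z x t0 e0.
  by apply: filterS nA => z' Az'; rewrite distrC; apply: H => //; exact: nbhs_singleton.
have [z _ Hz] := compact_EVT_min (ex_intro _ point I) M_compact (continuous_subspaceT cphi).
exists z; apply/eqP; rewrite eq_le; apply/andP; split.
  by have := limit_dominated x z t0; rewrite lerBlDl.
rewrite -/(phi z) leNgt; apply/negP => h.
(* Three errors [e] are made: in the infimum over [y], in the lower limit, and in the uniform lower
   bound at the cut. A gap of [4 * e] is therefore contradictory. *)
pose e := (phi z - limit_solution x t) / 4; have e0 : 0 < e by rewrite divr_gt0 // subr_gt0.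
have [y Hy] := limit_near x t e0; have [N HN] := uniform_lower e0.
have [_ h2] := liminfP (action_bounded t y x); have [k Nk Fk] := h2 _ (maxn N 1) e0.
have k0 : (0 < k)%N by apply: leq_trans Nk; exact: leq_maxr.
have k0R : 0 < (k%:R : R) by rewrite ltr0n.
have kt : (k%:R : R) < t + k%:R by rewrite ltrDr.
have [w Ew] := F_split y x k0R kt.
have Es : F k%:R (t + k%:R) w x = F 0 t w x by rewrite -[RHS](F_shiftn k) // add0r.
have z01 : 0 <= (0 : R) <= 1 by rewrite lexx ler01.
have := HN k 0 y w (leq_trans (leq_maxl _ _) Nk) z01; rewrite add0r => Lw.
have := Hz w; rewrite inE => /(_ I); have := limit_le w 0 y.
rewrite Ew Es in Fk; move: Fk Hy Lw e0; rewrite /barrier /e /phi; lra.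
Qed.

(** Exactly what the convergence of [U_seq] uses: a lower bound for all long durations, and a
    near-optimal duration inside the window, both uniform in [x] and [t]. *)
Lemma limit_barrier (e : R) : 0 < e -> exists N, forall n t x, (N <= n)%N -> 0 <= t <= 1 ->
  (forall k y, (n <= k)%N -> limit_solution x t - e <= u y + F 0 (t + k%:R) y x) /\
  exists k y, (n <= k <= n.*2)%N /\ u y + F 0 (t + k%:R) y x <= limit_solution x t + e.
Proof.
move=> e0; have e2 : 0 < e / 2 by exact: divr_gt0.
have [N1 H1] := uniform_lower e0; have [N2 H2] := uniform_window e2.
exists (maxn N1 N2) => n t x Nn t01; split => [k y nk|].
  have := H1 k t y x (leq_trans (leq_trans (leq_maxl _ _) Nn) nk) t01; have := limit_le x t y; lra.
have [y Hy] := limit_near x t e2.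
have [k [nk Fk]] := H2 n t y x (leq_trans (leq_maxr _ _) Nn) t01.
exists k, y; split => //; move: Hy Fk; lra.
Qed.

End WeakKAM.

(** * Back to the Lagrangian *)

Lemma limf_einf_ge {R : realType} (f : R * R -> \bar R) (G : set_system (R * R)) (c : \bar R) (A : set (R * R)) :
  G A -> (forall p, A p -> (c <= f p)%E) -> (c <= limf_einf f G)%E.
Proof.
move=> GA H; rewrite /limf_einf limf_esupE leeNr; apply: le_trans (ereal_inf_lbound _) _; first by exists A.
by apply: ge_ereal_sup => _ [p Ap <-] /=; rewrite leeN2; exact: H.
Qed.

Lemma limf_einf_le {R : realType} (f : R * R -> \bar R) (G : set_system (R * R)) (c : \bar R) :
  (forall A, G A -> exists2 p, A p & (f p <= c)%E) -> (limf_einf f G <= c)%E.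
Proof.
move=> H; rewrite /limf_einf limf_esupE leeNl; apply: le_ereal_inf_tmp => _ [A GA <-].
have [p Ap fp] := H A GA; apply: (@le_trans _ _ (- f p)%E); first by rewrite leeN2.
by apply: ereal_sup_ubound; exists p.
Qed.

Lemma eq_within_eps {R : realType} (x : \bar R) (r : R) :
  (forall e, 0 < e -> ((r - e)%:E <= x)%E /\ (x <= (r + e)%:E)%E) -> x = r%:E.
Proof.
move=> H; case: x H => [x H| /(_ 1 ltr01)[] //| /(_ 1 ltr01)[] //].
congr (_%:E); apply/eqP; rewrite eq_le; apply/andP; split; apply/ler_addgt0Pr => e /H[];
  by rewrite !lee_fin // lerBlDr.
Qed.

Lemma calibrated_arith {R : realType} (X Y Z A B : R) : X - Y <= B -> Y - Z <= A -> X - Z = A + B -> X - Y = B.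
Proof. lra. Qed.

Lemma calibrated_cat {R : realType} (X Y Z A B C : R) : X = Y + Z -> Z = A - B -> Y = B - C -> X = A - C.
Proof. lra. Qed.

Section Main.
Context {R : realType} {M : ptopologicalType} {d : nat}.
Variable SM : smooth_structure R M d.
Hypothesis M_hausdorff : hausdorff_space M.
Hypothesis M_compact : compact [set: M].
Hypothesis M_connected : connected [set: M].
Notation V := 'rV[R]_d.
Notation is_path := (is_path SM).
Variable g : M -> V -> V -> R.
Hypothesis g_metric : is_riemannian_metric SM g.
Variable L : M -> V -> R -> R.
Hypothesis L_smooth : lagrangian_smooth SM L.
Hypothesis L_periodic : lagrangian_periodic L.
Hypothesis L_superlinear : lagrangian_superlinear g L.
Hypothesis L_posdef : lagrangian_posdef L.
Hypothesis L_complete : EL_complete SM L.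
Hypothesis L_critical : is_critical_value SM L 0.
Variable u : M -> R.
Hypothesis u_continuous : continuous u.
Notation lag_action := (lag_action SM L).
Notation F := (potential SM L).
Notation U := (U_seq SM L u).
Notation ub := (limit_solution F u).

Let F_tri a b c x y z : a < b -> b < c -> F a c x z <= F a b x y + F b c y z.
Proof. by move=> ab bc; apply: (potential_tri M_hausdorff M_compact M_connected g_metric L_smooth L_periodic L_superlinear L_posdef L_complete). Qed.

Let F_split a b c x z : a < b -> b < c -> exists y, F a c x z = F a b x y + F b c y z.
Proof. by move=> ab bc; apply: (potential_split M_hausdorff M_compact M_connected g_metric L_smooth L_periodic L_superlinear L_posdef L_complete). Qed.

Let F_shift (k : int) a b x y : a < b -> F (a + k%:~R) (b + k%:~R) x y = F a b x y.
Proof. by move=> ab; apply: (potential_shift M_hausdorff M_compact M_connected g_metric L_smooth L_periodic L_superlinear L_posdef L_complete). Qed.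

Let F_cont (y x : M) (t : R) : 0 < t -> {for (y, x, t), continuous (fun p : M * M * R => F 0 p.2 p.1.1 p.1.2)}.
Proof.
move=> t0; apply/cvgrPdist_le => e e0.
have [del del0 [[A B] [nA nB] AB]] := potential_cont M_hausdorff M_compact M_connected g_metric L_smooth L_periodic L_superlinear L_posdef L_complete y x t0 e0.
exists (A `*` B, [set s | `|s - t| < del]); first split => /=.
- by exists (A, B).
- by apply: filterS (nbhsx_ballx t del del0) => s; rewrite /ball /= distrC.
move=> [[y' x'] s] /= [[Ay Bx] hs]; have z0 : `|0 - 0 : R| < del by rewrite subrr normr0.
by have [_] := AB (y', x') (conj Ay Bx) 0 s z0 hs; rewrite distrC.
Qed.

Let F_bounded : exists2 C, 0 <= C & forall n x y, (0 < n)%N -> `|F 0 n%:R x y| <= C.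
Proof. by have [C0 C00 [HC0 _]] := potential_ge M_hausdorff M_compact M_connected g_metric L_smooth L_periodic L_superlinear L_posdef L_complete; exact: (potential_int_bounded M_hausdorff M_compact M_connected g_metric L_smooth L_periodic L_superlinear L_posdef L_complete L_critical C00 HC0). Qed.

Let ub_int (k : int) x t : ub x (t + k%:~R) = ub x t.
Proof. exact: limit_int M_compact F_split F_shift F_cont F_bounded _ _ _ _. Qed.

Let ub_dominated x y s t : s < t -> ub x t - ub y s <= F s t y x.
Proof. exact: limit_dominated M_compact F_tri F_split F_shift F_cont F_bounded _ u_continuous _ _ _ _. Qed.

Let ubar (x : M) (tau : circle R) : R := ub x (circle_repr tau).

Let ubarE x t : ubar x (circle_of t) = ub x t.
Proof. by rewrite /ubar; have [k ->] := circle_reprE t; exact: ub_int. Qed.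

(** A pair of times with classes of 0 and [t] is, up to a common integer translation that leaves the
    minimal action unchanged, a pair [0], [t + k]. Only the integer [k] is thus free in the lower
    limit. *)
Lemma peierls_barrierE (t : R) y x : peierls_barrier SM L (circle_of 0) (circle_of t) y x = (barrier F t y x)%:E.
Proof.
apply: eq_within_eps => e e0.
have [h1 h2] := liminfP (action_bounded M_compact F_split F_shift F_cont F_bounded t y x).
have low (k : nat) : `|t| + 1 <= k%:R -> 0 < t + k%:R.
  by move=> h; have := ler_norm (- t); rewrite normrN; move: h; lra.
have mE (i : int) (k : nat) : `|t| + 1 <= k%:R ->
    min_action SM L i%:~R (t + k%:R + i%:~R) y x = (F 0 (t + k%:R) y x)%:E.
  move=> /low h; have h' : i%:~R < t + k%:R + i%:~R by rewrite ltrDr.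
  rewrite (min_action_fin M_hausdorff M_compact M_connected g_metric L_smooth L_periodic L_superlinear L_posdef L_complete _ _ h'); have := F_shift i y x h; rewrite add0r => -> //.
split.
  have [N HN] := h1 e e0.
  (* As [p.2 - p.1 = t + (j - i)], this threshold gives [j - i >= N + |t| + 1]: the integer [k]
     exceeds [N] and the duration [t + k] is positive. *)
  pose T := N%:R + `|t| + `|t| + 1.
  pose A : set (R * R) := [set p | [/\ circle_of p.1 = circle_of 0, circle_of p.2 = circle_of t & T <= p.2 - p.1]].
  apply: (limf_einf_ge (A := A)); first by exists T.
  move=> [a b] [/= /circle_ofP[i Ei] /circle_ofP[j Ej] hT]; rewrite /= Ei Ej add0r in hT *.
  have [k kN Ek] : exists2 k : nat, `|t| + 1 <= k%:R /\ (N <= k)%N & j = (k%:Z + i)%R.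
    have hk : N%:R + `|t| + 1 <= (j - i)%:~R :> R.
      by rewrite intrB; have := ler_norm t; move: hT; rewrite /T; lra.
    have ji : (0 <= j - i)%R.
      by rewrite -(ler0z R); apply: le_trans hk; rewrite addr_ge0 // addr_ge0.
    exists `|j - i|%N; last by rewrite gez0_abs // subrK.
    have Ek : (`|j - i|%N%:R : R) = (j - i)%:~R by rewrite -[in RHS](gez0_abs ji) -pmulrn.
    split; first by rewrite Ek; have := ler0n R N; move: hk; lra.
    by rewrite -(ler_nat R) Ek; have := normr_ge0 t; move: hk; lra.
  rewrite Ek intrD addrA -pmulrn mE; last by case: kN.
  by rewrite lee_fin; apply: HN; case: kN.
apply: limf_einf_le => A [T _ HT].
have [k Nk Fk] := h2 e (Num.truncn (`|T| + `|t| + 1)).+1 e0.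
have kT : `|T| + `|t| + 1 < k%:R by apply: lt_le_trans (truncnS_gt _) _; rewrite ler_nat.
have tk : `|t| + 1 <= k%:R by have := normr_ge0 T; move: kT; lra.
exists (0, t + k%:R).
  apply: HT; split => //=; first by apply/circle_ofP; exists k.
  by rewrite subr0; have := ler_norm T; have := ler_norm (- t); rewrite normrN; move: kT; lra.
by have := mE 0 k tk; rewrite /= mulr0z addr0 => ->; rewrite lee_fin.
Qed.

Lemma limit_formula x tau : (ubar x tau)%:E =
  ereal_inf [set ((u y)%:E + peierls_barrier SM L (circle_of 0) tau y x)%E | y in [set: M]].
Proof.
have [t ->] : exists t, tau = circle_of t by exists (circle_repr tau); rewrite /circle_of /circle_repr reprK.
rewrite ubarE; apply/esym/eq_within_eps => e e0; split.
  apply: le_ereal_inf_tmp => _ [y _ <-]; rewrite peierls_barrierE -EFinD lee_fin.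
  have := limit_le M_compact F_split F_shift F_cont F_bounded u_continuous x t y; move: e0; lra.
have [y Hy] := limit_near M_compact F_split F_shift F_cont F_bounded u_continuous x t e0.
apply: le_trans (ereal_inf_lbound _) _; first by exists y.
by rewrite peierls_barrierE -EFinD lee_fin ltW.
Qed.

Lemma U_seq_le n k x tau gamma : (n <= k <= n.*2)%N -> is_path 0 (tau + k%:R) gamma -> gamma (tau + k%:R) = x ->
  (U n x tau <= (u (gamma 0%R) + lag_action 0 (tau + k%:R) gamma)%:E)%E.
Proof.
move=> nk p e; apply: le_trans (ereal_inf_lbound _) _; first by exists k.
by apply: ereal_inf_lbound; exists gamma.
Qed.

Lemma U_seq_ge n x tau c : (forall k gamma, (n <= k <= n.*2)%N -> is_path 0 (tau + k%:R) gamma -> gamma (tau + k%:R) = x ->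
  c <= u (gamma 0) + lag_action 0 (tau + k%:R) gamma) -> (c%:E <= U n x tau)%E.
Proof.
move=> H; apply: le_ereal_inf_tmp => _ [k nk <-]; apply: le_ereal_inf_tmp => _ [gamma [p e] <-].
by rewrite lee_fin; exact: H.
Qed.

Lemma U_seq_fin n x tau : 0 <= tau <= 1 -> U n x tau \is a fin_num.
Proof.
move=> /andP[t0 t1]; rewrite fin_numElt; apply/andP; split.
  have [C0 C00 [HC0 _]] := potential_ge M_hausdorff M_compact M_connected g_metric L_smooth L_periodic L_superlinear L_posdef L_complete.
  have [C HC] := continuous_bounded_below M_compact u_continuous.
  apply: lt_le_trans (ltNyr (C - C0 * (1 + n.*2%:R))) _.
  apply: U_seq_ge => k gamma /andP[_ kn] p e; apply: lerD; first exact: HC.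
  apply: le_trans (action_ge L_smooth HC0 p); rewrite lerN2 subr0; apply: ler_wpM2l => //.
  by apply: lerD => //; rewrite ler_nat.
have nk : (n <= n <= n.*2)%N by rewrite leqnn -addnn leq_addr.
have tn : 0 <= tau + n%:R by rewrite addr_ge0.
move: tn; rewrite le_eqVlt => /predU1P[E|tn].
  (* The case [n = 0] and [tau = 0], where the window allows only duration zero: the constant curve
     is a competitor. *)
  have p : is_path 0 (tau + n%:R) (fun=> x) by rewrite -E; exact: path_refl.
  exact: le_lt_trans (U_seq_le nk p erefl) (ltry _).
have [gam [p _ _ e _]] := potential_attained M_hausdorff M_compact M_connected g_metric L_smooth L_periodic L_superlinear L_posdef L_complete x x tn.
exact: le_lt_trans (U_seq_le nk p e) (ltry _).
Qed.

Lemma U_seq_limit e : 0 < e -> exists N, forall n x tau, (N <= n)%N -> 0 <= tau <= 1 ->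
  `|ub x tau - fine (U n x tau)| <= e.
Proof.
move=> e0; have [N HN] := limit_barrier M_compact F_tri F_split F_shift F_cont F_bounded u_continuous e0.
exists (maxn N 1) => n x tau Nn t01; have [h1 [k [y [nk h2]]]] := HN n tau x (leq_trans (leq_maxl _ _) Nn) t01.
have pos (j : nat) : (n <= j)%N -> 0 < tau + j%:R.
  move=> nj; have j0 : (0 < j)%N := leq_trans (leq_trans (leq_maxr _ _) Nn) nj.
  by case/andP: t01 => ? _; rewrite ltr_wpDl // ltr0n.
rewrite ler_distlC -!lee_fin fineK ?U_seq_fin //; apply/andP; split.
  apply: U_seq_ge => j gamma /andP[nj _] p E.
  apply: le_trans (h1 j (gamma 0) nj) _; rewrite lerD2l -{1}E.
  exact: (potential_le M_hausdorff M_compact M_connected g_metric L_smooth L_periodic L_superlinear L_posdef L_complete (pos j nj) p).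
have [gam [p _ g0 gx gA]] := potential_attained M_hausdorff M_compact M_connected g_metric L_smooth L_periodic L_superlinear L_posdef L_complete y x (pos k (proj1 (andP nk))).
apply: le_trans (U_seq_le nk p gx) _; rewrite lee_fin g0 gA; exact: h2.
Qed.

Lemma ubar_dominated x tau y s : ((ubar x tau - ubar y s)%:E <= action_potential SM L s tau y x)%E.
Proof.
apply: le_ereal_inf_tmp => _ [[a b] [/= <- <- ab] <-]; rewrite !ubarE.
have ab' : a < b by apply: lt_le_trans ab; rewrite ltrDl.
by rewrite (min_action_fin M_hausdorff M_compact M_connected g_metric L_smooth L_periodic L_superlinear L_posdef L_complete _ _ ab') lee_fin; exact: ub_dominated.
Qed.

Lemma lag_action_dominated a b gamma : is_path a b gamma -> ub (gamma b) b - ub (gamma a) a <= lag_action a b gamma.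
Proof.
move=> p; have := path_le p; rewrite le_eqVlt => /predU1P[E|ab].
  by subst b; rewrite subrr lag_actionxx.
exact: le_trans (ub_dominated _ _ ab) (potential_le M_hausdorff M_compact M_connected g_metric L_smooth L_periodic L_superlinear L_posdef L_complete ab p).
Qed.

Lemma calibrated_step b x : 0 < b -> exists z eta, [/\ is_path 0 b eta, eta 0 = z, eta b = x &
  lag_action 0 b eta = ub x b - ub z 0].
Proof.
move=> b0; have [z Ez] := limit_calibrated M_compact F_tri F_split F_shift F_cont F_bounded u_continuous x b0.
have [eta [p _ e1 e2 e3]] := potential_attained M_hausdorff M_compact M_connected g_metric L_smooth L_periodic L_superlinear L_posdef L_complete z x b0.
by exists z, eta; split => //; rewrite e3 Ez addrAC subrr add0r.
Qed.

(** Unit minimizers, taken on [[0, 1]] by periodicity and translated, are concatenated backwards in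
    time. Calibration at integer times then forces it at all times. *)
Lemma calibrated_curve x b : 0 < b -> exists gamma, gamma b = x /\
  forall t, t <= b -> is_path t b gamma /\ ub x b - ub (gamma t) t = lag_action t b gamma.
Proof.
move=> b0; have ub1 z : ub z 1 = ub z 0 by have := ub_int 1 z 0; rewrite add0r.
have [z0 [eta0 [p0 a0 ab A0]]] := calibrated_step x b0.
have /choice[st Hst] : forall z, exists p : M * (R -> M), [/\ is_path 0 1 p.2, p.2 0 = p.1, p.2 1 = z & lag_action 0 1 p.2 = ub z 0 - ub p.1 0].
  move=> z; have [z' [eta [e1 e2 e3 e4]]] := calibrated_step z ltr01; rewrite (ub1 z) in e4.
  exists (z', eta); split; [exact: e1|exact: e2|exact: e3|exact: e4].
(* [Z i] is the position at time [- i], and [delta i] runs over the unit interval ending at [- i],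
   from [Z i.+1] to [Z i]. *)
pose Z (i : nat) := iter i (fun z => (st z).1) z0.
have ZS i : Z i.+1 = (st (Z i)).1 by [].
pose delta (i : nat) (s : R) := (st (Z i)).2 (s + i.+1%:R).
pose gamma (s : R) := if 0 <= s then eta0 s else delta (Num.truncn (- s)) s.
have d0 i : delta i (- i.+1%:R) = Z i.+1 by rewrite /delta addNr; have [_ -> _ _] := Hst (Z i).
have d1 i : delta i (- i%:R) = Z i.
  by rewrite /delta -natr1 addrA addNr add0r; have [_ _ -> _] := Hst (Z i).
have gE i : {in `[- i.+1%:R, - i%:R], delta i =1 gamma}.
  move=> s; rewrite in_itv /= => /andP[s1 s2]; rewrite /gamma; case: ifPn => [s0|].
    have si : i%:R <= (0 : R) by rewrite -oppr_ge0 (le_trans s0).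
    have i0 : i = 0%N by apply/eqP; rewrite -leqn0 -(ler_nat R).
    have s00 : s = 0 by apply/le_anti; rewrite s0 andbT (le_trans s2) // i0 oppr0.
    by rewrite i0 s00 a0; have := d1 0%N; rewrite mulr0n oppr0.
  rewrite -ltNge => s0; have ns : 0 <= - s by rewrite oppr_ge0 ltW.
  (* At the left end point [Num.truncn] already selects the next piece; both pieces take the value
     [Z i.+1] there. *)
  move: s1; rewrite le_eqVlt => /predU1P[<-|s1].
    have tr : Num.truncn (- - i.+1%:R : R) = i.+1 by rewrite opprK; apply: truncn_def; rewrite lexx ltr_nat /=.
    by rewrite tr d0 d1.
  by rewrite (@truncn_def _ _ i) // lerNr s2 ltrNl.
have g0 : {in `[0, b], eta0 =1 gamma} by move=> s; rewrite in_itv /= /gamma => /andP[-> _].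
have gd i : is_path (- i.+1%:R) (- i%:R) gamma /\ lag_action (- i.+1%:R) (- i%:R) gamma = ub (Z i) 0 - ub (Z i.+1) 0.
  have [q1 q2 q3 q4] := Hst (Z i).
  have q5 : is_path (- i.+1%:R + i.+1%:Z%:~R) (- i%:R + i.+1%:Z%:~R) (st (Z i)).2.
    by rewrite -pmulrn addNr -natr1 addKr.
  have q6 : is_path (- i.+1%:R) (- i%:R) (delta i) := path_shift q5.
  have q7 := lag_action_shift L_smooth L_periodic q5.
  rewrite -pmulrn addNr -[in X in _ = _ 0 X _]natr1 addKr q4 in q7.
  split; first exact: path_eq (gE i) q6.
  rewrite -(lag_action_congr L_smooth (gE i) q6); apply: etrans q7 _.
  exact (congr1 (fun z => ub (Z i) 0 - ub z 0) (esym (ZS i))).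
have main (i : nat) : [/\ is_path (- i%:R) b gamma, gamma (- i%:R) = Z i & lag_action (- i%:R) b gamma = ub x b - ub (Z i) 0].
  elim: i => [|i [IH1 IH2 IH3]].
    rewrite oppr0; split; first exact: path_eq g0 p0.
      by rewrite /gamma lexx.
    by rewrite -(lag_action_congr L_smooth g0 p0).
  have [k1 k2] := gd i; have le1 : - i.+1%:R <= - i%:R :> R by rewrite lerN2 ler_nat.
  have p := path_cat k1 IH1; split; first exact: p.
    have ii : - i.+1%:R \in `[- i.+1%:R : R, - i%:R] by rewrite in_itv /= lexx.
    by rewrite -(gE i _ ii) d0.
  exact (calibrated_cat (lag_action_cat L_smooth p le1 (path_le IH1)) IH3 k2).
have gb : gamma b = x by rewrite /gamma (ltW b0).
exists gamma; split; [exact: gb|] => t tb.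
pose i := (Num.truncn `|t|).+1; have it : - i%:R <= t.
  by rewrite lerNl; apply: le_trans (ler_norm _) _; rewrite normrN ltW // truncnS_gt.
have [m1 m2 m3] := main i; have p1 := pathW m1 it tb (lexx b).
have p2 := pathW m1 (lexx _) it tb.
split; first exact: p1.
(* Domination holds on both sides of [t]. Since it is an equality over the whole of [[- i, b]], it
   is one on each side. *)
have e1 := lag_action_dominated p1; have e2 := lag_action_dominated p2.
have e3 := lag_action_cat L_smooth m1 it tb.
have e4 : ub (Z i) (- i%:R) = ub (Z i) 0 by rewrite -(ub_int i (Z i) (- i%:R)) -pmulrn addNr.
rewrite gb in e1; rewrite m2 e4 in e2; rewrite m3 in e3.
exact: calibrated_arith e1 e2 e3.
Qed.

Lemma ubar_weak_KAM : backward_weak_KAM SM L ubar.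
Proof.
split; first exact: ubar_dominated.
(* An integer shift makes the final time positive, as [calibrated_curve] requires: its last piece is
   a minimizer starting at time 0. *)
move=> x tau; pose r := circle_repr tau; pose b := r + (1 - Num.ceil r)%:~R.
have b0 : 0 < b.
  by rewrite /b intrB; have := ceilB1_lt r; rewrite intrB; lra.
have Eb : circle_of b = tau.
  by rewrite -[RHS](_ : circle_of r = tau); [apply/circle_ofP; exists (1 - Num.ceil r)|rewrite /circle_of /r /circle_repr reprK].
have [gamma [gb H]] := calibrated_curve x b0.
exists b, gamma; split; [exact: Eb|exact: gb|] => t tb; have [p E] := H t tb; split; first exact: p.
by rewrite -Eb !ubarE.
Qed.

Lemma U_seq_uniform : {uniform [set z : M * R | 0 <= z.2 <= 1],
  (fun (n : nat) (z : M * R) => fine (U n z.1 z.2)) @ \oo --> (fun z : M * R => ubar z.1 (circle_of z.2))}.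
Proof.
move=> P /uniform_nbhs[E [entE HE]].
have [e e0 eE] : exists2 e : R, 0 < e & forall a b : R, `|a - b| < e -> E (a, b).
  have [e e0 He] := entE.
  by exists e => // a b ab; apply: He.
have e2 : 0 < e / 2 by exact: divr_gt0.
have [N HN] := U_seq_limit e2; exists N => // n /= Nn; apply: HE => -[x tau] /= t01.
by apply: eE; rewrite ubarE; apply: le_lt_trans (HN n x tau Nn t01) _; move: e0; lra.
Qed.

Lemma weak_KAM_convergence : (forall n x (tau : R), 0 <= tau <= 1 -> U n x tau \is a fin_num) /\
  exists ubar : M -> circle R -> R,
    [/\ {uniform [set z : M * R | 0 <= z.2 <= 1],
          (fun (n : nat) (z : M * R) => fine (U n z.1 z.2)) @ \oo
            --> (fun z : M * R => ubar z.1 (circle_of z.2))},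
        forall x (tau : circle R),
          (ubar x tau)%:E =
          ereal_inf [set ((u y)%:E + peierls_barrier SM L (circle_of 0) tau y x)%E
                    | y in [set: M]] &
        backward_weak_KAM SM L ubar].
Proof.
split; first exact: U_seq_fin.
by exists ubar; split; [exact: U_seq_uniform|exact: limit_formula|exact: ubar_weak_KAM].
Qed.

End Main.

Theorem theorem1p2 (R : realType) (M : ptopologicalType) (d : nat)
  (SM : smooth_structure R M d)
  (M_hausdorff : hausdorff_space M)
  (M_compact : compact [set: M])
  (M_connected : connected [set: M])
  (g : M -> 'rV[R]_d -> 'rV[R]_d -> R)
  (g_metric : is_riemannian_metric SM g)
  (L : M -> 'rV[R]_d -> R -> R)
  (L_smooth : lagrangian_smooth SM L)
  (L_periodic : lagrangian_periodic L)
  (L_posdef : lagrangian_posdef L)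
  (L_superlinear : lagrangian_superlinear g L)
  (L_complete : EL_complete SM L)
  (L_critical : is_critical_value SM L 0)
  (u : M -> R) (u_continuous : continuous u) :
  (forall n x (tau : R), 0 <= tau <= 1 -> U_seq SM L u n x tau \is a fin_num) /\
  exists ubar : M -> circle R -> R,
    [/\ {uniform [set z : M * R | 0 <= z.2 <= 1],
          (fun (n : nat) (z : M * R) => fine (U_seq SM L u n z.1 z.2)) @ \oo
            --> (fun z : M * R => ubar z.1 (circle_of z.2))},
        forall x (tau : circle R),
          (ubar x tau)%:E =
          ereal_inf [set ((u y)%:E + peierls_barrier SM L (circle_of 0) tau y x)%E
                    | y in [set: M]] &
        backward_weak_KAM SM L ubar].
Proof.
exact: (weak_KAM_convergence M_hausdorff M_compact M_connected g_metric L_smooth L_periodic L_superlinear L_posdef L_complete L_critical u_continuous).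
Qed.
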